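(* Let $F$ be a graph with at least one edge. Then for each $\varepsilon > 0$ there exists an $n_0 = n_0(\varepsilon,F)$ such that every $F$-divisible graph $G$ on $n\geq n_0$ vertices with minimum degree $\delta(G) \geq (\delta+\varepsilon)n$, where $\delta := \max \{ \delta^{*}_{K_{\chi(F)}} ,\, 1-\frac{1}{6e(F)} \}$, has an $F$-decomposition.
   Context: All graphs are finite and simple; $e(G)$ is the number of edges of $G$, $\chi(F)$ the chromatic number of $F$. A graph $G$ has an $F$-decomposition if $E(G)$ can be partitioned into edge sets of copies of $F$ in $G$. $\gcd(G)$ is the largest integer dividing the degree of every vertex of $G$. $G$ is $F$-divisible if $e(F)$ divides $e(G)$ and $\gcd(F)$ divides $\gcd(G)$. Let $\binom{G}{F}$ denote the set of copies of $F$ in $G$. $G$ has a fractional $F$-decomposition if there is a function $\psi:\binom{G}{F}\to[0,1]$ with $\sum_{F'\in\binom{G}{F}: e\in F'}\psi(F')\le 1$ for each $e\in E(G)$ and $\sum_{F'\in\binom{G}{F}}\psi(F')=e(G)/e(F)$. For $n\in\mathbb{N}$, $\delta^*_F(n)$ is the infimum over all $\delta$ such that every graph $G$ on $n$ vertices with $\delta(G)\ge\delta n$ has a fractional $F$-decomposition, and $\delta^*_F:=\limsup_{n\to\infty}\delta^*_F(n)$. *)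

(* Defs.v *)
From HB Require Import structures.
From mathcomp Require Import all_boot all_order all_algebra.
From mathcomp Require Import all_classical all_reals all_analysis.

Set Implicit Arguments.
Unset Strict Implicit.
Unset Printing Implicit Defensive.

Import Order.TTheory GRing.Theory Num.Theory.

Record sgraph := SGraph {
  vertex :> finType;
  adj : rel vertex;
  adj_sym : symmetric adj;
  adj_irrefl : irreflexive adj }.

Definition edges (G : sgraph) : {set {set G}} :=
  [set A : {set G} | [exists x, exists y, adj x y && (A == [set x; y])]].

Definition num_edges (G : sgraph) : nat := #|edges G|.

Definition degree (G : sgraph) (x : G) : nat := #|[set y | adj x y]|.

(* Degrees are smaller than #|vertex G|, so the default value of the bigop only
   matters for the graph without vertices, whose minimum degree is set to 0. *)
Definition min_degree (G : sgraph) : nat :=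
  \big[minn/#|vertex G|]_(x : G) degree x.

(* If all the degrees are 0, every integer divides them and this gcd is 0, which
   every integer divides. *)
Definition gcd_degree (G : sgraph) : nat := \big[gcdn/0%N]_(x : G) degree x.

Definition colorable (G : sgraph) (k : nat) : bool :=
  [exists c : {ffun G -> 'I_k}, [forall x, forall y, adj x y ==> (c x != c y)]].

Lemma colorable_ex (G : sgraph) : exists k, colorable G k.
Proof.
exists #|vertex G|; apply/existsP; exists [ffun x => enum_rank x].
apply/forallP => x; apply/forallP => y; apply/implyP => xy; rewrite !ffunE.
by apply: contraTneq xy => /enum_rank_inj ->; rewrite adj_irrefl.
Qed.

Definition chromatic_number (G : sgraph) : nat := ex_minn (colorable_ex G).

Lemma complete_sym (r : nat) : symmetric (fun x y : 'I_r => x != y).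
Proof. by move=> x y; rewrite eq_sym. Qed.

Lemma complete_irrefl (r : nat) : irreflexive (fun x y : 'I_r => x != y).
Proof. by move=> x; rewrite eqxx. Qed.

Definition complete_graph (r : nat) : sgraph :=
  SGraph (@complete_sym r) (@complete_irrefl r).

(* A pair (vertex set, edge set): a copy of F is a subgraph of G, not an
   embedding, so embeddings with the same image are not counted separately. *)
Definition subgraph_data (G : sgraph) : finType := ({set G} * {set {set G}})%type.

Definition is_copy (F G : sgraph) (H : subgraph_data G) : bool :=
  (H.2 \subset edges G) &&
  [exists f : {ffun F -> G},
    [&& injectiveb f, f @: [set: F] == H.1
      & [set f @: (A : {set F}) | A in edges F] == H.2]].

Definition copies (F G : sgraph) : {set subgraph_data G} :=
  [set H | is_copy F H].

Definition has_decomposition (F G : sgraph) : Prop :=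
  exists P : {set {set {set G}}},
    finset.partition P (edges G) /\
    forall D, D \in P -> exists2 H, H \in copies F G & H.2 = D.

Definition divisible (F G : sgraph) : Prop :=
  (num_edges F %| num_edges G)%N /\ (gcd_degree F %| gcd_degree G)%N.

Local Open Scope ring_scope.

Definition has_fractional_decomposition (R : realType) (F G : sgraph) : Prop :=
  exists psi : subgraph_data G -> R,
    [/\ forall H, H \in copies F G -> 0 <= psi H <= 1,
        forall e, e \in edges G ->
          \sum_(H in copies F G | e \in H.2) psi H <= 1
      & \sum_(H in copies F G) psi H = (num_edges G)%:R / (num_edges F)%:R].

Local Open Scope classical_set_scope.

(* The infimum is taken in the extended reals: if every graph on n vertices has
   a fractional F-decomposition (as for F = K_2), all real d qualify and the
   value is -oo. *)
Definition delta_star_n (R : realType) (F : sgraph) (n : nat) : \bar R :=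
  ereal_inf [set d%:E | d in [set d : R |
    forall G : sgraph, #|vertex G| = n -> d * n%:R <= (min_degree G)%:R ->
      has_fractional_decomposition R F G]].

Definition delta_star (R : realType) (F : sgraph) : \bar R :=
  limn_esup (delta_star_n R F).

Definition delta_bound (R : realType) (F : sgraph) : \bar R :=
  Order.max (delta_star R (complete_graph (chromatic_number F)))
            (1 - 1 / (6 * (num_edges F)%:R))%:E.

(* Main.v *)
(* Three ingredients are combined. A randomly sampled fractional decomposition gives a law on cliques
   with nearly uniform edge marginals; duplicating colour classes turns it into a law on copies of F,
   and a random greedy packing driven by it covers all edges up to a small maximum degree. A random
   labelling of the vertices by pairs yields a sparse reserve X, made of the edges whose ends share a
   coordinate: every uncovered edge lies in a copy of F whose other edges are in X. Finally there is a
   sparse F-decomposable set A, disjoint from X, such that A together with any F-divisible subset of X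
   is F-decomposable: the divisibility defects of the edges of X are transported along a bounded degree
   network of local gadgets ending in small absorbers, which exist because any 4 e(F) vertices have many
   common neighbours. *)
Require Import Defs.
From mathcomp Require Import all_boot all_order all_algebra.
From mathcomp Require Import zify ring lra.

Set Implicit Arguments.
Unset Strict Implicit.
Unset Printing Implicit Defensive.

(** * Multisets of edges decomposed into injective copies *)

(** The leftover inside the reserve is known only at the end and has exponentially many possible
    values, so no value can have an absorber of its own. The network makes the choice local: a
    relation sees four slots, each next to two banks with finitely many settings, so it meets
    boundedly many multisets and can own an absorber for each of them; an absorber whose setting
    does not occur is decomposed alone.

    Every embedding asks for common neighbours of at most 2|F| vertices, and 2|F| <= 4e(F) once
    isolated vertices of F are dropped. Minimum degree (1 - 1/(6e(F)))n gives any 4e(F) vertices at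
    least n/3 common neighbours.

    For the packing, a fractional decomposition of G itself could put large weight on few cliques
    and ruin the codegrees. Sampling boundedly many vertices bounds the mass of each r-clique by
    O(n^-r). Keeping a positive lower bound on all homomorphisms makes the conditional laws used in
    duplication well behaved. Probability appears only as counting and as finite weighted sums, and
    the greedy packing is derandomised by a potential. *)

Lemma edgesP (G : sgraph) (A : {set G}) :
  reflect (exists x y, adj x y /\ A = [set x; y]) (A \in edges G).
Proof.
rewrite inE; apply: (iffP existsP).
  by case=> x /existsP[y /andP[xy /eqP->]]; exists x, y.
by case=> x [y [xy ->]]; exists x; apply/existsP; exists y; rewrite xy eqxx.
Qed.

Lemma adj_neq (G : sgraph) (x y : G) : adj x y -> x != y.
Proof. by apply: contraTneq => ->; rewrite adj_irrefl. Qed.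

Lemma edges_pair (G : sgraph) (x y : G) : ([set x; y] \in edges G) = adj x y.
Proof.
apply/edgesP/idP => [[a [b [ab E]]]|xy]; last by exists x, y.
have nab := adj_neq ab.
have xab : x \in [set a; b] by rewrite -E !inE eqxx.
have yab : y \in [set a; b] by rewrite -E !inE eqxx orbT.
have axy : a \in [set x; y] by rewrite E !inE eqxx.
have bxy : b \in [set x; y] by rewrite E !inE eqxx orbT.
move: xab yab axy bxy; rewrite !inE.
case/orP=> /eqP-> /orP[] /eqP->; rewrite ?eqxx //=.
- by move=> _ /orP[] /eqP ba; move: nab; rewrite ba eqxx.
- by rewrite adj_sym.
- by move=> /orP[] /eqP ba; move: nab; rewrite ba eqxx.
Qed.

Lemma edges_card2 (G : sgraph) (A : {set G}) : A \in edges G -> #|A| = 2.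
Proof. by case/edgesP=> x [y [xy ->]]; rewrite cards2 (adj_neq xy). Qed.

Definition star (G : sgraph) (v : G) : {set {set G}} := [set f in edges G | v \in f].

Lemma sum_star (G : sgraph) (v : G) (X : {set G} -> nat) :
  \sum_(f in star v) X f = \sum_(w | adj v w) X [set v; w].
Proof.
rewrite (_ : star v = [set [set v; w] | w in [set w | adj v w]]); last first.
  apply/setP=> f; rewrite inE; apply/andP/imsetP => [[/edgesP[x [y [xy ->]]]]|[w]].
    rewrite !inE => /orP[] /eqP ->; first by exists y; rewrite ?inE.
    by exists x; rewrite ?inE 1?adj_sym // setUC.
  by rewrite inE => vw ->; rewrite edges_pair vw !inE eqxx.
rewrite big_imset /=; first by apply: eq_bigl => w; rewrite inE.
move=> x y; rewrite !inE => vx vy /setP/(_ x).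
by rewrite !inE eqxx orbT eq_sym (negPf (adj_neq vx)) /= => /esym/eqP.
Qed.

Lemma card_star (G : sgraph) (v : G) : #|star v| = degree v.
Proof.
rewrite /degree -sum1_card sum_star -sum1_card.
by apply: eq_bigl => w; rewrite inE.
Qed.

Section Mult.
Variables (F : sgraph) (V : finType).
Implicit Types (phi : F -> V) (m : {set V} -> nat) (S : {set {set F}}).

(** Edge multisets are functions to [nat]. Counting preimages makes sense for any map [phi], so a
    copy can be cut into stars and re-centred without side conditions. *)
Definition mul S phi : {set V} -> nat := fun e => \sum_(f in S) (phi @: f == e).

(** Multiset decompositions add up ([mdecD]) with no disjointness to check. Edge-disjointness comes
    back when [m] is the indicator [ind] of a set of edges. *)
Definition mdec m := exists s : seq {ffun F -> V},
  (forall phi : {ffun F -> V}, phi \in s -> injective phi) /\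
  m =1 (fun e => \sum_(phi <- s) mul (edges F) phi e).

Lemma mdec_eq m1 m2 : m1 =1 m2 -> mdec m1 -> mdec m2.
Proof. by move=> E [s [h1 h2]]; exists s; split=> // e; rewrite -E. Qed.

Lemma mdec0 : mdec (fun=> 0).
Proof. by exists [::]; split=> // e; rewrite big_nil. Qed.

Lemma mdecD m1 m2 : mdec m1 -> mdec m2 -> mdec (fun e => m1 e + m2 e).
Proof.
case=> s1 [i1 e1] [s2 [i2 e2]]; exists (s1 ++ s2); split.
  by move=> phi; rewrite mem_cat => /orP[/i1|/i2].
by move=> e; rewrite big_cat /= e1 e2.
Qed.

Lemma mdec_sum (I : Type) (r : seq I) (P : pred I) (m : I -> {set V} -> nat) :
  (forall i, P i -> mdec (m i)) -> mdec (fun e => \sum_(i <- r | P i) m i e).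
Proof.
move=> h; elim: r => [|i r IH].
  by apply: mdec_eq mdec0 => e; rewrite big_nil.
case Pi: (P i); last by apply: mdec_eq IH => e; rewrite big_cons Pi.
by apply: mdec_eq (mdecD (h i Pi) IH) => e; rewrite big_cons Pi.
Qed.

Lemma mdec_copy phi : injective phi -> mdec (mul (edges F) phi).
Proof.
move=> ip; exists [:: finfun phi]; split.
  by move=> psi; rewrite inE => /eqP-> x y; rewrite !ffunE => /ip.
move=> e; rewrite big_seq1; apply: eq_bigr => f _.
by congr (nat_of_bool (_ == _)); apply: eq_imset => x; rewrite ffunE.
Qed.

Lemma mul_setU S1 S2 phi : [disjoint S1 & S2] ->
  mul (S1 :|: S2) phi =1 fun e => mul S1 phi e + mul S2 phi e.
Proof.
by move=> d e; rewrite /mul -bigU //; apply: eq_bigl => f; rewrite !inE.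
Qed.

Lemma mulD1 S f phi : f \in S ->
  mul S phi =1 fun e => (phi @: f == e) + mul (S :\ f) phi e.
Proof. by move=> fS e; rewrite /mul (big_setD1 _ fS). Qed.

Lemma mul_star v phi :
  mul (star v) phi =1 fun e => \sum_(w | adj v w) ([set phi v; phi w] == e).
Proof.
move=> e; rewrite /mul sum_star; apply: eq_bigr => w _.
by rewrite imsetU1 imset_set1.
Qed.

Lemma mul_split v phi : mul (edges F) phi =1 fun e =>
  \sum_(w | adj v w) ([set phi v; phi w] == e) + mul (edges F :\: star v) phi e.
Proof.
move=> e; rewrite -mul_star -mul_setU.
  by congr (mul _ _ _); apply/setP=> f; rewrite !inE; case: (_ \in f); rewrite ?andbT ?andbF ?orbF ?orbT //=; case: existsP.
by rewrite disjoints_subset; apply/subsetP=> f; rewrite !inE => ->.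
Qed.

Lemma mul_eq S phi psi : (forall f w, f \in S -> w \in f -> phi w = psi w) ->
  mul S phi =1 mul S psi.
Proof.
move=> h e; apply: eq_bigr => f fS; congr (nat_of_bool (_ == _)).
by apply: eq_in_imset => w wf; apply: h fS wf.
Qed.

Lemma mul_gt0 S phi e : 0 < mul S phi e -> exists2 f, f \in S & e = phi @: f.
Proof.
rewrite lt0n sum_nat_eq0 => /forallPn[f].
by rewrite negb_imply eqb0 negbK => /andP[fS /eqP<-]; exists f.
Qed.

Lemma mul_le1 S phi e : injective phi -> mul S phi e <= 1.
Proof.
move=> ip; case: (posnP (mul S phi e)) => [->//|/mul_gt0[f fS ->]].
rewrite /mul (big_setD1 _ fS) /= eqxx big1 // => f'.
rewrite in_setD1 => /andP[nf _]; apply/eqP; rewrite eqb0.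
by apply: contraNneq nf => /(imset_inj ip) ->.
Qed.

Lemma mul_edges phi e : injective phi ->
  mul (edges F) phi e = (e \in [set phi @: (A : {set F}) | A in edges F]).
Proof.
move=> ip; apply/eqP; rewrite eqn_leq; apply/andP; split.
  case: (posnP (mul (edges F) phi e)) => [->//|h].
  have [f fE ->] := mul_gt0 h; rewrite imset_f //.
  exact: mul_le1.
case: imsetP => // -[f fE ->].
by rewrite /mul (big_setD1 _ fE) /= eqxx.
Qed.

Definition mdeg m (x : V) := \sum_(e : {set V} | x \in e) m e.
Definition mtot m := \sum_(e : {set V}) m e.

Lemma mdegD m1 m2 x : mdeg (fun e => m1 e + m2 e) x = mdeg m1 x + mdeg m2 x.
Proof. by rewrite /mdeg big_split. Qed.
Lemma mtotD m1 m2 : mtot (fun e => m1 e + m2 e) = mtot m1 + mtot m2.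
Proof. by rewrite /mtot big_split. Qed.
Lemma mdeg_sum (I : Type) (r : seq I) (P : pred I) (m : I -> {set V} -> nat) x :
  mdeg (fun e => \sum_(i <- r | P i) m i e) x = \sum_(i <- r | P i) mdeg (m i) x.
Proof. by rewrite /mdeg exchange_big. Qed.
Lemma mtot_sum (I : Type) (r : seq I) (P : pred I) (m : I -> {set V} -> nat) :
  mtot (fun e => \sum_(i <- r | P i) m i e) = \sum_(i <- r | P i) mtot (m i).
Proof. by rewrite /mtot exchange_big. Qed.
Lemma mdeg_eq m1 m2 x : m1 =1 m2 -> mdeg m1 x = mdeg m2 x.
Proof. by move=> E; apply: eq_bigr. Qed.
Lemma mtot_eq m1 m2 : m1 =1 m2 -> mtot m1 = mtot m2.
Proof. by move=> E; apply: eq_bigr. Qed.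

Lemma mdeg_ind (e0 : {set V}) x : mdeg (fun e => (e0 == e)) x = (x \in e0).
Proof.
rewrite /mdeg; case: (boolP (x \in e0)) => xe.
  rewrite (bigD1 e0) //= eqxx big1 // => e /andP[_ ne].
  by rewrite eq_sym (negPf ne).
by rewrite big1 // => e xe'; apply/eqP; rewrite eqb0; apply: contraNneq xe => ->.
Qed.

Lemma mtot_ind (e0 : {set V}) : mtot (fun e => (e0 == e)) = 1.
Proof.
rewrite /mtot (bigD1 e0) //= eqxx big1 // => e ne.
by rewrite eq_sym (negPf ne).
Qed.

Lemma mtot_mul S phi : mtot (mul S phi) = #|S|.
Proof.
rewrite /mul mtot_sum -sum1_card; apply: eq_bigr => f _; exact: mtot_ind.
Qed.

Lemma mdeg_mul phi w : injective phi -> mdeg (mul (edges F) phi) (phi w) = degree w.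
Proof.
move=> ip; rewrite /mul mdeg_sum -card_star -sum1_card.
rewrite (bigID (fun f : {set F} => w \in f)) /= [X in _ + X]big1 ?addn0.
  rewrite [RHS](eq_bigl (fun f => (f \in edges F) && (w \in f))) => [|f]; last by rewrite inE.
  by apply: eq_bigr => f /andP[_ wf]; rewrite mdeg_ind mem_imset ?wf.
by move=> f /andP[_ nwf]; rewrite mdeg_ind mem_imset // (negPf nwf).
Qed.

Lemma mdeg_mul0 S phi x : (forall w, phi w != x) -> mdeg (mul S phi) x = 0.
Proof.
move=> h; rewrite /mul mdeg_sum big1 // => f _; rewrite mdeg_ind.
by apply/eqP; rewrite eqb0; apply/imsetP => -[w _ E]; move: (h w); rewrite E eqxx.
Qed.

Lemma gcd_degree_dvd (w : F) : gcd_degree F %| degree w.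
Proof.
rewrite /gcd_degree (bigD1 w) //=; exact: dvdn_gcdl.
Qed.

Definition mdiv m := (forall x, gcd_degree F %| mdeg m x) /\ (num_edges F %| mtot m).

Lemma mdec_mdiv m : mdec m -> mdiv m.
Proof.
case=> s [si sE]; split=> [x|].
  rewrite (mdeg_eq _ sE) mdeg_sum big_seq; apply: dvdn_sum => phi /si ip.
  case: (boolP [exists w, phi w == x]) => [/existsP[w /eqP<-]|].
    by rewrite mdeg_mul //; apply: gcd_degree_dvd.
  by rewrite negb_exists => /forallP h; rewrite mdeg_mul0.
rewrite (mtot_eq sE) mtot_sum; apply: dvdn_sum => phi _; by rewrite mtot_mul.
Qed.

(** With [mdec_mdiv], this keeps what remains divisible after decomposed pieces are taken away. *)
Lemma mdivDr m1 m2 : mdiv m1 -> mdiv (fun e => m1 e + m2 e) -> mdiv m2.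
Proof.
case=> a1 b1 [a2 b2]; split=> [x|].
  by move: (a2 x); rewrite mdegD dvdn_addr.
by move: b2; rewrite mtotD dvdn_addr.
Qed.

End Mult.

Arguments mdec F {V} m.
Arguments mdiv F {V} m.

(** * Embeddings into a rich host *)

Lemma sum_le1 (I : finType) (P : pred I) (m : I -> nat) :
  (forall i, P i -> m i <= 1) ->
  (forall i j, P i -> P j -> 0 < m i -> 0 < m j -> i = j) ->
  \sum_(i | P i) m i <= 1.
Proof.
move=> h1 h2; case: (boolP [exists i, P i && (0 < m i)]).
  case/existsP=> i /andP[Pi mi]; rewrite (bigD1 i) //= big1 ?addn0 ?h1 //.
  move=> j /andP[Pj nj]; apply/eqP; rewrite -leqn0 leqNgt.
  by apply: contra nj => mj; rewrite (h2 _ _ Pj Pi mj mi).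
move/existsPn=> h; rewrite big1 // => i Pi.
by move: (h i); rewrite Pi /= -eqn0Ngt => /eqP.
Qed.

Lemma sum_gt0 (I : finType) (P : pred I) (m : I -> nat) :
  0 < \sum_(i | P i) m i -> exists2 i, P i & 0 < m i.
Proof.
rewrite lt0n sum_nat_eq0 => /forallPn[i]; rewrite negb_imply -lt0n.
by case/andP=> Pi mi; exists i.
Qed.

Section Host.
Variables (V : finType) (Gam : rel V) (C : {set V}) (D : nat).

(** All that embedding uses of the ambient graph: [C] holds the vertices allowed as new ones, [D]
    bounds the number of prescribed neighbours, and [s] the number of vertices to avoid. *)
Definition host (s : nat) := [/\ symmetric Gam, irreflexive Gam &
  forall B Z : {set V}, #|B| <= D -> #|Z| <= s ->
  exists z, [/\ z \in C, z \notin Z & forall b, b \in B -> Gam z b]].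

Lemma host_le s s' : s' <= s -> host s -> host s'.
Proof.
by move=> ss [h1 h2 h3]; split=> // B Z hB hZ; apply: h3 => //; apply: leq_trans ss.
Qed.

(** Greedy extension, one vertex outside [A] at a time: its placed neighbours and the targets [S w]
    are at most [D] vertices. [S w] prescribes adjacencies to vertices of the host outside the
    pattern. *)
Lemma host_ext (T : finType) (a : rel T) (A : {set T}) (phi0 : T -> V)
    (Z : {set V}) (S : T -> {set V}) s :
  host s -> symmetric a -> irreflexive a ->
  {in A &, injective phi0} -> (forall w, w \in A -> phi0 w \in Z) ->
  (forall w, w \notin A -> #|[set w' | a w w']| + #|S w| <= D) ->
  #|Z| + #|~: A| <= s ->
  exists phi : T -> V, [/\ {in A, phi =1 phi0}, injective phi,
    forall w, w \notin A -> phi w \in C /\ phi w \notin Z,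
    forall w w', w \notin A -> a w w' -> Gam (phi w) (phi w') &
    forall w z, w \notin A -> z \in S w -> Gam (phi w) z].
Proof.
move=> [symG irrG rich] syma irra; move En: #|~: A| => n.
elim: n => [|n IH] in A En phi0 Z *.
  move=> inj0 AZ _ _; move/eqP: En; rewrite cards_eq0 => /eqP En.
  have inA w : w \in A by rewrite -[A]setCK En !inE.
  exists phi0; split=> //.
  - by move=> x y; apply: inj0; rewrite ?inA.
  - by move=> w; rewrite inA.
  - by move=> w w'; rewrite inA.
  - by move=> w z; rewrite inA.
move=> inj0 AZ hD hs.
have [w nwA] : exists w, w \in ~: A by apply/set0Pn; rewrite -cards_eq0 En.
have nwA' : w \notin A by move: nwA; rewrite inE.
pose B := phi0 @: [set w' in A | a w w'] :|: S w.
have hB : #|B| <= D.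
  apply: leq_trans (hD w nwA'); apply: leq_trans (leq_card_setU _ _) _.
  rewrite leq_add2r; apply: leq_trans (leq_imset_card _ _) _.
  by apply: subset_leq_card; apply/subsetP=> w'; rewrite !inE => /andP[].
have [|z [zC zZ zB]] := rich B Z hB; first by lia.
pose phi1 t := if t == w then z else phi0 t.
have phi1E t : t \in A -> phi1 t = phi0 t.
  by move=> tA; rewrite /phi1; case: eqP => // E; move: nwA'; rewrite -E tA.
have phi1w : phi1 w = z by rewrite /phi1 eqxx.
have [|||||phi [p1 p2 p3 p4 p5]] := IH (w |: A) _ phi1 (z |: Z).
- apply/eqP; rewrite -eqSS -En (cardsD1 w (~: A)) nwA add1n eqSS; apply/eqP.
  by congr #|pred_of_set _|; apply/setP=> t; rewrite !inE negb_or.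
- move=> x y; rewrite !in_setU1 => /orP[/eqP->|xA] /orP[/eqP->|yA] //.
  + by rewrite phi1w phi1E // => E; move: zZ; rewrite E AZ.
  + by rewrite phi1w phi1E // => E; move: zZ; rewrite -E AZ.
  + by rewrite !phi1E //; apply: inj0.
- move=> t; rewrite !in_setU1 => /orP[/eqP->|tA]; first by rewrite phi1w eqxx.
  by rewrite phi1E // AZ ?orbT.
- by move=> t; rewrite in_setU1 negb_or => /andP[_]; apply: hD.
- by rewrite cardsU1 zZ; lia.
have pw : phi w = z by rewrite p1 ?phi1w // setU11.
have pA t : t \in A -> phi t = phi0 t by move=> tA; rewrite p1 ?phi1E // setU1r.
exists phi; split=> //.
- move=> t ntA; have [->|ntw] := eqVneq t w; first by rewrite pw.
  have := p3 t; rewrite !in_setU1 !negb_or ntw ntA => /(_ isT)[tC /andP[_ tZ]] //.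
- move=> t t' ntA att'; have [tw|ntw] := eqVneq t w; last first.
    by apply: p4 => //; rewrite in_setU1 negb_or ntw ntA.
  rewrite {}tw in ntA att' *; have [t'A|nt'A] := boolP (t' \in A).
    rewrite pw pA //; apply: zB; rewrite in_setU imset_f // !inE t'A //.
  rewrite symG; apply: p4; last by rewrite syma.
  rewrite in_setU1 negb_or nt'A andbT; apply: contraTneq att' => ->.
  by rewrite irra.
- move=> t y ntA yS; have [tw|ntw] := eqVneq t w; last first.
    by apply: p5 => //; rewrite in_setU1 negb_or ntw ntA.
  by rewrite tw pw; apply: zB; rewrite in_setU -tw yS orbT.
Qed.

(** Every edge has an end among the new vertices [N]. Hence a gadget shares no edge with anything
    that lives on the old vertices [Z], and gadgets placed one after the other keep multiplicities
    at most 1 ([gadgetD]). *)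
Definition gadget (Z N : {set V}) (m : {set V} -> nat) :=
  [/\ N \subset C, [disjoint N & Z], forall e, m e <= 1 &
   forall e, 0 < m e ->
     exists x y, [/\ e = [set x; y], x \in N, y \in Z :|: N & Gam x y]].

Lemma gadget0 Z : gadget Z set0 (fun=> 0).
Proof. by split; rewrite ?sub0set // disjoints_subset sub0set. Qed.

Lemma gadget_eq Z N m1 m2 : m1 =1 m2 -> gadget Z N m1 -> gadget Z N m2.
Proof. by move=> E [h1 h2 h3 h4]; split=> // e; rewrite -E; auto. Qed.

Lemma gadgetD Z N1 N2 m1 m2 : gadget Z N1 m1 -> gadget (Z :|: N1) N2 m2 ->
  gadget Z (N1 :|: N2) (fun e => m1 e + m2 e).
Proof.
move=> [c1 d1 l1 g1] [c2 d2 l2 g2].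
have dis e : 0 < m1 e -> 0 < m2 e -> False.
  move=> /g1[x1 [y1 [-> x1N y1N _]]] /g2[x2 [y2 [E x2N _ _]]].
  have : x2 \in [set x1; y1] by rewrite E !inE eqxx.
  move=> h; move/pred0P/(_ x2): d2; rewrite /= x2N /= => /negP; apply.
  by move: h; rewrite !inE => /orP[] /eqP ->; rewrite ?x1N ?orbT //; move: y1N; rewrite inE.
split.
- by rewrite subUset c1.
- rewrite -setI_eq0 setIUl setU_eq0 !setI_eq0 d1 /=.
  by apply: disjointWr d2; rewrite subsetUl.
- move=> e; have := dis e; have := l1 e; have := l2 e; move: (m1 e) (m2 e).
  by move=> [|[|a]] [|[|b]] //= _ _ /(_ isT isT).
- move=> e; rewrite addn_gt0 => /orP[/g1|/g2] [x [y [-> xN yN xy]]]; exists x, y.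
    split=> //; first by rewrite inE xN.
    by move: yN; rewrite !inE => /orP[] ->; rewrite ?orbT.
  split=> //; first by rewrite inE xN orbT.
  by rewrite setUA.
Qed.

(** Gadgets for all indices are placed in turn, the vertices of the earlier ones being added to the
    old set. [X] carries the data of one gadget and [Q] what must be remembered about it. *)
Lemma gadget_fin (I : finType) (P : pred I) (X : Type) (x0 : X)
    (No : I -> X -> {set V}) (Mo : I -> X -> {set V} -> nat) (Q : I -> X -> Prop) c (Z : {set V}) s :
  (forall i (Z' : {set V}), P i -> Z \subset Z' -> #|Z'| + c <= s ->
     exists x, [/\ gadget Z' (No i x) (Mo i x), #|No i x| <= c & Q i x]) ->
  #|Z| + c * #|P| <= s ->
  exists x : I -> X, [/\ gadget Z (\bigcup_(i | P i) No i (x i))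
      (fun e => \sum_(i | P i) Mo i (x i) e),
    #|\bigcup_(i | P i) No i (x i)| <= c * #|P|, forall i, P i -> Q i (x i) &
    forall i j, P i -> P j -> i != j -> [disjoint No i (x i) & No j (x j)]].
Proof.
move=> h hs.
suff [x [g1 g2 g3 g4]] : exists x : I -> X,
   [/\ gadget Z (\bigcup_(i <- enum P) No i (x i))
      (fun e => \sum_(i <- enum P) Mo i (x i) e),
    #|\bigcup_(i <- enum P) No i (x i)| <= c * size (enum P),
    forall i, i \in enum P -> Q i (x i) &
    forall i j, i \in enum P -> j \in enum P -> i != j -> [disjoint No i (x i) & No j (x j)]].
  exists x; split.
  - rewrite -big_enum; apply: gadget_eq g1 => e; by rewrite -big_enum.
  - rewrite -big_enum; apply: leq_trans g2 _.
    by rewrite leq_mul2l -cardE leqnn orbT.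
  - by move=> i Pi; apply: g3; rewrite mem_enum.
  - by move=> i j Pi Pj; apply: g4; rewrite mem_enum.
have hsz : size (enum P) <= #|P| by rewrite -cardE.
have hP i : i \in enum P -> P i by rewrite mem_enum.
move: (enum_uniq P) hsz hP; elim: (enum P) => [|i r IH] /=.
  move=> _ _ _; exists (fun=> x0); split=> //.
  - rewrite big_nil; apply: gadget_eq (gadget0 Z) => e; by rewrite big_nil.
  - by rewrite big_nil cards0.
move=> /andP[nir ur] sr hP.
have [|||x [g1 g2 g3 g4]] := IH; [by []|exact: ltnW| |].
  by move=> j jr; apply: hP; rewrite inE jr orbT.
set N := \bigcup_(j <- r) _ in g1 g2.
have [|||y [y1 y2 y3]] := h i (Z :|: N).
- by apply: hP; rewrite inE eqxx.
- exact: subsetUl.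
- have hZN : #|Z :|: N| <= #|Z| + #|N| by apply: leq_card_setU.
  apply: leq_trans hs.
  have : c * (size r).+1 <= c * #|P| by rewrite leq_mul2l sr orbT.
  by rewrite mulnS; lia.
pose x' j := if j == i then y else x j.
have x'i : x' i = y by rewrite /x' eqxx.
have x'r j : j \in r -> x' j = x j.
  by move=> jr; rewrite /x'; case: eqP => // E; move: nir; rewrite -E jr.
have EN : \bigcup_(j <- r) No j (x' j) = N.
  by rewrite /N big_seq [RHS]big_seq; apply: eq_bigr => j /x'r ->.
have dj j : j \in r -> [disjoint No i y & No j (x j)].
  move=> jr; case: y1 => _ d _ _; apply: disjointWr d.
  apply: subset_trans (subsetUr _ _).
  by rewrite /N (big_rem j) //= subsetUl.
exists x'; split.
- rewrite big_cons EN x'i setUC; apply: gadget_eq (gadgetD g1 y1) => e.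
  rewrite big_cons x'i addnC; congr (_ + _).
  by rewrite big_seq [RHS]big_seq; apply: eq_bigr => j /x'r ->.
- rewrite big_cons EN x'i mulnS; apply: leq_trans (leq_card_setU _ _) _.
  by rewrite leq_add.
- by move=> j; rewrite inE => /orP[/eqP->|jr]; rewrite ?x'i ?x'r //; apply: g3.
- move=> j1 j2; rewrite !inE => /orP[/eqP->|j1r] /orP[/eqP->|j2r].
  + by rewrite eqxx.
  + by move=> _; rewrite x'i x'r // dj.
  + by move=> _; rewrite x'i x'r // disjoint_sym dj.
  + by move=> n12; rewrite !x'r // g4.
Qed.

End Host.

(** * Moving stars *)

Definition starm (V : finType) (u : V) (Y : seq V) : {set V} -> nat :=
  fun e => \sum_(y <- Y) ([set u; y] == e).

Lemma starm_cat (V : finType) (u : V) (Y1 Y2 : seq V) :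
  starm u (Y1 ++ Y2) =1 fun e => starm u Y1 e + starm u Y2 e.
Proof. by move=> e; rewrite /starm big_cat. Qed.

Lemma set2_inj (V : finType) (u y y' : V) : y != u -> [set u; y] = [set u; y'] -> y = y'.
Proof.
move=> yu /setP/(_ y); rewrite !inE eqxx orbT (negPf yu) /=.
by move/esym/eqP.
Qed.

Section StarMoves.
Variables (F : sgraph) (D : nat).
Hypothesis hD : 2 * #|F| <= D.

(* The star at [u] with [n] leaves can be exchanged for the star at [x] with the
   same leaves, at the cost of a gadget that has no edge between old vertices. *)
Definition movable_c (c n : nat) := forall (V : finType) (Gam : rel V)
    (C Z : {set V}) (u x : V) (Y : seq V),
  host Gam C D (#|Z| + c) -> u \in Z -> x \in Z -> u != x ->
  {subset Y <= Z} -> uniq Y -> u \notin Y -> x \notin Y -> size Y = n ->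
  exists N T, [/\ gadget Gam C Z N T, #|N| <= c,
    mdec F (fun e => T e + starm u Y e) & mdec F (fun e => T e + starm x Y e)].

Definition movable (n : nat) := exists c, movable_c c n.

Lemma movable_c_le c c' n : c <= c' -> movable_c c n -> movable_c c' n.
Proof.
move=> cc' h V Gam C Z u x Y hh uZ xZ ux YZ uY nu nx sY.
have [|N [T [g k d d']]] := h V Gam C Z u x Y _ uZ xZ ux YZ uY nu nx sY.
  by apply: host_le hh; lia.
by exists N, T; split=> //; apply: leq_trans k cc'.
Qed.

Lemma movable_c0 : movable_c 0 0.
Proof.
move=> V Gam C Z u x Y _ _ _ _ _ _ _ _ /size0nil->.
exists set0, (fun=> 0); split; rewrite ?cards0 //; first exact: gadget0.
  by apply: mdec_eq (mdec0 F V) => e; rewrite /starm big_nil.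
by apply: mdec_eq (mdec0 F V) => e; rewrite /starm big_nil.
Qed.

Lemma movable0 : movable 0. Proof. exists 0; exact: movable_c0. Qed.

Lemma movableD n1 n2 : movable n1 -> movable n2 -> movable (n1 + n2).
Proof.
move=> [c1 h1] [c2 h2]; exists (c1 + c2) => V Gam C Z u x Y hh uZ xZ ux YZ uY nu nx sY.
have sub1 y : y \in take n1 Y -> y \in Y by apply: mem_take.
have sub2 y : y \in drop n1 Y -> y \in Y by apply: mem_drop.
have [||||||N1 [T1 [g1 k1 d1 e1]]] := h1 V Gam C Z u x (take n1 Y) _ uZ xZ ux.
- by apply: host_le hh; lia.
- by move=> y /sub1/YZ.
- exact: take_uniq.
- by apply: contra nu => /sub1.
- by apply: contra nx => /sub1.
- by rewrite size_take sY; case: ltnP => //; lia.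
have hZN : #|Z :|: N1| <= #|Z| + #|N1| by apply: leq_card_setU.
have [|||||||||N2 [T2 [g2 k2 d2 e2]]] := h2 V Gam C (Z :|: N1) u x (drop n1 Y).
- by apply: host_le hh; lia.
- by rewrite inE uZ.
- by rewrite inE xZ.
- by [].
- by move=> y /sub2/YZ; rewrite inE => ->.
- exact: drop_uniq.
- by apply: contra nu => /sub2.
- by apply: contra nx => /sub2.
- by rewrite size_drop sY; lia.
exists (N1 :|: N2), (fun e => T1 e + T2 e); split.
- exact: gadgetD g1 g2.
- have : #|N1 :|: N2| <= #|N1| + #|N2| by apply: leq_card_setU.
  by lia.
- apply: mdec_eq (mdecD d1 d2) => e; rewrite -[in RHS](cat_take_drop n1 Y) starm_cat.
  by lia.
- apply: mdec_eq (mdecD e1 e2) => e; rewrite -[in RHS](cat_take_drop n1 Y) starm_cat.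
  by lia.
Qed.

(** Cancellation: join [n2] new leaves [W] to both [u] and [x]. Moving [Y ++ W] from [u] to [x]
    while moving [W] from [x] to [u] moves exactly [Y]. *)
Lemma movableB n1 n2 : 0 < #|F| -> movable (n1 + n2) -> movable n2 -> movable n1.
Proof.
move=> F0 [c1 h1] [c2 h2]; exists (n2 + c1 + c2) => V Gam C Z u x Y hh uZ xZ ux YZ uY nu nx sY.
have [||||||phi [_ pI pC _ pS]] := @host_ext V Gam C D 'I_n2 (fun _ _ => false) set0
    (fun=> u) Z (fun=> [set u; x]) _ hh.
- by [].
- by [].
- by move=> i j; rewrite inE.
- by move=> i; rewrite inE.
- move=> i _; rewrite cards2 ux (_ : [set w' | false] = set0) ?cards0; first by lia.
  by apply/setP=> j; rewrite !inE.
- by rewrite setC0 cardsT card_ord; lia.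
pose W := [seq phi i | i <- enum 'I_n2].
have WE y : y \in W -> exists i, y = phi i by case/mapP=> i _ ->; exists i.
have WnZ y : y \in W -> y \notin Z by case/WE=> i ->; case: (pC i) => //; rewrite inE.
have sW : size W = n2 by rewrite size_map size_enum_ord.
have uW : uniq W by rewrite map_inj_uniq // enum_uniq.
pose N0 := phi @: [set: 'I_n2].
have WN y : (y \in W) = (y \in N0).
  by apply/mapP/imsetP => -[i _ ->]; exists i; rewrite ?mem_enum ?inE.
have nuW : u \notin W by apply: contraL uZ => /WnZ.
have nxW : x \notin W by apply: contraL xZ => /WnZ.
have star1 z e : z \notin W -> starm z W e <= 1.
  move=> zW; rewrite /starm big_tnth; apply: sum_le1 => [i _|i j _ _]; first by case: eqP.
  rewrite !lt0b => /eqP <- /eqP E; apply/val_inj/eqP => /=.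
  have sW' : tnth (in_tuple W) i \in W by apply: mem_tnth.
  rewrite -(nth_uniq u (ltn_ord i) (ltn_ord j)) //; apply/eqP.
  move: (esym E) sW'; rewrite !(tnth_nth u) /= => E' sW'.
  by apply: (set2_inj _ E'); apply: contraNneq zW => <-.
have starE z e : 0 < starm z W e -> exists2 y, y \in W & e = [set z; y].
  rewrite lt0n sum_nat_seq_neq0 => /hasP[y yW /=].
  by rewrite eqb0 negbK => /eqP <-; exists y.
have g0 : gadget Gam C Z N0 (fun e => starm u W e + starm x W e).
  split.
  - apply/subsetP=> y; rewrite -WN => /WE[i ->]; by case: (pC i) => //; rewrite inE.
  - rewrite disjoint_subset; apply/subsetP=> y; rewrite -WN => /WnZ; by rewrite inE.
  - move=> e; have := star1 u e nuW; have := star1 x e nxW.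
    case: (posnP (starm u W e)) => [->//|/starE[y yW ->]].
    case: (posnP (starm x W [set u; y])) => [->|/starE[y' y'W E]]; first by rewrite addn0.
    have : u \in [set x; y'] by rewrite -E !inE eqxx.
    rewrite !inE (negPf ux) /= => /eqP E'; move: nuW; by rewrite E' y'W.
  - move=> e; rewrite addn_gt0 => /orP[] /starE[y yW ->].
      exists y, u; rewrite setUC; split; rewrite -?WN //; first by rewrite inE uZ.
      by have [i ->] := WE y yW; apply: pS; rewrite !inE ?eqxx.
    exists y, x; rewrite setUC; split; rewrite -?WN //; first by rewrite inE xZ.
    by have [i ->] := WE y yW; apply: pS; rewrite !inE ?eqxx ?orbT.
have cN0 : #|N0| = n2 by rewrite /N0 card_imset // cardsT card_ord.
have hZN : #|Z :|: N0| <= #|Z| + #|N0| by apply: leq_card_setU.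
have subYW y : y \in Y ++ W -> y \in Z :|: N0.
  by rewrite mem_cat inE WN => /orP[/YZ->|->]; rewrite ?orbT.
have [|||||||||N1 [T1 [g1 k1 d1 e1]]] := h1 V Gam C (Z :|: N0) u x (Y ++ W).
- by apply: host_le hh; move: hZN cN0; clear; lia.
- by rewrite inE uZ.
- by rewrite inE xZ.
- by [].
- exact: subYW.
- rewrite cat_uniq uY uW andbT; apply/hasPn=> y yW; apply: contra (WnZ y yW) => /YZ //.
- by rewrite mem_cat negb_or nu.
- by rewrite mem_cat negb_or nx.
- by rewrite size_cat sY sW.
have hZN1 : #|Z :|: N0 :|: N1| <= #|Z :|: N0| + #|N1| by apply: leq_card_setU.
have [|||||||||N2 [T2 [g2 k2 d2 e2]]] := h2 V Gam C (Z :|: N0 :|: N1) u x W.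
- by apply: host_le hh; move: hZN hZN1 cN0 k1; clear; lia.
- by rewrite !inE uZ.
- by rewrite !inE xZ.
- by [].
- by move=> y yW; rewrite !inE -WN yW orbT.
- by [].
- by [].
- by [].
- by [].
exists (N0 :|: N1 :|: N2), (fun e => starm u W e + starm x W e + T1 e + T2 e); split.
- rewrite -setUA in g2; exact: gadgetD (gadgetD g0 g1) g2.
- have : #|N0 :|: N1 :|: N2| <= #|N0 :|: N1| + #|N2| by apply: leq_card_setU.
  have : #|N0 :|: N1| <= #|N0| + #|N1| by apply: leq_card_setU.
  by move: cN0 k1 k2; clear; lia.
- by apply: mdec_eq (mdecD d1 e2) => e; rewrite starm_cat; clear; lia.
- by apply: mdec_eq (mdecD e1 d2) => e; rewrite starm_cat; clear; lia.
Qed.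

(** Movable sizes are closed under sums and under the differences of [movableB], so Bezout gives the
    gcd of the degrees and its multiples. *)
Lemma movable_dvd : 0 < #|F| -> (forall v : F, movable (degree v)) ->
  forall n, gcd_degree F %| n -> movable n.
Proof.
move=> F0 hv.
have hM a n : movable a -> movable (n * a).
  by move=> ha; elim: n => [|n IH]; [apply: movable0 | rewrite mulSn; apply: movableD].
have hG a b : movable a -> movable b -> movable (gcdn a b).
  move=> ha hb; case: (posnP a) => [->|a0]; first by rewrite gcd0n.
  (* Here [gcdn a b + u * b] is a multiple of [a], a form of Bezout without negative
     coefficients. *)
  have [u _ /dvdnP[q E]] := Bezoutl b a0.
  by apply: (@movableB _ (u * b)) => //; [rewrite E; apply: hM|apply: hM].
have : movable (gcd_degree F).
  rewrite /gcd_degree; elim/big_ind: _ => //; exact: movable0.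
by move=> h n /dvdnP[q ->]; apply: hM.
Qed.

End StarMoves.

Section Base.
Variables (F : sgraph) (D : nat).
Hypothesis hD : 2 * #|F| <= D.
Variables (v a b : F).
Hypothesis ab : adj a b.

(* [inl (i, w)] is the vertex [w] of the copy of [F] that contains the edge from
   the centre to the [i]-th leaf; [inr (j, z)] is the vertex [z] of the copy of
   [F] in which the centre plays [v] and whose neighbours are the [inl (i, j)]. *)
Let T := ((F * F) + (F * F))%type.

Let port (w : F) := adj a w && (w != b).

(** A port [inl (i, w)] with [adj v i] lies in two copies, the [i]-th of the first kind and the
    [w]-th of the second kind; the second disjunct holds the edges it has in the latter among
    neighbours of [v]. *)
Let aT (t t' : T) : bool := match t, t' with
  | inl (i, w), inl (i', w') =>
      [&& i == i', adj w w', w != a & w' != a] ||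
      [&& w == w', port w, adj i i', adj v i & adj v i']
  | inr (j, z), inr (j', z') => (j == j') && adj z z'
  | inr (j, z), inl (i, w) => [&& j == w, adj z i, port w, z != v & ~~ adj v z]
  | inl (i, w), inr (j, z) => [&& j == w, adj z i, port w, z != v & ~~ adj v z]
  end.

Let aT_sym : symmetric aT.
Proof.
suff h t t' : aT t t' -> aT t' t by move=> t t'; apply/idP/idP; apply: h.
case: t t' => [[i w]|[i w]] [[i' w']|[i' w']] //=.
  case/orP=> [/and4P[/eqP-> ww' wa wa']|/and5P[/eqP-> pw ii' vi vi']].
    by rewrite eqxx adj_sym ww' wa wa'.
  by rewrite eqxx pw adj_sym ii' vi vi' orbT.
by case/andP=> /eqP-> zz'; rewrite eqxx adj_sym.
Qed.

Let aT_irr : irreflexive aT.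
Proof. by move=> [[i w]|[i w]] /=; rewrite !adj_irrefl ?andbF. Qed.

(** The neighbours of [t0] that share a first-kind copy with it go to one summand and those that
    share a second-kind copy to the other; this bounds every degree by [2 * #|F|]. *)
Let proj (t0 t : T) : F + F := match t0, t with
  | inl (i0, w0), inl (i, w) => if i == i0 then inl w else inr i
  | _, inl (i, w) => inr i
  | inl _, inr (j, z) => inr z
  | inr _, inr (j, z) => inl z
  end.

Let proj_inj t0 : {in [set t | aT t0 t] &, injective (proj t0)}.
Proof.
case: t0 => [[i0 w0]|[j0 z0]] [[i w]|[j z]] [[i' w']|[j' z']]; rewrite !inE /=.
- have [->|ni] := eqVneq i i0; have [->|ni'] := eqVneq i' i0; rewrite ?eqxx ?(eq_sym i0) ?(negPf ni) ?(negPf ni') /=.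
  + by move=> _ _ [->].
  + by [].
  + by [].
  + by move=> /andP[/eqP<- _] /andP[/eqP<- _] [->].
- have [->|ni] := eqVneq i i0; rewrite ?eqxx ?(eq_sym i0) ?(negPf ni) //=.
  by move=> /and5P[_ _ _ _ h] /and5P[_ _ _ _ h'] [E]; move: h'; rewrite -E h.
- have [->|ni] := eqVneq i' i0; rewrite ?eqxx ?(eq_sym i0) ?(negPf ni) //=.
  by move=> /and5P[_ _ _ _ h] /and5P[_ _ _ _ h'] [E]; move: h; rewrite E h'.
- by move=> /andP[/eqP-> _] /andP[/eqP-> _] [->].
- by move=> /andP[/eqP<- _] /andP[/eqP<- _] [->].
- by [].
- by [].
- by move=> /andP[/eqP<- _] /andP[/eqP<- _] [->].
Qed.

Let card_sumF : #|{: F + F}| = 2 * #|F|.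
Proof. by rewrite card_sum mul2n addnn. Qed.

Let deg_aT t : #|[set t' | aT t t']| <= 2 * #|F|.
Proof.
rewrite -card_sumF -(card_in_imset (@proj_inj t)); exact: max_card.
Qed.

(** The values [inl a] and [inr v], which stand for the centre of either copy, are missed. This
    leaves room for two more neighbours, the centres [u] and [x]. *)
Let deg_aT_port i w : port w -> adj v i ->
  #|[set t' | aT (inl (i, w)) t']| + 2 <= 2 * #|F|.
Proof.
move=> pw vi; rewrite -(card_in_imset (@proj_inj (inl (i, w)))).
set B := [set _ | _ in _].
have aB : inl a \notin B.
  apply/imsetP => -[[[i' w']|[j z]]]; rewrite !inE //=.
  case: (eqVneq i' i) => // -> + [E]; rewrite -E => /orP[/and4P[_ _ _]|/and5P[_ _]].
    by rewrite eqxx.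
  by rewrite adj_irrefl.
have vB : inr v \notin B.
  apply/imsetP => -[[[i' w']|[j z]]]; rewrite !inE /=.
    case: (eqVneq i' i) => // ni + [E]; rewrite -E adj_irrefl !andbF orbF.
    by [].
  by move=> /and5P[_ _ _ + _] [E]; rewrite E eqxx.
have : #|inl a |: (inr v |: B)| <= #|{: F + F}| by apply: max_card.
by rewrite card_sumF !cardsU1 in_setU1 aB vB; lia.
Qed.

(** The gadget joins all ports to both [u] and [x]. If the copies of the first kind are centred at
    one of them, they use its ports and its star on [Y]; the copies of the second kind, centred at
    the other vertex, use up the remaining port edges. Exchanging the two centres moves the star. *)
Lemma movable_base : movable F D (degree v).
Proof.
pose n := #|{: T}|; exists n => V Gam C Z u x Y hh uZ xZ ux YZ uY nu nx sY.
pose nb := enum [set w | adj v w].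
pose y (i : F) := nth u Y (index i nb).
have nbE i : (i \in nb) = adj v i by rewrite mem_enum inE.
have snb : size nb = size Y by rewrite sY -cardE.
have ylt i : adj v i -> index i nb < size Y by rewrite -snb index_mem nbE.
have yY i : adj v i -> y i \in Y by move=> vi; apply/mem_nth/ylt.
have y_inj i i' : adj v i -> adj v i' -> y i = y i' -> i = i'.
  move=> vi vi' /eqP; rewrite nth_uniq ?ylt // => /eqP E.
  by rewrite -(nth_index v (_ : i \in nb)) ?nbE // E nth_index ?nbE.
(* The vertices that play [b] in the first-kind copies are the given leaves, the only old vertices
   of the pattern. *)
pose A := [set t : T | if t is inl (i, w) then (w == b) && adj v i else false].
pose phi0 (t : T) := if t is inl (i, w) then y i else u.
pose S (t : T) := if t is inl (i, w) then if port w && adj v i then [set u; x] else set0 else set0.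
have [||||phi [pA pI pC pG pS]] := host_ext (phi0 := phi0) (Z := Z) (S := S) (A := A) hh aT_sym aT_irr.
- move=> [[i w]|[i w]] [[i' w']|[i' w']]; rewrite !inE //=.
  by move=> /andP[/eqP-> vi] /andP[/eqP-> vi'] /y_inj ->.
- by move=> [[i w]|[i w]]; rewrite !inE //= => /andP[_ vi]; apply/YZ/yY.
- move=> t _; have := leq_trans (deg_aT t) hD; case: t => [[i w]|[i w]] dt; rewrite /S.
    case: ifP => [/andP[pw vi]|_]; last by rewrite cards0 addn0.
    by rewrite cards2 ux; apply: leq_trans (deg_aT_port pw vi) hD.
  by rewrite cards0 addn0.
- by rewrite leq_add2l max_card.
have inA i w : (inl (i, w) \in A) = (w == b) && adj v i by rewrite inE.
have inA' j z : (inr (j, z) \in A) = false by rewrite inE.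
have phib i : adj v i -> phi (inl (i, b)) = y i.
  by move=> vi; rewrite pA // inA eqxx.
have phi_nb z t : z \in Z -> z \notin Y -> phi t != z.
  move=> zZ zY; case: (boolP (t \in A)) => [|/pC[_]].
    case: t => [[i w]|[i w]]; rewrite ?inA ?inA' // => /andP[/eqP-> vi].
    by rewrite phib //; apply: contraNneq zY => <-; apply: yY.
  by apply: contraNneq => ->.
have uphi t := phi_nb u t uZ nu.
have xphi t := phi_nb x t xZ nx.
pose Fi (z : V) (i w : F) := if w == a then z else phi (inl (i, w)).
pose Fj (z : V) (j w : F) := if w == v then z else
   if adj v w then phi (inl (w, j)) else phi (inr (j, w)).
have FiI z i : (forall t, phi t != z) -> injective (Fi z i).
  move=> hz w w'; rewrite /Fi; case: eqP => [->|_]; case: eqP => [->|_] //.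
  - by move=> E; move: (hz (inl (i, w'))); rewrite -E eqxx.
  - by move=> E; move: (hz (inl (i, w))); rewrite E eqxx.
  - by move/pI => [].
have FjI z j : (forall t, phi t != z) -> injective (Fj z j).
  move=> hz w w'; rewrite /Fj; case: eqP => [->|_]; case: eqP => [->|_] //.
  - by case: ifP => _ E; [move: (hz (inl (w', j)))|move: (hz (inr (j, w')))]; rewrite -E eqxx.
  - by case: ifP => _ E; [move: (hz (inl (w, j)))|move: (hz (inr (j, w)))]; rewrite E eqxx.
  - by case: ifP => _; case: ifP => _ /pI // [].
pose p i j := phi (inl (i, j)).
pose mI i := mul (edges F :\: star a) (Fi u i).
pose mJ j := mul (edges F :\: star v) (Fj u j).
pose st z e := \sum_(ij : F * F | adj v ij.1 && port ij.2) ([set z; p ij.1 ij.2] == e).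
have mI_x i : mI i =1 mul (edges F :\: star a) (Fi x i).
  apply: mul_eq => f w; rewrite !inE => /andP[nf fE] wf; rewrite /Fi.
  by case: eqP => // wa; case/negP: nf; rewrite fE -wa wf.
have mJ_x j : mJ j =1 mul (edges F :\: star v) (Fj x j).
  apply: mul_eq => f w; rewrite !inE => /andP[nf fE] wf; rewrite /Fj.
  by case: eqP => // wa; case/negP: nf; rewrite fE -wa wf.
have mIP i e : 0 < mI i e -> exists w w', [/\ e = [set p i w; p i w'], adj w w', w != a & w' != a].
  case/mul_gt0=> f; rewrite !inE negb_and => /andP[nf fE] ->.
  rewrite fE /= in nf; case/existsP: (fE) => w /existsP[w' /andP[ww' /eqP Ef]].
  have wa : w != a by apply: contraNneq nf => <-; rewrite Ef !inE eqxx.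
  have wa' : w' != a by apply: contraNneq nf => <-; rewrite Ef !inE eqxx orbT.
  by exists w, w'; rewrite Ef imsetU1 imset_set1 /Fi (negPf wa) (negPf wa').
pose q j w := if adj v w then phi (inl (w, j)) else phi (inr (j, w)).
have mJP j e : 0 < mJ j e -> exists w w', [/\ e = [set q j w; q j w'], adj w w', w != v & w' != v].
  case/mul_gt0=> f; rewrite !inE negb_and => /andP[nf fE] ->.
  rewrite fE /= in nf; case/existsP: (fE) => w /existsP[w' /andP[ww' /eqP Ef]].
  have wa : w != v by apply: contraNneq nf => <-; rewrite Ef !inE eqxx.
  have wa' : w' != v by apply: contraNneq nf => <-; rewrite Ef !inE eqxx orbT.
  by exists w, w'; rewrite Ef imsetU1 imset_set1 /Fj (negPf wa) (negPf wa').
have stP z e : 0 < st z e -> exists i j, [/\ e = [set z; p i j], adj v i & port j].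
  by case/sum_gt0=> -[i j] /andP[/= vi pj]; rewrite lt0b => /eqP <-; exists i, j.
have pI2 i j i' j' : p i j = p i' j' -> i = i' /\ j = j' by move/pI => [-> ->].
have st1 z e : (forall t, phi t != z) -> st z e <= 1.
  move=> hz; apply: sum_le1 => [ij _|[i j] [i' j'] _ _ /=]; first by case: eqP.
  rewrite !lt0b => /eqP <- /eqP/esym/set2_inj => /(_ (hz _)) /pI2 [-> ->] //.
have sI1 e : \sum_(i | adj v i) mI i e <= 1.
  apply: sum_le1 => [i _|i i' _ _ /mIP[w [w' [-> _ _ _]]] /mIP[z [z' [E _ _ _]]]].
    by apply/mul_le1/FiI.
  have : p i w \in [set p i' z; p i' z'] by rewrite -E !inE eqxx.
  by rewrite !inE => /orP[] /eqP /pI2 [].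
have sJ1 e : \sum_(j | port j) mJ j e <= 1.
  apply: sum_le1 => [i _|i i' _ _ /mJP[w [w' [-> _ _ _]]] /mJP[z [z' [E _ _ _]]]].
    by apply/mul_le1/FjI.
  have : q i w \in [set q i' z; q i' z'] by rewrite -E !inE eqxx.
  by rewrite !inE /q => /orP[] /eqP; do 2 case: ifP => _; move/pI => // [].
pose TT e := \sum_(i | adj v i) mI i e + \sum_(j | port j) mJ j e + st u e + st x e.
have zI z i e : (forall t, phi t != z) -> 0 < mI i e -> z \notin e.
  move=> hz /mIP[w [w' [-> _ _ _]]]; rewrite !inE !(eq_sym z) negb_or.
  by rewrite !hz.
have zJ z j e : (forall t, phi t != z) -> 0 < mJ j e -> z \notin e.
  move=> hz /mJP[w [w' [-> _ _ _]]]; rewrite !inE !(eq_sym z) negb_or /q.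
  by apply/andP; split; case: ifP.
have zin z e : 0 < st z e -> z \in e by case/stP=> i [j [-> _ _]]; rewrite !inE eqxx.
have IJ i j e : 0 < mI i e -> 0 < mJ j e -> False.
  case/mIP=> w [w' [-> ww' _ _]] /mJP[z [z' [E _ _ _]]].
  have h1 : p i w \in [set q j z; q j z'] by rewrite -E !inE eqxx.
  have h2 : p i w' \in [set q j z; q j z'] by rewrite -E !inE eqxx orbT.
  have h t : p i t \in [set q j z; q j z'] -> t = j.
    by rewrite !inE /q => /orP[] /eqP; case: ifP => _; move/pI => // [].
  by move: ww'; rewrite (h _ h1) (h _ h2) adj_irrefl.
have uxst e : 0 < st u e -> 0 < st x e -> False.
  move=> /stP[i [j [-> _ _]]] /zin; rewrite !inE eq_sym (negPf ux) /=.
  by rewrite eq_sym (negPf (xphi _)).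
have stY z e : starm z Y e = \sum_(i | adj v i) ([set z; y i] == e).
  rewrite /starm (_ : Y = [seq y i | i <- nb]).
    by rewrite big_map /nb big_enum; apply: eq_bigl => i; rewrite inE.
  apply: (@eq_from_nth _ u); first by rewrite size_map snb.
  move=> k kY; rewrite (nth_map v) ?snb // /y index_uniq ?snb //.
  exact: enum_uniq.
have key z z' : (forall t, phi t != z) -> (forall t, phi t != z') ->
    (forall i, mI i =1 mul (edges F :\: star a) (Fi z i)) ->
    (forall j, mJ j =1 mul (edges F :\: star v) (Fj z' j)) ->
    mdec F (fun e => \sum_(i | adj v i) mI i e + \sum_(j | port j) mJ j e
                      + st z e + st z' e + starm z Y e).
  move=> hz hz' EI EJ.
  have dI : mdec F (fun e => \sum_(i | adj v i) mul (edges F) (Fi z i) e).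
    by apply: mdec_sum => i _; apply/mdec_copy/FiI.
  have dJ : mdec F (fun e => \sum_(j | port j) mul (edges F) (Fj z' j) e).
    by apply: mdec_sum => j _; apply/mdec_copy/FjI.
  apply: mdec_eq (mdecD dI dJ) => e.
  have -> : \sum_(i | adj v i) mul (edges F) (Fi z i) e =
      \sum_(i | adj v i) mI i e + st z e + starm z Y e.
    rewrite stY /st -(pair_big (adj v) port (fun i j => nat_of_bool ([set z; p i j] == e))) /=.
    rewrite -!big_split; apply: eq_bigr => i vi /=.
    rewrite (mul_split a) -EI addnC -addnA; congr (_ + _).
    have Fa : Fi z i a = z by rewrite /Fi eqxx.
    have Fw w : adj a w -> Fi z i w = p i w.
      by move=> aw; rewrite /Fi eq_sym (negPf (adj_neq aw)).
    rewrite (bigD1 b) //= addnC Fa Fw // /p phib //; congr (_ + _).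
    by apply: eq_bigr => w /andP[aw _]; rewrite Fw.
  have -> : \sum_(j | port j) mul (edges F) (Fj z' j) e =
      \sum_(j | port j) mJ j e + st z' e.
    rewrite /st -(pair_big (adj v) port (fun i j => nat_of_bool ([set z'; p i j] == e))) /=.
    rewrite [X in _ + X]exchange_big -big_split; apply: eq_bigr => j pj /=.
    rewrite (mul_split v) -EJ addnC; congr (_ + _).
    by apply: eq_bigr => w vw; rewrite /Fj eqxx (eq_sym w) (negPf (adj_neq vw)) vw.
  by lia.
exists (phi @: ~: A), TT; split.
- split.
  + by apply/subsetP=> z /imsetP[t]; rewrite inE => /pC[tC _] ->.
  + rewrite disjoint_subset; apply/subsetP=> z /imsetP[t]; rewrite inE => /pC[_ tC] ->.
    by rewrite inE.
  + move=> e; rewrite /TT; have := sI1 e; have := sJ1 e.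
    have := st1 u e uphi; have := st1 x e xphi.
    have := @uxst e.
    have k1 : 0 < \sum_(i | adj v i) mI i e -> 0 < \sum_(j | port j) mJ j e -> False.
      by move=> /sum_gt0[i _ hi] /sum_gt0[j _ hj]; apply: IJ hi hj.
    have k2 z : (forall t, phi t != z) -> 0 < \sum_(i | adj v i) mI i e -> 0 < st z e -> False.
      by move=> hz /sum_gt0[i _ /(zI z i e hz) hi] /zin; rewrite (negPf hi).
    have k3 z : (forall t, phi t != z) -> 0 < \sum_(j | port j) mJ j e -> 0 < st z e -> False.
      by move=> hz /sum_gt0[i _ /(zJ z i e hz) hi] /zin; rewrite (negPf hi).
    move: k1 (k2 _ uphi) (k2 _ xphi) (k3 _ uphi) (k3 _ xphi).
    move: (\sum_(i | _) _) (\sum_(i | _) _) (st u e) (st x e).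
    have ex a0 b0 : (0 < a0 -> 0 < b0 -> False) -> (a0 == 0) || (b0 == 0).
      by case: a0 b0 => [|?] [|?] // h; case: (h isT isT).
    by clear -ex => ? ? ? ? /ex h1 /ex h2 /ex h3 /ex h4 /ex h5 /ex h6; lia.
  + have inN t : t \notin A -> phi t \in phi @: ~: A.
      by move=> tA; apply: imset_f; rewrite inE.
    have inZN t : phi t \in Z :|: phi @: ~: A.
      have [tA|tA] := boolP (t \in A); last by rewrite inE inN ?orbT.
      rewrite inE; case: t tA => [[i w]|[i w]]; rewrite ?inA ?inA' // => /andP[/eqP-> vi].
      by rewrite phib // YZ // yY.
    have symG : symmetric Gam by case: hh.
    have edge t t' : aT t t' -> (t \notin A) || (t' \notin A) -> exists x0 y0,
       [/\ [set phi t; phi t'] = [set x0; y0], x0 \in phi @: ~: A, y0 \in Z :|: phi @: ~: A & Gam x0 y0].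
      move=> att' /orP[tA|tA].
        by exists (phi t), (phi t'); split=> //; [apply: inN|apply: pG].
      exists (phi t'), (phi t); split=> //; [by rewrite setUC|exact: inN|].
      by apply: pG => //; rewrite aT_sym.
    move=> e; rewrite /TT !addn_gt0 -!orbA => /or4P[/sum_gt0[i vi]|/sum_gt0[j pj]||].
    * case/mIP=> w [w' [-> ww' wa wa']]; apply: edge; first by rewrite /= eqxx ww' wa wa'.
      rewrite !inA; move: (adj_neq ww'); case: (eqVneq w b) => [->|] //=.
      by rewrite eq_sym => /negPf->; rewrite orbT.
    * case/andP: (pj) => aj jb.
      case/mJP=> w [w' [-> ww' wv wv']]; rewrite /q.
      case: ifP => vw; case: ifP => vw'; apply: edge; rewrite /= ?inA ?inA' ?(negPf jb) //=.
      -- by rewrite eqxx pj ww' vw vw' !orbT.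
      -- by rewrite eqxx adj_sym ww' pj wv' vw'.
      -- by rewrite eqxx ww' pj wv vw.
      -- by rewrite eqxx.
    * case/stP=> i [j [-> vi pj]]; exists (p i j), u; rewrite setUC; split=> //.
      -- by apply: inN; rewrite inA negb_and; case/andP: pj => _ ->.
      -- by rewrite inE uZ.
      -- by apply: pS; rewrite /= ?pj ?vi ?inE ?eqxx // negb_and; case/andP: pj => _ ->.
    * case/stP=> i [j [-> vi pj]]; exists (p i j), x; rewrite setUC; split=> //.
      -- by apply: inN; rewrite inA negb_and; case/andP: pj => _ ->.
      -- by rewrite inE xZ.
      -- by apply: pS; rewrite /= ?pj ?vi ?inE ?eqxx ?orbT // negb_and; case/andP: pj => _ ->.
- have : #|phi @: ~: A| <= #|~: A| by apply: leq_imset_card.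
  by move/leq_trans; apply; apply: max_card.
- by apply: mdec_eq (key _ _ uphi xphi (fun i e => erefl) mJ_x) => e; rewrite /TT; lia.
- by apply: mdec_eq (key _ _ xphi uphi mI_x (fun i e => erefl)) => e; rewrite /TT; lia.
Qed.

End Base.

Lemma movable_all (F : sgraph) (D : nat) : 2 * #|F| <= D -> 0 < #|F| ->
  forall n, gcd_degree F %| n -> movable F D n.
Proof.
move=> hD F0; apply: movable_dvd => // v.
case: (posnP (degree v)) => [->|]; first exact: movable0.
by case/card_gt0P=> w; rewrite inE => vw; apply: (movable_base hD _ vw).
Qed.

(** Stars of varying but bounded sizes have to be moved later with one constant. *)
Lemma movable_unif (F : sgraph) (D : nat) N : 2 * #|F| <= D -> 0 < #|F| ->
  exists c, forall n, n <= N -> gcd_degree F %| n -> movable_c F D c n.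
Proof.
move=> hD F0; elim: N => [|N [c IH]].
  exists 0 => n; rewrite leqn0 => /eqP-> _; exact: movable_c0.
case: (boolP (gcd_degree F %| N.+1)) => [/(movable_all hD F0)[c' h]|nd].
  exists (maxn c c') => n; rewrite leq_eqVlt => /orP[/eqP-> _|nN /(IH _ nN)].
    exact: movable_c_le (leq_maxr _ _) h.
  exact: movable_c_le (leq_maxl _ _).
exists c => n; rewrite leq_eqVlt => /orP[/eqP-> h|nN]; last exact: IH.
by rewrite h in nd.
Qed.

(** * Switching degree classes *)

Section Item.
Variables (F : sgraph) (V : finType) (Gam : rel V) (C Z : {set V}).

(** A partial copy of [F] together with edges from several alternative old centres to its ports: one
    copy is prepared so that it can later be closed at any of the centres [ctr i]. *)
Lemma gadget_item (phi : F -> V) (A : {set F}) (S : {set {set F}})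
    (I : finType) (ctr : I -> V) (pt : I -> pred F) :
  symmetric Gam -> injective phi ->
  (forall w, w \in A -> phi w \in Z) ->
  (forall w, w \notin A -> phi w \in C /\ phi w \notin Z) ->
  S \subset edges F -> (forall f, f \in S -> ~~ (f \subset A)) ->
  (forall w w', w \notin A -> adj w w' -> Gam (phi w) (phi w')) ->
  injective ctr -> (forall i, ctr i \in Z) ->
  (forall i f w, f \in S -> w \in f -> phi w != ctr i) ->
  (forall i w, pt i w -> w \notin A /\ Gam (phi w) (ctr i)) ->
  gadget Gam C Z (phi @: ~: A)
    (fun e => mul S phi e + \sum_i \sum_(w | pt i w) ([set ctr i; phi w] == e)).
Proof.
move=> symG pI pA pC SE SA pG cI cZ cS hpt.
pose st i e := \sum_(w | pt i w) ([set ctr i; phi w] == e : nat).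
have stP i e : 0 < st i e -> exists w, [/\ pt i w & e = [set ctr i; phi w]].
  by case/sum_gt0=> w pw; rewrite lt0b => /eqP <-; exists w.
have ptn i j w : pt i w -> phi w != ctr j.
  by case/hpt=> /pC[_ h] _; apply: contraNneq h => ->.
have st1 i e : st i e <= 1.
  apply: sum_le1 => [w _|w w' pw pw']; first by case: eqP.
  by rewrite !lt0b => /eqP <- /eqP/esym/set2_inj => /(_ (ptn _ _ _ pw)) /pI.
have stst i j e : 0 < st i e -> 0 < st j e -> i = j.
  case/stP=> w [pw ->] /stP[w' [pw' E]]; apply: cI.
  have : ctr i \in [set ctr j; phi w'] by rewrite -E !inE eqxx.
  by rewrite !inE => /orP[/eqP//|]; rewrite eq_sym (negPf (ptn _ _ _ pw')).
have s1 e : \sum_i st i e <= 1.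
  by apply: sum_le1 => // i j _ _; apply: stst.
have excl e : 0 < mul S phi e -> 0 < \sum_i st i e -> False.
  case/mul_gt0=> f fS -> /sum_gt0[i _ /stP[w [pw E]]].
  have : ctr i \in phi @: f by rewrite E !inE eqxx.
  by case/imsetP=> t tf Et; move: (cS i f t fS tf); rewrite Et eqxx.
have inN t : t \notin A -> phi t \in phi @: ~: A.
  by move=> tA; apply: imset_f; rewrite inE.
have inZN t : phi t \in Z :|: phi @: ~: A.
  by rewrite inE; case: (boolP (t \in A)) => [/pA->//|/inN ->]; rewrite orbT.
split.
- by apply/subsetP=> z /imsetP[t]; rewrite inE => /pC[tC _] ->.
- rewrite disjoint_subset; apply/subsetP=> z /imsetP[t]; rewrite inE => /pC[_ tC] ->.
  by rewrite inE.
- move=> e; have := s1 e; have := mul_le1 S e pI; have := excl e; rewrite -/(st _ e).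
  move: (mul S phi e) (\sum_i st i e).
  by move=> [|[|?]] [|[|?]] // h; case: (h isT isT).
- move=> e; rewrite addn_gt0 => /orP[/mul_gt0[f fS ->]|/sum_gt0[i _ /stP[w [pw ->]]]].
    have /edgesP[w [w' [ww' Ef]]] := subsetP SE f fS.
    have := SA f fS; rewrite Ef subUset !sub1set negb_and => /orP[wA|wA].
      exists (phi w), (phi w'); rewrite imsetU1 imset_set1; split=> //; first exact: inN.
      exact: pG.
    exists (phi w'), (phi w); rewrite imsetU1 imset_set1 setUC; split=> //; first exact: inN.
    by apply: pG; rewrite // adj_sym.
  have [wA wG] := hpt _ _ pw; exists (phi w), (ctr i).
  by rewrite setUC inE cZ; split=> //; apply: inN.
Qed.

Lemma mul_split2 (a b : F) (phi : F -> V) : adj a b ->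
  mul (edges F) phi =1 fun e => ([set phi a; phi b] == e) +
    \sum_(w | adj a w && (w != b)) ([set phi a; phi w] == e) +
    \sum_(w | adj b w && (w != a)) ([set phi b; phi w] == e) +
    mul (edges F :\: star a :\: star b) phi e.
Proof.
move=> ab e; rewrite (mul_split a) (bigD1 b) //= -!addnA; congr (_ + (_ + _)).
have nab := adj_neq ab.
have E2 f : f \in edges F -> (f == [set a; b]) = (a \in f) && (b \in f).
  move=> fE; apply/eqP/andP => [->|[af bf]]; first by rewrite !inE !eqxx orbT.
  apply/eqP; rewrite eq_sym eqEcard (edges_card2 fE) cards2 nab andbT.
  by rewrite subUset !sub1set af.
have abS : [set a; b] \in star b by rewrite inE edges_pair ab !inE eqxx orbT.
have -> : mul (edges F :\: star a) phi e =
   mul (star b :\ [set a; b]) phi e + mul (edges F :\: star a :\: star b) phi e.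
  rewrite -mul_setU.
    congr (mul _ _ _); apply/setP=> f; rewrite !in_setU !in_setD !in_set1 ![f \in star _]in_set.
    case fE: (f \in edges F) => /=; rewrite ?andbF //.
    by rewrite (E2 _ fE); case: (a \in f); case: (b \in f).
  by rewrite disjoint_subset; apply/subsetP=> f; rewrite !inE => /and3P[_ -> ->].
congr (_ + _); apply: (@addnI ([set phi a; phi b] == e)).
have -> : [set phi a; phi b] = phi @: [set a; b] by rewrite imsetU1 imset_set1.
rewrite -(mulD1 phi abS) mul_star (bigD1 a) 1?adj_sym //= imsetU1 imset_set1.
by rewrite [in RHS]setUC.
Qed.

End Item.

Section Switch.
Variables (F : sgraph) (D : nat).
Hypothesis hD : 2 * #|F| <= D.
Variables (a b : F).
Hypothesis ab : adj a b.

Let port (w : F) := adj a w && (w != b).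

Let F2 : 2 <= #|F|.
Proof.
have -> : 2 = #|[set a; b]| by rewrite cards2 (adj_neq ab).
exact: max_card.
Qed.

Definition pairsm (V : finType) (I : finType) (P : pred I) (c l : I -> V) :
  {set V} -> nat := fun e => \sum_(i | P i) ([set c i; l i] == e).

(* Both sides are turned into the same stars at one new vertex. *)
Lemma switch n : exists K, forall (V : finType) (Gam : rel V) (C Z : {set V})
    (I : finType) (P : pred I) (c c' l : I -> V),
  #|P| <= n -> host Gam C D (#|Z| + K) ->
  (forall i, P i -> [/\ c i \in Z, c' i \in Z & l i \in Z]) ->
  (forall i, P i -> c i != l i /\ c' i != l i) ->
  (forall i j, P i -> P j -> c i != c' j) ->
  (forall z, gcd_degree F %| #|[pred i | P i && (c i == z)]|) ->
  (forall z, gcd_degree F %| #|[pred i | P i && (c' i == z)]|) ->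
  exists N T, [/\ gadget Gam C Z N T, #|N| <= K,
    mdec F (fun e => T e + pairsm P c l e) & mdec F (fun e => T e + pairsm P c' l e)].
Proof.
have [K0 mov] := @movable_unif F D (n * #|F|) hD (ltnW F2).
(* One vertex [x], one copy of [F] for each index, and the moves of the stars at the at most [n]
   values of [c] and of [c']. *)
pose K := 1 + #|F| * n + (K0 * n + K0 * n); exists K.
move=> V Gam C Z I P c c' l Pn hh inZ ncl ncc' gc gc'.
have [symG irrG rich] := hh.
have [||x [xC xZ _]] := rich set0 Z; rewrite ?cards0 ?leq_addr //.
pose Z0 := x |: Z.
have cZ0 : #|Z0| = #|Z|.+1 by rewrite /Z0 cardsU1 xZ.
(* Each index has three possible centres: [c i], [c' i] and the common new vertex [x]. *)
pose ctr i (s : option bool) := if s is Some s' then if s' then c i else c' i else x.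
have ctrI i : P i -> injective (ctr i).
  move=> Pi; have [ci ci' _] := inZ i Pi; have ncc := ncc' i i Pi Pi.
  have xc : x != c i by apply: contraNneq xZ => ->.
  have xc' : x != c' i by apply: contraNneq xZ => ->.
  move=> [[]|] [[]|] //= /eqP; rewrite ?(negPf ncc) ?(negPf xc) ?(negPf xc') // eq_sym;
  by rewrite ?(negPf ncc) ?(negPf xc) ?(negPf xc').
have ctrZ i s : P i -> ctr i s \in Z0.
  by move=> Pi; have [ci ci' _] := inZ i Pi; case: s => [[]|]; rewrite !inE ?ci ?ci' ?eqxx ?orbT.
have lctr i s : P i -> l i != ctr i s.
  move=> Pi; have [ci ci'] := ncl i Pi; case: s => [[]|] /=; rewrite eq_sym //.
  by apply: contraNneq xZ => ->; have [] := inZ i Pi.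
pose Mo i (phi : F -> V) e := mul (edges F :\: star a) phi e +
  \sum_(s : option bool) \sum_(w | port w) ([set ctr i s; phi w] == e).
pose No (i : I) (phi : F -> V) := phi @: ~: [set b].
pose Q i (phi : F -> V) := [/\ injective phi, phi b = l i &
   forall w, w != b -> phi w \notin Z0].
have [i Z' Pi ZZ' hZ'||phi [g1 k1 q1 d1]] :=
   @gadget_fin V Gam C I P (F -> V) (fun=> x) No Mo Q #|F| Z0 (#|Z| + K).
- have [ci ci' li] := inZ i Pi.
  have Z0Z' z : z \in Z0 -> z \in Z' by apply/subsetP.
  have [||||||phi [pA pI pC pG pS]] := @host_ext V Gam C D F (@adj F) [set b]
     (fun=> l i) Z' (fun w => if port w then [set c i; c' i; x] else set0) (#|Z| + K) hh.
  + exact: adj_sym.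
  + exact: adj_irrefl.
  + by move=> ? ?; rewrite !inE => /eqP-> /eqP->.
  + by move=> w _; apply: Z0Z'; rewrite !inE li orbT.
  + move=> w wb; apply: leq_trans hD.
    have h1 : #|[set w' | adj w w']| < #|F|.
      rewrite -[X in _ < X](cardC [set w' | adj w w']) -{1}[X in X < _]addn0 ltn_add2l.
      by apply/card_gt0P; exists w; rewrite !inE adj_irrefl.
    have : #|if port w then [set c i; c' i; x] else set0| <= 3.
      case: ifP => _; rewrite ?cards0 //.
      apply: leq_trans (leq_card_setU _ _) _; rewrite cards1 addn1 ltnS.
      by rewrite cards2; case: (_ != _).
    move: h1 F2; clear; lia.
  + by apply: leq_trans hZ'; rewrite leq_add2l max_card.
  have pb : phi b = l i by apply: pA; rewrite inE.
  have pnZ w : w != b -> phi w \notin Z'.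
    by move=> wb; have [|//] := pC w; rewrite inE.
  exists phi; split; last first.
  + split=> // w wb; apply: contra (pnZ w wb); exact: Z0Z'.
  + by apply: leq_trans (leq_imset_card _ _) (max_card _).
  apply: (gadget_item (A := [set b]) (pt := fun _ => port)) => //.
  + by move=> w; rewrite inE => /eqP->; rewrite pb Z0Z' // !inE li orbT.
  + exact: subsetDl.
  + move=> f; rewrite inE => /andP[_ /edges_card2 f2]; apply/negP=> /subset_leq_card.
    by rewrite cards1 f2.
  + exact: ctrI.
  + by move=> s; apply/Z0Z'/ctrZ.
  + move=> s f w _ _; case: (eqVneq w b) => [->|wb]; first by rewrite pb lctr.
    by apply: contraNneq (pnZ w wb) => ->; apply/Z0Z'/ctrZ.
  + move=> s w pw; have wb : w \notin [set b] by rewrite inE; case/andP: pw.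
    split=> //; apply: pS => //; rewrite pw !inE; case: s => [[]|] /=; by rewrite eqxx ?orbT.
- have : #|F| * #|P| <= #|F| * n by rewrite leq_mul2l Pn orbT.
  move: cZ0; rewrite /K; clear; lia.
set N1 := \bigcup_(i | P i) _ in g1 k1.
have phib i : P i -> phi i b = l i by move=> /q1 [].
have phiZ i w : P i -> w != b -> phi i w \notin Z0 by move=> /q1 [_ _]; apply.
have phiI i i' w w' : P i -> P i' -> w != b -> w' != b -> phi i w = phi i' w' -> i = i' /\ w = w'.
  move=> Pi Pi' wb wb' E; have [ii'|ni] := eqVneq i i'.
    by subst i'; split=> //; have [pI _ _] := q1 i Pi; apply: pI.
  have := d1 i i' Pi Pi' ni; rewrite disjoint_subset => /subsetP/(_ (phi i w)).
  have h1 : phi i w \in No i (phi i) by apply: imset_f; rewrite !inE.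
  have h2 : phi i w \in No i' (phi i') by rewrite E; apply: imset_f; rewrite !inE.
  by move=> /(_ h1); rewrite inE /= h2.
pose R := [pred p : I * F | P p.1 && port p.2].
pose Pl (h : I -> V) z := [seq phi p.1 p.2 | p <- enum [pred p | R p & h p.1 == z]].
have Pl_sum h z y e : starm y (Pl h z) e = \sum_(p | R p && (h p.1 == z)) ([set y; phi p.1 p.2] == e).
  by rewrite /starm big_map big_enum.
have PlP h z y : y \in Pl h z -> exists p, [/\ R p, h p.1 = z & y = phi p.1 p.2].
  by case/mapP=> p; rewrite mem_enum inE => /andP[Rp /eqP hp] ->; exists p.
have RE p : R p -> P p.1 /\ p.2 != b by case/andP=> Pp /andP[].
have Plu h z : uniq (Pl h z).
  rewrite map_inj_in_uniq ?enum_uniq // => -[i w] [i' w']; rewrite !mem_enum !inE.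
  move=> /= /andP[/andP[Pi /andP[_ wb]] _] /andP[/andP[Pi' /andP[_ wb']] _] E.
  by have [-> ->] := phiI _ _ _ _ Pi Pi' wb wb' E.
have Pls h z : size (Pl h z) = #|[pred i | P i && (h i == z)]| * #|[pred w | port w]|.
  rewrite size_map -cardE -cardX; apply: eq_card => -[i w]; rewrite !inE /=.
  by rewrite andbAC.
have PlN h z y : y \in Pl h z -> y \in N1.
  case/PlP=> -[i w] [/RE[/= Pi wb] _ ->]; apply/bigcupP; exists i => //.
  by apply: imset_f; rewrite !inE.
have PlZ h z y : y \in Pl h z -> y \notin Z0.
  by case/PlP=> -[i w] [/RE[/= Pi wb] _ ->]; apply: phiZ.
(* The port edges at the centres [h i] are grouped by the value of [h]. Each group is a star whose
   size is a multiple of the gcd, hence can be moved to [x]. *)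
have step (h : I -> V) (Z1 : {set V}) : (forall z, gcd_degree F %| #|[pred i | P i && (h i == z)]|) ->
    (forall i, P i -> h i \in Z) -> Z0 :|: N1 \subset Z1 -> #|Z1| + K0 * n <= #|Z| + K ->
    exists N T, [/\ gadget Gam C Z1 N T, #|N| <= K0 * n,
     mdec F (fun e => T e + \sum_(p | R p) ([set h p.1; phi p.1 p.2] == e)) &
     mdec F (fun e => T e + \sum_(p | R p) ([set x; phi p.1 p.2] == e))].
  move=> gh hZ Z01 hZ1.
  pose P1 := [pred z | z \in h @: [pred i | P i]].
  have cP1 : #|P1| <= n.
    by apply: leq_trans Pn; apply: leq_trans (leq_imset_card _ _) _; apply: subset_leq_card; apply/subsetP.
  have hK : K0 * #|P1| <= K0 * n by rewrite leq_mul2l cP1 orbT.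
  have Rp1 p : R p -> h p.1 \in P1.
    by case/andP=> Pp _; rewrite inE; apply: imset_f; rewrite inE.
  have [z Z2 P1z ZZ2 hZ2||y [h1 h2 h3 _]] :=
     @gadget_fin V Gam C V P1 ({set V} * ({set V} -> nat)) (set0, fun=> 0) (fun _ p => p.1)
       (fun _ p => p.2) (fun z p => mdec F (fun e => p.2 e + starm z (Pl h z) e) /\
                                    mdec F (fun e => p.2 e + starm x (Pl h z) e)) K0 Z1 (#|Z| + K).
  + have zZ : z \in Z by case/imsetP: P1z => i; rewrite inE => /hZ hi ->.
    have Z0Z2 t : t \in Z0 :|: N1 -> t \in Z2 by move=> tZ; apply/(subsetP ZZ2)/(subsetP Z01).
    have [||||||||||N [T [gT kT mT mT']]] := mov _ _ _ V Gam C Z2 z x (Pl h z) _ _ _ _ _ _ _ _ erefl.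
    * rewrite Pls; apply: leq_mul; last exact: max_card.
      apply: leq_trans Pn; apply: subset_leq_card; apply/subsetP=> i; rewrite !inE; by case/andP.
    * by rewrite Pls dvdn_mulr.
    * exact: host_le hh.
    * by apply: Z0Z2; rewrite !inE zZ orbT.
    * by apply: Z0Z2; rewrite !inE eqxx.
    * by apply: contraNneq xZ => <-.
    * by move=> t /PlN tN; apply: Z0Z2; rewrite inE tN orbT.
    * exact: Plu.
    * by apply/negP=> /PlZ; rewrite !inE zZ orbT.
    * by apply/negP=> /PlZ; rewrite !inE eqxx.
    by exists (N, T).
  + by apply: leq_trans hZ1; rewrite leq_add2l.
  exists (\bigcup_(z | P1 z) (y z).1), (fun e => \sum_(z | P1 z) (y z).2 e); split=> //.
  + exact: leq_trans h2 hK.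
  + have := mdec_sum (index_enum V) (fun z hz => (h3 z hz).1); apply: mdec_eq => e.
    rewrite big_split /=; congr (_ + _).
    rewrite [RHS](partition_big (fun p : I * F => h p.1) P1) //=.
    apply: eq_bigr => z _; rewrite Pl_sum; apply: eq_bigr => p /andP[_ /eqP->] //.
  + have := mdec_sum (index_enum V) (fun z hz => (h3 z hz).2); apply: mdec_eq => e.
    rewrite big_split /=; congr (_ + _).
    rewrite [RHS](partition_big (fun p : I * F => h p.1) P1) //=.
    by apply: eq_bigr => z _; rewrite Pl_sum.
have hN1 : #|Z0 :|: N1| <= #|Z0| + #|N1| by apply: leq_card_setU.
have hN1' : #|N1| <= #|F| * n by apply: leq_trans k1 _; rewrite leq_mul2l Pn orbT.
have [|||N2 [T2 [g2 k2 m2 m2x]]] := step c (Z0 :|: N1) gc.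
- by move=> i /inZ [].
- exact: subxx.
- move: hN1 hN1' cZ0; rewrite /K; clear; lia.
have hN2 : #|Z0 :|: N1 :|: N2| <= #|Z0 :|: N1| + #|N2| by apply: leq_card_setU.
have [|||N3 [T3 [g3 k3 m3 m3x]]] := step c' (Z0 :|: N1 :|: N2) gc'.
- by move=> i /inZ [].
- exact: subsetUl.
- move: hN1 hN1' cZ0 hN2 k2; rewrite /K; clear; lia.
have gx : gadget Gam C Z [set x] (fun=> 0).
  split=> //; first by rewrite sub1set.
  by rewrite disjoints1.
(* To decompose with [c], the copies close at [c], [T2] takes the ports at [x] and [T3] those at
   [c']. With [c'], the copies close at [c'], [T2] takes the ports at [c] and [T3] those at [x]. *)
pose T e := \sum_(i | P i) Mo i (phi i) e + T2 e + T3 e.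
have copies (h : I -> V) : (forall i, P i -> exists s, h i = ctr i s) ->
   mdec F (fun e => \sum_(i | P i) mul (edges F :\: star a) (phi i) e +
      \sum_(p | R p) ([set h p.1; phi p.1 p.2] == e) + pairsm P h l e).
  move=> hs; pose psi i w := if w == a then h i else phi i w.
  have dI : mdec F (fun e => \sum_(i | P i) mul (edges F) (psi i) e).
    apply: mdec_sum => i Pi; apply: mdec_copy => w w'; have [s Es] := hs i Pi.
    have [pI _ _] := q1 i Pi.
    have hphi t : phi i t != h i.
      rewrite Es; case: (eqVneq t b) => [->|tb]; first by rewrite phib // lctr.
      by apply: contraNneq (phiZ i t Pi tb) => ->; apply: ctrZ.
    rewrite /psi; case: (eqVneq w a) => [->|_]; case: (eqVneq w' a) => [->|_] //.
    * by move=> E; move: (hphi w'); rewrite -E eqxx.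
    * by move=> E; move: (hphi w); rewrite E eqxx.
    * exact: pI.
  apply: mdec_eq dI => e.
  rewrite /R -(pair_big P port (fun i j => nat_of_bool ([set h i; phi i j] == e))) /=.
  rewrite /pairsm -!big_split; apply: eq_bigr => i Pi /=.
  have Fa : psi i a = h i by rewrite /psi eqxx.
  have Fw w : adj a w -> psi i w = phi i w.
    by move=> aw; rewrite /psi eq_sym (negPf (adj_neq aw)).
  rewrite (mul_split a) addnC -addnA; congr (_ + _).
    apply: mul_eq => f w; rewrite !inE => /andP[nf fE] wf; rewrite /psi.
    by case: eqP => // wa; case/negP: nf; rewrite fE -wa wf.
  rewrite (bigD1 b) //= addnC Fa Fw // phib //; congr (_ + _).
  by apply: eq_bigr => w /andP[aw _]; rewrite Fw.
have MoE e : \sum_(i | P i) Mo i (phi i) e = \sum_(i | P i) mul (edges F :\: star a) (phi i) e +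
   (\sum_(p | R p) ([set c p.1; phi p.1 p.2] == e) + \sum_(p | R p) ([set c' p.1; phi p.1 p.2] == e) +
    \sum_(p | R p) ([set x; phi p.1 p.2] == e)).
  rewrite /Mo big_split; congr (_ + _).
  rewrite exchange_big /= (bigD1 None) //= (bigD1 (Some true)) //= (bigD1 (Some false)) //=.
  rewrite [X in _ + (_ + (_ + X))]big1 ?addn0; last by move=> [[]|].
  rewrite !(pair_big P port (fun i j => nat_of_bool ([set _; phi i j] == e))) /=.
  by rewrite addnC.
have E1 : Z :|: [set x] = Z0 by rewrite setUC.
have g1' : gadget Gam C (Z :|: [set x]) N1 (fun e => \sum_(i | P i) Mo i (phi i) e) by rewrite E1.
have g2' : gadget Gam C (Z :|: ([set x] :|: N1)) N2 T2 by rewrite setUA E1.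
have g3' : gadget Gam C (Z :|: ([set x] :|: N1 :|: N2)) N3 T3 by rewrite !setUA E1.
exists ([set x] :|: N1 :|: N2 :|: N3), T; split.
- exact: gadgetD (gadgetD (gadgetD gx g1') g2') g3'.
- have h1 : #|[set x] :|: N1 :|: N2 :|: N3| <= #|[set x] :|: N1 :|: N2| + #|N3| by apply: leq_card_setU.
  have h2 : #|[set x] :|: N1 :|: N2| <= #|[set x] :|: N1| + #|N2| by apply: leq_card_setU.
  have h3 : #|[set x] :|: N1| <= #|[set x]| + #|N1| by apply: leq_card_setU.
  move: h1 h2 h3 hN1' k2 k3; rewrite cards1 /K; clear; lia.
- have hc := copies c (fun i _ => ex_intro _ (Some true) erefl).
  apply: mdec_eq (mdecD (mdecD hc m2x) m3) => e; rewrite /T MoE; clear; lia.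
- have hc := copies c' (fun i _ => ex_intro _ (Some false) erefl).
  apply: mdec_eq (mdecD (mdecD hc m2) m3x) => e; rewrite /T MoE; clear; lia.
Qed.

End Switch.

(** * Absorbers of fixed size *)

Lemma orient_edges (G : sgraph) : 0 < #|G| -> exists st : {set G} -> G * G,
  forall f, f \in edges G -> adj (st f).1 (st f).2 /\ f = [set (st f).1; (st f).2].
Proof.
case/card_gt0P=> x0 _.
apply: (@fin_all_exists _ _ (fun f p => f \in edges G -> adj p.1 p.2 /\ f = [set p.1; p.2])).
move=> f; case: (boolP (f \in edges G)) => [/edgesP[x [y [xy ->]]]|_]; last by exists (x0, x0).
by exists (x, y).
Qed.

Lemma enum_transfer (I T : finType) (A : {set T}) : #|I| = #|A| ->
  exists h : I -> T, [/\ injective h, forall i, h i \in A &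
    forall X : T -> nat, \sum_i X (h i) = \sum_(a in A) X a].
Proof.
move=> E; pose h i := enum_val (cast_ord E (enum_rank i)).
have hI : injective h by move=> i j /enum_val_inj/cast_ord_inj/enum_rank_inj.
have hA i : h i \in A by apply: enum_valP.
exists h; split=> // X.
have -> : A = h @: setT.
  apply/esym/eqP; rewrite eqEcard card_imset // cardsT E leqnn andbT.
  by apply/subsetP=> t /imsetP[i _ ->].
by rewrite big_imset /=; [apply: eq_bigl => i; rewrite inE | move=> i j _ _; apply: hI].
Qed.

Lemma num_edges_gt0 (G : sgraph) : 0 < num_edges G -> exists a b : G, adj a b.
Proof. by case/card_gt0P=> f /edgesP[a [b [ab _]]]; exists a, b. Qed.

(** Half of [D] serves the neighbours inside [F], the other half the extra targets [S w]. *)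
Lemma host_extF (F : sgraph) (D : nat) (V : finType) (Gam : rel V) (C Z : {set V})
    (A : {set F}) (phi0 : F -> V) (S : F -> {set V}) s :
  2 * #|F| <= D -> host Gam C D s ->
  {in A &, injective phi0} -> (forall w, w \in A -> phi0 w \in Z) ->
  (forall w, w \notin A -> #|S w| <= #|F|) -> #|Z| + #|F| <= s ->
  exists phi : F -> V, [/\ {in A, phi =1 phi0}, injective phi,
    forall w, w \notin A -> phi w \in C /\ phi w \notin Z,
    forall w w', w \notin A -> adj w w' -> Gam (phi w) (phi w') &
    forall w z, w \notin A -> z \in S w -> Gam (phi w) z].
Proof.
move=> hD hh i0 AZ hS hs; apply: (host_ext hh) => //.
- exact: adj_sym.
- exact: adj_irrefl.
- move=> w wA; apply: leq_trans hD; rewrite mul2n -addnn leq_add //; last exact: hS.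
  exact: max_card.
- by apply: leq_trans hs; rewrite leq_add2l max_card.
Qed.

Section Absorber.
Variables (F : sgraph) (D : nat).
Hypothesis hD : 2 * #|F| <= D.
Variables (a b : F).
Hypothesis ab : adj a b.
Let k := num_edges F.

Let F2 : 2 <= #|F|.
Proof.
have -> : 2 = #|[set a; b]| by rewrite cards2 (adj_neq ab).
exact: max_card.
Qed.

Let k0 : 0 < k.
Proof. by apply/card_gt0P; exists [set a; b]; rewrite edges_pair. Qed.

Let prt (s : bool) (w : F) := if s then adj a w && (w != b) else adj b w && (w != a).

Let card_prt s : #|[pred w | prt s w]| + 1 = degree (if s then a else b).
Proof.
rewrite /degree; case: s.
  rewrite (cardsD1 b) inE ab addnC; congr (_ + _).
  by apply: eq_card => w; rewrite !inE andbC.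
rewrite (cardsD1 a) inE adj_sym ab addnC; congr (_ + _).
by apply: eq_card => w; rewrite !inE andbC.
Qed.

Lemma mdeg_pairs (V : finType) (I : finType) (c d : I -> V) z :
  (forall i, c i != d i) ->
  mdeg (pairsm predT c d) z = \sum_i ((c i == z) + (d i == z)).
Proof.
move=> ncd; rewrite /pairsm mdeg_sum; apply: eq_bigr => i _; rewrite mdeg_ind !inE.
by rewrite ![z == _]eq_sym; case: (eqVneq (c i) z) => // <-; rewrite eq_sym (negPf (ncd i)).
Qed.

(** An index is a pair [i], an end of it ([true] for the end that plays [a]), and a neighbour in [F]
    of that end other than the opposite end. *)
Let Om (I : finType) := ((I * bool) * F)%type.
Let POm (I : finType) : pred (Om I) := fun o => prt o.1.2 o.2.
Let cOm (V I : finType) (c d : I -> V) (o : Om I) := if o.1.2 then c o.1.1 else d o.1.1.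

Let sum_Om (I : finType) (X : Om I -> nat) : \sum_(o | POm o) X o =
  \sum_i (\sum_(w | prt true w) X ((i, true), w) + \sum_(w | prt false w) X ((i, false), w)).
Proof.
transitivity (\sum_(p : I * bool) \sum_(w | prt p.2 w) X (p, w)).
  by rewrite pair_big_dep; apply: eq_big => [[[i s] w]|[[i s] w] _].
transitivity (\sum_i \sum_s \sum_(w | prt s w) X ((i, s), w)).
  by rewrite pair_bigA; apply: eq_bigr => -[i s] _.
by apply: eq_bigr => i _; rewrite big_bool.
Qed.

(** Each occurrence of [z] as an end of a pair gives, with the pair itself, [degree a] or [degree b]
    edges. The pairs alone contribute a divisible degree at [z], hence so do the ports. *)
Let gcd_Om (V I : finType) (c d : I -> V) z : (forall i, c i != d i) ->
  mdiv F (pairsm predT c d) -> gcd_degree F %| #|[pred o | POm o && (cOm c d o == z)]|.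
Proof.
move=> ncd [/(_ z) + _]; rewrite mdeg_pairs // => dg.
suff : gcd_degree F %| #|[pred o | POm o && (cOm c d o == z)]| + \sum_i ((c i == z) + (d i == z)).
  by rewrite dvdn_addl.
rewrite -sum1_card (eq_bigl (fun o => POm o && (cOm c d o == z))) // big_mkcondr.
rewrite sum_Om -big_split; apply: dvdn_sum => i _ /=.
rewrite /cOm /= !sum_nat_const.
have -> : #|[pred w | prt true w]| * (if c i == z then 1 else 0) +
   #|[pred w | prt false w]| * (if d i == z then 1 else 0) + ((c i == z) + (d i == z)) =
   (#|[pred w | prt true w]| + 1) * (c i == z) + (#|[pred w | prt false w]| + 1) * (d i == z).
  by case: (c i == z); case: (d i == z); clear; lia.
by rewrite !card_prt; apply: dvdn_add; apply: dvdn_mulr; apply: gcd_degree_dvd.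
Qed.

(** The pairs are matched with the edges of [q] disjoint copies of [F]. Each matched couple shares
    one copy of [F] without the vertices playing [a] and [b], whose ports are joined to the ends of
    both edges. It can be closed through either edge, and the ports left open on the other side are
    taken by the gadget of [switch]. *)
Lemma absorber n : exists K, forall (V : finType) (Gam : rel V) (C Z : {set V})
    (I : finType) (u v : I -> V),
  #|I| = n -> host Gam C D (#|Z| + K) ->
  (forall i, [/\ u i \in Z, v i \in Z & u i != v i]) ->
  mdiv F (pairsm predT u v) ->
  exists N A, [/\ gadget Gam C Z N A, #|N| <= K, mdec F A &
    mdec F (fun e => A e + pairsm predT u v e)].
Proof.
(* The bound counts triples of a pair, one of its two ends and a port. *)
have [K0 sw] := switch hD ab (n * (2 * #|F|)).
pose K := #|F| * n + #|F| * n + K0; exists K.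
move=> V Gam C Z I u v cI hh uvZ dH.
have [symG irrG rich] := hh.
have nuv i : u i != v i by have [] := uvZ i.
have kn : k %| n.
  have [_] := dH; rewrite /pairsm mtot_sum (eq_bigr (fun=> 1)) => [|i _]; last exact: mtot_ind.
  by rewrite sum1_card cI.
pose q := n %/ k.
have qk : q * k = n by rewrite divnK.
have qn : q <= n by rewrite leq_div.
have FqK : #|F| * q <= #|F| * n by rewrite leq_mul2l qn orbT.
have [[x0 _] [y0 _]] : (exists x : V, True) /\ (exists x : V, True).
  have [||x _] := rich set0 set0; rewrite ?cards0 //; by split; exists x.
have [t Z' _ ZZ' hZ'||phi' [g1 k1 q1 d1]] := @gadget_fin V Gam C 'I_q predT (F -> V)
    (fun=> x0) (fun _ phi => phi @: ~: set0) (fun _ phi => mul (edges F) phi)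
    (fun _ phi => injective phi) #|F| Z (#|Z| + K).
- have [||||phi [_ pI pC pG _]] := @host_extF F D V Gam C Z' set0 (fun=> x0) (fun=> set0) _ hD hh.
  + by move=> ?; rewrite inE.
  + by move=> ?; rewrite inE.
  + by move=> ? _; rewrite cards0.
  + exact: hZ'.
  exists phi; split=> //; last by apply: leq_trans (leq_imset_card _ _) (max_card _).
  pose ctr (i : void) : V := x0.
  apply: (gadget_eq (m1 := fun e => mul (edges F) phi e +
     \sum_(i : void) \sum_(w | xpredT w) ([set ctr i; phi w] == e))).
    by move=> e; rewrite [X in _ + X]big1 ?addn0 // => -[].
  apply: (gadget_item (pt := fun _ => xpredT)) => //; try by case.
  + by move=> ?; rewrite inE.
  + by move=> f /edges_card2 f2; apply/negP=> /subset_leq_card; rewrite cards0 f2.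
- move: FqK; rewrite /K (_ : #|[pred _ : 'I_q | true]| = q); last by rewrite -[RHS]card_ord; apply: eq_card.
  clear; lia.
set N1 := \bigcup_(i | _) _ in g1 k1.
pose Z1 := Z :|: N1.
have N1Z z : z \in N1 -> z \notin Z.
  by have [_ d _ _] := g1; rewrite disjoint_subset in d => /(subsetP d); rewrite inE.
have phi'N t w : phi' t w \in N1 by apply/bigcupP; exists t => //; apply: imset_f; rewrite !inE.
have [st stP] := @orient_edges F (ltnW F2).
(* The [q * k = n] edges of the copies, listed by [I]. *)
pose A0 := finset.setX [set: 'I_q] (edges F).
have [h [hI hA hS]] : exists h : I -> 'I_q * {set F}, [/\ injective h, forall i, h i \in A0 &
    forall X : _ -> nat, \sum_i X (h i) = \sum_(a in A0) X a].
  by apply: enum_transfer; rewrite cI cardsX cardsT card_ord -qk.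
have hE i : (h i).2 \in edges F by have := hA i; rewrite !inE.
pose u' i := phi' (h i).1 (st (h i).2).1.
pose v' i := phi' (h i).1 (st (h i).2).2.
have nuv' i : u' i != v' i.
  have [adjst _] := stP _ (hE i); apply: contra (adj_neq adjst) => /eqP.
  by move/(q1 (h i).1 isT) => ->.
have H'E : pairsm predT u' v' =1 fun e => \sum_(t < q) mul (edges F) (phi' t) e.
  move=> e; rewrite /pairsm.
  transitivity (\sum_(p in A0) (phi' p.1 @: p.2 == e)).
    rewrite -hS; apply: eq_bigr => i _; congr (nat_of_bool (_ == _)).
    by rewrite [in RHS](stP _ (hE i)).2 imsetU1 imset_set1.
  rewrite /mul pair_big_dep /=; apply: eq_bigl => -[t f]; by rewrite inE /= inE.
have dH' : mdec F (pairsm predT u' v').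
  by apply: mdec_eq (fsym H'E) _; apply: mdec_sum => t _; apply/mdec_copy/q1.
have u'N i : u' i \in N1 by apply: phi'N.
have v'N i : v' i \in N1 by apply: phi'N.
have uZ i : u i \in Z by have [] := uvZ i.
have vZ i : v i \in Z by have [] := uvZ i.
(* The first flag says which of [a] and [b] the centre plays, the second whether it belongs to the
   auxiliary copy or to the given pair. *)
pose ctr i (s : bool * bool) := if s.1 then if s.2 then u' i else u i
                                else if s.2 then v' i else v i.
have ctrZ i s : ctr i s \in Z1.
  by rewrite /ctr inE; case: s.1; case: s.2; rewrite ?uZ ?vZ ?u'N ?v'N ?orbT.
have dif z z' : z \in Z -> z' \in N1 -> z != z'.
  by move=> zZ /N1Z; apply: contraNneq => <-.
have ctrI i : injective (ctr i).
  have sy (x y : V) : x != y -> ((x == y) = false) * ((y == x) = false).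
    by move=> xy; rewrite [y == x]eq_sym (negPf xy).
  have E := (sy _ _ (nuv i), sy _ _ (nuv' i), sy _ _ (dif _ _ (uZ i) (u'N i)),
    sy _ _ (dif _ _ (uZ i) (v'N i)), sy _ _ (dif _ _ (vZ i) (u'N i)), sy _ _ (dif _ _ (vZ i) (v'N i))).
  by move=> [[] []] [[] []] //; rewrite /ctr /= => /eqP; rewrite E.
pose A := [set a; b].
pose E0 := edges F :\: star a :\: star b.
pose Mo i (phi : F -> V) e := mul E0 phi e +
  \sum_(s : bool * bool) \sum_(w | prt s.1 w) ([set ctr i s; phi w] == e).
pose No (i : I) (phi : F -> V) := phi @: ~: A.
pose Q i (phi : F -> V) := [/\ injective phi, phi a = u i, phi b = v i &
   forall w, w \notin A -> phi w \notin Z1].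
have hZ1 : #|Z1| <= #|Z| + #|N1| by apply: leq_card_setU.
have k1' : #|N1| <= #|F| * q.
  by apply: leq_trans k1 _; rewrite leq_mul2l -[X in _ <= X]card_ord subset_leq_card ?orbT //; apply/subsetP.
have prtA s w : prt s w -> w \notin A.
  rewrite /prt !inE negb_or; case: s => /andP[aw wb]; rewrite wb ?andbT /= eq_sym; exact: adj_neq.
have E0A f w : f \in E0 -> w \in f -> w \notin A.
  rewrite !inE => /and3P[nb na fE] wf; rewrite fE !andTb in nb na.
  by apply/norP; split; [apply: contraNneq na => <-|apply: contraNneq nb => <-].
have [i Z' _ ZZ' hZ'||phi [g2 k2 q2 d2]] :=
   @gadget_fin V Gam C I predT (F -> V) (fun=> x0) No Mo Q #|F| Z1 (#|Z| + K).
- have Z1Z' z : z \in Z1 -> z \in Z' by apply/subsetP.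
  have [||||phi [pA pI pC pG pS]] := @host_extF F D V Gam C Z' A
     (fun w => if w == a then u i else v i)
     (fun w => [set z | (z == u' i) || (z == v' i)]) _ hD hh.
  + move=> w w'; rewrite !inE => /orP[] /eqP-> /orP[] /eqP->; rewrite ?eqxx // (eq_sym b) (negPf (adj_neq ab)).
      by move/eqP; rewrite (negPf (nuv i)).
    by move/eqP; rewrite eq_sym (negPf (nuv i)).
  + by move=> w _; apply: Z1Z'; rewrite inE; case: ifP; rewrite ?uZ ?vZ.
  + move=> w _; apply: leq_trans F2; rewrite (_ : [set z | _] = [set u' i; v' i]).
      by rewrite cards2; case: (_ != _).
    by apply/setP=> z; rewrite !inE.
  + exact: hZ'.
  have pa : phi a = u i by rewrite pA ?eqxx // !inE eqxx.
  have pb : phi b = v i by rewrite pA ?inE ?eqxx ?orbT // eq_sym (negPf (adj_neq ab)).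
  have pnZ w : w \notin A -> phi w \notin Z' by move=> wA; have [] := pC w wA.
  exists phi; split; last first.
  + by split=> // w wA; apply: contra (pnZ w wA); apply: Z1Z'.
  + by apply: leq_trans (leq_imset_card _ _) (max_card _).
  apply: (gadget_item (A := A) (pt := fun s => prt s.1)) => //.
  + by move=> w; rewrite !inE => /orP[] /eqP->; rewrite ?pa ?pb Z1Z' // inE ?uZ ?vZ.
  + by rewrite /E0 !subDset; apply/subsetP=> f fE; rewrite !inE in fE *; rewrite fE !orbT.
  + move=> f fE; have fE' : f \in edges F by move: fE; rewrite !inE => /and3P[].
    have /edgesP[w [w' [_ Ef]]] := fE'.
    apply/negP=> /subsetP/(_ w); rewrite Ef !inE eqxx => /(_ isT); apply/negP.
    by have := @E0A f w fE; rewrite !inE; apply; rewrite Ef !inE eqxx.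
  + by move=> s; apply/Z1Z'.
  + move=> s f w fE wf; apply: contraNneq (pnZ w (E0A _ _ fE wf)) => ->; exact: Z1Z'.
  + move=> [s1 s2] w /= pw; have wA := prtA _ _ pw; split=> //; rewrite /ctr /=.
    case: s2; first by case: s1 {pw}; apply: pS => //; rewrite inE eqxx ?orbT.
    case: s1 pw => /andP[aw _]; first by rewrite -pa; apply: pG; rewrite // adj_sym.
    by rewrite -pb; apply: pG; rewrite // adj_sym.
- have -> : #|[pred _ : I | true]| = n by rewrite -cI; apply: eq_card.
  by move: hZ1 k1' FqK; rewrite /K; clear; lia.
set N2 := \bigcup_(i | _) _ in g2 k2.
have k2' : #|N2| <= #|F| * n.
  by apply: leq_trans k2 _; rewrite leq_mul2l -cI subset_leq_card ?orbT //; apply/subsetP.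
have phiZ i w : w \notin A -> phi i w \notin Z1 by have [_ _ _] := q2 i isT; apply.
pose Z2 := Z1 :|: N2.
have phiZ2 i w : w \notin A -> phi i w \in Z2.
  by move=> wA; rewrite inE; apply/orP; right; apply/bigcupP; exists i => //; apply: imset_f; rewrite inE.
have hZ2 : #|Z2| <= #|Z1| + #|N2| by apply: leq_card_setU.
pose lo (o : Om I) := phi o.1.1 o.2.
have cZ o : cOm u v o \in Z by rewrite /cOm; case: ifP.
have cN o : cOm u' v' o \in N1 by rewrite /cOm; case: ifP.
have [|||||||N3 [T [g3 k3 m3 m3']]] := sw V Gam C Z2 (Om I) (@POm I) (cOm u v) (cOm u' v') lo.
- apply: leq_trans (max_card _) _; rewrite !card_prod cI card_bool; clear; lia.
- by apply: host_le hh; move: hZ1 hZ2 k1' k2' FqK; rewrite /K; clear; lia.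
- move=> [[i s] w] /prtA /= wA; split; last exact: phiZ2.
    by rewrite !in_setU cZ.
  by rewrite !in_setU cN orbT.
- move=> [[i s] w] /prtA /= wA; have := phiZ i w wA.
  rewrite /lo /= in_setU negb_or => /andP[h1 h2].
  by split; [apply: contraNneq h1 => <-|apply: contraNneq h2 => <-].
- by move=> o o' _ _; apply: dif.
- by move=> z; apply: gcd_Om.
- by move=> z; apply: gcd_Om => //; apply: mdec_mdiv.
have copies (c d : I -> V) : (forall i, c i != d i) -> (forall i, c i \in Z1 /\ d i \in Z1) ->
   mdec F (fun e => pairsm predT c d e + \sum_i mul E0 (phi i) e + pairsm (@POm I) (cOm c d) lo e).
  move=> ncd cdZ; pose psi i w := if w == a then c i else if w == b then d i else phi i w.
  have psiA i w : w \notin A -> psi i w = phi i w.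
    by rewrite !inE negb_or /psi => /andP[/negPf-> /negPf->].
  have pa i : psi i a = c i by rewrite /psi eqxx.
  have pb i : psi i b = d i by rewrite /psi eqxx eq_sym (negPf (adj_neq ab)).
  have inA w : w \in A -> w = a \/ w = b by rewrite !inE => /orP[] /eqP; auto.
  have dI : mdec F (fun e => \sum_i mul (edges F) (psi i) e).
    apply: mdec_sum => i _; apply: mdec_copy => w w'.
    have [cZ1 dZ1] := cdZ i; have ncdi := ncd i.
    have pZ w0 : w0 \in A -> psi i w0 \in Z1 by move/inA=> [->|->]; rewrite ?pa ?pb.
    case: (boolP (w \in A)) => wA; case: (boolP (w' \in A)) => w'A.
    * case/inA: wA => ->; case/inA: w'A => ->; rewrite ?pa ?pb //.
        by move/eqP; rewrite (negPf ncdi).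
      by move/eqP; rewrite eq_sym (negPf ncdi).
    * by move=> E; have := pZ _ wA; rewrite E psiA // (negPf (phiZ _ _ w'A)).
    * by move=> E; have := pZ _ w'A; rewrite -E psiA // (negPf (phiZ _ _ wA)).
    * by rewrite !psiA //; have [pI _ _ _] := q2 i isT; apply: pI.
  apply: mdec_eq dI => e; rewrite /pairsm sum_Om -!big_split; apply: eq_bigr => i _ /=.
  rewrite (mul_split2 _ ab) !pa !pb /cOm /lo /=.
  have -> : mul (edges F :\: star a :\: star b) (psi i) e = mul E0 (phi i) e.
    by apply: mul_eq => f w fE wf; apply: psiA; apply: E0A fE wf.
  have hs s y : \sum_(w | prt s w) ([set y; psi i w] == e) = \sum_(w | prt s w) ([set y; phi i w] == e).
    by apply: eq_bigr => w /prtA wA; rewrite psiA.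
  have := hs true (c i); have := hs false (d i); rewrite /prt /= => -> ->; clear; lia.
have MoE e : \sum_i Mo i (phi i) e = \sum_i mul E0 (phi i) e +
   (pairsm (@POm I) (cOm u v) lo e + pairsm (@POm I) (cOm u' v') lo e).
  rewrite /Mo /pairsm !sum_Om -!big_split; apply: eq_bigr => i _ /=; congr (_ + _).
  rewrite (bigD1 (true, true)) //= (bigD1 (true, false)) //= (bigD1 (false, true)) //= (bigD1 (false, false)) //=.
  rewrite [X in _ + (_ + (_ + (_ + X)))]big1 ?addn0; last by move=> [[] []].
  rewrite /ctr /cOm /lo /=; clear; lia.
have g2' : gadget Gam C (Z :|: N1) N2 (fun e => \sum_i Mo i (phi i) e) by [].
have g3' : gadget Gam C (Z :|: (N1 :|: N2)) N3 T by rewrite setUA.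
exists (N1 :|: N2 :|: N3), (fun e => \sum_(t < q) mul (edges F) (phi' t) e + \sum_i Mo i (phi i) e + T e); split.
- exact: gadgetD (gadgetD g1 g2') g3'.
- have h1 : #|N1 :|: N2 :|: N3| <= #|N1 :|: N2| + #|N3| by apply: leq_card_setU.
  have h2 : #|N1 :|: N2| <= #|N1| + #|N2| by apply: leq_card_setU.
  move: h1 h2 k1' k2' k3 FqK; rewrite /K; clear; lia.
- have hc := copies u' v' nuv' (fun i => conj (subsetP (subsetUr _ _) _ (u'N i)) (subsetP (subsetUr _ _) _ (v'N i))).
  apply: mdec_eq (mdecD hc m3) => e; have := H'E e; have := MoE e.
  move: (pairsm _ _ _ e) (pairsm _ _ _ e) (pairsm _ _ _ e) => x1 x2 x3 /= -> <-; clear; lia.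
- have hc := copies u v nuv (fun i => conj (subsetP (subsetUl _ _) _ (uZ i)) (subsetP (subsetUl _ _) _ (vZ i))).
  apply: mdec_eq (mdecD (mdecD hc m3') dH') => e; have := H'E e; have := MoE e.
  move: (pairsm _ _ _ e) (pairsm _ _ _ e) (pairsm _ _ _ e) (pairsm _ _ _ e) => x1 x2 x3 x4 /= -> <-; clear; lia.
Qed.

End Absorber.

(** * Banks and simultaneous placement *)

Lemma gadget_copy (F : sgraph) (V : finType) (Gam : rel V) (C Z : {set V})
    (phi : F -> V) (A : {set F}) (S : {set {set F}}) :
  symmetric Gam -> injective phi ->
  (forall w, w \in A -> phi w \in Z) ->
  (forall w, w \notin A -> phi w \in C /\ phi w \notin Z) ->
  S \subset edges F -> (forall f, f \in S -> ~~ (f \subset A)) ->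
  (forall w w', w \notin A -> adj w w' -> Gam (phi w) (phi w')) ->
  gadget Gam C Z (phi @: ~: A) (mul S phi).
Proof.
move=> symG pI pA pC SE SA pG.
have H := @gadget_item F V Gam C Z phi A S void (fun i => match i with end) (fun i => xpred0)
  symG pI pA pC SE SA pG.
apply: (gadget_eq _ (H _ _ _ _)); try by case.
by move=> e; rewrite [X in _ + X]big1 ?addn0 // => -[].
Qed.

Lemma edge_nsub1 (F : sgraph) (a : F) f : f \in edges F -> ~~ (f \subset [set a]).
Proof.
by move=> /edges_card2 f2; apply/negP=> /subset_leq_card; rewrite cards1 f2.
Qed.

Lemma gadget_card (V : finType) (Gam : rel V) (C Z N : {set V}) m :
  gadget Gam C Z N m -> #|[set e | 0 < m e]| <= (#|Z| + #|N|) ^ 2.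
Proof.
case=> _ _ _ h.
have hc : #|Z :|: N| <= #|Z| + #|N| by apply: leq_card_setU.
apply: leq_trans (_ : #|Z :|: N| ^ 2 <= _); last by rewrite leq_exp2r.
rewrite -mulnn -cardsX.
apply: leq_trans (leq_imset_card (fun p : V * V => [set p.1; p.2]) _).
apply: subset_leq_card; apply/subsetP=> e; rewrite inE => /h[x [y [-> xN yN _]]].
by apply/imsetP; exists (x, y); rewrite // !inE xN orbT /= -in_setU.
Qed.

Section Bank.
Variables (F : sgraph) (D : nat).
Hypothesis hD : 2 * #|F| <= D.
Variables (a b : F).
Hypothesis ab : adj a b.
Let g := gcd_degree F.
Let k := num_edges F.

Let ab_card (V : finType) (x : V) : #|[set x]| <= #|F|.
Proof. by rewrite cards1; apply/card_gt0P; exists a. Qed.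

(** For the purposes of divisibility [m] looks like [s] parallel edges between [u] and [v]. The case
    [u = v] is a loop, which counts twice in the degree. *)
Definition has_class (V : finType) (m : {set V} -> nat) (u v : V) (s : nat) :=
  (forall x, mdeg m x = s * ((x == u) + (x == v)) %[mod g]) /\ mtot m = s %[mod k].

(** Take copies in which [a] is [u] and [v], and a third copy through the edge joining the two
    images of [b]. On the path from [u] to [v] so obtained, replace the middle edge by the rest of
    the third copy: the middle edge then counts as -1, so the inner degrees cancel and one edge [uv]
    is simulated. *)
Lemma bank_unit : exists c, forall (V : finType) (Gam : rel V) (C Z : {set V}) (u v : V),
  host Gam C D (#|Z| + c) -> u \in Z -> v \in Z ->
  exists N U U1, [/\ gadget Gam C Z N U, #|N| <= c, mdec F U,
    forall e, U1 e <= U e & has_class U1 u v 1].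
Proof.
exists (3 * #|F|) => V Gam C Z u v hh uZ vZ.
have nab := adj_neq ab.
have [symG irrG rich] := hh.
have cimg (phi : F -> V) (B : {set F}) : #|phi @: B| <= #|F|.
  exact: leq_trans (leq_imset_card _ _) (max_card _).
have [||||phi2 [pA2 pI2 pC2 pG2 _]] := @host_extF F D V Gam C Z [set a] (fun=> u) (fun=> set0) _ hD hh.
- by move=> ? ?; rewrite !inE => /eqP-> /eqP->.
- by [].
- by move=> ? _; rewrite cards0.
- by rewrite leq_add2l; clear; lia.
have p2a : phi2 a = u by rewrite pA2 ?inE.
have G2 : gadget Gam C Z (phi2 @: ~: [set a]) (mul (edges F) phi2).
  apply: gadget_copy => // [w|f fE]; last exact: edge_nsub1.
  by rewrite inE => /eqP->; rewrite p2a.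
set N2 := phi2 @: _ in G2.
have hZ2 : #|Z :|: N2| <= #|Z| + #|N2| by apply: leq_card_setU.
have cN2 : #|N2| <= #|F| by apply: cimg.
have [||||phi3 [pA3 pI3 pC3 pG3 pS3]] := @host_extF F D V Gam C (Z :|: N2) [set a] (fun=> v)
   (fun=> [set phi2 b]) _ hD hh.
- by move=> ? ?; rewrite !inE => /eqP-> /eqP->.
- by move=> ? _; rewrite inE vZ.
- by move=> ? _; apply: ab_card.
- by move: hZ2 cN2; clear; lia.
have p3a : phi3 a = v by rewrite pA3 ?inE.
have bA : b \notin [set a] by rewrite inE eq_sym.
have p2bN : phi2 b \in N2 by apply: imset_f; rewrite !inE eq_sym.
have p2bZ : phi2 b \notin Z by have [] := pC2 b bA.
have [p3bC p3bZ] := pC3 b bA.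
have G3 : gadget Gam C (Z :|: N2) (phi3 @: ~: [set a])
    (fun e => mul (edges F) phi3 e + \sum_(i : unit) \sum_(w | w == b) ([set phi2 b; phi3 w] == e)).
  apply: (gadget_item (A := [set a]) (ctr := fun _ : unit => phi2 b) (pt := fun _ w => w == b)) => //.
  - by move=> w; rewrite inE => /eqP->; rewrite p3a inE vZ.
  - by move=> f fE; apply: edge_nsub1.
  - by move=> [] [].
  - by move=> _; rewrite inE p2bN orbT.
  - move=> _ f w _ _; case: (eqVneq w a) => [->|wa]; first by rewrite p3a; apply: contraNneq p2bZ => <-.
    by have [|_] := pC3 w; [rewrite inE|apply: contraNneq => ->; rewrite inE p2bN orbT].
  - by move=> _ w /eqP->; split; [exact: bA|apply: pS3; [exact: bA|rewrite inE]].
set N3 := phi3 @: _ in G3.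
have cN3 : #|N3| <= #|F| by apply: cimg.
have p3bN : phi3 b \in N3 by apply: imset_f; rewrite !inE eq_sym.
have hZ3 : #|Z :|: N2 :|: N3| <= #|Z :|: N2| + #|N3| by apply: leq_card_setU.
have n23 : phi2 b != phi3 b by apply: contraNneq p3bZ => <-; rewrite inE p2bN orbT.
have [||||phi1 [pA1 pI1 pC1 pG1 _]] := @host_extF F D V Gam C (Z :|: N2 :|: N3) [set a; b]
   (fun w => if w == a then phi2 b else phi3 b) (fun=> set0) _ hD hh.
- move=> w w'; rewrite !inE => /orP[] /eqP-> /orP[] /eqP->; rewrite ?eqxx // (eq_sym b) (negPf nab).
    by move/eqP; rewrite (negPf n23).
  by move/eqP; rewrite eq_sym (negPf n23).
- by move=> w _; case: ifP => _; rewrite !inE ?p2bN ?p3bN ?orbT.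
- by move=> ? _; rewrite cards0.
- by move: hZ2 cN2 hZ3 cN3; clear; lia.
have p1a : phi1 a = phi2 b by rewrite pA1 ?eqxx // !inE eqxx.
have p1b : phi1 b = phi3 b by rewrite pA1 ?inE ?eqxx ?orbT // eq_sym (negPf nab).
have abE : [set a; b] \in edges F by rewrite edges_pair.
pose E1 := edges F :\ [set a; b].
have G1 : gadget Gam C (Z :|: N2 :|: N3) (phi1 @: ~: [set a; b]) (mul E1 phi1).
  apply: gadget_copy => //.
  - by move=> w; rewrite in_set2 => /orP[] /eqP->; rewrite ?p1a ?p1b 2!in_setU ?p2bN ?p3bN ?orbT.
  - exact: subsetDl.
  - move=> f; rewrite in_setD1 => /andP[nf fE]; apply: contra nf => fs.
    by rewrite eqEcard fs cards2 nab (edges_card2 fE).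
set N1 := phi1 @: _ in G1.
have cN1 : #|N1| <= #|F| by apply: cimg.
have sum_ab e : \sum_(i : unit) \sum_(w | w == b) ([set phi2 b; phi3 w] == e) = ([set phi2 b; phi3 b] == e).
  by rewrite (bigD1 tt) //= [X in _ + X]big1 ?addn0 ?big_pred1_eq // => -[].
have cp1 : mul (edges F) phi1 =1 fun e => ([set phi2 b; phi3 b] == e) + mul E1 phi1 e.
  by move=> e; rewrite (mulD1 _ abE) imsetU1 imset_set1 p1a p1b.
have ge (phi : F -> V) e : ([set phi a; phi b] == e) <= mul (edges F) phi e.
  by rewrite (mulD1 _ abE) imsetU1 imset_set1 leq_addr.
(* Adding back the middle edge turns [U1] into the two outer edges and a full copy; this avoids
   subtraction in [nat]. *)
have [U1 [U1le U1E]] : exists U1 : {set V} -> nat,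
    (forall e, U1 e <= ([set u; phi2 b] == e) + ([set v; phi3 b] == e) + mul E1 phi1 e) /\
    (fun e => U1 e + ([set phi2 b; phi3 b] == e)) =1
      fun e => ([set u; phi2 b] == e) + ([set v; phi3 b] == e) + mul (edges F) phi1 e.
  exists (fun e => ([set u; phi2 b] == e) + ([set v; phi3 b] == e) + mul E1 phi1 e); split=> // e.
  by rewrite cp1; clear; lia.
exists (N2 :|: N3 :|: N1), (fun e => mul (edges F) phi2 e + (mul (edges F) phi3 e +
   \sum_(i : unit) \sum_(w | w == b) ([set phi2 b; phi3 w] == e)) + mul E1 phi1 e), U1; split.
- by apply: gadgetD (gadgetD G2 G3) _; rewrite setUA.
- have h1 : #|N2 :|: N3 :|: N1| <= #|N2 :|: N3| + #|N1| by apply: leq_card_setU.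
  have h2 : #|N2 :|: N3| <= #|N2| + #|N3| by apply: leq_card_setU.
  by move: h1 h2 cN1 cN2 cN3; clear; lia.
- apply: mdec_eq (mdecD (mdecD (mdec_copy pI2) (mdec_copy pI3)) (mdec_copy pI1)) => e.
  by rewrite cp1 sum_ab; clear; lia.
- move=> e; apply: leq_trans (U1le e) _; have := ge phi2 e; have := ge phi3 e; rewrite p2a p3a; clear; lia.
- split=> [x|].
    have := mdeg_eq x U1E; rewrite !mdegD !mdeg_ind !inE => E.
    have nu : u != phi2 b by apply: contraNneq p2bZ => <-.
    have nv : v != phi3 b by apply: contraNneq p3bZ => <-; rewrite inE vZ.
    have dg : g %| mdeg (mul (edges F) phi1) x by have [] := mdec_mdiv (mdec_copy pI1).
    have {}E : mdeg U1 x = ((x == u) + (x == v)) + mdeg (mul (edges F) phi1) x.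
      have or2 (y z : V) : y != z -> nat_of_bool ((x == y) || (x == z)) = (x == y) + (x == z).
        by move=> yz; case: (eqVneq x y) => [->|_] //=; rewrite (negPf yz).
      by move: E; rewrite !or2 //; clear; lia.
    by rewrite E mul1n -modnDmr (eqP dg) addn0.
  have := mtot_eq U1E; rewrite !mtotD !mtot_ind mtot_mul => E.
  have {}E : mtot U1 = 1 + #|edges F| by move: E; clear; lia.
  by rewrite E -modnDmr modnn addn0.
Qed.

Lemma has_class0 (V : finType) (u v : V) : has_class (fun=> 0) u v 0.
Proof.
by split=> [x|]; rewrite /mdeg /mtot big1.
Qed.

Lemma has_classD (V : finType) (m1 m2 : {set V} -> nat) u v s1 s2 :
  has_class m1 u v s1 -> has_class m2 u v s2 ->
  has_class (fun e => m1 e + m2 e) u v (s1 + s2).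
Proof.
move=> [a1 b1] [a2 b2]; split=> [x|].
  by rewrite mdegD mulnDl -modnDm a1 a2 modnDm.
by rewrite mtotD -modnDm b1 b2 modnDm.
Qed.

(* [Us s] and its complement in [U] have opposite classes, so a bank placed at [{u, v}] can lend the
   class [s] to one side and the class [- s] to the other. *)
Lemma bank K : exists c, forall (V : finType) (Gam : rel V) (C Z : {set V}) (u v : V),
  host Gam C D (#|Z| + c) -> u \in Z -> v \in Z ->
  exists N U (Us : nat -> {set V} -> nat), [/\ gadget Gam C Z N U, #|N| <= c, mdec F U,
    forall s e, Us s e <= U e & forall s, s <= K -> has_class (Us s) u v s].
Proof.
have [c hc] := bank_unit; exists (c * K) => V Gam C Z u v hh uZ vZ.
have cK : #|[pred _ : 'I_K | true]| = K by rewrite -[RHS]card_ord; apply: eq_card.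
have [i Z' _ ZZ' hZ'||x [g1 k1 q1 _]] := @gadget_fin V Gam C 'I_K predT
   ({set V} * (({set V} -> nat) * ({set V} -> nat))) (set0, (fun=> 0, fun=> 0))
   (fun _ x => x.1) (fun _ x => x.2.1) (fun _ x => [/\ mdec F x.2.1,
    forall e, x.2.2 e <= x.2.1 e & has_class x.2.2 u v 1]) c Z (#|Z| + c * K).
- have [|||N [U [U1 [gU cU dU lU hU]]]] := hc V Gam C Z' u v.
  + exact: host_le hh.
  + exact: (subsetP ZZ').
  + exact: (subsetP ZZ').
  by exists (N, (U, U1)).
- by rewrite cK.
exists (\bigcup_(i | predT i) (x i).1), (fun e => \sum_(i | predT i) (x i).2.1 e),
  (fun s e => \sum_(i < K | i < s) (x i).2.2 e); split=> //.
- by rewrite -[X in _ <= c * X]cK.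
- by apply: mdec_sum => i _; have [] := q1 i isT.
- move=> s e; rewrite big_mkcond; apply: leq_sum => i _.
  by case: ifP => // _; have [] := q1 i isT.
- elim=> [|s IH] sK.
    have := @has_class0 V u v; rewrite /has_class.
    rewrite (@mtot_eq V _ (fun e => \sum_(i < K | i < 0) (x i).2.2 e)) => [[h1 h2]|e]; last by rewrite big_pred0.
    split=> // y; rewrite -h1; congr (_ %% _); apply: mdeg_eq => e; by rewrite big_pred0.
  have E : (fun e => \sum_(i < K | i < s.+1) (x i).2.2 e) =1
      fun e => \sum_(i < K | i < s) (x i).2.2 e + (x (Ordinal sK)).2.2 e.
    move=> e; rewrite (bigD1 (Ordinal sK)) //= addnC; congr (_ + _).
    by apply: eq_bigl => i; rewrite ltnS ltn_neqAle andbC.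
  have [_ _ h1] := q1 (Ordinal sK) isT.
  have [ha hb] := has_classD (IH (ltnW sK)) h1; split=> [y|].
    by rewrite (mdeg_eq y E) ha addn1.
  by rewrite (mtot_eq E) hb addn1.
Qed.

(** The absorber for listed pairs, put in the form needed by the network: a multiset of bounded size
    and one constant for all sizes. *)
Lemma absorber_mult n : exists K, forall (V : finType) (Gam : rel V) (C Z : {set V})
    (m : {set V} -> nat),
  mtot m <= n -> host Gam C D (#|Z| + K) ->
  (forall e, 0 < m e -> exists x y, [/\ e = [set x; y], x != y, x \in Z & y \in Z]) ->
  mdiv F m ->
  exists N A, [/\ gadget Gam C Z N A, #|N| <= K, mdec F A & mdec F (fun e => A e + m e)].
Proof.
have [K hK] : exists K, forall i, i <= n -> forall (V : finType) (Gam : rel V) (C Z : {set V})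
    (I : finType) (u v : I -> V),
  #|I| = i -> host Gam C D (#|Z| + K) ->
  (forall i, [/\ u i \in Z, v i \in Z & u i != v i]) ->
  mdiv F (pairsm predT u v) ->
  exists N A, [/\ gadget Gam C Z N A, #|N| <= K, mdec F A &
    mdec F (fun e => A e + pairsm predT u v e)].
  elim: n => [|n [K IH]].
    have [K h] := absorber hD ab 0; exists K => i; rewrite leqn0 => /eqP-> //.
  have [K' h] := absorber hD ab n.+1; exists (maxn K K') => i hi V Gam C Z I u v cI hh h1 h2.
  have [E|ni] := eqVneq i n.+1.
    have [||N [A [gA cA dA dA']]] := h V Gam C Z I u v _ _ h1 h2; [by rewrite cI|by apply: host_le hh; lia|].
    by exists N, A; split=> //; apply: leq_trans cA (leq_maxr _ _).
  have [||N [A [gA cA dA dA']]] := IH i _ V Gam C Z I u v cI _ h1 h2; [lia|by apply: host_le hh; lia|].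
  by exists N, A; split=> //; apply: leq_trans cA (leq_maxl _ _).
exists K => V Gam C Z m mn hh mZ dm.
have mle e : m e <= n by apply: leq_trans mn; rewrite /mtot (bigD1 e) //= leq_addr.
have [[x0 _] _] : (exists x : V, True) /\ True.
  have [_ _ rich] := hh; have [||x _] := rich set0 set0; rewrite ?cards0 //; by split=> //; exists x.
have [st stP] : exists st : {set V} -> V * V, forall e, 0 < m e ->
   [/\ e = [set (st e).1; (st e).2], (st e).1 != (st e).2, (st e).1 \in Z & (st e).2 \in Z].
  apply: (@fin_all_exists _ _ (fun e p => 0 < m e -> [/\ e = [set p.1; p.2], p.1 != p.2, p.1 \in Z & p.2 \in Z])).
  move=> e; case: (posnP (m e)) => [_|/mZ[x [y h]]]; first by exists (x0, x0).
  by exists (x, y).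
(* Each edge [e] is listed [m e] times. *)
pose S := [set p : {set V} * 'I_n | p.2 < m p.1].
pose I := 'I_#|S|; pose w (i : I) := enum_val i.
have Ipos (i : I) : 0 < m (w i).1.
  by have := enum_valP i; rewrite inE; apply: leq_ltn_trans.
have sumI (X : {set V} -> nat) : \sum_(i : I) X (w i).1 = \sum_e m e * X e.
  rewrite /w -(big_enum_val (A := mem S) (fun p => X p.1)) /=.
  rewrite (eq_bigl (fun p : {set V} * 'I_n => true && (p.2 < m p.1))) => [|p]; last by rewrite inE.
  rewrite -(pair_big_dep xpredT (fun (e : {set V}) (j : 'I_n) => j < m e) (fun e _ => X e)) /=.
  apply: eq_bigr => e _; rewrite sum_nat_const; congr (_ * _).
  rewrite -sum1_card (big_ord_narrow (mle e)) /= sum1_card card_ord //.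
pose u (i : I) := (st (w i).1).1; pose v (i : I) := (st (w i).1).2.
have uvE : pairsm predT u v =1 m.
  move=> e; transitivity (\sum_(i : I) ((w i).1 == e)).
    by apply: eq_bigr => i _; have [<- _ _ _] := stP _ (Ipos i).
  rewrite (sumI (fun e' => nat_of_bool (e' == e))) (bigD1 e) //= eqxx muln1 big1 ?addn0 //.
  by move=> e' /negPf->; rewrite muln0.
have cI : #|{: I}| <= n.
  have E : #|{: I}| = \sum_(i : I) 1 by rewrite sum1_card.
  by rewrite E (sumI (fun=> 1)); apply: leq_trans mn; rewrite /mtot leq_sum // => e _; rewrite muln1.
have [||N [A [gA cA dA dA']]] := hK _ cI V Gam C Z I u v erefl hh.
- by move=> i; have [_ h1 h2 h3] := stP _ (Ipos i).
- have [h1 h2] := dm; split=> [x|]; first by rewrite (mdeg_eq x uvE).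
  by rewrite (mtot_eq uvE).
by exists N, A; split=> //; apply: mdec_eq dA' => e; rewrite uvE.
Qed.

End Bank.

(** Greedy placement of edge-disjoint pieces, where a vertex outside [Q j] must not be overloaded. A
    vertex lies in at most [L] sets [Q j] and is used at most [th] further times, each time with at
    most [c] edges, which bounds the degree of what is already used. *)
Lemma mass_place (V J : finType) (Q : J -> {set V}) (Sol : J -> {set {set V}} -> Prop)
    (c L th : nat) :
  (forall j (U : {set {set V}}) (O : {set V}),
     (forall x, #|[set e in U | x \in e]| <= c * (L + th)) -> #|O| * th <= c * #|J| ->
     exists A, [/\ Sol j A, [disjoint A & U], #|A| <= c, #|cover A| <= c &
       forall x, x \in cover A -> x \notin Q j -> x \notin O]) ->
  (forall x, #|[set j | x \in Q j]| <= L) ->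
  exists A : J -> {set {set V}}, [/\ forall j, Sol j (A j),
    forall i j, i != j -> [disjoint A i & A j] &
    forall x, #|[set e in \bigcup_j A j | x \in e]| <= c * (L + th)].
Proof.
move=> h hL.
have degU (r : seq J) (A : J -> {set {set V}}) x : uniq r -> (forall j, j \in r -> #|A j| <= c) ->
   count (fun j => (x \notin Q j) && (x \in cover (A j))) r <= th ->
   #|[set e in \bigcup_(j <- r) A j | x \in e]| <= c * (L + th).
  move=> ur cA hx.
  apply: leq_trans (_ : \sum_(j <- r) c * (x \in cover (A j)) <= _).
    elim: r ur cA {hx} => [_ _|j r IH /= /andP[_ ur] cA].
      by rewrite !big_nil leqn0 cards_eq0; apply/eqP/setP=> e; rewrite !inE.
    rewrite !big_cons; set B := \bigcup_(_ <- _) _.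
    have IH' : #|[set e in B | x \in e]| <= \sum_(j <- r) c * (x \in cover (A j)).
      by apply: IH => // i ir; apply: cA; rewrite inE ir orbT.
    have hj : #|[set e in A j | x \in e]| <= c * (x \in cover (A j)).
      case: (boolP (x \in cover (A j))) => [_|nx].
        rewrite muln1; apply: leq_trans (cA j _); last by rewrite inE eqxx.
        by apply: subset_leq_card; apply/subsetP=> e; rewrite inE => /andP[].
      rewrite muln0 leqn0 cards_eq0; apply/eqP/setP=> e; rewrite !inE; apply/negP=> /andP[eA xe].
      by case/negP: nx; apply/bigcupP; exists e.
    have -> : [set e in A j :|: B | x \in e] = [set e in A j | x \in e] :|: [set e in B | x \in e].
      by apply/setP=> e; rewrite !inE; case: (x \in e); rewrite ?andbT ?andbF.
    apply: leq_trans (_ : _ <= #|[set e in A j | x \in e]| + #|[set e in B | x \in e]|) _.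
      exact: leq_card_setU.
    exact: leq_add.
  rewrite -big_distrr leq_mul2l; apply/orP; right.
  apply: leq_trans (_ : count (fun j => x \in Q j) r + count (fun j => (x \notin Q j) && (x \in cover (A j))) r <= _).
    elim: (r) => [|j r' IH]; first by rewrite big_nil.
    rewrite big_cons /=; move: IH; case: (x \in Q j); case: (x \in cover _) => /=; clear; lia.
  rewrite leq_add //; apply: leq_trans (hL x).
  rewrite -size_filter cardE; apply: uniq_leq_size; first exact: filter_uniq.
  by move=> j; rewrite mem_filter mem_enum inE => /andP[].
suff [A [hS hd hA hc hx]] : exists A : J -> {set {set V}}, [/\ forall j, j \in enum J -> Sol j (A j),
    forall i j, i \in enum J -> j \in enum J -> i != j -> [disjoint A i & A j],
    forall j, j \in enum J -> #|A j| <= c, forall j, j \in enum J -> #|cover (A j)| <= c &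
    forall x, count (fun j => (x \notin Q j) && (x \in cover (A j))) (enum J) <= th].
  have inJ j : j \in enum J by rewrite mem_enum.
  exists A; split; [by move=> j; apply: hS|by move=> i j; apply: hd|move=> x].
  by rewrite -big_enum; apply: degU => //; apply: enum_uniq.
have sJ : size (enum J) <= #|J| by rewrite -cardE.
elim: (enum J) (enum_uniq J) sJ => [|j r IH] /=.
  by exists (fun=> set0); split.
move=> /andP[jr ur] sr; have [A [hS hd hA hc hx]] := IH ur (ltnW sr).
pose nr x := count (fun j => (x \notin Q j) && (x \in cover (A j))) r.
(* Vertices that have already been used [th] times outside their sets [Q] are forbidden. Counting
   covers shows that [th] times their number is at most [c * #|J|]. *)
have [||B [SB dB cB kB nB]] := h j (\bigcup_(i <- r) A i) [set x | th <= nr x].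
- by move=> x; apply: degU.
- apply: leq_trans (_ : \sum_x nr x <= _).
    rewrite -sum_nat_const big_mkcond leq_sum // => x _; case: ifP => //.
    by rewrite inE.
  apply: leq_trans (_ : \sum_(i <- r) #|cover (A i)| <= _).
    rewrite /nr; elim: (r) => [|i r' IH']; first by rewrite big1 // big_nil.
    rewrite /= big_split big_cons leq_add // -sum1_card [X in _ <= X]big_mkcond leq_sum // => x _.
    by case: (x \in cover _); rewrite ?andbF //; case: (x \notin _).
  apply: leq_trans (_ : \sum_(i <- r) c <= _).
    by rewrite big_seq [X in _ <= X]big_seq leq_sum // => i ir; apply: hc.
  by rewrite big_const_seq count_predT iter_addn_0 leq_mul2l (ltnW sr) orbT.
pose A' i := if i == j then B else A i.
have A'j : A' j = B by rewrite /A' eqxx.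
have A'r i : i \in r -> A' i = A i.
  by move=> ir; rewrite /A'; case: eqP => // E; move: jr; rewrite -E ir.
have dBi i : i \in r -> [disjoint B & A i].
  move=> ir; apply: disjointWr dB; rewrite (big_rem i) //=; exact: subsetUl.
exists A'; split.
- by move=> i; rewrite inE => /orP[/eqP->|ir]; rewrite ?A'j ?A'r //; apply: hS.
- move=> i1 i2; rewrite !inE => /orP[/eqP->|r1] /orP[/eqP->|r2]; rewrite ?eqxx // => ni.
  + by rewrite A'j A'r // dBi.
  + by rewrite A'j A'r // disjoint_sym dBi.
  + by rewrite !A'r // hd.
- by move=> i; rewrite inE => /orP[/eqP->|ir]; rewrite ?A'j ?A'r //; apply: hA.
- by move=> i; rewrite inE => /orP[/eqP->|ir]; rewrite ?A'j ?A'r //; apply: hc.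
- move=> x; rewrite /= A'j.
  have -> : count (fun j => (x \notin Q j) && (x \in cover (A' j))) r = nr x.
    by apply: eq_in_count => i ir; rewrite A'r.
  case: (boolP (_ && _)) => [/andP[xQ xB]|_]; last exact: hx.
  by have := nB x xB xQ; rewrite inE -ltnNge.
Qed.

(** * Prefix sums along cycles, robust hosts and congruences *)

Import GRing.Theory Num.Theory.

(** Prefix sums. At the first element the cyclic predecessor is the last one, whose prefix sum is
    the whole sum, that is 0. *)
Lemma cyc_prefix (T : eqType) (s : seq T) (w : T -> int) : uniq s ->
  (\sum_(a <- s) w a = 0)%R ->
  exists f : T -> int, forall a, a \in s -> (f a - f (prev s a) = w a)%R.
Proof.
case: s => [|y p] us s0; first by exists (fun=> 0%R).
pose f a := (\sum_(b <- take (index a (y :: p)).+1 (y :: p)) w b)%R.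
exists f => a ap.
have yp : y \notin p by case/andP: us.
have fi a' : a' \in y :: p -> f a' = (\sum_(b <- take (index a' (y :: p)) (y :: p)) w b + w a')%R.
  move=> ap'; rewrite /f (take_nth y) ?index_mem // nth_index // -cats1 big_cat /= big_seq1.
  by [].
rewrite fi //; suff -> : f (prev (y :: p) a) = (\sum_(b <- take (index a (y :: p)) (y :: p)) w b)%R.
  by rewrite addrC addKr.
rewrite prev_nth ap; case: (eqVneq a y) => [->|ay].
  rewrite [index y (y :: p)]/= eqxx take0 big_nil (memNindex yp).
  have -> : nth y (y :: p) (size p) = last y (y :: p) by exact: (nth_last y (y :: p)).
  by rewrite /f [last y _]/= index_last // take_oversize.
have ap' : a \in p by move: ap; rewrite inE (negPf ay).
rewrite /f index_uniq //= 1?eq_sym ?(negPf ay) //.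
by apply: leq_trans (_ : index a p < size p) _; rewrite ?index_mem // ltnW.
Qed.

(** All fibres of [P] are arranged in cycles at once. The permutation [pv] is fixed before the
    weights [w] are known, since the banks are placed before the leftover is. *)
Lemma cyclic_classes (A : finType) (T : eqType) (P : A -> T) :
  exists pv : A -> A, [/\ injective pv, forall a, P (pv a) = P a &
    forall w : A -> int, (forall t, \sum_(a | P a == t) w a = 0)%R ->
      exists f : A -> int, forall a, (f a - f (pv a) = w a)%R].
Proof.
pose s t := [seq a <- enum A | P a == t].
have us t : uniq (s t) by rewrite filter_uniq // enum_uniq.
have sE t a : (a \in s t) = (P a == t) by rewrite mem_filter mem_enum andbT.
pose pv a := prev (s (P a)) a.
have Ppv a : P (pv a) = P a by apply/eqP; rewrite -sE mem_prev sE.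
exists pv; split=> //.
  move=> a b E; have Pab : P a = P b by rewrite -(Ppv a) E Ppv.
  by rewrite -(next_prev (us (P a)) a) -/(pv a) E /pv Pab next_prev.
move=> w w0.
have hs t : exists f : A -> int, forall a, a \in s t -> (f a - f (prev (s t) a) = w a)%R.
  apply: cyc_prefix => //; rewrite big_filter big_enum_cond -[RHS](w0 t).
  exact: eq_bigl.
have [f fP] := fin_all_exists (fun a0 => hs (P a0)).
pose r a := head a (s (P a)).
have rE a : P (r a) = P a.
  by apply/eqP; rewrite -sE /r; have := sE (P a) a; case: (s (P a)) => [|b q] /=; rewrite ?eqxx ?inE ?eqxx.
have rpv a : r (pv a) = r a.
  by rewrite /r Ppv; have := sE (P a) a; case: (s (P a)); rewrite // in_nil eqxx.
exists (fun a => f (r a) a) => a; rewrite rpv.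
by have := fP (r a) a; rewrite rE sE eqxx; apply.
Qed.

Lemma or_pair (V : finType) (x y z : V) : y != z ->
  nat_of_bool ((x == y) || (x == z)) = (x == y) + (x == z).
Proof. by move=> yz; case: (eqVneq x y) => [->|_] //=; rewrite (negPf yz). Qed.

Lemma pair_deg (V : finType) (u v u' v' x : V) : [set u; v] = [set u'; v'] ->
  (x == u) + (x == v) = (x == u') + (x == v').
Proof.
move=> E; have := congr1 (fun A : {set V} => x \in A) E; rewrite !inE.
have := congr1 (fun A : {set V} => #|A|) E; rewrite !cards2.
case: (eqVneq u v) => [->|nuv]; case: (eqVneq u' v') => [->|nuv'] //= _.
  by rewrite !orbb => ->.
by move/(congr1 nat_of_bool); rewrite !or_pair.
Qed.

Definition ind (V : finType) (A : {set {set V}}) : {set V} -> nat := fun e => (e \in A).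

Definition rem (V : finType) (Gam : rel V) (U : {set {set V}}) : rel V :=
  fun x y => Gam x y && ([set x; y] \notin U).

Definition redges (V : finType) (Gam : rel V) : {set {set V}} :=
  [set e : {set V} | [exists x, exists y, Gam x y && (e == [set x; y])]].

Lemma redgesP (V : finType) (Gam : rel V) e :
  reflect (exists x y, Gam x y /\ e = [set x; y]) (e \in redges Gam).
Proof.
rewrite inE; apply: (iffP existsP).
  by case=> x /existsP[y /andP[xy /eqP->]]; exists x, y.
by case=> x [y [xy ->]]; exists x; apply/existsP; exists y; rewrite xy eqxx.
Qed.

(** The host property survives the removal of any edge set of maximum degree [B] and of any [o]
    vertices, which is what the greedy placement of many gadgets runs into. *)
Definition robust (V : finType) (Gam : rel V) (D B o s : nat) :=
  forall (U : {set {set V}}) (O : {set V}),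
  (forall x, #|[set e in U | x \in e]| <= B) -> #|O| <= o ->
  host (rem Gam U) (~: O) D s.

Lemma host_eq (V : finType) (G1 G2 : rel V) (C : {set V}) D s :
  G1 =2 G2 -> host G1 C D s -> host G2 C D s.
Proof.
move=> E [h1 h2 h3]; split.
- by move=> x y; rewrite -!E.
- by move=> x; rewrite -E.
- by move=> B Z hB hZ; have [z [z1 z2 z3]] := h3 B Z hB hZ; exists z; split=> // b /z3; rewrite E.
Qed.

(** Converts a gadget into a set of edges in the form required by [mass_place]. *)
Lemma gadget_sol (V : finType) (Gam : rel V) (U : {set {set V}}) (O Z N : {set V}) m :
  gadget (rem Gam U) (~: O) Z N m ->
  exists A : {set {set V}}, [/\ ind A =1 m, A \subset redges Gam, [disjoint A & U],
    #|A| <= (#|Z| + #|N|) ^ 2 & #|cover A| <= (#|Z| + #|N|) ^ 2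
    /\ (forall x, x \in cover A -> x \notin Z -> x \notin O)].
Proof.
move=> g; have [NO dNZ m1 mP] := g; exists [set e | 0 < m e].
have cov x : x \in cover [set e | 0 < m e] -> x \in Z :|: N.
  case/bigcupP=> e; rewrite inE => /mP[y [z [-> yN zN _]]].
  by rewrite !inE => /orP[] /eqP->; rewrite ?yN ?orbT //; move: zN; rewrite inE.
split.
- by move=> e; rewrite /ind inE; have := m1 e; case: (m e) => [|[]].
- apply/subsetP=> e; rewrite inE => /mP[x [y [-> _ _ /andP[xy _]]]].
  by apply/redgesP; exists x, y.
- rewrite disjoint_subset; apply/subsetP=> e; rewrite !inE => /mP[x [y [-> _ _ /andP[_]]]] //.
- exact: gadget_card g.
- split; last first.
    move=> x /cov; rewrite inE => /orP[->//|xN _].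
    by have := subsetP NO x xN; rewrite inE.
  apply: leq_trans (_ : #|Z :|: N| <= _); first by apply/subset_leq_card/subsetP.
  have h : #|Z :|: N| <= #|Z| + #|N| by apply: leq_card_setU.
  by apply: leq_trans h _; rewrite -mulnn; case: (#|Z| + #|N|) => // n; rewrite mulnS leq_addr.
Qed.

Lemma ind_bigcup (V J : finType) (A : J -> {set {set V}}) :
  (forall i j, i != j -> [disjoint A i & A j]) ->
  ind (\bigcup_j A j) =1 fun e => \sum_j ind (A j) e.
Proof.
move=> dA e; rewrite /ind; case: (boolP (e \in _)) => [/bigcupP[j _ ej]|ne].
  rewrite (bigD1 j) //= ej big1 // => i ij; apply/eqP; rewrite eqb0.
  by apply: contraL ej => ei; have := dA i j ij; rewrite disjoint_subset => /subsetP/(_ e ei).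
rewrite big1 // => j _; apply/eqP; rewrite eqb0.
by apply: contra ne => ej; apply/bigcupP; exists j.
Qed.

Lemma natmod_dvdz (d m s : nat) : m = s %[mod d] -> (d%:Z %| (m%:Z - s%:Z)%R)%Z.
Proof. by move=> h; rewrite -eqz_mod_dvd !modz_nat h. Qed.

(** Choosing in each [D a] that reaches [x] an edge through [x] is injective, because the sets are
    disjoint. *)
Lemma deg_cover_count (V A : finType) (D : A -> {set {set V}}) x :
  (forall i j, i != j -> [disjoint D i & D j]) ->
  #|[set a | x \in cover (D a)]| <= #|[set e in \bigcup_a D a | x \in e]|.
Proof.
move=> dD.
have [f fP] : exists f : A -> {set V}, forall a, x \in cover (D a) -> f a \in D a /\ x \in f a.
  apply: (@fin_all_exists _ _ (fun a e => x \in cover (D a) -> e \in D a /\ x \in e)) => a.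
  case: (boolP (x \in cover (D a))) => [/bigcupP[e eD xe]|_]; last by exists set0.
  by exists e.
rewrite -(@card_in_imset _ _ f).
  apply: subset_leq_card; apply/subsetP=> e /imsetP[a]; rewrite inE => /fP[h1 h2] ->.
  by rewrite inE h2 andbT; apply/bigcupP; exists a.
move=> a b; rewrite !inE => /fP[h1 _] /fP[h2 _] E; apply/eqP; apply: contraLR h2 => ab.
by rewrite -E; have := dD a b ab; rewrite disjoint_subset => /subsetP/(_ _ h1).
Qed.

(** Sizes are naturals but the coefficients of the relations have signs, hence a congruence between
    a [nat] and an [int]. *)
Definition cong (d m : nat) (z : int) : bool := (d%:Z %| (m%:Z - z)%R)%Z.

Lemma congD d m1 m2 z1 z2 : cong d m1 z1 -> cong d m2 z2 -> cong d (m1 + m2) (z1 + z2)%R.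
Proof.
move=> h1 h2; rewrite /cong.
have -> : ((m1 + m2)%N%:Z - (z1 + z2) = (m1%:Z - z1) + (m2%:Z - z2))%R by lia.
exact: rpredD.
Qed.

Lemma congBr d m1 m2 z z2 : cong d (m1 + m2) z -> cong d m2 z2 -> cong d m1 (z - z2)%R.
Proof.
move=> h1 h2; rewrite /cong.
have -> : (m1%:Z - (z - z2) = ((m1 + m2)%N%:Z - z) - (m2%:Z - z2))%R by lia.
exact: rpredB.
Qed.

Lemma cong_sum (I : finType) d (m : I -> nat) (z : I -> int) :
  (forall i, cong d (m i) (z i)) -> cong d (\sum_i m i) (\sum_i z i)%R.
Proof.
move=> h; elim/big_rec2: _ => [|i z' m' _ IH]; first by rewrite /cong subrr dvdz0.
by apply: congD.
Qed.

Lemma cong_dvdn d m z : cong d m z -> (d%:Z %| z)%Z -> d %| m.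
Proof.
move=> h1 h2; have : (d%:Z %| (m%:Z - z + z)%R)%Z by apply: rpredD.
by rewrite subrK dvdzE.
Qed.

Lemma card_bigcup_le (I T : finType) (P : pred I) (A : I -> {set T}) :
  #|\bigcup_(i | P i) A i| <= \sum_(i | P i) #|A i|.
Proof.
elim/big_rec2: _ => [|i m B _ IH]; first by rewrite cards0.
apply: leq_trans (_ : _ <= #|A i| + #|B|) _; first exact: leq_card_setU.
by rewrite leq_add2l.
Qed.

Lemma mtot_set (V : finType) (A : {set {set V}}) : mtot (ind A) = #|A|.
Proof. by rewrite /mtot /ind -sum1_card [RHS]big_mkcond; apply: eq_bigr => e _; case: (_ \in _). Qed.

Lemma mtot_le (V : finType) (m1 m2 : {set V} -> nat) : (forall e, m1 e <= m2 e) -> mtot m1 <= mtot m2.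
Proof. by move=> h; apply: leq_sum. Qed.

(** * The network of relations *)

Section Network.
Variables (F : sgraph) (D : nat).
Hypothesis hD : 2 * #|F| <= D.
Variables (a b : F).
Hypothesis ab : adj a b.
Let g := gcd_degree F.
Let k := num_edges F.

(* The [j]-th relation expresses that [c] times the formal sum of its four slots
   [rho j i * {pu j i, pw j i}], plus its real edge if [r], is divisible. *)
Definition balanced (V J : finType) (pu pw : J -> 'I_4 -> V) (rho : J -> 'I_4 -> int)
    (ed : J -> {set V}) (j : J) (c : int) (r : bool) : Prop :=
  (forall x, (g%:Z %| (\sum_i c * rho j i * ((x == pu j i)%:Z + (x == pw j i)%:Z)
                       + (r && (x \in ed j))%:Z)%R)%Z) /\
  (k%:Z %| (\sum_i c * rho j i + r%:Z)%R)%Z.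

Let g0 : 0 < g.
Proof.
rewrite /g lt0n; apply/negP=> /eqP g0; have := gcd_degree_dvd a.
rewrite g0 dvd0n => /eqP d0; have : b \in [set y | adj a y] by rewrite inE.
by move/eqP: d0; rewrite /degree cards_eq0 => /eqP ->; rewrite inE.
Qed.

Let k0 : 0 < k.
Proof. by apply/card_gt0P; exists [set a; b]; rewrite edges_pair. Qed.

(** At slot [i] the relation receives the part [so i] of its own bank and the complement of the part
    [si i] of the preceding bank, hence the class [so i - si i], which is [c * rho j i] modulo [g]
    and [k]. So the multiset it sees is congruent to its formal sum. *)
Lemma cell_mdiv (V J : finType) (pu pw : J -> 'I_4 -> V) (rho : J -> 'I_4 -> int)
    (ed : J -> {set V}) (pv : J * 'I_4 -> J * 'I_4)
    (Us : J * 'I_4 -> nat -> {set V} -> nat) (U : J * 'I_4 -> {set V} -> nat)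
    (j : J) (c : int) (r : bool) (so si : 'I_4 -> nat) K :
  (g %| K) -> (k %| K) ->
  (forall t, [set pu (pv t).1 (pv t).2; pw (pv t).1 (pv t).2] = [set pu t.1 t.2; pw t.1 t.2]) ->
  (forall t s, s <= K -> has_class F (Us t s) (pu t.1 t.2) (pw t.1 t.2) s) ->
  (forall t s e, Us t s e <= U t e) -> (forall t, mdiv F (U t)) ->
  (forall i, so i <= K) -> (forall i, si i <= K) ->
  (forall i, (K%:Z %| ((so i)%:Z - (si i)%:Z - c * rho j i)%R)%Z) ->
  balanced pu pw rho ed j c r ->
  mdiv F (fun e => \sum_i (Us (j, i) (so i) e + (U (pv (j, i)) e - Us (pv (j, i)) (si i) e))
                   + (r && (ed j == e))).
Proof.
move=> gK kK pvE hUs UsU dU soK siK hst [hbg hbk].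
have [H HH] : exists H : {set V} -> nat, forall e,
    H e = \sum_i (Us (j, i) (so i) e + (U (pv (j, i)) e - Us (pv (j, i)) (si i) e)) by eexists.
suff [d1 d2] : mdiv F (fun e => H e + (r && (ed j == e))).
  by split=> [x|]; [rewrite -(mdeg_eq (m1 := fun e => H e + (r && (ed j == e)))) // => e; rewrite HH|
    rewrite -(mtot_eq (m1 := fun e => H e + (r && (ed j == e)))) // => e; rewrite HH].
have HE : (fun e => H e + \sum_i Us (pv (j, i)) (si i) e) =1
    fun e => \sum_i Us (j, i) (so i) e + \sum_i U (pv (j, i)) e.
  move=> e; rewrite HH -!big_split; apply: eq_bigr => i _ /=.
  by rewrite -addnA subnK.
have bz : forall K' (z : int), (K' %| K) -> (K%:Z %| z)%Z -> (K'%:Z %| z)%Z.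
  by move=> K' z h1 h2; apply: dvdz_trans h2; rewrite dvdzE.
split=> [x|].
  have := mdeg_eq x HE; rewrite !mdegD !mdeg_sum => E; clear HH HE.
  have -> : mdeg (fun e => nat_of_bool (r && (ed j == e))) x = (r && (x \in ed j)).
    case: r {hbg hbk}; last by rewrite /mdeg big1.
    by rewrite /= mdeg_ind.
  pose chi i : int := ((x == pu j i)%:Z + (x == pw j i)%:Z)%R.
  have c1 : cong g (\sum_i mdeg (Us (j, i) (so i)) x + \sum_i mdeg (U (pv (j, i))) x)
      (\sum_i (so i)%:Z * chi i + \sum_(i < 4) 0)%R.
    apply: congD; [apply: cong_sum => i|apply: cong_sum => i; have [h _] := dU (pv (j, i)); rewrite /cong subr0 dvdzE; exact: (h x)].
    have [/(_ x) h _] := hUs (j, i) _ (soK i); move/natmod_dvdz in h.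
    by rewrite /cong /chi -PoszD -PoszM.
  have c2 : cong g (\sum_i mdeg (Us (pv (j, i)) (si i)) x) (\sum_i (si i)%:Z * chi i)%R.
    apply: cong_sum => i; have [/(_ x) h _] := hUs (pv (j, i)) _ (siK i).
    rewrite (pair_deg x (pvE (j, i))) in h; move/natmod_dvdz in h.
    by rewrite /cong /chi -PoszD -PoszM.
  rewrite -E in c1; have c3 := congBr c1 c2.
  have c4 : cong g (r && (x \in ed j)) (r && (x \in ed j))%:Z by rewrite /cong subrr dvdz0.
  apply: cong_dvdn (congD c3 c4) _.
  have -> : (\sum_i (so i)%:Z * chi i + \sum_(i < 4) 0 - \sum_i (si i)%:Z * chi i + (r && (x \in ed j))%:Z =
    \sum_i ((so i)%:Z - (si i)%:Z - c * rho j i) * chi i +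
     (\sum_i c * rho j i * chi i + (r && (x \in ed j))%:Z))%R.
    rewrite big1_eq addr0 addrA; congr (_ + _)%R.
    by rewrite -sumrB -big_split; apply: eq_bigr => i _ /=; ring.
  apply: rpredD; last exact: hbg.
  by apply: rpred_sum => i _; apply: dvdz_mulr; apply: bz (hst i).
have := mtot_eq HE; rewrite !mtotD !mtot_sum => E; clear HH HE.
have -> : mtot (fun e => nat_of_bool (r && (ed j == e))) = r.
  case: r {hbg hbk}; last by rewrite /mtot big1.
  by rewrite /= mtot_ind.
have c1 : cong k (\sum_i mtot (Us (j, i) (so i)) + \sum_i mtot (U (pv (j, i))))
      (\sum_i (so i)%:Z + \sum_(i < 4) 0)%R.
  apply: congD; [apply: cong_sum => i|apply: cong_sum => i; have [_ h] := dU (pv (j, i)); rewrite /cong subr0 dvdzE; exact: h].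
  by have [_ h] := hUs (j, i) _ (soK i); apply: natmod_dvdz.
have c2 : cong k (\sum_i mtot (Us (pv (j, i)) (si i))) (\sum_i (si i)%:Z)%R.
  by apply: cong_sum => i; have [_ h] := hUs (pv (j, i)) _ (siK i); apply: natmod_dvdz.
rewrite -E in c1; have c3 := congBr c1 c2.
have c4 : cong k r r%:Z by rewrite /cong subrr dvdz0.
apply: cong_dvdn (congD c3 c4) _.
have -> : (\sum_i (so i)%:Z + \sum_(i < 4) 0 - \sum_i (si i)%:Z + r%:Z =
    \sum_i ((so i)%:Z - (si i)%:Z - c * rho j i) + (\sum_i c * rho j i + r%:Z))%R.
  rewrite big1_eq addr0 addrA; congr (_ + _)%R.
  by rewrite -sumrB -big_split; apply: eq_bigr => i _ /=; ring.
apply: rpredD; last exact: hbk.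
by apply: rpred_sum => i _; apply: bz (hst i).
Qed.

(* The slots on a common pair are arranged in a cycle with a bank between any two consecutive ones,
   which is set to the prefix sum of the coefficients modulo [g * k]. Each relation then sees a
   divisible multiset out of finitely many, and has an absorber for each of them. *)
Lemma network : exists c, forall (V : finType) (Gam : rel V) (J : finType)
    (pu pw : J -> 'I_4 -> V) (rho : J -> 'I_4 -> int) (ed : J -> {set V}) (hr : pred J)
    (l th o : nat),
  0 < th -> robust Gam D (c * (l + th)) o c -> c * #|J| <= o * th ->
  (forall x, #|[set t : J * 'I_4 | (x == pu t.1 t.2) || (x == pw t.1 t.2)]| <= l) ->
  (forall x, #|[set j | hr j && (x \in ed j)]| <= l) ->
  (forall j, hr j -> exists x y, ed j = [set x; y] /\ x != y) ->
  exists A : {set {set V}}, [/\ A \subset redges Gam,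
    forall x, #|[set e in A | x \in e]| <= c * (l + th) &
    forall (c : J -> int) (r : J -> bool), (forall j, r j -> hr j) ->
      (forall j, balanced pu pw rho ed j (c j) (r j)) ->
      (forall P : {set V}, \sum_(t : J * 'I_4 | [set pu t.1 t.2; pw t.1 t.2] == P) c t.1 * rho t.1 t.2 = 0)%R ->
      mdec F (fun e => ind A e + \sum_j (r j && (ed j == e)))].
Proof.
pose K := g * k.
have K0 : 0 < K by rewrite muln_gt0 g0.
have [cb hb] := bank hD ab K.
pose c1 := (2 + cb) ^ 2.
pose h := 4 * (2 * c1) + 1.
have [Ka ha] := absorber_mult hD ab h.
pose z := 4 * (2 * c1) + 2.
pose c2 := (z + Ka) ^ 2.
(* A state of a relation: the settings of the banks after and before its four slots, and whether its
   real edge is present. *)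
pose ST := ({ffun 'I_4 -> 'I_K} * {ffun 'I_4 -> 'I_K} * bool)%type.
pose s := #|{: ST}|.
pose B := c1 + c2 * (s * (2 * c1 + 1) + 1).
pose c := B + 4 * c1 + c2 * s + 2 + cb + z + Ka; exists c.
move=> V Gam J pu pw rho ed hr l th o th0 rob hcJ hl hle hed.
have sq n : n <= n ^ 2 by rewrite -mulnn; case: n => // n; rewrite mulnS leq_addr.
have smallO (O : {set V}) n : #|O| * th <= n -> n <= c * #|J| -> #|O| <= o.
  by move=> h1 h2; rewrite -(leq_pmul2r th0); apply: leq_trans h1 (leq_trans h2 hcJ).
have irrG : irreflexive Gam.
  have [||_ irr _] := rob set0 set0; rewrite ?cards0 //.
    by move=> x; rewrite (_ : [set e in _ | _] = set0) ?cards0 //; apply/setP=> e; rewrite !inE.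
  by move=> x; apply/negbTE; move: (irr x); rewrite /rem inE andbT => ->.
pose A4 := (J * 'I_4)%type.
pose Pt (t : A4) := [set pu t.1 t.2; pw t.1 t.2].
have cardPt t : #|Pt t| <= 2 by rewrite cards2; case: (_ != _).
have cA4 : #|{: A4}| = #|J| * 4 by rewrite card_prod card_ord.
(* First round of placement: one bank for each slot, on the pair of the slot. *)
have [|x|Db [hD1 hD2 hD3]] := @mass_place V A4 Pt
  (fun t Dt => Dt \subset redges Gam /\ (mdec F (ind Dt) /\ (#|cover Dt| <= c1 /\ (#|Dt| <= c1 /\
     exists Us : nat -> {set V} -> nat, (forall s e, Us s e <= ind Dt e) /\
       forall s, s <= K -> has_class F (Us s) (pu t.1 t.2) (pw t.1 t.2) s))))
  c1 l th.
- move=> t U O hU hO.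
  have hh : host (rem Gam U) (~: O) D (#|Pt t| + cb).
    apply: host_le (rob U O _ _).
    + by move: (cardPt t); rewrite /c; clear; lia.
    + move=> x; apply: leq_trans (hU x) _; rewrite leq_mul2r; apply/orP; right.
      by rewrite /c /B; clear; lia.
    + apply: smallO hO _; rewrite cA4 mulnA mulnC mulnA leq_mul2r; apply/orP; right.
      by rewrite /c; clear; lia.
  have [||N [Um [Us [gU cN dU UsU hUs]]]] := hb V (rem Gam U) (~: O) (Pt t) (pu t.1 t.2) (pw t.1 t.2) hh.
  + by rewrite !inE eqxx.
  + by rewrite !inE eqxx orbT.
  have [A [hA1 hA2 hA3 hA4 [hA5 hA6]]] := gadget_sol gU.
  have cc : (#|Pt t| + #|N|) ^ 2 <= c1 by rewrite leq_exp2r // leq_add.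
  exists A; split=> //; try exact: leq_trans cc.
  split=> //; split; first by apply: mdec_eq dU => e; rewrite hA1.
  split; first exact: leq_trans cc.
  split; first exact: leq_trans cc.
  by exists Us; split=> // s0 e; rewrite hA1.
- by apply: leq_trans (hl x); apply: subset_leq_card; apply/subsetP=> t; rewrite !inE.
pose cD t := #|cover (Db t)|.
have [Us hUs] : exists Us : A4 -> nat -> {set V} -> nat, forall t,
    (forall s e, Us t s e <= ind (Db t) e) /\
    forall s, s <= K -> has_class F (Us t s) (pu t.1 t.2) (pw t.1 t.2) s.
  apply: (@fin_all_exists _ _ (fun t (u : nat -> {set V} -> nat) =>
    (forall s e, u s e <= ind (Db t) e) /\ forall s, s <= K -> has_class F (u s) (pu t.1 t.2) (pw t.1 t.2) s)).
  by move=> t; have [_ [_ [_ [_ H]]]] := hD1 t.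
have [pv [pvI Ppv hpv]] := cyclic_classes Pt.
pose U1 := \bigcup_t Db t.
(* Everything the relation can see: the two banks next to each of its slots, and its real edge. *)
pose Qj j := \bigcup_i (cover (Db (j, i)) :|: cover (Db (pv (j, i)))) :|: (if hr j then ed j else set0).
pose Hm (t : J * ST) e := \sum_i (Us (t.1, i) (t.2.1.1 i) e +
    (ind (Db (pv (t.1, i))) e - Us (pv (t.1, i)) (t.2.1.2 i) e)) + (t.2.2 && (ed t.1 == e)).
have cQ j : #|Qj j| <= z.
  rewrite /Qj; apply: leq_trans (_ : _ <= #|\bigcup_i (cover (Db (j, i)) :|: cover (Db (pv (j, i))))| +
     #|if hr j then ed j else set0|) _; first exact: leq_card_setU.
  apply: leq_add; last first.
    case: (boolP (hr j)) => [/hed[x [y [-> _]]]|_]; last by rewrite cards0.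
    by rewrite cards2; case: (_ != _).
  apply: leq_trans (_ : _ <= \sum_(i < 4) 2 * c1) _; last by rewrite sum_nat_const card_ord.
  apply: leq_trans (card_bigcup_le _ _) _.
  apply: leq_sum => i _; apply: leq_trans (_ : _ <= cD (j, i) + cD (pv (j, i))) _; first exact: leq_card_setU.
  have [_ [_ [h1 _]]] := hD1 (j, i); have [_ [_ [h2 _]]] := hD1 (pv (j, i)).
  by rewrite mul2n -addnn leq_add.
have cB : c1 * (l + th) + c2 * (s * (2 * (c1 * (l + th)) + l) + th) <= c * (l + th).
  have h1 : s * (2 * (c1 * (l + th)) + l) + th <= (s * (2 * c1 + 1) + 1) * (l + th).
    rewrite [X in _ <= X]mulnDl mul1n -mulnA [X in _ <= s * X + _]mulnDl mul1n -mulnA.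
    by rewrite leq_add ?leq_mul2l ?leq_add2l ?leq_addr ?leq_addl ?orbT.
  apply: leq_trans (_ : c1 * (l + th) + c2 * ((s * (2 * c1 + 1) + 1) * (l + th)) <= _).
    by rewrite leq_add2l leq_mul2l h1 orbT.
  rewrite mulnA -mulnDl leq_mul2r; apply/orP; right; rewrite /c /B.
  by move: (c2 * (s * (2 * c1 + 1) + 1)) (c2 * s); clear; lia.
have degU x (U : {set {set V}}) : #|[set e in U1 :|: U | x \in e]| <=
   #|[set e in U1 | x \in e]| + #|[set e in U | x \in e]|.
  have -> : [set e in U1 :|: U | x \in e] = [set e in U1 | x \in e] :|: [set e in U | x \in e].
    by apply/setP=> e; rewrite !inE; case: (x \in e); rewrite ?andbT ?andbF.
  exact: leq_card_setU.
(* Second round, off the edges of the banks: one absorber for each relation and each state. A vertex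
   is seen by at most [2 * (c1 * (l + th)) + l] relations, each with [s] states. *)
have [||A2 [hA1 hA2 hA3]] := @mass_place V (J * ST)%type (fun t => Qj t.1)
   (fun t At => At \subset redges (rem Gam U1) /\ (mdec F (ind At) /\
      (mdiv F (Hm t) -> (t.2.2 -> hr t.1) -> mdec F (fun e => ind At e + Hm t e))))
   c2 (s * (2 * (c1 * (l + th)) + l)) th.
- move=> [j [[so si] r]] U O hU hO /=.
  have hh : host (rem (rem Gam U1) U) (~: O) D (#|Qj j| + Ka).
    apply: (@host_eq _ (rem Gam (U1 :|: U))).
      by move=> x y; rewrite /rem in_setU negb_or andbA.
    apply: host_le (rob (U1 :|: U) O _ _).
    + by move: (cQ j); rewrite /c; clear; lia.
    + by move=> x; apply: leq_trans (degU x U) _; apply: leq_trans cB; rewrite leq_add.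
    + apply: smallO hO _; rewrite card_prod -/s mulnCA mulnC leq_mul2r; apply/orP; right.
      by rewrite /c; clear; lia.
  have [[dm hrr]|ndm] : (mdiv F (Hm (j, (so, si, r))) /\ (r -> hr j)) \/
      ~ (mdiv F (Hm (j, (so, si, r))) /\ (r -> hr j)).
    case: (boolP ([forall x, gcd_degree F %| mdeg (Hm (j, (so, si, r))) x] &&
       (num_edges F %| mtot (Hm (j, (so, si, r)))) && (r ==> hr j))) => [/andP[/andP[/forallP h1 h2] /implyP h3]|nd].
      by left.
    right=> -[[h1 h2] h3]; case/negP: nd; rewrite h2 andbT; apply/andP; split; last exact/implyP.
    exact/forallP.
  + have [|e He|N [Am [gA cN dA dA']]] := ha V _ (~: O) (Qj j) (Hm (j, (so, si, r))) _ hh _ dm.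
    * apply: leq_trans (_ : _ <= mtot (fun e => \sum_i (ind (Db (j, i)) e + ind (Db (pv (j, i))) e) + (ed j == e))) _.
        apply: mtot_le => e; apply: leq_add; last by case: r {dm hrr}.
        apply: leq_sum => i _; apply: leq_add; first by have [h1 _] := hUs (j, i).
        exact: leq_subr.
      rewrite mtotD mtot_ind mtot_sum leq_add2r.
      apply: leq_trans (_ : _ <= \sum_(i < 4) 2 * c1) _; last by rewrite sum_nat_const card_ord.
      apply: leq_sum => i _; rewrite mtotD !mtot_set mul2n -addnn.
      have [_ [_ [_ [h1 _]]]] := hD1 (j, i); have [_ [_ [_ [h2 _]]]] := hD1 (pv (j, i)).
      exact: leq_add.
    * have inD (t : A4) (e0 : {set V}) : e0 \in Db t -> cover (Db t) \subset Qj j ->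
         exists x y, [/\ e0 = [set x; y], x != y, x \in Qj j & y \in Qj j].
        move=> eD cQj; have [sD _] := hD1 t.
        have /redgesP[x [y [xy E]]] := subsetP sD e0 eD; exists x, y.
        have cov x0 : x0 \in e0 -> x0 \in Qj j.
          by move=> xe; apply: (subsetP cQj); apply/bigcupP; exists e0.
        split=> //; [|by apply: cov; rewrite E !inE eqxx|by apply: cov; rewrite E !inE eqxx orbT].
        by apply: contraTneq xy => ->; rewrite irrG.
      move: He; rewrite /Hm /= addn_gt0 => /orP[/sum_gt0[i _]|].
        rewrite addn_gt0 => /orP[h0|h0].
          apply: (inD (j, i)).
            have [h1 _] := hUs (j, i); have := leq_trans h0 (h1 _ e).
            by rewrite /ind; case: (_ \in _).
          apply: subset_trans (subsetUl _ _); apply: subset_trans (bigcup_sup i _) => //.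
          exact: subsetUl.
        apply: (inD (pv (j, i))).
          have := leq_trans h0 (leq_subr _ _).
          by rewrite /ind; case: (_ \in _).
        apply: subset_trans (subsetUl _ _); apply: subset_trans (bigcup_sup i _) => //.
        exact: subsetUr.
      rewrite lt0b => /andP[rr /eqP Ee]; have hj := hrr rr.
      have [x [y [Exy xy]]] := hed j hj; exists x, y; rewrite -Ee Exy /Qj hj Exy !inE !eqxx !orbT.
      by split.
    have [A [hA1 hA2 hA3 hA4 [hA5 hA6]]] := gadget_sol gA.
    have cc : (#|Qj j| + #|N|) ^ 2 <= c2 by rewrite leq_exp2r // leq_add.
    exists A; split=> //; try exact: leq_trans cc.
    split=> //; split; first by apply: mdec_eq dA => e; rewrite hA1.
    by move=> _ _; apply: mdec_eq dA' => e; rewrite hA1.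
  (* A state whose multiset is not divisible, or which has an edge where there is none, never occurs
     and gets the empty absorber. *)
  + exists set0; split.
    * split; first exact: sub0set.
      split; first by apply: mdec_eq (mdec0 F V) => e; rewrite /ind inE.
      by move=> h1 h2; case: ndm.
    * by rewrite disjoints_subset sub0set.
    * by rewrite cards0.
    * by rewrite /cover big_set0 cards0.
    * by move=> x; rewrite /cover big_set0 inE.
- move=> x; have -> : [set t : J * ST | x \in Qj t.1] = finset.setX [set j | x \in Qj j] [set: ST].
    by apply/setP=> t; rewrite !inE andbT.
  rewrite cardsX cardsT -/s mulnC leq_mul2l; apply/orP; right.
  pose S1 := [set t : A4 | x \in cover (Db t)].
  pose S2 := [set t : A4 | x \in cover (Db (pv t))].
  have hS1 : #|S1| <= c1 * (l + th) by apply: leq_trans (deg_cover_count x hD2) (hD3 x).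
  have hS2 : #|S2| <= #|S1|.
    rewrite -(card_imset _ pvI); apply: subset_leq_card; apply/subsetP=> t /imsetP[t']; by rewrite !inE => h1 ->.
  apply: leq_trans (_ : _ <= #|(fst @: S1) :|: (fst @: S2) :|: [set j | hr j && (x \in ed j)]|) _.
    apply/subset_leq_card/subsetP=> j; rewrite !inE => /orP[/bigcupP[i _]|].
      rewrite inE => /orP[h1|h1]; apply/orP; left; apply/orP; [left|right];
      by apply/imsetP; exists (j, i); rewrite ?inE.
    by case: (hr j); rewrite ?inE // => ->; rewrite orbT.
  apply: leq_trans (_ : _ <= #|fst @: S1 :|: fst @: S2| + #|[set j | hr j && (x \in ed j)]|) _; first exact: leq_card_setU.
  apply: leq_add (hle x).
  apply: leq_trans (_ : _ <= #|fst @: S1| + #|fst @: S2|) _; first exact: leq_card_setU.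
  have h1 : #|fst @: S1| <= #|S1| by apply: leq_imset_card.
  have h2 : #|fst @: S2| <= #|S2| by apply: leq_imset_card.
  by move: h1 h2 hS1 hS2; clear; lia.
have gK : g %| K by rewrite dvdn_mulr.
have kK : k %| K by rewrite dvdn_mull.
have disU1 : [disjoint U1 & \bigcup_t A2 t].
  rewrite disjoint_sym disjoint_subset; apply/subsetP=> e /bigcupP[t _ eA].
  have [sA _] := hA1 t; have /redgesP[x [y [/andP[_ h1] E]]] := subsetP sA e eA.
  by rewrite inE E.
exists (U1 :|: \bigcup_t A2 t); split.
- rewrite subUset; apply/andP; split; apply/subsetP=> e /bigcupP[t _ eA].
    by have [sD _] := hD1 t; apply: (subsetP sD).
  have [sA _] := hA1 t; have /redgesP[x [y [/andP[h1 _] E]]] := subsetP sA e eA.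
  by apply/redgesP; exists x, y.
- by move=> x; apply: leq_trans (degU x _) _; apply: leq_trans cB; rewrite leq_add.
move=> cc r rhr hbal hsum.
(* The banks are set to the prefix sums along the cycles; they exist because the coefficients on
   each pair sum to zero. *)
have [f fP] := hpv (fun t => cc t.1 * rho t.1 t.2)%R hsum.
have sK t : (`|(f t %% K)%Z| < K)%N.
  have h1 : (0 <= (f t %% K)%Z)%R by apply: modz_ge0; rewrite eqz_nat -lt0n.
  have h2 : ((f t %% K)%Z < K%:Z)%R by apply: ltz_pmod; rewrite ltz_nat.
  by move: h1 h2; clear; lia.
pose sg t : 'I_K := Ordinal (sK t).
pose st j : ST := ([ffun i => sg (j, i)], [ffun i => sg (pv (j, i))], r j).
have dH j : mdiv F (Hm (j, st j)).
  apply: (@cell_mdiv V J pu pw rho ed pv Us (fun t e => ind (Db t) e) j (cc j) (r j)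
    (fun i => (st j).1.1 i : nat) (fun i => (st j).1.2 i : nat) K gK kK) => //=.
  - by move=> t s0; have [_ h1] := hUs t; apply: h1.
  - by move=> t s0 e; have [h1 _] := hUs t.
  - by move=> t; have [_ [h1 _]] := hD1 t; apply: mdec_mdiv.
  - by move=> i; rewrite ffunE ltnW.
  - by move=> i; rewrite ffunE ltnW.
  - move=> i; rewrite !ffunE /=.
    have mk (q : int) : (`|(q %% K)%Z|%:Z - q = - (q %/ K)%Z * K%:Z)%R.
      have h1 : (0 <= (q %% K)%Z)%R by apply: modz_ge0; rewrite eqz_nat -lt0n.
      by rewrite gez0_abs // {2}(divz_eq q K); ring.
    have := fP (j, i); rewrite /= => <-.
    have -> : (`|(f (j, i) %% K)%Z|%:Z - `|(f (pv (j, i)) %% K)%Z|%:Z - (f (j, i) - f (pv (j, i))) =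
      (`|(f (j, i) %% K)%Z|%:Z - f (j, i)) - (`|(f (pv (j, i)) %% K)%Z|%:Z - f (pv (j, i))))%R by ring.
    by rewrite !mk; apply: rpredB; apply: dvdz_mull.
have d1 : mdec F (fun e => \sum_j (ind (A2 (j, st j)) e + Hm (j, st j) e)).
  by apply: mdec_sum => j _; have [_ [_ h1]] := hA1 (j, st j); apply: h1 (dH j) (rhr j).
(* The absorbers of the states that do not occur. *)
have d2 : mdec F (fun e => \sum_j \sum_(s' | s' != st j) ind (A2 (j, s')) e).
  by apply: mdec_sum => j _; apply: mdec_sum => s' _; have [_ [h1 _]] := hA1 (j, s').
apply: mdec_eq (mdecD d1 d2) => e.
have -> : ind (U1 :|: \bigcup_t A2 t) e = \sum_t ind (Db t) e + \sum_t ind (A2 t) e.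
  rewrite -(ind_bigcup hD2) -(ind_bigcup hA2) /ind in_setU.
  case: (boolP (e \in U1)) => //= eU; case: (boolP (e \in \bigcup_t A2 t)) => //= eA.
  by move: disU1; rewrite disjoint_subset => /subsetP/(_ e eU); rewrite inE eA.
have -> : \sum_t ind (A2 t) e = \sum_j ind (A2 (j, st j)) e + \sum_j \sum_(s' | s' != st j) ind (A2 (j, s')) e.
  transitivity (\sum_j \sum_s' ind (A2 (j, s')) e); first by rewrite pair_bigA; apply: eq_bigr => -[].
  by rewrite -big_split; apply: eq_bigr => j _; rewrite (bigD1 (st j)).
(* Each bank is used up: its chosen part goes to the relation of its slot, and the complement to the
   relation of the next slot. Reindexing along [pv] brings the two parts together. *)
have HE : \sum_j Hm (j, st j) e = \sum_t ind (Db t) e + \sum_j (r j && (ed j == e)).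
  rewrite /Hm /= big_split; congr (_ + _).
  transitivity (\sum_(t : A4) (Us t (sg t) e + (ind (Db (pv t)) e - Us (pv t) (sg (pv t)) e))).
    by rewrite pair_bigA; apply: eq_bigr => -[j i] _ /=; rewrite !ffunE.
  rewrite big_split /= -(@reindex_inj _ _ _ _ pv xpredT (fun t => ind (Db t) e - Us t (sg t) e) pvI) /=.
  rewrite -big_split; apply: eq_bigr => t _ /=; apply: subnKC.
  by have [h1 _] := hUs t.
by rewrite big_split /= HE addnCA -!addnA [X in _ + (_ + X)]addnC.
Qed.

End Network.

(** * Token algebra *)

Section Tokens.
Local Open Scope ring_scope.
Variable V : finType.
Implicit Types (z : {ffun {set V} -> int}) (P : {set V}).

(* A token [u v] is the unordered pair {u, v} with u = v allowed; a loop counts twice in the degree. *)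
Definition tok P : {ffun {set V} -> int} := [ffun Q => (P == Q)%:Z].
Definition tdeg (x : V) z : int := \sum_P z P * ((x \in P)%:Z * (#|P| == 1%N).+1%:Z).
Definition tsum z : int := \sum_P z P.

Lemma tdegD x z1 z2 : tdeg x (z1 + z2) = tdeg x z1 + tdeg x z2.
Proof. by rewrite /tdeg -big_split; apply: eq_bigr => P _; rewrite ffunE mulrDl. Qed.
Lemma tsumD z1 z2 : tsum (z1 + z2) = tsum z1 + tsum z2.
Proof. by rewrite /tsum -big_split; apply: eq_bigr => P _; rewrite ffunE. Qed.
Lemma tdegMz x z c : tdeg x (z *~ c) = tdeg x z * c.
Proof. by rewrite /tdeg big_distrl; apply: eq_bigr => P _ /=; rewrite ffunMzE -mulrzr intz; ring. Qed.
Lemma tsumMz z c : tsum (z *~ c) = tsum z * c.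
Proof. by rewrite /tsum big_distrl; apply: eq_bigr => P _ /=; rewrite ffunMzE -mulrzr intz; ring. Qed.
Lemma tdeg0 x : tdeg x 0 = 0.
Proof. by rewrite /tdeg big1 // => P _; rewrite ffunE mul0r. Qed.
Lemma tsum0 : tsum 0 = 0.
Proof. by rewrite /tsum big1 // => P _; rewrite ffunE. Qed.
Lemma tdegB x z1 z2 : tdeg x (z1 - z2) = tdeg x z1 - tdeg x z2.
Proof. by rewrite -[- z2]mulrN1z tdegD tdegMz mulrN1. Qed.
Lemma tsumB z1 z2 : tsum (z1 - z2) = tsum z1 - tsum z2.
Proof. by rewrite -[- z2]mulrN1z tsumD tsumMz mulrN1. Qed.
Lemma tdeg_sum (I : Type) (r : seq I) (Q : pred I) (f : I -> {ffun {set V} -> int}) x :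
  tdeg x (\sum_(i <- r | Q i) f i) = \sum_(i <- r | Q i) tdeg x (f i).
Proof. by elim/big_rec2: _ => [|i y1 y2 _ <-]; rewrite ?tdeg0 ?tdegD. Qed.
Lemma tsum_sum (I : Type) (r : seq I) (Q : pred I) (f : I -> {ffun {set V} -> int}) :
  tsum (\sum_(i <- r | Q i) f i) = \sum_(i <- r | Q i) tsum (f i).
Proof. by elim/big_rec2: _ => [|i y1 y2 _ <-]; rewrite ?tsum0 ?tsumD. Qed.

Lemma tdeg_tok x u v : tdeg x (tok [set u; v]) = (x == u)%:Z + (x == v)%:Z.
Proof.
rewrite /tdeg (bigD1 [set u; v]) //= ffunE eqxx mul1r big1 ?addr0; last first.
  by move=> P nP; rewrite ffunE eq_sym (negPf nP) mul0r.
rewrite !inE cards2; case: (eqVneq u v) => [->|nuv] /=; first by case: (x == v).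
by case: (eqVneq x u) => [->|nxu] /=; rewrite ?(negPf nuv) //; case: (x == v).
Qed.
Lemma tsum_tok P : tsum (tok P) = 1.
Proof.
rewrite /tsum (bigD1 P) //= ffunE eqxx big1 ?addr0 // => Q nQ.
by rewrite ffunE eq_sym (negPf nQ).
Qed.

(** [reach] stands for the group of formal sums that the relations can produce. The parent map [pi]
    is a tree rooted at [top], with [h] strictly decreasing towards the root. *)
Variables (g k : nat) (reach : {ffun {set V} -> int} -> Prop).
Hypothesis reach0 : reach 0.
Hypothesis reachD : forall z1 z2, reach z1 -> reach z2 -> reach (z1 + z2).
Hypothesis reachN : forall z, reach z -> reach (- z).
Hypothesis reach_inv : forall z, reach z -> (forall x, (g%:Z %| tdeg x z)%Z) /\ (k%:Z %| tsum z)%Z.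
Variables (pi : V -> V) (top : V) (h : V -> nat) (W : {set V}).
Hypothesis pitop : pi top = top.
Hypothesis hpi : forall u, u != top -> (h (pi u) < h u)%N.
Hypothesis piW : forall u, pi u \in W.
Let b u := tok [set u; pi u].
Hypothesis r_vertex : forall u, reach ((b u - tok [set pi u; pi u]) *~ g).
Hypothesis r_sweep : forall x y, x \in W -> y \in W ->
  reach (tok [set x; y] - tok [set pi x; y] - b x + tok [set pi x; pi x]).
Hypothesis r_top : forall c : int, (g%:Z %| c * 2)%Z -> (k%:Z %| c)%Z -> reach (tok [set top; top] *~ c).

Let reachMz z c : reach z -> reach (z *~ c).
Proof.
move=> hz; case: (intP c) => [|n|n]; rewrite ?mulr0z //.
  by elim: n => [|n IH]; rewrite ?mulr1z // -[n.+2]addn1 PoszD mulrzDr mulr1z; apply: reachD.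
rewrite mulrNz; apply: reachN.
by elim: n => [|n IH]; rewrite ?mulr1z // -[n.+2]addn1 PoszD mulrzDr mulr1z; apply: reachD.
Qed.

Let reach_sum (I : Type) (r : seq I) (Q : pred I) (f : I -> {ffun {set V} -> int}) :
  (forall i, Q i -> reach (f i)) -> reach (\sum_(i <- r | Q i) f i).
Proof. by move=> H; elim/big_rec: _ => // i z Qi hz; apply: reachD => //; apply: H. Qed.

(** Modulo reachable sums, a combination of the tree edges [{u, pi u}]. *)
Definition spanned z := exists X : V -> int, reach (z - \sum_u b u *~ X u).

Lemma spannedD z1 z2 : spanned z1 -> spanned z2 -> spanned (z1 + z2).
Proof.
case=> X1 h1 [X2 h2]; exists (fun u => X1 u + X2 u).
rewrite (_ : _ - _ = (z1 - \sum_u b u *~ X1 u) + (z2 - \sum_u b u *~ X2 u)); first exact: reachD.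
under eq_bigr do rewrite mulrzDr.
by rewrite big_split opprD addrACA.
Qed.

Lemma spannedN z : spanned z -> spanned (- z).
Proof.
case=> X hX; exists (fun u => - X u); rewrite (_ : _ - _ = - (z - \sum_u b u *~ X u)); first exact: reachN.
by under eq_bigr do rewrite mulrNz; rewrite sumrN opprB opprK addrC.
Qed.

Lemma spanned_reach z : reach z -> spanned z.
Proof. by move=> hz; exists (fun=> 0); rewrite big1 ?subr0. Qed.

Lemma spanned_b u : spanned (b u).
Proof.
exists (fun v => (v == u)%:Z); rewrite (bigD1 u) //= eqxx big1 ?addr0 ?subrr //.
by move=> v /negPf->.
Qed.

(** A sweep replaces [{x, y}] by [{pi x, y}], up to a tree edge and a loop one level lower. Loops
    are treated first by induction on [h x], then pairs by induction on [h x + h y], sweeping the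
    end that is not yet [top]. *)
Lemma spanned_W x y : x \in W -> y \in W -> spanned (tok [set x; y]).
Proof.
have step x' y' : x' \in W -> y' \in W -> spanned (tok [set pi x'; y']) ->
    spanned (tok [set pi x'; pi x']) -> spanned (tok [set x'; y']).
  move=> hx hy h1 h2; have := spanned_reach (r_sweep hx hy).
  move=> /spannedD/(_ (spannedD h1 (spannedD (spanned_b x') (spannedN h2)))).
  rewrite (_ : _ + _ = tok [set x'; y']) //.
  set A := tok [set x'; y']; set B := tok [set pi x'; y']; set C := b x'; set D := tok _.
  by apply/ffunP=> P; rewrite !ffunE; ring.
have loop n x' : x' \in W -> (h x' < n)%N -> spanned (tok [set x'; x']).
  elim: n x' => // n IH x' hx hn; case: (eqVneq x' top) => [->|nx].
    by have := spanned_b top; rewrite /b pitop.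
  apply: step => //; first by rewrite setUC; apply: spanned_b.
  by apply: IH => //; apply: leq_trans (hpi nx) _.
have [n hn] : exists n, (h x + h y < n)%N by exists (h x + h y).+1.
elim: n x y hn => // n IH x y hn hx hy; case: (eqVneq x top) => [Ex|nx].
  case: (eqVneq y top) => [Ey|ny]; first by have := spanned_b top; rewrite /b pitop Ex Ey.
  rewrite setUC; apply: step => //; last exact: (loop (h (pi y)).+1).
  by apply: IH => //; have := hpi ny; move: hn; clear; lia.
apply: step => //; last exact: (loop (h (pi x)).+1).
by apply: IH => //; have := hpi nx; move: hn; clear; lia.
Qed.

(** Taken [g] times, two vertex relations and the sweep of the loop at [pi u] combine to exchange
    the tree edge of [u] for that of [pi u]; repeat down to the root. *)
Lemma reach_b_top u : reach ((b u - tok [set top; top]) *~ g).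
Proof.
have [n hn] : exists n, (h u < n)%N by exists (h u).+1.
elim: n u hn => // n IH u hn; case: (eqVneq u top) => [->|nu].
  by rewrite /b pitop subrr mul0rz.
have h1 := r_vertex u; have h2 := reachMz g (r_sweep (piW u) (piW u)).
have h3 := r_vertex (pi u).
have h4 : reach ((b (pi u) - tok [set top; top]) *~ g).
  by apply: IH; apply: leq_trans (hpi nu) _.
have := reachD (reachD h1 h2) (reachD h3 h4).
rewrite (_ : _ + _ = (b u - tok [set top; top]) *~ g) //.
have -> : [set pi (pi u); pi u] = [set pi u; pi (pi u)] by rewrite setUC.
rewrite /b; set A := tok [set u; pi u]; set B := tok [set pi u; pi u]; set C := tok [set pi u; pi (pi u)].
set D := tok [set pi (pi u); pi (pi u)]; set E := tok _.
rewrite -!mulrzDl; congr (_ *~ _).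
by apply/ffunP=> P; rewrite !ffunE; ring.
Qed.

(** Degrees modulo [g] and total modulo [k] are complete invariants on spanned sums. After reduction
    to tree edges, all coefficients except that of [top] are multiples of [g]; then everything moves
    to the loop at [top], where [r_top] decides. *)
Lemma reach_of_inv z : spanned z -> (forall x, (g%:Z %| tdeg x z)%Z) -> (k%:Z %| tsum z)%Z -> reach z.
Proof.
case=> X hX hd hs; set S := \sum_u b u *~ X u in hX *.
have [Sd Ss] : (forall x, (g%:Z %| tdeg x S)%Z) /\ (k%:Z %| tsum S)%Z.
  have [d1 d2] := reach_inv hX; split=> [x|].
    have -> : tdeg x S = tdeg x z - tdeg x (z - S) by rewrite tdegB; ring.
    exact: rpredB.
  have -> : tsum S = tsum z - tsum (z - S) by rewrite tsumB; ring.
  exact: rpredB.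
have SdE x : tdeg x S = X x + \sum_(u | pi u == x) X u.
  rewrite /S tdeg_sum.
  under eq_bigr do rewrite tdegMz tdeg_tok mulrDl.
  rewrite big_split /=; congr (_ + _).
    rewrite (bigD1 x) //= eqxx mul1r big1 ?addr0 // => u; rewrite eq_sym => /negPf->.
    by rewrite mul0r.
  rewrite [RHS]big_mkcond; apply: eq_bigr => u _; rewrite eq_sym.
  by case: eqP => _; rewrite ?mul1r ?mul0r.
(* From the leaves towards the root: the degree at [u] is [X u] plus the coefficients of its
   children, which are already known to be divisible. The induction runs upwards in [h], hence the
   complemented measure. *)
have Xg u : u != top -> (g%:Z %| X u)%Z.
  have hub v : (h v < \sum_w (h w).+1)%N by rewrite (bigD1 v) //= leq_addr.
  have [n hn] : exists n, (\sum_w (h w).+1 - h u < n)%N by exists (\sum_w (h w).+1 - h u).+1.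
  elim: n u hn => // n IH u hn nu.
  have -> : X u = tdeg u S - \sum_(v | pi v == u) X v by rewrite SdE; ring.
  apply: rpredB => //; apply: rpred_sum => v /eqP Ev.
  have nv : v != top by apply: contraNneq nu => E; rewrite -Ev E pitop.
  by apply: IH => //; have := hpi nv; have := hub v; move: hn; rewrite Ev; clear; lia.
have ST : reach (S - tok [set top; top] *~ (\sum_u X u)).
  rewrite mulrz_sumr /S -sumrB; apply: reach_sum => u _; rewrite -mulrzBl.
  case: (eqVneq u top) => [->|nu]; first by rewrite /b pitop subrr mul0rz.
  have /dvdzP[q ->] := Xg u nu.
  rewrite mulrC mulrzA; apply: reachMz; exact: reach_b_top.
have [Td Ts] := reach_inv ST.
have : reach (tok [set top; top] *~ (\sum_u X u)).
  apply: r_top.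
    have := rpredB (Sd top) (Td top).
    by rewrite tdegB opprB addrC subrK tdegMz tdeg_tok eqxx mulrC.
  have := rpredB Ss Ts.
  by rewrite tsumB opprB addrC subrK tsumMz tsum_tok mul1r.
move=> hT; have -> : z = (z - S) + (S - tok [set top; top] *~ (\sum_u X u)) + tok [set top; top] *~ (\sum_u X u).
  by rewrite addrA subrK subrK.
by apply: reachD => //; apply: reachD.
Qed.

End Tokens.

Local Close Scope ring_scope.

(** * An absorber for all divisible subsets of a reserve *)

Lemma card_sig_le (T : finType) (A P : pred T) :
  #|[set e : {e | A e} | P (val e)]| <= #|[set e | A e && P e]|.
Proof.
rewrite -(card_imset _ val_inj); apply: subset_leq_card; apply/subsetP=> e /imsetP[e'].
by rewrite !inE => Pe ->; rewrite Pe (valP e').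
Qed.

Section Omni.
Variables (F : sgraph) (D : nat).
Hypothesis hD : 2 * #|F| <= D.
Variables (a b : F).
Hypothesis ab : adj a b.
Let g := gcd_degree F.
Let k := num_edges F.

Definition item (G : sgraph) (X : {set {set G}}) (W : {set G}) : finType :=
  ({e | e \in X} + G + {p : G * G | (p.1 \in W) && (p.2 \in W)})%type.

(* An edge of [X] is pushed along [pi] to a pair of [W]; the last kind of relation sweeps a pair of [W]
   towards [top], and the second one turns the pairs [{u, pi u}] into loops. *)
Definition slots (G : sgraph) (X : {set {set G}}) (W : {set G}) (pi : G -> G)
    (st : {set G} -> G * G) (j : item X W) : seq (G * G * int) :=
  match j with
  | inl (inl e) => let u := (st (val e)).1 in let v := (st (val e)).2 in
      [:: ((u, pi u), -1); ((v, pi v), -1); ((pi u, pi v), 1); ((u, u), 0)]%R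
  | inl (inr u) =>
      [:: ((u, pi u), 1); ((pi u, pi u), if pi u == u then 0 else -1); ((u, u), 0); ((u, u), 0)]%R
  | inr p => let x := (val p).1 in let y := (val p).2 in
      [:: ((x, y), 1); ((pi x, y), -1); ((x, pi x), -1); ((pi x, pi x), 1)]%R
  end.

(** The network is applied to the relations of [slots]. A divisible subset of [X] switches on the
    relations of its edges, and [reach_of_inv] supplies coefficients for relations without real edge
    that cancel the resulting sum of tokens. *)
Lemma omni_absorber : exists c, forall (G : sgraph) (Gam : rel G) (X : {set {set G}})
    (pi : G -> G) (top : G) (h : G -> nat) (W : {set G}) (Dl f l th o : nat),
  0 < th -> robust Gam D (c * (l + th)) o c ->
  c * (#|X| + #|G| + #|W| ^ 2) <= o * th -> X \subset edges G ->
  (forall x, #|[set e in X | x \in e]| <= Dl) ->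
  (forall x, #|[set u | pi u == x]| <= f) ->
  (forall x, #|[set u in W | pi u == x]| <= 2) ->
  ((1 + f) * Dl + (1 + f) + 4 * #|W|) * 4 <= l ->
  pi top = top -> (forall u, u != top -> h (pi u) < h u) -> (forall u, pi u \in W) ->
  exists A : {set {set G}}, [/\ A \subset redges Gam,
    forall x, #|[set e in A | x \in e]| <= c * (l + th), mdec F (ind A) &
    forall L : {set {set G}}, L \subset X -> mdiv F (ind L) ->
      mdec F (fun e => ind A e + ind L e)].
Proof.
have [c hc] := network hD ab; exists c.
move=> G Gam X pi top h W Dl f l th o th0 rob hX XG hDl hf hW hl pitop hh piW.
have G0 : 0 < #|G| by apply/card_gt0P; exists top.
have [st hst] := orient_edges G0.
pose J := item X W.
pose sl (j : J) (i : 'I_4) := nth ((top, top), 0%R) (slots pi st j) i.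
pose pu j i := (sl j i).1.1; pose pw j i := (sl j i).1.2; pose rho j i := (sl j i).2.
pose ed (j : J) := if j is inl (inl e) then val e else set0.
pose hr (j : J) := if j is inl (inl e) then true else false.
have eX (e : {e | e \in X}) : val e = [set (st (val e)).1; (st (val e)).2] /\ (st (val e)).1 != (st (val e)).2.
  by have [h1 h2] := hst _ (subsetP XG _ (valP e)); split=> //; apply: adj_neq h1.
have uE (e : {e | e \in X}) : (st (val e)).1 \in val e by have [E _] := eX e; rewrite [in X in _ \in X]E !inE eqxx.
have vE (e : {e | e \in X}) : (st (val e)).2 \in val e by have [E _] := eX e; rewrite [in X in _ \in X]E !inE eqxx orbT.
(* An overestimate of the vertices met by the slots of [j]. An edge relation meets the ends of its
   edge and their parents, which gives the term [(1 + f) * Dl] in the load. *)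
pose tch (j : J) x := match j with
  | inl (inl e) => [exists u in val e, (x == u) || (x == pi u)]
  | inl (inr u) => (x == u) || (pi u == x)
  | inr p => [|| x == (val p).1, x == (val p).2 | pi (val p).1 == x] end.
have tchP j i x : (x == pu j i) || (x == pw j i) -> tch j x.
  case: j => [[e|u]|p]; rewrite /pu /pw /sl /tch; case: i => [[|[|[|[|i]]]] Hi] //=;
    try by [case/orP=> /eqP->; rewrite eqxx ?orbT].
  - move=> H; apply/existsP; exists (st (val e)).1; by rewrite uE.
  - move=> H; apply/existsP; exists (st (val e)).2; by rewrite vE.
  - case/orP=> H; apply/existsP; [exists (st (val e)).1|exists (st (val e)).2];
      by rewrite ?uE ?vE H ?orbT.
  - by case/orP=> H; apply/existsP; exists (st (val e)).1; rewrite uE H.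

have cJ : #|J| <= #|X| + #|G| + #|W| ^ 2.
  rewrite !card_sum leq_add ?leq_add2r //; first by rewrite card_sig.
  rewrite card_sig -mulnn -cardsX subset_leq_card //; apply/subsetP=> p; rewrite !inE.
  by rewrite unfold_in.
have ltch x : #|[set j | tch j x]| <= (1 + f) * Dl + (1 + f) + 4 * #|W|.
  rewrite -sum1dep_card !big_sumType /=; apply: leq_add; first apply: leq_add.
  - rewrite sum1dep_card.
    apply: leq_trans (card_sig_le (mem X) (fun e => [exists u in e, (x == u) || (x == pi u)])) _.
    apply: leq_trans (_ : _ <= #|[set e in X | x \in e] :|: \bigcup_(u | pi u == x) [set e in X | u \in e]|) _.
      apply/subset_leq_card/subsetP=> e; rewrite !inE => /andP[eXX /existsP[u /andP[ue /orP[/eqP->|/eqP xu]]]].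
        by rewrite eXX ue.
      apply/orP; right; apply/bigcupP; exists u; first by rewrite xu.
      by rewrite inE eXX.
    apply: leq_trans (_ : _ <= #|[set e in X | x \in e]| + #|\bigcup_(u | pi u == x) [set e in X | u \in e]|) _.
      exact: leq_card_setU.
    rewrite mulnDl mul1n; apply: leq_add (hDl x) _.
    apply: leq_trans (card_bigcup_le _ _) _.
    apply: leq_trans (_ : \sum_(u | pi u == x) Dl <= _); first by apply: leq_sum.
    by rewrite sum_nat_const leq_mul2r; apply/orP; right; have := hf x; rewrite cardsE.
  - rewrite sum1dep_card.
    apply: leq_trans (_ : _ <= #|[set x] :|: [set u | pi u == x]|) _.
      by apply/subset_leq_card/subsetP=> u; rewrite !inE eq_sym.
    apply: leq_trans (_ : _ <= #|[set x]| + #|[set u | pi u == x]|) _; first exact: leq_card_setU.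
    by rewrite cards1 leq_add2l.
  - rewrite sum1dep_card.
    apply: leq_trans (card_sig_le (fun p : G * G => (p.1 \in W) && (p.2 \in W))
      (fun p => [|| x == p.1, x == p.2 | pi p.1 == x])) _.
    apply: leq_trans (_ : _ <= #|finset.setX [set x] W :|: finset.setX W [set x] :|:
        finset.setX [set u in W | pi u == x] W|) _.
      apply/subset_leq_card/subsetP=> p; rewrite !inE => /andP[/andP[-> ->]].
      by rewrite !andbT /= !(eq_sym x) => /or3P[]->; rewrite ?orbT.
    apply: leq_trans (_ : _ <= #|finset.setX [set x] W :|: finset.setX W [set x]| + #|finset.setX [set u in W | pi u == x] W|) _.
      exact: leq_card_setU.
    apply: leq_trans (_ : _ <= #|finset.setX [set x] W| + #|finset.setX W [set x]| + #|finset.setX [set u in W | pi u == x] W|) _.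
      by rewrite leq_add2r; apply: leq_card_setU.
    rewrite !cardsX cards1 mul1n muln1; have := hW x; move: #|[set u in W | _]| #|W|; clear.
    by move=> m n mn; have : m * n <= 2 * n by [rewrite leq_mul2r mn orbT]; lia.
have rE e : \sum_j (hr j && (ed j == e)) = (e \in X).
  rewrite !big_sumType /= [X in _ + X]big1 ?addn0 // [X in _ + X]big1 ?addn0 //.
  rewrite -(big_sub (mem X) (fun e' => nat_of_bool (e' == e))).
  case: (boolP (e \in X)) => eXX.
    by rewrite (bigD1 e) //= eqxx big1 // => e' /andP[_ /negPf->].
  by rewrite big1 // => e' e'X; apply/eqP; rewrite eqb0; apply: contraNneq eXX => <-.
have [||||A [A1 A2 A3]] := hc G Gam J pu pw rho ed hr l th o th0 rob _ _ _ _.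
- by apply: leq_trans hX; rewrite leq_mul2l cJ orbT.
- move=> x; apply: leq_trans hl; apply: leq_trans (_ : _ <= #|finset.setX [set j | tch j x] [set: 'I_4]|) _.
    by apply/subset_leq_card/subsetP=> t; rewrite !inE andbT => /tchP.
  by rewrite cardsX cardsT card_ord leq_mul2r ltch orbT.
- move=> x; apply: leq_trans (_ : _ <= Dl * 4) _; last first.
    apply: leq_trans hl; rewrite leq_mul2r; apply/orP; right; rewrite mulnDl mul1n -!addnA leq_addr //.
  apply: leq_trans (_ : _ <= Dl) _; last by rewrite leq_pmulr.
  apply: leq_trans (hDl x); apply: leq_trans (_ : _ <= #|[set j : J | if j is inl (inl e) then x \in val e else false]|) _.
    by apply/subset_leq_card/subsetP=> -[[e|u]|p]; rewrite !inE.
  rewrite -sum1dep_card !big_sumType /= [X in _ + X]big_pred0_eq addn0 [X in _ + X]big_pred0_eq addn0.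
  rewrite sum1dep_card; exact: (card_sig_le (mem X) (fun e => x \in e)).
- case=> [[e|u]|p] //= _; have [h1 h2] := eX e; by exists (st (val e)).1, (st (val e)).2.
(* The relation read as a formal sum of tokens. *)
pose relf j : {ffun {set G} -> int} := (\sum_i tok [set pu j i; pw j i] *~ rho j i)%R.
have degf j x c0 : (tdeg x (relf j *~ c0) = \sum_i c0 * rho j i * ((x == pu j i)%:Z + (x == pw j i)%:Z))%R.
  rewrite tdegMz tdeg_sum big_distrl; apply: eq_bigr => i _ /=; rewrite tdegMz tdeg_tok; ring.
have sumf j c0 : (tsum (relf j *~ c0) = \sum_i c0 * rho j i)%R.
  by rewrite tsumMz tsum_sum big_distrl; apply: eq_bigr => i _ /=; rewrite tsumMz tsum_tok mul1r mulrC.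
pose bal j c0 r0 := balanced F pu pw rho ed j c0 r0.
have balP j c0 (r0 : bool) : (forall x, (g%:Z %| (tdeg x (relf j *~ c0) + (r0 && (x \in ed j))%:Z)%R)%Z) ->
    (k%:Z %| (tsum (relf j *~ c0) + r0%:Z)%R)%Z -> bal j c0 r0.
  by move=> h1 h2; split=> [x|]; [rewrite -degf; apply: h1|rewrite -sumf].
have balE j c0 (r0 : bool) : bal j c0 r0 -> (forall x, (g%:Z %| (tdeg x (relf j *~ c0) + (r0 && (x \in ed j))%:Z)%R)%Z) /\
    (k%:Z %| (tsum (relf j *~ c0) + r0%:Z)%R)%Z.
  by case=> h1 h2; split=> [x|]; [rewrite degf; apply: h1|rewrite sumf].
have balD j c1 c2 r1 : bal j c1 r1 -> bal j c2 false -> bal j (c1 + c2)%R r1.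
  move=> /balE[d1 s1] /balE[d2 s2]; apply: balP => [x|].
    rewrite mulrzDr tdegD addrAC; apply: rpredD => //; have := d2 x; by rewrite addr0.
  rewrite mulrzDr tsumD addrAC; apply: rpredD => //; by move: s2; rewrite addr0.
pose reach z := exists c0 : J -> int, (forall j, bal j (c0 j) false) /\ z = (\sum_j relf j *~ c0 j)%R.
have bal0 j : bal j 0%R false.
  by apply: balP => [x|]; rewrite mulr0z ?tdeg0 ?tsum0 addr0 dvdz0.
have gen j c0 : bal j c0 false -> reach (relf j *~ c0)%R.
  move=> hb; exists (fun j' => if j' == j then c0 else 0%R); split=> [j'|].
    by case: (j' =P j) => [->|_].
  rewrite (bigD1 j) //= eqxx big1 ?addr0 // => j' /negPf->; exact: mulr0z.
have reach0 : reach 0%R.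
  by exists (fun=> 0%R); split=> //; rewrite big1 // => j _; rewrite mulr0z.
have reachD z1 z2 : reach z1 -> reach z2 -> reach (z1 + z2)%R.
  case=> c1 [h1 ->] [c2 [h2 ->]]; exists (fun j => c1 j + c2 j)%R; split=> [j|]; first exact: balD.
  by rewrite -big_split; apply: eq_bigr => j _; rewrite mulrzDr.
have reachN z : reach z -> reach (- z)%R.
  case=> c1 [h1 ->]; exists (fun j => - c1 j)%R; split=> [j|].
    have [d1 s1] := balE _ _ _ (h1 j); apply: balP => [x|].
      by rewrite mulrNz -mulrN1z tdegMz mulrN1 /= addr0 rpredN; have := d1 x; rewrite /= addr0.
    by rewrite mulrNz -mulrN1z tsumMz mulrN1 /= addr0 rpredN; move: s1; rewrite /= addr0.
  by rewrite -sumrN; apply: eq_bigr => j _; rewrite mulrNz.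
have reach_inv z : reach z -> (forall x, (g%:Z %| tdeg x z)%Z) /\ (k%:Z %| tsum z)%Z.
  case=> c1 [h1 ->]; split=> [x|].
    rewrite tdeg_sum; apply: rpred_sum => j _.
    by have [d1 _] := balE _ _ _ (h1 j); have := d1 x; rewrite addr0.
  rewrite tsum_sum; apply: rpred_sum => j _.
  by have [_ d1] := balE _ _ _ (h1 j); move: d1; rewrite addr0.
have relV u : relf (inl (inr u)) = (if pi u == u then tok [set u; u] else tok [set u; pi u] - tok [set pi u; pi u])%R.
  rewrite /relf !big_ord_recl big_ord0 /rho /pu /pw /sl /= !mulr0z mulr1z !addr0.
  by case: (pi u =P u) => [->|_]; rewrite ?mulr0z ?addr0 // mulrN1z.
have relE e : relf (inl (inl e)) = (- tok [set (st (val e)).1; pi (st (val e)).1] -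
    tok [set (st (val e)).2; pi (st (val e)).2] + tok [set pi (st (val e)).1; pi (st (val e)).2])%R.
  by rewrite /relf !big_ord_recl big_ord0 /rho /pu /pw /sl /= !mulr0z mulr1z !mulrN1z !addr0 addrA.
have relP (p : {p : G * G | (p.1 \in W) && (p.2 \in W)}) : relf (inr p) = (tok [set (val p).1; (val p).2] -
    tok [set pi (val p).1; (val p).2] - tok [set (val p).1; pi (val p).1] + tok [set pi (val p).1; pi (val p).1])%R.
  by rewrite /relf !big_ord_recl big_ord0 /rho /pu /pw /sl /= !mulr1z !mulrN1z !addr0 !addrA.
have r_vertex u : reach ((tok [set u; pi u] - tok [set pi u; pi u]) *~ g)%R.
  case: (eqVneq (pi u) u) => [E|nu]; first by rewrite E subrr mul0rz.
  have := gen (inl (inr u)) g; rewrite relV (negPf nu); apply; apply: balP => [x|].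
    by rewrite addr0 tdegMz; apply: dvdz_mull.
  by rewrite addr0 tsumMz relV (negPf nu) tsumB !tsum_tok subrr mul0r.
have r_sweep x y : x \in W -> y \in W -> reach (tok [set x; y] - tok [set pi x; y] - tok [set x; pi x] + tok [set pi x; pi x])%R.
  move=> xW yW; have pP : ((x, y).1 \in W) && ((x, y).2 \in W) by rewrite xW yW.
  have := gen (inr (exist _ (x, y) pP)) 1%R; rewrite relP mulr1z /=; apply; apply: balP => [z|].
    by rewrite addr0 mulr1z relP /= tdegD !tdegB !tdeg_tok; apply/dvdzP; exists 0%R; rewrite mul0r; ring.
  by rewrite addr0 mulr1z relP /= tsumD !tsumB !tsum_tok.
(* At the root the vertex relation has its second coefficient set to 0 and degenerates to a loop, so
   its balance conditions are exactly the two divisibilities. *)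
have r_top (c0 : int) : (g%:Z %| (c0 * 2)%R)%Z -> (k%:Z %| c0)%Z -> reach (tok [set top; top] *~ c0)%R.
  move=> d1 d2; have := gen (inl (inr top)) c0; rewrite relV pitop eqxx; apply; apply: balP => [x|].
    rewrite addr0 relV pitop eqxx tdegMz tdeg_tok.
    by case: (x == top) => /=; [rewrite mulrC|rewrite addr0 mul0r dvdz0].
  by rewrite addr0 relV pitop eqxx tsumMz tsum_tok mul1r.
have span_inv := reach_of_inv reach0 reachD reachN reach_inv pitop hh piW r_vertex r_sweep r_top.
have main (L : {set {set G}}) : L \subset X -> mdiv F (ind L) -> mdec F (fun e => ind A e + ind L e).
  move=> LX [Ld Ls].
  pose r (j : J) := hr j && (ed j \in L).
  have rL e : \sum_j (r j && (ed j == e)) = ind L e.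
    rewrite /ind /r; case: (boolP (e \in L)) => eL.
      rewrite -[RHS](_ : (e \in X) = _ :> nat); last by rewrite (subsetP LX).
      rewrite -rE; apply: eq_bigr => j _; congr (nat_of_bool _).
      by case: (hr j) => //=; case: eqP => [->|]; rewrite ?eL ?andbF.
    by rewrite big1 // => j _; apply/eqP; rewrite eqb0; apply: contraNN eL => /andP[/andP[_ h1] /eqP<-].
  (* With coefficient 1 an edge relation is balanced together with its real edge: the tree edges at
     both ends and the pair of the parents cancel all degrees and the total. *)
  have bal1 j : bal j (r j)%:Z%R (r j).
    case: j => [[e|u]|p]; rewrite /r /=; try exact: bal0.
    case: (val e \in L); last exact: bal0.
    have [E1 n1] := eX e.
    apply: balP => [x|]; rewrite mulr1z relE.
      have xe : nat_of_bool (x \in val e) = (x == (st (val e)).1) + (x == (st (val e)).2).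
        by rewrite [in X in _ \in X]E1 !inE or_pair.
      rewrite tdegD tdegB -[(- tok _)%R]mulrN1z tdegMz !tdeg_tok /= xe PoszD.
      by apply/dvdzP; exists 0%R; rewrite mul0r; ring.
    by rewrite tsumD tsumB -[(- tok _)%R]mulrN1z tsumMz !tsum_tok.
  pose z := (\sum_j relf j *~ (r j)%:Z)%R.
  have rz : reach z.
    apply: span_inv.
    - have sD := spannedD reachD (pi := pi); have sN := spannedN reachN (pi := pi).
      have sb := spanned_b reach0 pi.
      have s0 : spanned reach pi 0%R by apply: spanned_reach.
      rewrite /z; elim/big_rec: _ => // j z' _ hz'; apply: (sD _ _ _ hz').
      case: j => [[e|u]|p]; rewrite /r /= ?mulr0z //.
      case: (val e \in L); rewrite ?mulr0z // mulr1z relE.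
      apply: (sD); first by apply: (sD); apply: (sN); apply: (sb).
      exact: (spanned_W reach0 reachD reachN pitop hh piW r_sweep).
    - move=> x; have EL : mdeg (ind L) x = \sum_j (r j && (x \in ed j)).
        rewrite -(mdeg_eq x rL) mdeg_sum; apply: eq_bigr => j _.
        by case: (r j); rewrite /= ?mdeg_ind // /mdeg big1.
      have -> : tdeg x z = (\sum_j (tdeg x (relf j *~ (r j)%:Z)%R+ (r j && (x \in ed j))%:Z) - (mdeg (ind L) x)%:Z)%R.
        rewrite EL (big_morph Posz PoszD (erefl (Posz 0))) -sumrB tdeg_sum.
        by apply: eq_bigr => j _; rewrite addrK.
      apply: rpredB; last by rewrite dvdzE; apply: Ld.
      by apply: rpred_sum => j _; have [d1 _] := balE _ _ _ (bal1 j).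
    - have EL : mtot (ind L) = \sum_j r j.
        rewrite -(mtot_eq rL) mtot_sum; apply: eq_bigr => j _.
        by case: (r j); rewrite /= ?mtot_ind // /mtot big1.
      have -> : tsum z = (\sum_j (tsum (relf j *~ (r j)%:Z) + (r j)%:Z) - (mtot (ind L))%:Z)%R.
        rewrite EL (big_morph Posz PoszD (erefl (Posz 0))) -sumrB tsum_sum.
        by apply: eq_bigr => j _; rewrite addrK.
      apply: rpredB; last by rewrite dvdzE.
      by apply: rpred_sum => j _; have [_ d1] := balE _ _ _ (bal1 j).
  (* The relations of the edges of [L] leave the sum [z]; since [z] is reachable, so is [- z], and
     adding its coefficients makes the slots on every pair sum to zero. *)
  have [c0 [hc0 Ez]] := reachN _ rz.
  apply: mdec_eq (A3 (fun j => (r j)%:Z + c0 j)%R r _ _ _).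
  - by move=> e; rewrite rL.
  - by move=> j /andP[].
  - by move=> j; apply: balD.
  - move=> P.
    have : (\sum_j relf j *~ ((r j)%:Z + c0 j) = 0)%R.
      under eq_bigr do rewrite mulrzDr.
      by rewrite big_split /= -Ez subrr.
    move/ffunP/(_ P); rewrite sum_ffunE ffunE => E; rewrite -[RHS]E.
    rewrite big_mkcond /= -(pair_bigA _ (fun j i => if [set pu j i; pw j i] == P then ((r j)%:Z + c0 j) * rho j i else 0)%R) /=.
    apply: eq_bigr => j _; rewrite ffunMzE sum_ffunE -mulrzr intz big_distrl; apply: eq_bigr => i _ /=.
    rewrite ffunMzE ffunE -mulrzr intz; case: (_ == P); rewrite ?mul0r // mul1r; ring.
exists A; split=> //.
apply: mdec_eq (A3 (fun=> 0%R) (fun=> false) _ _ _) => //.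
- by move=> e; rewrite big1 ?addn0.
- by move=> P; rewrite big1 // => t _; rewrite mul0r.
Qed.
End Omni.

(** * Reserves and their use *)

Lemma pick_avoiding (V : finType) (U : {set {set V}}) (B N O Z : {set V}) m :
  (forall x, #|[set e in U | x \in e]| <= m) -> #|B| * m + #|O| + #|Z| < #|N| ->
  exists y, [/\ y \in N, y \notin O, y \notin Z & forall b, b \in B -> [set y; b] \notin U].
Proof.
move=> hU hN; pose Y b := [set y | [set y; b] \in U].
have cY b : #|Y b| <= m.
  apply: leq_trans (hU b).
  have ij : injective (fun y : V => [set y; b]).
    move=> y y' E; have : y \in [set y'; b] by rewrite -E !inE eqxx.
    have : y' \in [set y; b] by rewrite E !inE eqxx.
    by rewrite !inE => /orP[/eqP->//|/eqP->] /orP[/eqP->|/eqP->].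
  rewrite -(card_imset _ ij); apply/subset_leq_card/subsetP=> e /imsetP[y]; rewrite !inE => yU ->.
  by rewrite yU !inE eqxx orbT.
have : ~~ (N \subset (\bigcup_(b in B) Y b) :|: O :|: Z).
  apply/negP=> /subset_leq_card; rewrite leqNgt => /negP; apply.
  apply: leq_ltn_trans hN.
  apply: leq_trans (_ : _ <= #|(\bigcup_(b in B) Y b) :|: O| + #|Z|) _; first exact: leq_card_setU.
  rewrite leq_add2r; apply: leq_trans (_ : _ <= #|\bigcup_(b in B) Y b| + #|O|) _; first exact: leq_card_setU.
  rewrite leq_add2r -sum_nat_const; apply: leq_trans (card_bigcup_le _ _) _; exact: leq_sum.
case/subsetPn=> y yN; rewrite !inE !negb_or => /andP[/andP[yB yO] yZ]; exists y; split=> // b bB.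
by apply: contra yB => yb; apply/bigcupP; exists b; rewrite ?inE.
Qed.

Definition common (G : sgraph) (B : {set G}) : {set G} := [set y | [forall b in B, adj y b]].

Lemma commonP (G : sgraph) (B : {set G}) y b : y \in common B -> b \in B -> adj y b.
Proof. by rewrite inE => /forallP/(_ b)/implyP. Qed.

Lemma robust_of_common (G : sgraph) (X : {set {set G}}) (D Dl B o s m : nat) :
  (forall x, #|[set e in X | x \in e]| <= Dl) ->
  (forall S : {set G}, #|S| <= D -> m <= #|common S|) ->
  D * (Dl + B) + o + s < m -> robust (rem (@adj G) X) D B o s.
Proof.
move=> hX hm hlt U O hU hO; split.
- by move=> x y; rewrite /rem adj_sym setUC.
- by move=> x; rewrite /rem adj_irrefl.
move=> S Z hS hZ.
have hXU x : #|[set e in X :|: U | x \in e]| <= Dl + B.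
  apply: leq_trans (_ : _ <= #|[set e in X | x \in e]| + #|[set e in U | x \in e]|) _; last exact: leq_add.
  rewrite (_ : [set e in X :|: U | x \in e] = [set e in X | x \in e] :|: [set e in U | x \in e]).
    exact: leq_card_setU.
  by apply/setP=> e; rewrite !inE; case: (x \in e); rewrite ?andbT ?andbF.
have [|y [yN yO yZ yS]] := pick_avoiding (N := common S) (O := O) (Z := Z) (B := S) hXU.
  apply: leq_trans (hm S hS); apply: leq_ltn_trans hlt.
  by rewrite leq_add // leq_add // leq_mul2r hS orbT.
exists y; split=> //; first by rewrite inE.
move=> b bS; have := yS b bS; rewrite in_setU negb_or => /andP[h1 h2].
by rewrite /rem (commonP yN bS) h1 h2.
Qed.

Section Cover.
Variables (T : eqType) (G : sgraph) (lab : G -> T * T).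

Definition same (x y : G) := ((lab x).1 == (lab y).1) || ((lab x).2 == (lab y).2).
Definition reserve : {set {set G}} :=
  [set e in edges G | [exists x, exists y, (e == [set x; y]) && same x y]].

Lemma reserve_pair x y : adj x y -> same x y -> [set x; y] \in reserve.
Proof.
move=> xy sxy; rewrite inE edges_pair xy; apply/existsP; exists x; apply/existsP; exists y.
by rewrite eqxx.
Qed.

(* The new vertices of the copy through [xy] have the label [((lab x).1, (lab y).2)], which puts all
   its other edges into the reserve. *)
Lemma cover_leftover (F : sgraph) (D : nat) (hD : 2 * #|F| <= D) (a b : F) (ab : adj a b)
    (L0 : {set {set G}}) (l th o s0 : nat) :
  let c := num_edges F + #|F| in
  0 < th -> L0 \subset edges G :\: reserve ->
  (forall x, #|[set e in L0 | x \in e]| <= l) ->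
  (forall (z : T * T) (B : {set G}), #|B| <= D ->
     s0 <= #|[set y in common B | lab y == z]|) ->
  D * (c * (l + th)) + o + (#|F| + 2) < s0 -> c * #|L0| <= o * th ->
  exists C : {set {set G}}, C \subset reserve /\ mdec F (fun e => ind L0 e + ind C e).
Proof.
move=> c th0 L0E hl hs hlt hcL.
pose J : finType := {e | e \in L0}.
have [|x|A [hA dA _]] := @mass_place G J (fun j => val j)
  (fun j A => A \subset reserve /\ mdec F (fun e => (val j == e) + ind A e)) c l th.
- move=> j U O hU hO.
  have jE : val j \in edges G by have := subsetP L0E _ (valP j); rewrite inE => /andP[].
  have jX : val j \notin reserve by have := subsetP L0E _ (valP j); rewrite inE => /andP[].
  have /edgesP[x [y [xy Ej]]] := jE.
  pose z := ((lab x).1, (lab y).2).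
  have oO : #|O| <= o.
    rewrite -(leq_pmul2r th0); apply: leq_trans hO _; apply: leq_trans hcL.
    by rewrite leq_mul2l card_sig leqnn orbT.
  pose C := [set w | (lab w == z) && (w \notin O)].
  have hh : host (rem (@adj G) U) C D (#|F| + 2).
    split.
    - by move=> u v; rewrite /rem adj_sym setUC.
    - by move=> u; rewrite /rem adj_irrefl.
    move=> B Z hB hZ.
    have [|w [wN wO wZ wB]] := pick_avoiding (N := [set y in common B | lab y == z]) (O := O) (Z := Z) (B := B) hU.
      apply: leq_trans (hs z B hB); apply: leq_ltn_trans hlt.
      by rewrite leq_add // leq_add // leq_mul2r hB orbT.
    move: wN; rewrite inE => /andP[wN wz].
    exists w; split; rewrite ?inE ?wz ?wO // => b' b'B; by rewrite /rem (commonP wN b'B) wB.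
  have nab := adj_neq ab.
  have [||||phi [p1 p2 p3 p4 _]] := @host_extF F D G (rem (@adj G) U) C [set x; y] [set a; b]
      (fun w => if w == a then x else y) (fun=> set0) (#|F| + 2) hD hh.
  - move=> w w'; rewrite !inE => /orP[/eqP->|/eqP->] /orP[/eqP->|/eqP->] //;
      rewrite ?eqxx ?(negPf nab) eq_sym ?(negPf nab) // => E; move: xy; by rewrite E adj_irrefl.
  - by move=> w _; case: (w == a); rewrite !inE eqxx ?orbT.
  - by move=> w _; rewrite cards0.
  - by rewrite cards2 addnC; case: (_ != _) => //; rewrite leq_add2l.
  have pa : phi a = x by rewrite p1 ?inE ?eqxx.
  have pb : phi b = y by rewrite p1 ?inE ?eqxx ?orbT // eq_sym (negPf nab).
  have abE : [set a; b] \in edges F by rewrite edges_pair.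
  have labw w : w \notin [set a; b] -> lab (phi w) = z.
    by move=> /p3[]; rewrite inE => /andP[/eqP-> _].
  have sw w w' : w \notin [set a; b] -> same (phi w) (phi w').
    move=> nw; rewrite /same (labw _ nw) /=; case: (boolP (w' \in [set a; b])) => [|/labw->]; last by rewrite !eqxx.
    by rewrite !inE => /orP[/eqP->|/eqP->]; rewrite ?pa ?pb eqxx ?orbT.
  have new f : f \in edges F :\ [set a; b] -> exists w w', [/\ w \notin [set a; b], adj w w' & f = [set w; w']].
    rewrite !inE => /andP[fab fE]; have /edgesP[w [w' [ww E]]] : f \in edges F by rewrite inE.
    case: (boolP (w \in [set a; b])) => wab; last by exists w, w'.
    case: (boolP (w' \in [set a; b])) => wab'; last by exists w', w; split=> //; [rewrite adj_sym|rewrite E setUC].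
    case/negP: fab; rewrite E eqEcard subUset !sub1set wab wab' !cards2 nab (adj_neq ww) //.
  pose Aj := [set phi @: (f : {set F}) | f in edges F :\ [set a; b]].
  have AjP e : e \in Aj -> exists w w', [/\ w \notin [set a; b], adj w w' & e = [set phi w; phi w']].
    by case/imsetP=> f /new[w [w' [h1 h2 ->]]] ->; exists w, w'; rewrite imsetU1 imset_set1.
  have EAj e : mul (edges F) phi e = (val j == e) + ind Aj e.
    rewrite (mulD1 phi abE) imsetU1 imset_set1 pa pb -Ej; congr (_ + _).
    rewrite /ind /mul; case: (boolP (e \in Aj)) => [/imsetP[f fS ->]|ne].
      rewrite (bigD1 f) //= eqxx big1 // => f' /andP[_ nf]; apply/eqP; rewrite eqb0.
      by apply: contra nf => /eqP/(imset_inj p2)->.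
    by rewrite big1 // => f fS; apply/eqP; rewrite eqb0; apply: contraNneq ne => <-; apply: imset_f.
  exists Aj; split.
  + split.
      apply/subsetP=> e /AjP[w [w' [nw ww ->]]].
      by apply: reserve_pair; [have /andP[] := p4 w w' nw ww|exact: sw].
    by apply: mdec_eq (mdec_copy p2).
  + rewrite disjoint_subset; apply/subsetP=> e /AjP[w [w' [nw ww ->]]].
    by have /andP[] := p4 w w' nw ww.
  + apply: leq_trans (leq_imset_card _ _) _; apply: leq_trans (subset_leq_card (subsetDl _ _)) _.
    by rewrite leq_addr.
  + apply: leq_trans (_ : #|phi @: [set: F]| <= _).
      apply/subset_leq_card/subsetP=> v /bigcupP[e /AjP[w [w' [_ _ ->]]]].
      by rewrite !inE => /orP[]/eqP->; apply: imset_f.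
    by apply: leq_trans (leq_imset_card _ _) _; rewrite cardsT leq_addl.
  + move=> v /bigcupP[e /AjP[w [w' [_ _ ->]]]] ve vj.
    have [u Eu] : exists u, v = phi u by move: ve; rewrite !inE => /orP[]/eqP->; [exists w|exists w'].
    have nu : u \notin [set a; b].
      apply: contra vj; rewrite Eu Ej !inE => /orP[]/eqP->; by rewrite ?pa ?pb eqxx ?orbT.
    by have [] := p3 u nu; rewrite -Eu inE => /andP[].
- apply: leq_trans (hl x); exact: (card_sig_le (mem L0) (fun e => x \in e)).
exists (\bigcup_j A j); split.
  by apply/subsetP=> e /bigcupP[j _ eA]; have [h _] := hA j; apply: (subsetP h).
apply: mdec_eq (@mdec_sum F G J (index_enum J) xpredT (fun j e => (val j == e) + ind (A j) e) _).
  move=> e; rewrite big_split /= -(ind_bigcup dA); congr (_ + _).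
  rewrite -(big_sub (mem L0) (fun e' => nat_of_bool (e' == e))) /ind.
  case: (boolP (e \in L0)) => eL.
    by rewrite (bigD1 e) //= eqxx big1 // => e' /andP[_ /negPf->].
  by rewrite big1 // => e' e'X; apply/eqP; rewrite eqb0; apply: contraNneq eL => <-.
by move=> j _; have [] := hA j.
Qed.

End Cover.

Lemma card_le_seq (V : finType) (S : {set V}) (f : V -> nat) (s : seq nat) :
  {in S &, injective f} -> (forall x, x \in S -> f x \in s) -> #|S| <= size s.
Proof.
move=> fi fs; rewrite cardE -(size_map f); apply: uniq_leq_size.
  by rewrite map_inj_in_uniq ?enum_uniq // => x y; rewrite !mem_enum; apply: fi.
by move=> y /mapP[x]; rewrite mem_enum => /fs h ->.
Qed.

Lemma card_edges_le (G : sgraph) (X : {set {set G}}) l : X \subset edges G ->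
  (forall x, #|[set e in X | x \in e]| <= l) -> #|X| <= #|G| * l.
Proof.
move=> XG hl; apply: leq_trans (_ : \sum_(x : G) #|[set e in X | x \in e]| <= _); last first.
  by rewrite -sum_nat_const; apply: leq_sum.
under eq_bigr do rewrite -sum1dep_card.
rewrite (exchange_big_dep (mem X)) /=; last by move=> x e _ /andP[].
rewrite -sum1_card; apply: leq_sum => e eX; rewrite eX sum1_card.
by have := edges_card2 (subsetP XG e eX) => h; apply: leq_trans (_ : #|e| <= _); [rewrite h|apply: subset_leq_card; apply/subsetP].
Qed.

(** Each vertex misses at most n/(6k) others, so 4k vertices together miss at most 2n/3. This is
    where the term 1 - 1/(6e(F)) enters. *)
Lemma common_large (G : sgraph) (k : nat) : (forall x : G, 6 * k * (#|G| - degree x) <= #|G|) ->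
  forall S : {set G}, #|S| <= 4 * k -> #|G| <= 3 * #|common S|.
Proof.
move=> hd S hS; have [x0 _|] := pickP (mem G); last first.
  by move=> e; rewrite (eq_card0 e).
have [x1 x1S hx1] := @arg_maxnP _ x0 predT (fun x => #|G| - degree x) isT.
set m := #|G| - degree x1 in hx1.
have c1 : #|~: common S| <= #|S| * m.
  apply: leq_trans (_ : #|\bigcup_(s in S) [set y | ~~ adj y s]| <= _).
    apply/subset_leq_card/subsetP=> y; rewrite !inE => /forallPn[s]; rewrite negb_imply => /andP[sS ys].
    by apply/bigcupP; exists s; rewrite ?inE.
  apply: leq_trans (_ : \sum_(s in S) m <= _); last by rewrite sum_nat_const.
  elim/big_rec2: _ => [|s a B sS h]; first by rewrite cards0.
  apply: leq_trans (_ : #|[set y | ~~ adj y s]| + #|B| <= _); first exact: leq_card_setU.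
  apply: leq_add => //; apply: leq_trans (hx1 s isT).
  rewrite -(cardC [set y | adj s y]) addKn; apply: subset_leq_card; apply/subsetP=> y.
  by rewrite !inE adj_sym.
have := cardsC (common S); have := hd x1; rewrite -/m.
have : #|S| * m <= 4 * k * m by rewrite leq_mul2r hS orbT.
move: c1; move: #|~: _| #|common S| (#|S| * m) => a b c; have -> : 6 * k * m = 6 * (k * m) by rewrite mulnA.
have -> : 4 * k * m = 4 * (k * m) by rewrite mulnA.
by move: (k * m) #|G| => d n; clear; lia.
Qed.

(** * Deleting edges of the host, and isolated vertices of the pattern *)

Section Remove.
Variables (G : sgraph) (U : {set {set G}}).

Lemma rem_adj_sym : symmetric (rem (@adj G) U).
Proof. by move=> x y; rewrite /rem adj_sym setUC. Qed.
Lemma rem_adj_irrefl : irreflexive (rem (@adj G) U).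
Proof. by move=> x; rewrite /rem adj_irrefl. Qed.

Definition remove : sgraph := SGraph rem_adj_sym rem_adj_irrefl.

Lemma edges_remove : edges remove = edges G :\: U :> {set {set G}}.
Proof.
apply/setP=> e; rewrite in_setD; apply/(@edgesP remove)/andP => [[x [y [/andP[xy nU] ->]]]|[nU /edgesP[x [y [xy E]]]]].
  by rewrite edges_pair.
by exists x, y; split=> //; rewrite /= /rem xy -E.
Qed.

Lemma degree_remove (x : G) : degree x <= degree (x : remove) + #|[set e in U | x \in e]|.
Proof.
apply: leq_trans (_ : #|[set y | adj (x : remove) y]| + #|[set y | adj x y && ([set x; y] \in U)]| <= _).
  apply: leq_trans (leq_card_setU _ _); apply/subset_leq_card/subsetP=> y; rewrite !inE /= /rem => ->.
  by case: (_ \in U).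
rewrite leq_add2l -(card_in_imset (f := fun y => [set x; y])).
  apply/subset_leq_card/subsetP=> e /imsetP[y]; rewrite inE => /andP[_ yU] ->; by rewrite !inE yU eqxx.
move=> y z; rewrite !inE => /andP[xy _] _ /setP/(_ y).
by rewrite !inE eqxx orbT eq_sym (negPf (adj_neq xy)) => /esym/eqP.
Qed.

End Remove.

Section PullBack.
Variable F : sgraph.

(** The map [s] may repeat vertices, which then become non-adjacent indices. This serves below for
    subsets of vertices and for random samples alike. *)
Definition pull (G : sgraph) (I : finType) (s : I -> G) : sgraph :=
  @SGraph I (fun i j => adj (s i) (s j)) (fun i j => adj_sym (s i) (s j)) (fun i => adj_irrefl (s i)).

(** Without isolated vertices the order of [F] is at most [2 * num_edges F], so a degree condition
    in terms of edges suffices for embedding. *)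
Definition support : sgraph := pull (fun x : {x : F | 0 < degree x} => val x).

Lemma degree_support (x : support) : degree x = degree (val x).
Proof.
rewrite /degree -(card_imset _ val_inj); apply: eq_card => y; rewrite inE; apply/imsetP/idP => [[z]|xy].
  by rewrite inE => h ->.
have y0 : 0 < degree y by apply/card_gt0P; exists (val x); rewrite inE adj_sym.
by exists (exist _ y y0 : support); rewrite ?inE.
Qed.

Lemma sum_degree_support : \sum_(x : support) degree x = \sum_(x : F) degree x.
Proof.
rewrite [RHS](bigID (fun x => 0 < degree x)) /= [X in _ = _ + X]big1 ?addn0 => [|x]; last by case: (degree x).
rewrite (reindex_omap (val : support -> F) insub) /=; last first.
  by move=> x hx; rewrite insubT.
apply: eq_big => [x|x _]; last by rewrite degree_support.
by rewrite (valP x) valK eqxx.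
Qed.

Lemma gcd_support : gcd_degree support %| gcd_degree F.
Proof.
rewrite /gcd_degree; apply/dvdn_biggcdP => x _; case: (posnP (degree x)) => [->|hx]; first exact: dvdn0.
have -> : degree x = degree (exist _ x hx : support) by rewrite degree_support.
exact: gcd_degree_dvd.
Qed.

Lemma chromatic_le_support : 0 < #|support| -> chromatic_number F <= #|support|.
Proof.
move=> h0; rewrite /chromatic_number; case: ex_minnP => m _; apply.
have [s0 _] := card_gt0P h0.
apply/existsP; exists [ffun x => enum_rank (if insub x is Some y then y else s0)].
apply/forallP=> x; apply/forallP=> y; apply/implyP=> xy; rewrite !ffunE.
have hx : 0 < degree x by apply/card_gt0P; exists y; rewrite inE.
have hy : 0 < degree y by apply/card_gt0P; exists x; rewrite inE adj_sym.
rewrite (inj_eq enum_rank_inj) !insubT; apply: contraTneq xy => /(congr1 val) /= ->.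
by rewrite adj_irrefl.
Qed.

End PullBack.

Lemma extend_injection (T V : finType) (P : pred T) (phi : {x | P x} -> V) : #|T| <= #|V| -> injective phi ->
  exists psi : {ffun T -> V}, injective psi /\ forall x, psi (val x) = phi x.
Proof.
move=> TV pi; pose N := [set x | ~~ P x]; pose B := ~: (phi @: [set: {x | P x}]).
have cB : #|N| <= #|B|.
  rewrite cardsCs (_ : ~: N = [set x | P x]); last by apply/setP=> x; rewrite !inE negbK.
  by rewrite [#|B|]cardsCs setCK card_imset // cardsT card_sig cardsE leq_sub2r.
case: (pickP (mem T)) => [t0 _|none]; last first.
  by exists (ffun0 (eq_card0 none)); split=> x; have := none; [move/(_ x)|move/(_ (val x))].
have /card_gt0P[v0 _] : 0 < #|V| by apply: leq_trans TV; apply/card_gt0P; exists t0.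
pose f x := nth v0 (enum B) (index x (enum N)).
have fB x : x \in N -> f x \in B.
  by move=> xN; rewrite -mem_enum mem_nth // -cardE (leq_trans _ cB) // [X in _ < X]cardE index_mem mem_enum.
exists [ffun x => if insub x is Some y then phi y else f x]; split; last first.
  by move=> x; rewrite ffunE valK.
have nB x : x \in B -> forall y, x != phi y.
  by rewrite inE => xB y; apply: contraNneq xB => ->; apply: imset_f; rewrite inE.
move=> x y; rewrite !ffunE; case: insubP => [x' _ <-|Px]; case: insubP => [y' _ <-|Py] E.
- by rewrite (pi _ _ E).
- by have := nB _ (fB y _) x'; rewrite -E eqxx inE => /(_ Py).
- by have := nB _ (fB x _) y'; rewrite -E eqxx inE => /(_ Px).
have xN : x \in N by rewrite inE.
have yN : y \in N by rewrite inE.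
move/eqP: E; rewrite /f nth_uniq ?enum_uniq -?cardE ?(leq_trans _ cB) // ?[X in _ < X]cardE ?index_mem ?mem_enum //.
by move/eqP/(congr1 (nth x (enum N))); rewrite !nth_index ?mem_enum.
Qed.

Lemma edges_support (F : sgraph) (A : {set F}) :
  (A \in edges F) = (A \in [set val @: (B : {set support F}) | B in edges (support F)]).
Proof.
apply/edgesP/imsetP => [[x [y [xy ->]]]|[B /edgesP[x [y [xy ->]]] ->]].
  have hx : 0 < degree x by apply/card_gt0P; exists y; rewrite inE.
  have hy : 0 < degree y by apply/card_gt0P; exists x; rewrite inE adj_sym.
  exists [set (exist _ x hx : support F); (exist _ y hy : support F)]; first by rewrite edges_pair.
  by rewrite imsetU1 imset_set1.
by exists (val x), (val y); rewrite imsetU1 imset_set1.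
Qed.

(** The indicator of a set has values at most 1, so the copies in the list are edge-disjoint. Each
    is then completed by the isolated vertices of [F], for which [G] has enough vertices. *)
Lemma mdec_decomposition (F G : sgraph) : 0 < num_edges (support F) -> #|F| <= #|G| ->
  mdec (support F) (ind (edges G)) -> has_decomposition F G.
Proof.
move=> k0 FG [s [si hs]].
pose cp (phi : {ffun support F -> G}) : {set {set G}} := [set phi @: (A : {set support F}) | A in edges (support F)].
have mcp phi e : phi \in s -> mul (edges (support F)) phi e = (e \in cp phi) by move=> ps; apply/mul_edges/si.
have memcp phi e : phi \in s -> e \in cp phi -> e \in edges G.
  move=> ps ep; have := hs e; rewrite (big_rem phi) //= mcp // ep /ind; by case: (e \in edges G).
have dis phi psi e : phi \in s -> psi \in s -> e \in cp phi -> e \in cp psi -> phi = psi.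
  move=> ps qs ep eq; have := hs e; rewrite (big_rem phi) //= mcp // ep /ind.
  case: (eqVneq psi phi) => [-> //|ne].
  have qs' : psi \in seq.rem phi s by move: qs; rewrite (perm_mem (perm_to_rem ps)) inE (negPf ne).
  rewrite (big_rem psi) //= mcp // eq; by case: (e \in edges G).
exists [set D | D \in [seq cp phi | phi <- s]]; split.
  apply/and3P; split.
  - apply/eqP/setP=> e; apply/bigcupP/idP => [[D]|eG].
      by rewrite inE => /mapP[phi ps ->]; apply: memcp.
    have : 0 < \sum_(phi <- s) mul (edges (support F)) phi e by rewrite -hs /ind eG.
    rewrite lt0n sum_nat_seq_neq0 => /hasP[phi ps]; rewrite mcp //= eqb0 negbK => ep.
    by exists (cp phi) => //; rewrite inE; apply: map_f.
  - apply/trivIsetP=> D1 D2; rewrite !inE => /mapP[phi ps ->] /mapP[psi qs ->] ne.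
    rewrite -setI_eq0; apply/eqP/setP=> e; rewrite !inE; apply/negP=> /andP[ep eq].
    by move: ne; rewrite (dis _ _ _ ps qs ep eq) eqxx.
  - rewrite inE; apply/mapP=> -[phi ps /setP E]; have /card_gt0P[A hA] := k0.
    by have := E (phi @: A); rewrite inE imset_f.
move=> D; rewrite inE => /mapP[phi ps ->].
have [psi [psii psiE]] := extend_injection FG (si _ ps).
exists (psi @: [set: F], cp phi) => //; rewrite inE /is_copy; apply/andP; split.
  by apply/subsetP=> e; apply: memcp.
apply/existsP; exists psi; apply/and3P; split=> //; first exact/injectiveP.
apply/eqP/setP=> e; apply/imsetP/imsetP => [[A]|[B BE ->]].
  rewrite edges_support => /imsetP[B BE ->] ->; exists B => //.
  by rewrite -imset_comp; apply: eq_imset => x /=; rewrite psiE.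
exists (val @: B); first by rewrite edges_support imset_f.
by rewrite -imset_comp; apply: eq_imset => x /=; rewrite psiE.
Qed.

Lemma double_floor n d z : n < d * z.+1 -> 0 < z -> n <= 2 * (d * z).
Proof. by rewrite mulnS => h /(leq_pmulr d); move: h; move: (d * z) => a; lia. Qed.

(* The parent map folds the vertices, ranked by [rk], onto the path of the [q] first ones,
   which is followed down to rank 0. *)
Lemma reserve_absorber (F : sgraph) (D N : nat) (a b : F) : 2 * #|F| <= D -> adj a b ->
  exists t n0, 0 < t /\ forall (G : sgraph) (lab : G -> 'I_t * 'I_t), n0 <= #|G| ->
  (forall S : {set G}, #|S| <= D -> #|G| <= 3 * #|common S|) ->
  (forall x, #|[set e in reserve lab | x \in e]| * t <= 4 * #|G|) ->
  exists A : {set {set G}}, [/\ A \subset edges G :\: reserve lab,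
    forall x, #|[set e in reserve lab :|: A | x \in e]| * N <= #|G|, mdec F (ind A) &
    forall L : {set {set G}}, L \subset reserve lab -> mdiv F (ind L) ->
      mdec F (fun e => ind A e + ind L e)].
Proof.
move=> hD ab; have [c hc] := omni_absorber hD ab.
(* [c1 * z] bounds the degree of the reserve and the absorber together. The first summand of [c0]
   leaves room inside common neighbourhoods of size n/3, the second gives the required factor
   [N]. *)
pose c1 := 1 + 41 * c; pose c0 := 3 * (D * c1 + 8 * c + 1) + N * c1.
exists (8 * c0 * (c0 + 4)), (c0 * (2 * c0 + 5)).
have c00 : 0 < c0 by rewrite /c0; lia.
have c02 : 1 < c0 by rewrite /c0 mulnDr; lia.
split=> [|G lab hn hcom hX]; first by rewrite !muln_gt0 c00 addnS.
set n := #|G| in hn hcom hX *; set X := reserve lab in hX *.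
(* [z] is the unit of load, linear in [n], and [q] the length of the path. The choice of [t] makes
   the degree of the reserve at most [Dl], where [Dl * (c0 + 4) <= z]. *)
pose z := n %/ c0; pose q := z.+1; pose Dl := z %/ (c0 + 4).
have hz : 2 * c0 + 5 <= z by rewrite leq_divRL // mulnC.
have nz : c0 * z <= n by rewrite mulnC leq_trunc_div.
have nq : n < c0 * q by rewrite mulnC ltn_ceil.
have z0 : 0 < z by apply: leq_trans hz; rewrite addnS.
have nz2 : n <= 2 * (c0 * z) by apply: double_floor.
have hDl x : #|[set e in X | x \in e]| <= Dl.
  rewrite leq_divRL ?addn_gt0 ?orbT //; have := hX x.
  move: #|[set e in X | x \in e]| => y hy.
  have h1 : y * (c0 + 4) * (8 * c0) <= z * (8 * c0).
    have -> : y * (c0 + 4) * (8 * c0) = y * (8 * c0 * (c0 + 4)) by ring.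
    apply: leq_trans hy _; have -> : z * (8 * c0) = 4 * (2 * (c0 * z)) by ring.
    by rewrite leq_mul2l.
  by rewrite leq_pmul2r ?muln_gt0 // in h1.
have Dlz : Dl * (c0 + 4) <= z by apply: leq_trunc_div.
have Dz : Dl <= z by apply: leq_div.
have n0 : 0 < n by apply: leq_trans hn; rewrite muln_gt0 c00 addnS.
have sz : size (enum G) = n by rewrite -cardE.
pose rk (u : G) := index u (enum G).
have rk_lt u : rk u < n by rewrite -sz index_mem mem_enum.
pose at_ u i := nth u (enum G) i.
have rk_at u i : i < n -> rk (at_ u i) = i by move=> hi; rewrite /rk index_uniq ?sz ?enum_uniq.
have rk_inj : injective rk by move=> u v /(congr1 (at_ u)); rewrite /at_ !nth_index ?mem_enum.
have [u0 _] := card_gt0P n0.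
pose par i := if i < q then i.-1 else i %% q.
have qn : q <= n.
  apply: leq_trans nz; apply: leq_trans (_ : 2 * z <= _); first by rewrite /q mul2n -addnn -addn1 leq_add2l.
  by rewrite leq_mul2r c02 orbT.
have par_lt i : par i < q.
  rewrite /par; case: ifP => [|_]; last by rewrite ltn_mod.
  by apply: leq_ltn_trans; apply: leq_pred.
pose pi u := at_ u (par (rk u)).
have rk_pi u : rk (pi u) = par (rk u) by rewrite /pi rk_at // (leq_trans (par_lt _) qn).
pose W := [set u | rk u < q].
have cW : #|W| <= q.
  rewrite -(size_iota 0 q); apply: (@card_le_seq _ _ rk) => [u v _ _|u]; first exact: rk_inj.
  by rewrite inE mem_iota.
have XG : X \subset edges G by apply/subsetP=> e; rewrite inE => /andP[].
have cX : #|X| <= n * Dl by apply: card_edges_le.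
(* Fibres of [pi] have at most [c0 + 3] elements since [n < c0 * q]. The load is below [40 * z]. The
   number of relations is at most [2 + 1 + 4 = 7] times [z * z], for the edges of [X], the vertices
   and the pairs of [W]. *)
have [|||||||||||A [AG dA mA hA]] := hc G (rem (@adj G) X) X pi (at_ u0 0) rk W Dl (c0 + 3) (40 * z) z (7 * c * z).
- exact: z0.
- apply: (@robust_of_common _ _ _ Dl _ _ _ (n %/ 3 + (n %% 3 != 0))) => //.
  + move=> S hS; have := hcom S hS; have := divn_eq n 3; have := ltn_pmod n (isT : 0 < 3).
    move: (n %/ 3) (n %% 3) #|common S| => y w v; case: w => [|[|[|w]]] //= _; lia.
  + have h3 : n <= 3 * (n %/ 3 + (n %% 3 != 0)).
      have := divn_eq n 3; have := ltn_pmod n (isT : 0 < 3).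
      by move: (n %/ 3) (n %% 3) => y w; case: w => [|[|[|w]]] //= _; lia.
    have h1 : c0 * z = 3 * (D * z + 41 * (D * (c * z)) + 8 * (c * z) + z) + N * c1 * z by rewrite /c0 /c1; ring.
    have h2 : D * (Dl + c * (40 * z + z)) <= D * z + 41 * (D * (c * z)).
      have -> : D * z + 41 * (D * (c * z)) = D * (z + c * (40 * z + z)) by ring.
      by rewrite leq_mul2l leq_add2r Dz orbT.
    have h4 : c <= c * z by rewrite leq_pmulr.
    have h5 : 7 * c * z = 7 * (c * z) by rewrite mulnA.
    move: (leq_trans nz h3); rewrite h1 h5; move: h2 h4 z0.
    by move: (D * (Dl + _)) (D * z) (D * (c * z)) (c * z) (N * c1 * z) (n %/ 3 + _); clear; lia.
- have h1 : #|X| <= 2 * (z * z).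
    apply: leq_trans cX _; apply: leq_trans (_ : 2 * (c0 * z) * Dl <= _); first by rewrite leq_mul2r nz2 orbT.
    have -> : 2 * (c0 * z) * Dl = 2 * (z * (Dl * c0)) by ring.
    rewrite !leq_mul2l; apply/orP; right; apply/orP; right.
    by apply: leq_trans Dlz; rewrite leq_mul2l leq_addr orbT.
  have h2 : n <= z * z.
    by apply: leq_trans nz2 _; rewrite mulnA leq_mul2r (leq_trans _ hz) ?orbT // leq_addr.
  have h3 : #|W| ^ 2 <= 4 * (z * z).
    apply: leq_trans (_ : (2 * z) ^ 2 <= _); last by rewrite expnMn mulnn.
    by rewrite leq_sqr (leq_trans cW) // /q mul2n -addnn -addn1 leq_add2l.
  have -> : 7 * c * z * z = c * (7 * (z * z)) by ring.
  by rewrite leq_mul2l; apply/orP; right; move: h1 h2 h3; move: #|X| (#|W| ^ 2) (z * z); clear; lia.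
- exact: XG.
- exact: hDl.
- move=> x; apply: leq_trans (_ : size [:: rk x, (rk x).+1 & [seq i * q + rk x | i <- iota 0 c0]] <= _).
    apply: (@card_le_seq _ _ rk) => [u v _ _|u]; first exact: rk_inj.
    rewrite inE => /eqP/(congr1 rk); rewrite rk_pi /par !in_cons; case: ifP => [_ <-|_ <-].
      by case: (rk u) => [|i] //=; rewrite eqxx ?orbT.
    apply/orP; right; apply/orP; right; apply/mapP; exists (rk u %/ q); last exact: divn_eq.
    by rewrite mem_iota ltn_divLR // (ltn_trans (rk_lt u)).
  by rewrite /= size_map size_iota addn3.
- move=> x; apply: leq_trans (_ : size [:: rk x; (rk x).+1] <= _) => //.
  apply: (@card_le_seq _ _ rk) => [u v _ _|u]; first exact: rk_inj.
  rewrite !inE => /andP[uq] /eqP/(congr1 rk); rewrite rk_pi /par uq => <-.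
  by case: (rk u) => [|i] //=; rewrite eqxx ?orbT.
- have h1 : (1 + (c0 + 3)) * Dl = Dl * (c0 + 4) by ring.
  rewrite h1; move: Dlz cW hz; rewrite /q; move: (Dl * _) #|W|; clear; lia.
- by apply: rk_inj; rewrite rk_pi rk_at //.
- move=> u ut; rewrite rk_pi /par.
  have ru : 0 < rk u by rewrite lt0n; apply: contra ut => /eqP h; apply/eqP/rk_inj; rewrite h rk_at.
  case: ifP => [_|/negbT]; first by rewrite ltn_predL.
  by rewrite -leqNgt; apply: leq_trans; rewrite ltn_mod.
- by move=> u; rewrite inE rk_pi.
exists A; split=> //.
  apply/subsetP=> e /(subsetP AG) /redgesP[x [y [/andP[xy nX] ->]]].
  by rewrite in_setD nX edges_pair.
move=> x; apply: leq_trans (_ : (c1 * z) * N <= _); last first.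
  by apply: leq_trans nz; rewrite mulnC mulnA /c0 mulnDl leq_addl.
rewrite leq_mul2r; apply/orP; right.
apply: leq_trans (_ : #|[set e in X | x \in e]| + #|[set e in A | x \in e]| <= _).
  apply: leq_trans (leq_card_setU _ _); apply/subset_leq_card/subsetP=> e; rewrite !inE.
  by case/andP=> /orP[]h ->; rewrite ?h ?orbT ?andbT //; move: h => /andP[-> ->].
have -> : c1 * z = z + c * (40 * z + z) by rewrite /c1; ring.
by apply: leq_add; [apply: leq_trans (hDl x) Dz|exact: dA].
Qed.

(** Instantiates [cover_leftover] with loads linear in [n]: every label class meets every common
    neighbourhood in a fixed proportion of the vertices, so a sufficiently sparse leftover can be
    covered greedily. *)
Lemma reserve_cover (F : sgraph) (D t : nat) (a b : F) : 2 * #|F| <= D -> adj a b -> 0 < t ->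
  exists M n0, 0 < M /\ forall (G : sgraph) (lab : G -> 'I_t * 'I_t) (L0 : {set {set G}}), n0 <= #|G| ->
  (forall z (S : {set G}), #|S| <= D -> #|G| <= 6 * t ^ 2 * #|[set y in common S | lab y == z]|) ->
  L0 \subset edges G :\: reserve lab -> (forall x, #|[set e in L0 | x \in e]| * M <= #|G|) ->
  exists C : {set {set G}}, C \subset reserve lab /\ mdec F (fun e => ind L0 e + ind C e).
Proof.
move=> hD ab t0; pose c := num_edges F + #|F|; pose T := 6 * t ^ 2.
have c0 : 0 < c by rewrite /c addn_gt0; apply/orP; right; apply/card_gt0P; exists a.
have T0 : 0 < T by rewrite muln_gt0 expn_gt0 t0.
have [c2 c2E] : exists c2, c2 = T * (2 * D * c + 3) by exists (T * (2 * D * c + 3)).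
(* Quadratic in [c2], so that the at most [n * l] leftover edges satisfy [c * (n * l) <= z * z] with
   [z = n %/ c2]. *)
pose M := 4 * c2 ^ 2 * c.
have c20 : 0 < c2 by rewrite c2E muln_gt0 T0 addnS.
have M0 : 0 < M by rewrite /M !muln_gt0 c20 c0.
exists M, (c2 * (#|F| + 2)); split=> // G lab L0 hn hlab hL0 hdL.
set n := #|G| in hn hlab hdL *; pose z := n %/ c2; pose s0 := n %/ T; pose l := n %/ M.
have hz : #|F| + 2 <= z by rewrite leq_divRL // mulnC.
have nz : c2 * z <= n by rewrite mulnC leq_trunc_div.
have nz1 : n < c2 * z.+1 by rewrite mulnC ltn_ceil.
have ns : n < T * s0.+1 by rewrite mulnC ltn_ceil.
have lM : l * M <= n by apply: leq_trunc_div.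
have hl x : #|[set e in L0 | x \in e]| <= l by rewrite leq_divRL.
have z0 : 0 < z by apply: leq_trans hz; rewrite addnS.
have nz2 : n <= 2 * (c2 * z) by apply: double_floor.
have lz : l <= z.
  suff h : 2 * c2 * l <= 2 * c2 * z by rewrite leq_pmul2l ?muln_gt0 in h.
  apply: leq_trans (_ : l * M <= _); last by apply: leq_trans lM _; rewrite -mulnA.
  have -> : l * M = 2 * c2 * l * (2 * c2 * c) by rewrite /M; ring.
  by rewrite leq_pmulr // !muln_gt0 c20.
have hs z' (B : {set G}) : #|B| <= D -> s0 <= #|[set y in common B | lab y == z']|.
  move=> hB; rewrite -ltnS ltn_divLR // (leq_ltn_trans (hlab z' B hB)) // -/T mulSn mulnC.
  by rewrite -[X in X < _]add0n ltn_add2r.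
apply: (cover_leftover hD ab (th := z) (o := z) _ hL0 hl hs) => //.
- have h1 : (2 * (D * c) + 3) * z <= s0.
    rewrite -ltnS -(ltn_pmul2l T0); apply: leq_ltn_trans ns; apply: leq_trans nz.
    by rewrite leq_eqVlt; apply/orP; left; apply/eqP; rewrite c2E; ring.
  have h2 : D * (c * (l + z)) <= 2 * (D * c * z).
    have -> : 2 * (D * c * z) = D * (c * (z + z)) by ring.
    by rewrite leq_mul2l leq_mul2l leq_add2r lz !orbT.
  move: h1; have -> : (2 * (D * c) + 3) * z = 2 * (D * c * z) + 3 * z by ring.
  have ar x y s w v : 0 < v -> x <= 2 * y -> w + 2 <= v -> 2 * y + 3 * v <= s -> x + v + (w + 2) < s by clear; lia.
  by apply: ar.
- have cL : #|L0| <= n * l.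
    apply: card_edges_le => //; apply: subset_trans hL0 _; exact: subsetDl.
  have q0 : 0 < 4 * c2 ^ 2 by rewrite !muln_gt0 c20.
  rewrite -/c -(leq_pmul2l q0); apply: leq_trans (_ : n * (l * M) <= _).
    have -> : n * (l * M) = 4 * c2 ^ 2 * (c * (n * l)) by rewrite /M; ring.
    by rewrite !leq_mul2l cL !orbT.
  apply: leq_trans (_ : (2 * (c2 * z)) * (2 * (c2 * z)) <= _).
    by apply: leq_mul => //; apply: leq_trans lM nz2.
  by rewrite leq_eqVlt; apply/orP; left; apply/eqP; ring.
Qed.

(** * Concentration *)

From mathcomp Require Import all_fingroup all_classical all_reals all_analysis.
Import Order.TTheory GRing.Theory Num.Theory.

Section Chernoff.
Local Open Scope ring_scope.
Variable R : realType.
Implicit Types (c e rho : R).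

Lemma expRN_le (x : R) : 0 <= x -> expR (- x) <= 1 - x + x ^+ 2.
Proof.
move=> x0; rewrite expRN; apply: le_trans (_ : (1 + x)^-1 <= _).
  by rewrite lef_pV2 ?posrE ?expR_gt0 ?expR_ge1Dx //; lra.
rewrite -(ler_pM2r (_ : 0 < 1 + x)); last lra.
rewrite mulVf; last by apply/eqP; lra.
have : 0 <= x ^+ 3 by apply: exprn_ge0.
by rewrite !exprS expr0; nra.
Qed.

(** A lower tail bound stated as a count over a product family, so that coordinates can be fixed by
    shrinking [A i]. The weight [expR (- l)] for each hit, with [l = e / 2], factorises over the
    coordinates. *)
Lemma chernoff (I L : finType) (A : I -> pred L) (S : {set I}) (q : I -> pred L) rho e :
  0 < e -> rho <= 1 ->
  (forall i, i \in S -> rho * #|A i|%:R <= #|[pred y | A i y && q i y]|%:R) ->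
  \sum_(f in family A) ((\sum_(i in S) q i (f i))%N%:R <= (rho - e) * #|S|%:R :> R)%R%:R
    <= expR (- (e ^+ 2 / 4 * #|S|%:R)) * \prod_i #|A i|%:R :> R.
Proof.
move=> e0 r1 hq; pose l := e / 2.
have l0 : 0 <= l by rewrite /l; lra.
pose w i y := if i \in S then (if q i y then expR (- l) else 1) else 1.
have b1 := expRN_le l0; set b := expR (- l) in b1.
have bN : 0 <= b by apply: expR_ge0.
apply: le_trans (_ : \sum_(f in family A) expR (l * ((rho - e) * #|S|%:R)) * \prod_i w i (f i) <= _).
  apply: ler_sum => f _.
  have -> : \prod_i w i (f i) = expR (- (l * (\sum_(i in S) q i (f i))%N%:R)).
    rewrite natr_sum mulr_sumr -sumrN expR_sum [RHS]big_mkcond; apply: eq_bigr => i _.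
    by rewrite /w; case: (i \in S) => //; case: (q i (f i)); rewrite ?mulr1 ?mulr0 ?oppr0 ?expR0.
  rewrite -expRD; case: (boolP (((\sum_(i in S) q i (f i))%N%:R <= (rho - e) * #|S|%:R :> R)%R)) => [h|_]; last exact: expR_ge0.
  rewrite -[X in X <= _]expR0 ler_expR -mulrN -mulrDr; apply: mulr_ge0 => //; lra.
rewrite -mulr_sumr -(bigA_distr_big_dep A).
apply: le_trans (_ : expR (l * ((rho - e) * #|S|%:R)) * \prod_i (#|A i|%:R * (if i \in S then expR (- ((1 - b) * rho)) else 1)) <= _).
  rewrite ler_pM2l ?expR_gt0 //; apply: ler_prod => i _; apply/andP; split.
    apply: sumr_ge0 => y _; rewrite /w; case: (i \in S) => //; case: (q i y) => //.
  rewrite /w; case: (boolP (i \in S)) => iS; last by rewrite mulr1 sumr_const.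
  rewrite (bigID (q i)) /=.
  under eq_bigr => y /andP[_ ->] do [].
  under [X in _ + X]eq_bigr => y /andP[_ /negPf->] do [].
  rewrite !sumr_const.
  set N1 := #|_|; set N2 := #|_|; have EN : #|A i| = (N1 + N2)%N.
    rewrite -(cardID (q i) (A i)); congr (_ + _)%N; apply: eq_card => y; rewrite !inE //.
    by rewrite andbC.
  have h1 : rho * (N1 + N2)%:R <= N1%:R :> R.
    have := hq i iS; rewrite EN; congr (_ <= _); congr (_%:R); apply: eq_card => y; by rewrite !inE.
  have h2 := expR_ge1Dx (- ((1 - b) * rho)).
  have bl1 : b <= 1 by rewrite /b -[X in _ <= X]expR0 ler_expR; lra.
  rewrite natrD in h1; rewrite -[expR (- l) *+ N1]mulr_natr EN natrD -/b.
  move: (expR _) h2 => E h2.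
  have n1 : 0 <= N1%:R :> R by []. have n2 : 0 <= N2%:R :> R by [].
  move: (N1%:R : R) (N2%:R : R) n1 n2 h1 => x y x0 y0 h1.
  have h3 : (x + y) * (1 + - ((1 - b) * rho)) <= (x + y) * E by rewrite ler_wpM2l // addr_ge0.
  have h4 : (1 - b) * (rho * (x + y)) <= (1 - b) * x by rewrite ler_wpM2l // subr_ge0.
  by nra.
rewrite big_split /= -big_mkcond prodr_const /= mulrCA mulrC ler_wpM2r //; first by apply: prodr_ge0.
rewrite -expRM_natr -expRD ler_expR.
have s0 : 0 <= #|S|%:R :> R by [].
have -> : l * ((rho - e) * #|S|%:R) + - ((1 - b) * rho) * #|S|%:R = (l * (rho - e) - (1 - b) * rho) * #|S|%:R by ring.
rewrite -[X in _ <= X]mulNr ler_wpM2r //.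
case: (lerP 0 rho) => r0.
  have h : (l - l ^+ 2) * rho <= (1 - b) * rho by rewrite ler_wpM2r //; lra.
  have : l ^+ 2 * rho <= l ^+ 2 by rewrite ler_piMr // sqr_ge0.
  by rewrite /l in h *; move: h; rewrite !exprS expr0; nra.
have h : 0 <= (1 - b) by rewrite subr_ge0 /b -[X in _ <= X]expR0 ler_expR; lra.
have h' : (1 - b) <= l by have := expR_ge1Dx (- l); rewrite -/b; lra.
have : l * rho <= (1 - b) * rho by rewrite ler_wnM2r // ltW.
by rewrite /l !exprS expr0; nra.
Qed.

(** Union bound: the bad functions of all events together are fewer than all functions. *)
Lemma chernoff_union (I L E : finType) (S : E -> {set I}) (q : E -> I -> pred L) (rho : E -> R) e s :
  0 < e -> (0 < #|L|)%N -> (forall v, rho v <= 1) ->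
  (forall v i, i \in S v -> rho v * #|L|%:R <= #|[pred y | q v i y]|%:R) ->
  (forall v, s <= #|S v|%:R :> R) -> #|E|%:R * expR (- (e ^+ 2 / 4 * s)) < 1 ->
  exists f : {ffun I -> L}, forall v, (rho v - e) * #|S v|%:R < (\sum_(i in S v) q v i (f i))%N%:R.
Proof.
move=> e0 L0 r1 hq hs hE.
suff /existsP[f /forallP hf] : [exists f : {ffun I -> L}, [forall v, (rho v - e) * #|S v|%:R < (\sum_(i in S v) q v i (f i))%N%:R]].
  by exists f => v; apply: hf.
apply: contraLR hE; rewrite negb_exists => /forallP hf; rewrite -leNgt.
pose N : R := \prod_(i : I) #|L|%:R.
have N0 : 0 < N by apply: prodr_gt0 => i _; rewrite ltr0n.
rewrite -(ler_pM2r N0) mul1r.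
have EN : \sum_(f in family (fun _ : I => predT : pred L)) 1 = N.
  rewrite sumr_const card_family /N; rewrite foldrE big_map big_enum /= natr_prod.
  by apply: eq_bigr.
rewrite -{1}EN; apply: le_trans (_ : \sum_(f in family (fun _ : I => predT : pred L)) \sum_v ((\sum_(i in S v) q v i (f i))%N%:R <= (rho v - e) * #|S v|%:R :> R)%R%:R <= _).
  apply: ler_sum => f _; have := hf f; rewrite negb_forall => /existsP[v]; rewrite -leNgt => hv.
  by rewrite (bigD1 v) //= hv lerDl; apply: sumr_ge0.
rewrite exchange_big /=.
apply: le_trans (_ : \sum_(v : E) (expR (- (e ^+ 2 / 4 * s)) * N) <= _); last by rewrite sumr_const -[_ *+ #|_|]mulr_natl mulrA.
apply: ler_sum => v _.
apply: le_trans (chernoff (A := fun=> predT) (rho := rho v) e0 (r1 v) _) _.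
  by move=> i iS; apply: le_trans (hq v i iS) _; rewrite ler_nat; apply: subset_leq_card; apply/fintype.subsetP=> y; rewrite !inE.
rewrite ler_wpM2r //; first by apply: prodr_ge0.
by rewrite ler_expR lerN2 ler_wpM2l //; apply: divr_ge0 => //; apply: sqr_ge0.
Qed.

Lemma exp_beats_poly (K : nat) (d : nat) c : 0 < c ->
  exists n0 : nat, forall n, (n0 <= n)%N -> (K * n ^ d)%:R * expR (- (c * n%:R)) < 1.
Proof.
move=> c0; pose x := c / d.+1%:R; have x0 : 0 < x by apply: divr_gt0.
pose B := K%:R / x ^+ d.+1; exists (Num.trunc B).+1 => n hn.
have n0 : (0 < n)%N by apply: leq_trans hn.
have hB : B < n%:R.
  apply: lt_le_trans (_ : (Num.trunc B).+1%:R <= _); last by rewrite ler_nat.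
  exact: truncnS_gt.
rewrite expRN ltr_pdivrMr ?expR_gt0 // mul1r.
apply: lt_le_trans (_ : (x * n%:R) ^+ d.+1 <= _).
  have -> : (x * n%:R) ^+ d.+1 = n%:R * x ^+ d.+1 * n%:R ^+ d.
    by rewrite exprMn (exprSr (n%:R : R) d); move: (x ^+ d.+1) (n%:R ^+ d : R) => X Y; ring.
  rewrite natrM natrX ltr_pM2r ?exprn_gt0 ?ltr0n //.
  by move: hB; rewrite /B ltr_pdivrMr ?exprn_gt0.
have -> : c * n%:R = d.+1%:R * (x * n%:R) by rewrite /x; field; rewrite nat1r pnatr_eq0.
have xn : 0 <= x * n%:R by rewrite mulr_ge0 // ltW.
rewrite expRM_natl; apply: lerXn2r; rewrite ?nnegrE ?expR_ge0 //.
by apply: le_trans (expR_ge1Dx _); rewrite lerDr.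
Qed.

End Chernoff.

Local Close Scope ring_scope.

Lemma same_sym (T : eqType) (G : sgraph) (lab : G -> T * T) : symmetric (same lab).
Proof. by move=> x y; rewrite /same eq_sym [X in _ || X]eq_sym. Qed.

Lemma deg_reserve (T : eqType) (G : sgraph) (lab : G -> T * T) (x : G) :
  #|[set e in reserve lab | x \in e]| <= #|[set y | (lab y).1 == (lab x).1]| + #|[set y | (lab y).2 == (lab x).2]|.
Proof.
apply: leq_trans (_ : _ <= #|[set y | (lab y).1 == (lab x).1] :|: [set y | (lab y).2 == (lab x).2]|) _; last first.
  exact: leq_card_setU.
apply: leq_trans (leq_imset_card (fun y => [set x; y]) _).
apply/subset_leq_card/fintype.subsetP=> e; rewrite inE => /andP[]; rewrite inE => /andP[_].
move=> /existsP[u /existsP[v /andP[/eqP-> suv]]]; rewrite !inE => /orP[/eqP Ex|/eqP Ex].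
  by apply/imsetP; exists v; rewrite -?Ex // !inE; rewrite Ex; move: suv; rewrite same_sym.
by apply/imsetP; exists u; rewrite ?Ex; [rewrite !inE; move: suv|rewrite finset.setUC].
Qed.

(** A uniform labelling works: a label has expected share 1/t^2 of each common neighbourhood, and a
    row or a column share 1/t of all vertices. *)
Lemma partition_exists (R : realType) (D t : nat) : 0 < t ->
  exists n0, forall G : sgraph, n0 <= #|G| ->
    (forall S : {set G}, #|S| <= D -> #|G| <= 3 * #|common S|) ->
  exists lab : G -> 'I_t * 'I_t,
    (forall z (S : {set G}), #|S| <= D -> #|G| <= 6 * t ^ 2 * #|[set y in common S | lab y == z]|) /\
    (forall x, #|[set e in reserve lab | x \in e]| * t <= 4 * #|G|).
Proof.
move=> t0; have t0R : (0 < t%:R :> R)%R by rewrite ltr0n.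
(* Half of the expected share of a label, so that half of it survives. *)
pose e : R := (1 / (2 * t%:R ^+ 2))%R.
have e0 : (0 < e)%R by apply: divr_gt0 => //; apply: mulr_gt0 => //; apply: exprn_gt0.
have c0 : (0 < e ^+ 2 / 12)%R by apply: divr_gt0 => //; apply: exprn_gt0.
have [n1 hn1] := exp_beats_poly (t ^ 2 + 2 * t) D c0.
exists n1.+1 => G hn hS; have n0 : 0 < #|G| by apply: leq_trans hn.
(* Events: a tuple of [D] vertices with a label, which covers all sets of at most [D] vertices, and
   the rows and columns of labels. *)
pose E := ({ffun 'I_D -> G} * ('I_t * 'I_t) + ('I_t + 'I_t))%type.
pose S (v : E) : {set G} := if v is inl p then common [set p.1 i | i : 'I_D] else [set: G].
(* Only the lower tail is available, so a row is bounded from above by counting the vertices outside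
   it. *)
pose q (v : E) (y : G) (z : 'I_t * 'I_t) : bool := match v with
  | inl p => z == p.2 | inr (inl r) => z.1 != r | inr (inr r) => z.2 != r end.
pose rho (v : E) : R := (if v is inl p then 1 / t%:R ^+ 2 else 1 - 1 / t%:R)%R.
have cL : #|{: 'I_t * 'I_t}| = t ^ 2 by rewrite card_prod card_ord mulnn.
have t1 : (1 <= t%:R :> R)%R by rewrite ler1n.
have [|||v||f hf] := @chernoff_union R G ('I_t * 'I_t)%type E S q rho e (#|G|%:R / 3)%R e0.
- by rewrite cL expn_gt0 t0.
- case=> [p|w]; rewrite /rho; last by rewrite gerBl divr_ge0 // ltW.
  by rewrite ler_pdivrMr ?exprn_gt0 // mul1r -[X in (X <= _)%R](expr1n _ 2) lerXn2r // ?nnegrE ltW.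
- move=> v y _; rewrite cL natrX; case: v => [p|[r|r]]; rewrite /rho /q.
  + rewrite mul1r mulVf ?expf_neq0 ?gt_eqF // ler1n; apply/card_gt0P; exists p.2; by rewrite inE.
  + have -> : #|[pred z : 'I_t * 'I_t | z.1 != r]| = (t.-1 * t)%N.
      rewrite (eq_card (B := mem (finset.setX [set~ r] [set: 'I_t]))); last by move=> z; rewrite !inE andbT.
      by rewrite cardsX cardsC1 cardsT card_ord.
    rewrite -subn1 natrM natrB // le_eqVlt; apply/orP; left; apply/eqP; field; by rewrite gt_eqF.
  + have -> : #|[pred z : 'I_t * 'I_t | z.2 != r]| = (t * t.-1)%N.
      rewrite (eq_card (B := mem (finset.setX [set: 'I_t] [set~ r]))); last by move=> z; rewrite !inE.
      by rewrite cardsX cardsC1 cardsT card_ord.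
    rewrite -subn1 natrM natrB // le_eqVlt; apply/orP; left; apply/eqP; field; by rewrite gt_eqF.
- rewrite /S ler_pdivrMr // -natrM ler_nat mulnC; case: v => [p|w]; last by rewrite cardsT leq_pmull.
  by apply: hS; apply: leq_trans (leq_imset_card _ _) _; rewrite card_ord.
- apply: le_lt_trans (hn1 #|G| (ltnW hn)).
  have -> : (e ^+ 2 / 4 * (#|G|%:R / 3) = e ^+ 2 / 12 * #|G|%:R)%R by field.
  rewrite ler_wpM2r ?expR_ge0 // ler_nat !card_sum !card_prod card_ffun !card_ord.
  have h1 : 1 <= #|G| ^ D by rewrite expn_gt0 n0.
  rewrite mulnDl -mulnn [#|G| ^ D * _]mulnC leq_add2l addnn -mul2n -[X in X <= _]muln1.
  by rewrite leq_mul2l h1 orbT.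
exists f; split=> [z B hB|x].
- have /card_gt0P[y0 _] := n0.
  pose phi := [ffun i : 'I_D => nth y0 (enum B) i].
  have := hf (inl (phi, z)); rewrite /S /q /rho /=.
  set N := common _; have cN : #|G| <= 3 * #|N|.
    by apply: hS; apply: leq_trans (leq_imset_card _ _) _; rewrite card_ord.
  have NB : N \subset common B.
    apply/fintype.subsetP=> y yN; rewrite inE; apply/forallP=> b; apply/implyP=> bB; apply: (commonP yN).
    have hi : index b (enum B) < D by apply: leq_trans hB; rewrite cardE index_mem mem_enum.
    by apply/imsetP; exists (Ordinal hi); rewrite // ffunE /= nth_index ?mem_enum.
  have hc : \sum_(i in N) (f i == z) <= #|[set y in common B | f y == z]|.
    rewrite -sum1dep_card big_mkcond [X in _ <= X]big_mkcond /=; apply: leq_sum => y _.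
    case: (boolP (y \in N)) => // /(fintype.subsetP NB)->; by case: (_ == _).
  move=> h; rewrite -(ler_nat R) !natrM.
  have h2 : (#|G|%:R <= 3 * #|N|%:R :> R)%R by rewrite -natrM ler_nat.
  have h3 : ((\sum_(i in N) (f i == z))%N%:R <= #|[set y in common B | f y == z]|%:R :> R)%R by rewrite ler_nat.
  have h4 := lt_le_trans h h3.
  have h5 : (#|N|%:R < 2 * t%:R ^+ 2 * #|[set y in common B | f y == z]|%:R :> R)%R.
    rewrite -(ltr_pM2l e0); have -> : (e * #|N|%:R = (1 / t%:R ^+ 2 - e) * #|N|%:R)%R.
      by rewrite /e; field; rewrite gt_eqF.
    apply: lt_le_trans h4 _; rewrite mulrA /e le_eqVlt; apply/orP; left; apply/eqP.
    by field; rewrite gt_eqF.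
  rewrite -expr2; apply: le_trans h2 _; move: h5; move: (#|N|%:R)%R (#|[set y in _ | _]|%:R)%R (t%:R ^+ 2)%R => x y c; lra.
- have row r (pr : 'I_t * 'I_t -> 'I_t) : (pr = fst \/ pr = snd) -> #|[set y | pr (f y) == r]| * t <= 2 * #|G|.
    move=> hpr.
    have h : ((1 - 1 / t%:R - e) * #|G|%:R < (\sum_(i : G) (pr (f i) != r))%N%:R)%R.
      have E1 := hf (inr (inl r)); have E2 := hf (inr (inr r)); move: E1 E2.
      have SE (c : G -> nat) : \sum_(i in [set: G]) c i = \sum_i c i by apply: eq_bigl => i; rewrite inE.
      by rewrite /S /q /rho /= cardsT !SE; case: hpr => -> h1 h2; [exact: h1|exact: h2].
    have h2 : #|[set y | pr (f y) == r]| + \sum_(i : G) (pr (f i) != r) = #|G|.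
      rewrite -sum1dep_card big_mkcond -big_split /= -sum1_card; apply: eq_bigr => y _.
      by case: (_ == _).
    rewrite -(ler_nat R) !natrM.
    have h3 : (#|[set y | pr (f y) == r]|%:R + (\sum_(i : G) (pr (f i) != r))%N%:R = #|G|%:R :> R)%R by rewrite -natrD h2.
    move: h h3; move: (_%:R : R)%R => a; move: (_%:R : R)%R => b h h3.
    have h4 : (a < (1 / t%:R + e) * #|G|%:R)%R by lra.
    have h5 : (1 / t%:R + e <= 2 / t%:R)%R.
      have -> : (2 / t%:R = 1 / t%:R + 1 / t%:R :> R)%R by field; rewrite gt_eqF.
      rewrite lerD2l /e !div1r lef_pV2 ?posrE ?mulr_gt0 ?exprn_gt0 //; nra.
    apply: le_trans (_ : (2 / t%:R * #|G|%:R) * t%:R <= _)%R.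
      rewrite ler_pM2r //; apply: le_trans (ltW h4) _; by rewrite ler_wpM2r.
    by rewrite le_eqVlt; apply/orP; left; apply/eqP; field; rewrite gt_eqF.
  apply: leq_trans (_ : (#|[set y | (f y).1 == (f x).1]| + #|[set y | (f y).2 == (f x).2]|) * t <= _).
    by rewrite leq_mul2r deg_reserve orbT.
  rewrite mulnDl -[4]/(2 + 2) mulnDl; apply: leq_add; [exact: (row _ fst (or_introl erefl))|exact: (row _ snd (or_intror erefl))].
Qed.

(** * A random greedy packing *)

Local Open Scope ring_scope.

Section NibbleStep.
Variable R : realType.

Lemma expR_le_quad (y : R) : `|y| <= 1 / 2 -> expR y <= 1 + y + 2 * y ^+ 2.
Proof.
rewrite ler_norml => /andP[h1 h2]; case: (lerP 0 y) => y0; last first.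
  have := expRN_le (_ : 0 <= - y); rewrite opprK sqrrN => /(_ ltac:(lra)) h.
  by apply: le_trans h _; have := sqr_ge0 y; lra.
have h := expR_ge1Dx (- y).
have e0 : 0 < expR (- y) by apply: expR_gt0.
rewrite -[y in expR y]opprK expRN; apply: le_trans (_ : (1 - y)^-1 <= _).
  by rewrite lef_pV2 // ?posrE //; lra.
rewrite -(ler_pM2r (_ : 0 < 1 - y)); last lra.
rewrite mulVf; last by apply/eqP; lra.
by rewrite !exprS expr0; nra.
Qed.

(** A small variable with nonpositive mean has exponential moment at most 1 plus twice a bound on
    its second moment. *)
Lemma mean_exp_le (I : finType) (pr y : I -> R) V :
  (forall i, 0 <= pr i) -> \sum_i pr i = 1 -> (forall i, 0 < pr i -> `|y i| <= 1 / 2) ->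
  \sum_i pr i * y i <= 0 -> \sum_i pr i * y i ^+ 2 <= V ->
  \sum_i pr i * expR (y i) <= 1 + 2 * V.
Proof.
move=> p0 p1 hy h1 h2; apply: le_trans (_ : \sum_i pr i * (1 + y i + 2 * y i ^+ 2) <= _).
  apply: ler_sum => i _; have := p0 i; rewrite le_eqVlt => /orP[/eqP<-|pi]; first by rewrite !mul0r.
  by rewrite ler_pM2l //; apply: expR_le_quad; apply: hy.
have -> : \sum_i pr i * (1 + y i + 2 * y i ^+ 2) = \sum_i pr i + \sum_i pr i * y i + 2 * \sum_i pr i * y i ^+ 2.
  by rewrite mulr_sumr -!big_split; apply: eq_bigr => i _ /=; ring.
rewrite p1; lra.
Qed.

(** [s] is the factor by which the normalisation of a test of order [a] changes when the density
    drops from [p] to [p * (1 - u)]. *)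
Lemma inv_pow_bounds (u : R) (a : nat) : 0 <= u -> a%:R * u <= 1 / 2 -> u <= 1 / 2 ->
  let s := ((1 - u) ^+ a)^-1 in let v := a%:R * u in
  [/\ 1 + v <= s, s * (1 - v) <= 1, s <= 1 + 2 * v & s <= 2].
Proof.
move=> u0 hau hu s v.
have b1 : 1 - v <= (1 - u) ^+ a.
  rewrite /v; elim: (a) => [|n IH]; first by rewrite mul0r expr0; lra.
  rewrite exprS -natr1 mulrDl mul1r.
  have h : (1 - n%:R * u) * (1 - u) <= (1 - u) * (1 - u) ^+ n by rewrite mulrC ler_wpM2l //; lra.
  have h0 : 0 <= n%:R * u * u by rewrite !mulr_ge0.
  by move: h h0; move: ((1 - u) ^+ n) (n%:R) => z y; nra.
have v0 : 0 <= v by rewrite mulr_ge0.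
have b2 : (1 + v) * (1 - u) ^+ a <= 1.
  rewrite /v; elim: (a) => [|n IH]; first by rewrite mul0r expr0; lra.
  rewrite exprS -natr1 (mulrDl n%:R 1 u) mul1r.
  have h0 : 0 <= (1 - u) ^+ n by apply: exprn_ge0; lra.
  have h : (1 + (n%:R * u + u)) * (1 - u) <= 1 + n%:R * u.
    have h1 : 0 <= n%:R * u * u by rewrite !mulr_ge0.
    by move: h1; move: (n%:R) => y; nra.
  rewrite mulrA; apply: le_trans IH; exact: ler_wpM2r.
have z0 : 0 < (1 - u) ^+ a by apply: exprn_gt0; lra.
have s0 : 0 < s by rewrite invr_gt0.
have sz : s * (1 - u) ^+ a = 1 by rewrite mulVf // gt_eqF.
move: (_ ^+ a) b1 b2 z0 sz => z b1 b2 z0 sz.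
have c1 : 1 + v <= s by rewrite -[s]mul1r -[1 + v]mulr1 -{1}sz; nra.
have c2 : s * (1 - v) <= 1 by have : s * (1 - v) <= s * z by [rewrite ler_pM2l]; rewrite sz.
have hv : v <= 1 / 2 by [].
have c3 : s <= 1 + 2 * v.
  rewrite -(ler_pM2r (_ : 0 < 1 - v)); last lra.
  by apply: le_trans c2 _; move: v0 hv; clear; nra.
by split=> //; lra.
Qed.

(** When a copy is removed, the normalised test [X] changes by [(s - 1) * X] through renormalisation
    and by [- s * m] through the mean loss. The two cancel to first order, up to the relative error
    of the loss. *)
Lemma drift_up (v b c s X m : R) : 0 <= v -> 0 <= b -> 0 <= c -> 0 <= X -> X <= 2 -> 0 <= s ->
  s <= 2 -> s * (1 - v) <= 1 -> X * (v * (1 - 2 * b - c)) <= m ->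
  (s - 1) * X - s * m <= 4 * v * (2 * b + c).
Proof.
move=> v0 b0 c0 X0 X2 s0 s2 sv hm.
have h1 : s * (X * (v * (1 - 2 * b - c))) <= s * m by rewrite ler_wpM2l.
have h2 : X * (s * (1 - v) - 1) <= 0 by rewrite mulr_ge0_le0 // subr_le0.
have w0 : 0 <= v * (2 * b + c) by rewrite mulr_ge0 // addr_ge0 // mulr_ge0.
have h3 : X * s * (v * (2 * b + c)) <= 4 * (v * (2 * b + c)).
  by rewrite ler_wpM2r //; nra.
nra.
Qed.

(** The same cancellation in the other direction, where the second order of the renormalisation also
    counts. *)
Lemma drift_low (v b s X m : R) : 0 <= v -> v <= 1 -> 0 <= b -> 0 <= X -> X <= 2 ->
  1 + v <= s -> s <= 2 -> m <= X * (v * (1 + 3 * b)) ->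
  - ((s - 1) * X - s * m) <= 2 * v ^+ 2 + 12 * v * b.
Proof.
move=> v0 v1 b0 X0 X2 s1 s2 hm.
have s0 : 0 <= s by lra.
have h1 : s * m <= s * (X * (v * (1 + 3 * b))) by rewrite ler_wpM2l.
have h2 : (1 + v) * (1 - v) <= s * (1 - v) by rewrite ler_wpM2r // subr_ge0.
have h3 : X * (1 - s * (1 - v)) <= X * v ^+ 2 by rewrite ler_wpM2l //; lra.
have h4 : X * v ^+ 2 <= 2 * v ^+ 2 by rewrite ler_wpM2r // sqr_ge0.
have w0 : 0 <= v * b by rewrite mulr_ge0.
have h5 : X * s * (v * b) <= 4 * (v * b) by rewrite ler_wpM2r //; nra.
nra.
Qed.
End NibbleStep.

Section Scalars.
Variable R : realType.

Lemma deviation_le (sg s v z X l lg dd : R) : `|sg| = 1 -> 0 <= v -> 1 + v <= s -> s <= 1 + 2 * v ->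
  s <= 2 -> v <= z -> 0 <= X -> X <= 4 / 3 -> 0 <= l -> l <= lg -> 0 <= dd -> dd <= 5 * z ->
  `|sg * ((s - 1) * X - s * l) - dd| <= 9 * z + 2 * lg.
Proof.
move=> hsg v0 s1 s3 s4 vz X0 X2 l0 llg dd0 dd5.
have h0 := ler_normB (sg * ((s - 1) * X - s * l)) dd; rewrite normrM hsg mul1r (ger0_norm dd0) in h0.
have h1 : 0 <= (s - 1) * X by rewrite mulr_ge0 //; lra.
have h2 : (s - 1) * X <= 2 * v * 2 by apply: ler_pM => //; lra.
have h3 : 0 <= s * l by rewrite mulr_ge0 //; lra.
have h4 : s * l <= 2 * lg by apply: ler_pM => //; lra.
have h6 : `|(s - 1) * X - s * l| <= 4 * z + 2 * lg by rewrite ler_norml; apply/andP; split; lra.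
lra.
Qed.

Lemma mean_bound (v z b X P : R) : 0 <= v -> v <= z -> 0 <= b -> b <= 1 / 3 -> 0 <= X -> X <= 4 / 3 ->
  0 <= P -> P <= 1 -> X * P * (v * (1 + 3 * b)) <= 4 * z.
Proof.
move=> v0 vz b0 b1 X0 X2 P0 P1.
have h1 : v * (1 + 3 * b) <= z * 2 by apply: ler_pM => //; lra.
have h0 : 0 <= v * (1 + 3 * b) by rewrite mulr_ge0 //; lra.
have h2 : X * P <= 4 / 3 * 1 by apply: ler_pM.
apply: le_trans (_ : 4 / 3 * 1 * (z * 2) <= _); last lra.
by apply: ler_pM => //; rewrite mulr_ge0.
Qed.
End Scalars.

Section Hypergraph.
Variables (R : realType) (E : finType).

Definition deg_in (w : {set E} -> R) (A : {set E}) (e : E) := \sum_(K : {set E} | (K \subset A) && (e \in K)) w K.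
(** A test: the weight of the sets that are still entirely uncovered. For sets of size [a] it should
    behave like its initial value times the [a]-th power of the density. *)
Definition inside (om : {set E} -> R) (A : {set E}) := \sum_(S : {set E} | S \subset A) om S.

(** State of the packing: [A] is the uncovered set, [p] its density relative to [N], [b] the current
    relative error, [eta] the codegree bound, and [g] a lower bound for the powers of [p] up to
    [k]. *)
Variables (k : nat) (w : {set E} -> R) (A : {set E}) (b eta p g kap N : R).
Hypothesis k0 : (0 < k)%N.
Hypothesis w0 : forall K, 0 <= w K.
Hypothesis wk : forall K, w K != 0 -> #|K| = k.
Hypothesis codeg : forall e e', e != e' -> \sum_(K : {set E} | (e \in K) && (e' \in K)) w K <= eta.
Hypothesis M0 : (0 < #|A|)%N.
Hypothesis g0 : 0 < g.
Hypothesis g1 : g <= 1.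
Hypothesis gp : forall a, (a <= k)%N -> g <= p ^+ a.
Hypothesis p1 : p <= 1.
Hypothesis b0 : 0 < b.
Hypothesis b1 : b <= 1 / 3.
Hypothesis eta0 : 0 < eta.
Hypothesis N0 : 0 < N.
Hypothesis Neta : N^-1 <= eta.
Hypothesis kapE : kap = k%:R ^+ 2 / g.
Hypothesis heta : 2 * kap * eta <= b.
Hypothesis pA : #|A|%:R = p * N.
Hypothesis degA : forall e, e \in A -> `|deg_in w A e / p ^+ k.-1 - 1| <= b.
Let u := k%:R / #|A|%:R : R.
Let Dt := \sum_(K : {set E} | K \subset A) w K.
Let P1 := p ^+ k.-1.
(** The next hyperedge is drawn among those inside [A], proportionally to its weight. *)
Definition pick_prob (K : {set E}) := if K \subset A then w K / Dt else 0.
Local Notation pr := pick_prob.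

Let M0R : 0 < #|A|%:R :> R. Proof. by rewrite ltr0n. Qed.
Let p0 : 0 < p.
Proof. by have := M0R; rewrite pA pmulr_lgt0. Qed.
Let kR : 1 <= k%:R :> R. Proof. by rewrite ler1n. Qed.
Let P10 : 0 < P1. Proof. by apply: exprn_gt0. Qed.
Let P1g : g <= P1. Proof. by apply: gp; rewrite leq_pred. Qed.

Let degb e : e \in A -> P1 * (1 - b) <= deg_in w A e <= P1 * (1 + b).
Proof.
move=> /degA; rewrite ler_norml => /andP[h1 h2]; apply/andP; split.
  rewrite mulrC -ler_pdivlMr //; move: h1; rewrite -/P1; lra.
by rewrite mulrC -ler_pdivrMr //; move: h2; rewrite -/P1; lra.
Qed.

Let DtE : k%:R * Dt = \sum_(e in A) deg_in w A e.
Proof.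
rewrite /deg_in (exchange_big_dep (fun K : {set E} => K \subset A)) /=; last by move=> e K _ /andP[].
rewrite mulr_sumr; apply: eq_bigr => K KA.
have [->|nw] := eqVneq (w K) 0; first by rewrite mulr0 big1.
rewrite (eq_bigl (mem K)) => [|e]; first by rewrite sumr_const (wk nw) mulr_natl.
by rewrite KA /=; apply/andP/idP => [[]//|eK]; rewrite eK (fintype.subsetP KA).
Qed.

Let Dtb : #|A|%:R * (P1 * (1 - b)) <= k%:R * Dt <= #|A|%:R * (P1 * (1 + b)).
Proof.
rewrite DtE !mulr_natl -!sumr_const; apply/andP; split; apply: ler_sum => e eA;
  by have /andP[] := degb eA.
Qed.

Let Dt0 : 0 < Dt.
Proof.
have /andP[h _] := Dtb; rewrite -(pmulr_rgt0 _ (_ : 0 < k%:R)) ?ltr0n //.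
have hb1 := b1; have b2 : 0 < 1 - b by lra.
by apply: lt_le_trans h; apply: mulr_gt0 => //; apply: mulr_gt0.
Qed.

Lemma pick_prob_ge0 K : 0 <= pr K.
Proof. by rewrite /pr; case: ifP => // _; rewrite divr_ge0 // ltW. Qed.

Lemma pick_prob_sum : \sum_K pr K = 1.
Proof. by rewrite -big_mkcond /= -mulr_suml mulfV // gt_eqF. Qed.

Let u0 : 0 < u. Proof. by rewrite divr_gt0 // ltr0n. Qed.

Let hitE f : f \in A -> \sum_K pr K * (f \in K)%:R = deg_in w A f / Dt.
Proof.
move=> fA; rewrite /deg_in mulr_suml [RHS]big_mkcond; apply: eq_bigr => K _; rewrite /pr.
by case: (K \subset A); case: (f \in K); rewrite ?mulr1 ?mulr0 ?mul0r.
Qed.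

Let hit_b f : f \in A -> u * (1 - 2 * b) <= \sum_K pr K * (f \in K)%:R <= u * (1 + 3 * b).
Proof.
have hb0 := b0; have hb1 := b1; move=> fA; rewrite hitE //; have /andP[d1 d2] := degb fA; have /andP[D1 D2] := Dtb.
have k0R : 0 < k%:R :> R by rewrite ltr0n.
rewrite /u; apply/andP; split.
  rewrite ler_pdivlMr //.
  have -> : k%:R / #|A|%:R * (1 - 2 * b) * Dt = (1 - 2 * b) * (k%:R * Dt) / #|A|%:R by ring.
  rewrite ler_pdivrMr //.
  apply: le_trans (_ : (1 - 2 * b) * (#|A|%:R * (P1 * (1 + b))) <= _); first by rewrite ler_wpM2l //; lra.
  apply: le_trans (_ : #|A|%:R * (P1 * (1 - b)) <= _); last by rewrite mulrC ler_wpM2r // ltW.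
  have : 0 <= #|A|%:R * P1 by rewrite mulr_ge0 // ltW.
  move=> h; have -> : (1 - 2 * b) * (#|A|%:R * (P1 * (1 + b))) = (#|A|%:R * P1) * ((1 - 2 * b) * (1 + b)) by ring.
  by rewrite mulrA ler_wpM2l //; nra.
rewrite ler_pdivrMr //.
have -> : k%:R / #|A|%:R * (1 + 3 * b) * Dt = (1 + 3 * b) * (k%:R * Dt) / #|A|%:R by ring.
rewrite ler_pdivlMr //.
apply: le_trans (_ : P1 * (1 + b) * #|A|%:R <= _); first by rewrite ler_wpM2r // ltW.
apply: le_trans (_ : (1 + 3 * b) * (#|A|%:R * (P1 * (1 - b))) <= _).
  have h : 0 <= P1 * #|A|%:R by rewrite mulr_ge0 // ltW.
  have -> : P1 * (1 + b) * #|A|%:R = (P1 * #|A|%:R) * (1 + b) by ring.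
  have -> : (1 + 3 * b) * (#|A|%:R * (P1 * (1 - b))) = (P1 * #|A|%:R) * ((1 + 3 * b) * (1 - b)) by ring.
  by rewrite ler_wpM2l //; nra.
by rewrite ler_wpM2l //; lra.
Qed.

Let hit2 f f' : f != f' -> \sum_K pr K * ((f \in K) && (f' \in K))%:R <= u * (2 * eta / g).
Proof.
have hb0 := b0; have hb1 := b1; move=> ff; apply: le_trans (_ : eta / Dt <= _).
  rewrite ler_pdivlMr // mulr_suml; apply: le_trans (codeg ff).
  rewrite [X in _ <= X]big_mkcond; apply: ler_sum => K _; rewrite /pr.
  case: (K \subset A); case: (_ && _); rewrite ?mulr1 ?mulr0 ?mul0r //.
  by rewrite mulfVK // gt_eqF.
have /andP[D1 D2] := Dtb.
rewrite ler_pdivrMr //.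
have -> : u * (2 * eta / g) * Dt = k%:R * Dt * (2 * eta / g) / #|A|%:R by rewrite /u; ring.
rewrite ler_pdivlMr //.
apply: le_trans (_ : (#|A|%:R * (P1 * (1 - b))) * (2 * eta / g) <= _); last first.
  by rewrite ler_wpM2r // divr_ge0 ?(ltW g0) // mulr_ge0 // ltW.
have -> : #|A|%:R * (P1 * (1 - b)) * (2 * eta / g) = eta * #|A|%:R * (2 * (1 - b) * (P1 / g)) by ring.
rewrite -[X in X <= _]mulr1 ler_wpM2l ?mulr_ge0 ?(ltW eta0) //.
have h1 : 1 <= P1 / g by rewrite ler_pdivlMr // mul1r.
nra.
Qed.

Section Test.
Variables (a : nat) (om : {set E} -> R).
Hypothesis ak : (a <= k)%N.
Hypothesis om0 : forall S, 0 <= om S.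
Hypothesis oma : forall S, om S != 0 -> #|S| = a.
Hypothesis ometa : forall f, \sum_(S : {set E} | f \in S) om S <= eta.

Let meets (S K : {set E}) : R := (~~ [disjoint S & K])%:R.

Let meets_up S K : meets S K <= \sum_(f in S) (f \in K)%:R.
Proof.
rewrite /meets; case: (boolP [disjoint S & K]) => [_|]; first by apply: sumr_ge0.
by rewrite -setI_eq0 => /set0Pn[f]; rewrite inE => /andP[fS fK]; rewrite (bigD1 f) //= fK lerDl sumr_ge0.
Qed.

(** Bonferroni: inclusion and exclusion cut after the pairs is a lower bound. *)
Let meets_low (S K : {set E}) : \sum_(f in S) (f \in K)%:R - \sum_(f in S) \sum_(f' in S | f' != f) ((f \in K) && (f' \in K))%:R
  <= meets S K.
Proof.
pose x := #|S :&: K|.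
have sx : \sum_(f in S) (f \in K)%:R = x%:R :> R.
  rewrite -natr_sum /x -sum1_card; congr (_%:R); rewrite [LHS]big_mkcond [RHS]big_mkcond.
  by apply: eq_bigr => f _; rewrite !inE; case: (f \in S); case: (f \in K).
have sxx : \sum_(f in S) \sum_(f' in S | f' != f) ((f \in K) && (f' \in K))%:R = x%:R * x%:R - x%:R :> R.
  rewrite -{1 3}sx mulr_suml -sumrB; apply: eq_bigr => f fS; rewrite -sx (bigD1 f fS) /=.
  rewrite mulrDr mulr_sumr; case: (f \in K); rewrite ?mul1r /=.
    by rewrite addrC addrA addNr add0r; apply: eq_bigr => f' _; rewrite mul1r.
  by rewrite mul0r !subr0 add0r big1 ?big1 // => f' _; rewrite mul0r.
rewrite sx sxx /meets -setI_eq0 -cards_eq0 -/x.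
case: x {sx sxx} => [|[|n]] /=; rewrite ?mulr0 ?subr0 ?mul1r ?subrr //; first by rewrite subr0.
have : 2 <= n.+2%:R :> R by rewrite ler_nat.
by move: (n.+2%:R : R) => z; nra.
Qed.

Let loss K := inside om A - inside om (A :\: K).

Let lossE K : loss K = \sum_(S : {set E} | S \subset A) om S * meets S K.
Proof.
rewrite /loss /inside [X in X - _](bigID (fun S : {set E} => [disjoint S & K])) /=.
rewrite (eq_bigl (fun S : {set E} => S \subset A :\: K)) => [|S]; last by rewrite finset.subsetD.
rewrite addrAC subrr add0r [RHS](bigID (fun S : {set E} => [disjoint S & K])) /=.
rewrite [X in _ = X + _]big1 ?add0r => [|S /andP[_ d]]; last by rewrite /meets d mulr0.
by apply: eq_bigr => S /andP[_ d]; rewrite /meets d mulr1.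
Qed.

Lemma loss_ge0 K : 0 <= inside om A - inside om (A :\: K).
Proof. by rewrite -/(loss K) lossE; apply: sumr_ge0 => S _; rewrite mulr_ge0. Qed.

Lemma loss_le K : 0 < pr K -> inside om A - inside om (A :\: K) <= k%:R * eta.
Proof.
move=> prK; have wK : w K != 0.
  by apply: contraTneq prK => E0; rewrite /pr E0 mul0r; case: ifP => _; rewrite ltxx.
rewrite -/(loss K) lossE.
apply: le_trans (_ : \sum_(f in K) \sum_(S : {set E} | f \in S) om S <= _); last first.
  by rewrite -(wk wK) mulr_natl -sumr_const; apply: ler_sum => f _; apply: ometa.
rewrite (exchange_big_dep predT) //= [X in X <= _]big_mkcond; apply: ler_sum => S _.
apply: le_trans (_ : om S * meets S K <= _).
  by case: ifP => // _; rewrite mulr_ge0.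
apply: le_trans (_ : om S * \sum_(f in S) (f \in K)%:R <= _); first by rewrite ler_wpM2l.
rewrite mulr_sumr [X in _ <= X]big_mkcond [X in X <= _]big_mkcond; apply: ler_sum => f _.
by case: (f \in S); case: (f \in K); rewrite /= ?mulr1 ?mulr0.
Qed.

Let mean_loss := \sum_K pr K * loss K.

Let mean_lossE : mean_loss = \sum_(S : {set E} | S \subset A) om S * \sum_K pr K * meets S K.
Proof.
rewrite /mean_loss; under eq_bigr do rewrite lossE mulr_sumr.
rewrite exchange_big; apply: eq_bigr => S _; rewrite mulr_sumr; apply: eq_bigr => K _; ring.
Qed.

Lemma mean_loss_up : \sum_K pr K * (inside om A - inside om (A :\: K)) <= inside om A * (a%:R * u * (1 + 3 * b)).
Proof.
rewrite -/mean_loss mean_lossE /inside mulr_suml; apply: ler_sum => S SA.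
have [->|nS] := eqVneq (om S) 0; first by rewrite !mul0r.
rewrite ler_wpM2l //; apply: le_trans (_ : \sum_(f in S) \sum_K pr K * (f \in K)%:R <= _).
  rewrite exchange_big; apply: ler_sum => K _; rewrite -mulr_sumr ler_wpM2l //; exact: pick_prob_ge0.
rewrite -(oma nS) -mulrA mulr_natl -sumr_const; apply: ler_sum => f fS.
by have /andP[] := hit_b (fintype.subsetP SA f fS).
Qed.

(** The pair terms of [meets_low] are rare because of the codegree bound, which gives the correction
    with [eta]. *)
Lemma mean_loss_low : inside om A * (a%:R * u * (1 - 2 * b - a%:R * (2 * eta / g)))
  <= \sum_K pr K * (inside om A - inside om (A :\: K)).
Proof.
rewrite -/mean_loss mean_lossE /inside mulr_suml; apply: ler_sum => S SA.
have [->|nS] := eqVneq (om S) 0; first by rewrite !mul0r.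
rewrite ler_wpM2l //; apply: le_trans (_ : \sum_(f in S) \sum_K pr K * (f \in K)%:R -
   \sum_(f in S) \sum_(f' in S | f' != f) \sum_K pr K * ((f \in K) && (f' \in K))%:R <= _).
  rewrite -sumrB -(oma nS) -[X in X <= _]mulrA mulr_natl -sumr_const; apply: ler_sum => f fS.
  have /andP[h1 _] := hit_b (fintype.subsetP SA f fS).
  have h2 : \sum_(f' in S | f' != f) \sum_K pr K * ((f \in K) && (f' \in K))%:R <= #|S|%:R * (u * (2 * eta / g)).
    apply: le_trans (_ : \sum_(f' in S | f' != f) u * (2 * eta / g) <= _).
      by apply: ler_sum => f' /andP[_ nf]; apply: hit2; rewrite eq_sym.
    apply: le_trans (_ : \sum_(f' in S) u * (2 * eta / g) <= _); last by rewrite sumr_const -[_ *+ #|S|]mulr_natl.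
    rewrite [X in X <= _]big_mkcondr; apply: ler_sum => f' _.
    by case: ifP => // _; rewrite mulr_ge0 ?(ltW u0) // divr_ge0 ?(ltW g0) // mulr_ge0 // ltW.
  by move: h1 h2; move: (\sum_K _) (\sum_(f' in _ | _) _) (#|S|%:R) => x y z; lra.
apply: le_trans (_ : \sum_K pr K * (\sum_(f in S) (f \in K)%:R - \sum_(f in S) \sum_(f' in S | f' != f) ((f \in K) && (f' \in K))%:R) <= _).
  rewrite le_eqVlt; apply/orP; left; apply/eqP.
  under [RHS]eq_bigr do rewrite mulrBr !mulr_sumr.
  rewrite sumrB; congr (_ - _); first exact: exchange_big.
  rewrite [RHS]exchange_big; apply: eq_bigr => f _.
  under [RHS]eq_bigr do rewrite mulr_sumr.
  exact: exchange_big.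
by apply: ler_sum => K _; rewrite ler_wpM2l //; exact: pick_prob_ge0.
Qed.

Let z : R := kap / N.

Let facts : [/\ 0 < kap, 0 < z, k%:R * u <= z, z <= kap * eta & [/\ k%:R / g <= kap, k%:R <= kap & kap <= kap / g ^+ 2]].
Proof.
have k0R : 0 < k%:R :> R by rewrite ltr0n.
have kap0 : 0 < kap by rewrite kapE divr_gt0 // exprn_gt0.
have gp1 : g <= p by have := gp k0; rewrite expr1.
split=> //; first by rewrite divr_gt0.
- rewrite /u /z pA kapE.
  have -> : k%:R * (k%:R / (p * N)) = k%:R ^+ 2 * (p * N)^-1 by ring.
  have -> : k%:R ^+ 2 / g / N = k%:R ^+ 2 * (g * N)^-1 by rewrite invfM mulrA.
  rewrite ler_wpM2l ?sqr_ge0 //.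
  by rewrite lef_pV2 ?posrE ?mulr_gt0 // ler_pM2r.
- by rewrite /z ler_pM2l.
split.
- by rewrite kapE ler_pM2r ?invr_gt0 // expr2 ler_pMl.
- rewrite kapE expr2 -mulrA ler_pMr // ler_pdivlMr // mul1r.
  by apply: le_trans g1 _.
- by rewrite ler_pdivlMr ?exprn_gt0 // ler_piMr ?(ltW kap0) // exprn_ile1 // ltW.
Qed.

(** One random step changes the exponential moment of a test only by the second-order factor,
    provided that the tolerated error grows from [b] to [b * (1 + 14 * kap / N)]. The sign [sg]
    treats both tails. *)
Lemma test_step (q lam sg : R) : 0 <= q -> q <= 1 -> sg = 1 \/ sg = -1 ->
  `|inside om A / p ^+ a - q| <= b -> 0 < lam -> lam * (11 * kap * eta) <= 1 / 2 ->
  \sum_K pr K * expR (lam * (sg * (inside om (A :\: K) / (p * (1 - u)) ^+ a - q) - b * (1 + 14 * kap / N)))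
   <= expR (lam * (sg * (inside om A / p ^+ a - q) - b)) * (1 + 2 * (lam ^+ 2 * (200 * kap ^+ 2 / g ^+ 2 * eta / N))).
Proof.
move=> q0 q1 hsg hX lam0 hlam.
have [kap0 z0 kuz zke [kgk kk kg2]] := facts.
have hb0 := b0; have hb1 := b1; have heta' := heta; have eta0' := eta0.
set Q := inside om A in hX *; set Pa := p ^+ a; set X := Q / Pa in hX *.
have Pa0 : 0 < Pa by apply: exprn_gt0.
have Pag : g <= Pa by apply: gp.
have Pa1 : Pa <= 1 by apply: exprn_ile1 => //; apply: ltW.
have QE : Q = X * Pa by rewrite /X mulfVK // gt_eqF.
have X0 : 0 <= X by rewrite divr_ge0 ?(ltW Pa0) //; apply: sumr_ge0.
have X2 : X <= 4 / 3 by move: hX; rewrite ler_norml => /andP[h1 h2]; lra.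
have u0' := u0; have kR' := kR.
set v := a%:R * u.
have v0 : 0 <= v by rewrite mulr_ge0 // ltW.
have vz : v <= z by apply: le_trans kuz; rewrite /v ler_wpM2r ?(ltW u0) // ler_nat.
have zb : z <= b / 2 by apply: le_trans zke _; lra.
have uz : u <= z by apply: le_trans kuz; rewrite ler_peMl // ltW.
have hau : a%:R * u <= 1 / 2 by apply: le_trans vz _; lra.
have hu2 : u <= 1 / 2 by lra.
have := inv_pow_bounds (ltW u0) hau hu2; rewrite -/v.
set V0 := (1 - u) ^+ a; set s := V0^-1; move=> /= [s1 s2 s3 s4].
have V00 : 0 < V0 by apply: exprn_gt0; lra.
have s0 : 0 < s by rewrite invr_gt0.
(* The growth of the tolerated error. It dominates the drift: the worse bound is that of
   [drift_low], and [14 = 2 + 12]. *)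
pose dd := b * (14 * z).
pose y K := lam * (sg * ((s - 1) * X - s * (loss K / Pa)) - dd).
have XK K : inside om (A :\: K) / (p * (1 - u)) ^+ a = X + ((s - 1) * X - s * (loss K / Pa)).
  rewrite exprMn -/Pa -/V0; have -> : inside om (A :\: K) = X * Pa - loss K by rewrite /loss -/Q QE; ring.
  by rewrite /s; field; rewrite !gt_eqF.
have expE K : lam * (sg * (inside om (A :\: K) / (p * (1 - u)) ^+ a - q) - b * (1 + 14 * kap / N)) =
    lam * (sg * (X - q) - b) + y K.
  by rewrite XK /y /dd /z; ring.
under eq_bigr do rewrite expE expRD mulrCA.
rewrite -mulr_sumr ler_pM2l ?expR_gt0 //.
have sgE : `|sg| = 1 by case: hsg => ->; rewrite ?normrN normr1.
have l0 K : 0 <= loss K by apply: loss_ge0.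
have Dle K : `|sg * ((s - 1) * X - s * (loss K / Pa)) - dd| <= 9 * z + 2 * (loss K / g).
  have dd0 : 0 <= dd by rewrite mulr_ge0 ?(ltW b0) // mulr_ge0 // ltW.
  have dd5 : dd <= 5 * z by rewrite /dd mulrA ler_wpM2r ?(ltW z0) //; lra.
  apply: (deviation_le sgE v0 s1 s3 s4 vz X0 X2 _ _ dd0 dd5); first by rewrite divr_ge0 // ltW.
  by rewrite ler_wpM2l // lef_pV2.
have mle : \sum_K pr K * loss K <= 4 * z.
  apply: le_trans mean_loss_up _; rewrite -/Q -/v QE.
  exact: (mean_bound v0 vz (ltW b0) b1 X0 X2 (ltW Pa0) Pa1).
have m0 : 0 <= \sum_K pr K * loss K.
  by apply: sumr_ge0 => K _; rewrite mulr_ge0 //; apply: pick_prob_ge0.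
apply: mean_exp_le.
- exact: pick_prob_ge0.
- exact: pick_prob_sum.
- move=> K prK; rewrite /y normrM (gtr0_norm lam0); apply: le_trans hlam.
  rewrite ler_pM2l //; apply: le_trans (Dle K) _.
  have h1 : loss K / g <= kap * eta.
    apply: le_trans (_ : k%:R * eta / g <= _).
      by rewrite ler_pM2r ?invr_gt0 //; apply: loss_le.
    by rewrite mulrAC ler_wpM2r // ltW.
  lra.
- have -> : \sum_K pr K * y K = lam * (sg * ((s - 1) * X - s * ((\sum_K pr K * loss K) / Pa)) - dd).
    rewrite (eq_bigr (fun K => pr K * (lam * (sg * ((s - 1) * X) - dd)) - pr K * loss K * (lam * sg * s / Pa))).
      by rewrite sumrB -!mulr_suml pick_prob_sum; ring.
    by move=> K _; rewrite /y; ring.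
  rewrite pmulr_rle0 // subr_le0.
  set m := _ / Pa; pose c := a%:R * (2 * eta / g).
  have c0 : 0 <= c by rewrite mulr_ge0 // divr_ge0 ?(ltW g0) // mulr_ge0 // ltW.
  have cb : c <= b.
    apply: le_trans heta; rewrite /c.
    apply: le_trans (_ : k%:R * (2 * eta / g) <= _).
      by rewrite ler_wpM2r ?ler_nat // divr_ge0 ?(ltW g0) // mulr_ge0 // ltW.
    have -> : k%:R * (2 * eta / g) = 2 * (k%:R / g) * eta by ring.
    by rewrite ler_wpM2r ?(ltW eta0) // ler_wpM2l.
  have vb : v <= b by lra.
  have vbz : v * b <= b * z by rewrite mulrC ler_wpM2l // ltW.
  case: hsg => ->.
  + rewrite mul1r; apply: le_trans (drift_up (b := b) (c := c) v0 (ltW b0) c0 X0 _ (ltW s0) s4 s2 _) _.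
    * lra.
    * rewrite /m ler_pdivlMr // mulrAC -QE; exact: mean_loss_low.
    * have hvc : v * c <= v * b by rewrite ler_wpM2l.
      have bz0 : 0 <= b * z by rewrite mulr_ge0 // ltW.
      by rewrite /dd; lra.
  + rewrite mulN1r; apply: le_trans (drift_low (b := b) (m := m) v0 _ (ltW b0) X0 _ s1 s4 _) _.
    * lra.
    * lra.
    * rewrite /m ler_pdivrMr // mulrAC -QE; exact: mean_loss_up.
    * have : v ^+ 2 <= v * b by rewrite expr2 ler_wpM2l.
      by rewrite /dd; lra.
(* Second moment: the square of the loss is at most its maximum [k * eta] times the loss, whose mean
   is at most [4 * z]; hence the order [eta / N]. *)
- apply: le_trans (_ : \sum_K lam ^+ 2 * (pr K * (162 * z ^+ 2) + 8 / g ^+ 2 * (k%:R * eta) * (pr K * loss K)) <= _).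
    apply: ler_sum => K _; rewrite /y exprMn mulrCA ler_wpM2l ?sqr_ge0 //.
    have := pick_prob_ge0 K; rewrite le_eqVlt => /orP[/eqP<-|prK]; first by rewrite !mul0r mulr0 addr0.
    have -> : pr K * (162 * z ^+ 2) + 8 / g ^+ 2 * (k%:R * eta) * (pr K * loss K) =
      pr K * (162 * z ^+ 2 + 8 / g ^+ 2 * (k%:R * eta) * loss K) by ring.
    rewrite ler_pM2l // -real_normK ?num_real //.
    apply: le_trans (_ : (9 * z + 2 * (loss K / g)) ^+ 2 <= _).
      have B0 : 0 <= 9 * z + 2 * (loss K / g) by apply: le_trans (Dle K).
      by rewrite lerXn2r ?nnegrE.
    apply: le_trans (_ : 162 * z ^+ 2 + 8 * (loss K / g) ^+ 2 <= _).
      have := sqr_ge0 (9 * z - 2 * (loss K / g)); move: (loss K / g) => x; rewrite !expr2; lra.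
    rewrite lerD2l; have -> : 8 * (loss K / g) ^+ 2 = 8 / g ^+ 2 * loss K * loss K.
      by field; rewrite gt_eqF.
    rewrite ler_wpM2r // ler_wpM2l ?divr_ge0 ?exprn_ge0 ?(ltW g0) //.
    exact: loss_le.
  rewrite -mulr_sumr big_split /= -mulr_suml pick_prob_sum mul1r -mulr_sumr.
  rewrite ler_wpM2l ?sqr_ge0 //.
  have g2 : 0 <= 8 / g ^+ 2 * (k%:R * eta) by rewrite mulr_ge0 ?divr_ge0 ?exprn_ge0 ?(ltW g0) // mulr_ge0 // ltW.
  apply: le_trans (_ : 162 * z ^+ 2 + 8 / g ^+ 2 * (k%:R * eta) * (4 * z) <= _).
    by rewrite lerD2l ler_wpM2l.
  have ez : 0 <= eta * z by rewrite mulr_ge0 // ltW.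
  have h1 : z ^+ 2 <= kap / g ^+ 2 * (eta * (kap * N^-1)).
    rewrite expr2 -/z; apply: le_trans (_ : (kap * eta) * z <= _); first by rewrite ler_wpM2r // ltW.
    by rewrite -mulrA ler_wpM2r.
  have h2 : 8 / g ^+ 2 * (k%:R * eta) * (4 * z) <= 32 * (kap / g ^+ 2 * (eta * (kap * N^-1))).
    have -> : 8 / g ^+ 2 * (k%:R * eta) * (4 * z) = (32 * (eta * z) / g ^+ 2) * k%:R by ring.
    have -> : 32 * (kap / g ^+ 2 * (eta * (kap * N^-1))) = (32 * (eta * z) / g ^+ 2) * kap by rewrite /z; ring.
    by rewrite ler_wpM2l // divr_ge0 ?exprn_ge0 ?(ltW g0) // mulr_ge0.
  have h3 : 0 <= kap / g ^+ 2 * (eta * (kap * N^-1)).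
    by apply: le_trans h1; apply: sqr_ge0.
  have -> : 200 * kap ^+ 2 / g ^+ 2 * eta / N = 200 * (kap / g ^+ 2 * (eta * (kap * N^-1))) by ring.
  lra.
Qed.
End Test.
End Hypergraph.

Lemma mean_le_ex (R : realType) (I : finType) (pr f : I -> R) c :
  (forall i, 0 <= pr i) -> \sum_i pr i = 1 -> \sum_i pr i * f i <= c ->
  exists2 i, 0 < pr i & f i <= c.
Proof.
move=> p0 p1 hc; suff /existsP[i /andP[h1 h2]] : [exists i, (0 < pr i) && (f i <= c)] by exists i.
apply: contraLR hc; rewrite negb_exists => /forallP h; rewrite -ltNge.
have -> : c = \sum_i pr i * c by rewrite -mulr_suml p1 mul1r.
have [i pi] : exists i, 0 < pr i.
  case: (boolP [exists i, 0 < pr i]) => [/existsP//|/existsPn h'].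
  have := oner_neq0 R; rewrite -p1 big1 ?eqxx // => i _.
  by apply/eqP; rewrite eq_le p0 andbT leNgt h'.
have hle j : pr j * c <= pr j * f j.
  have := p0 j; rewrite le_eqVlt => /orP[/eqP<-|pj]; first by rewrite !mul0r.
  by rewrite ler_pM2l //; have := h j; rewrite pj /= -ltNge => /ltW.
rewrite (bigD1 i) //= [X in _ < X](bigD1 i) //=; apply: ltr_leD; last exact: ler_sum.
by rewrite ltr_pM2l //; have := h i; rewrite pi /= -ltNge.
Qed.

Lemma dev_bound (R : realType) (x q b : R) : x - q <= b -> b <= 1 / 3 -> q <= 1 -> x <= 2.
Proof. lra. Qed.

Lemma half_third (R : realType) (x y b : R) : 2 * x * y <= b -> b <= 1 / 3 -> x * y < 1.
Proof. nra. Qed.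

Section Potential.
Variables (R : realType) (E T : finType) (k : nat) (gam : R).
Hypothesis k0 : (0 < k)%N.
Hypothesis gam0 : 0 < gam.
Hypothesis gam1 : gam < 1.
Let g := gam ^+ k.
Let kap := k%:R ^+ 2 / g.
Let C3 := 200 * kap ^+ 2 / g ^+ 2.
Variables (A0 : {set E}) (w : {set E} -> R) (a : T -> nat) (om : T -> {set E} -> R)
  (q : T -> R) (te : E -> T) (eta b0 lam : R).
Let N := #|A0|%:R : R.
Hypothesis N0 : (0 < #|A0|)%N.
Hypothesis w0 : forall K, 0 <= w K.
Hypothesis wk : forall K, w K != 0 -> #|K| = k.
Hypothesis codeg : forall e e', e != e' -> \sum_(K : {set E} | (e \in K) && (e' \in K)) w K <= eta.
Hypothesis om0 : forall t S, 0 <= om t S.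
Hypothesis oma : forall t S, om t S != 0 -> #|S| = a t.
Hypothesis ak : forall t, (a t <= k)%N.
Hypothesis ometa : forall t f, \sum_(S : {set E} | f \in S) om t S <= eta.
Hypothesis q0 : forall t, 0 <= q t.
Hypothesis q1 : forall t, q t <= 1.
Hypothesis teE : forall e, e \in A0 -> a (te e) = k.-1 /\ q (te e) = 1.
Hypothesis teD : forall e (A : {set E}), A \subset A0 -> e \in A -> deg_in w A e = inside (om (te e)) A.
Hypothesis eta0 : 0 < eta.
Hypothesis Neta : N^-1 <= eta.
Hypothesis b00 : 0 < b0.
Hypothesis heta : 2 * kap * eta <= b0.
Hypothesis lam0 : 0 < lam.
Hypothesis hlam : lam * (11 * kap * eta) <= 1 / 2.

Definition dev (A : {set E}) (t : T) : R := inside (om t) A / (#|A|%:R / N) ^+ a t - q t.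
(* Exponential moments of the deviations: some choice of the next copy does not increase their mean. *)
Definition potential (A : {set E}) (b : R) : R :=
  \sum_t (expR (lam * (1 * dev A t - b)) + expR (lam * (-1 * dev A t - b))).

(** Each exponential is below 1, so each exponent is negative. *)
Lemma dev_le (A : {set E}) b t : potential A b < 1 -> `|dev A t| <= b.
Proof.
move=> h; have {}h : expR (lam * (1 * dev A t - b)) + expR (lam * (-1 * dev A t - b)) < 1.
  apply: le_lt_trans h; rewrite /potential (bigD1 t) //= lerDl.
  by apply: sumr_ge0 => t' _; rewrite addr_ge0 ?expR_ge0.
have p1 := expR_gt0 (lam * (1 * dev A t - b)); have p2 := expR_gt0 (lam * (-1 * dev A t - b)).
have h1 : expR (lam * (1 * dev A t - b)) < expR 0 by rewrite expR0; lra.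
have h2 : expR (lam * (-1 * dev A t - b)) < expR 0 by rewrite expR0; lra.
rewrite !ltr_expR in h1 h2; rewrite pmulr_rlt0 // in h1; rewrite pmulr_rlt0 // in h2.
by rewrite ler_norml; apply/andP; split; lra.
Qed.

Let NR : 0 < N. Proof. by rewrite ltr0n. Qed.
Let g0 : 0 < g. Proof. by apply: exprn_gt0. Qed.
Let g1 : g <= 1. Proof. by apply: exprn_ile1 => //; apply: ltW. Qed.

(** As long as the potential is below 1, all degrees are under control and [test_step] applies to
    every test. Since the mean of the new potential is small, some drawable hyperedge achieves
    it. *)
Lemma potential_step (A : {set E}) b : A \subset A0 -> gam * N <= #|A|%:R -> b0 <= b -> b <= 1 / 3 ->
  potential A b < 1 -> exists K : {set E}, [/\ K \subset A, w K != 0 &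
    potential (A :\: K) (b * (1 + 14 * kap / N)) <= potential A b * (1 + 2 * (lam ^+ 2 * (C3 * eta / N)))].
Proof.
move=> AA gA bb b1 hP; pose p := #|A|%:R / N.
have pA : #|A|%:R = p * N by rewrite /p mulfVK // gt_eqF.
have gp1 : gam <= p by rewrite /p ler_pdivlMr.
have p1 : p <= 1 by rewrite /p ler_pdivrMr // mul1r ler_nat subset_leq_card.
have M0 : (0 < #|A|)%N by rewrite -(ltr0n R); apply: lt_le_trans gA; rewrite mulr_gt0.
have gp a' : (a' <= k)%N -> g <= p ^+ a'.
  move=> hak; apply: le_trans (_ : gam ^+ a' <= _); last by rewrite lerXn2r // ?nnegrE ?(ltW gam0) // (le_trans (ltW gam0)).
  by rewrite /g; apply: ler_wiXn2l => //; apply: ltW.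
have hb : 0 < b by apply: lt_le_trans bb.
have hetab : 2 * kap * eta <= b by apply: le_trans bb.
have degA e : e \in A -> `|deg_in w A e / p ^+ k.-1 - 1| <= b.
  move=> eA; have [h1 h2] := teE (fintype.subsetP AA e eA).
  by have := dev_le (te e) hP; rewrite /dev h1 h2 teD.
pose u : R := k%:R / #|A|%:R.
have step t sg : sg = 1 \/ sg = -1 -> _ := fun hs => @test_step R E k w A b eta p g kap N k0 w0 wk codeg M0 g0 g1 gp p1 hb b1 eta0
  NR Neta (erefl _) hetab pA degA (a t) (om t) (@ak t) (om0 t) (@oma t) (ometa t) (q t) lam sg (q0 t) (q1 t) hs (dev_le t hP) lam0 hlam.
have pr0 := pick_prob_ge0 k0 w0 wk M0 b1 NR pA degA.
have pr1 := pick_prob_sum k0 wk M0 b1 NR pA degA.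
pose ex t sg K := expR (lam * (sg * (inside (om t) (A :\: K) / (p * (1 - k%:R / #|A|%:R)) ^+ a t - q t) -
   b * (1 + 14 * kap / N))).
have [|K prK hK] := mean_le_ex (f := fun K => \sum_t (ex t 1 K + ex t (-1) K))
  (c := potential A b * (1 + 2 * (lam ^+ 2 * (C3 * eta / N)))) pr0 pr1.
  rewrite /potential mulr_suml; under eq_bigr do rewrite mulr_sumr.
  rewrite exchange_big; apply: ler_sum => t _.
  under eq_bigr do rewrite mulrDr.
  rewrite big_split mulrDl; apply: lerD; apply: step; [by left|by right].
have KA : K \subset A.
  by apply: contraTT prK; rewrite /pick_prob => /negPf->; rewrite ltxx.
have wK : w K != 0.
  by apply: contraTneq prK => E0; rewrite /pick_prob E0 mul0r; case: ifP => _; rewrite ltxx.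
exists K; split=> //; apply: le_trans hK; rewrite le_eqVlt; apply/orP; left; apply/eqP.
have kA : (k <= #|A|)%N by rewrite -(wk wK) subset_leq_card.
have pu : p * (1 - k%:R / #|A|%:R) = #|A :\: K|%:R / N.
  rewrite cardsD (finset.setIidPr KA) (wk wK) natrB // /p; field.
  by rewrite !gt_eqF // ltr0n.
by rewrite /potential /ex /dev pu.
Qed.

Let b_ i := b0 * (1 + 14 * kap / N) ^+ i.
Hypothesis hb0 : b0 * expR (14 * kap) <= 1 / 3.
Hypothesis hP0 : potential A0 b0 * expR (2 * (lam ^+ 2 * (C3 * eta))) < 1.

Lemma pow_le_exp (x : R) (i : nat) : 0 <= x -> (i <= #|A0|)%N -> (1 + x / N) ^+ i <= expR x.
Proof.
move=> x0 hi; have x1 : 0 <= x / N by rewrite divr_ge0 // ltW.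
apply: le_trans (_ : expR (x / N) ^+ i <= _).
  by apply: lerXn2r; rewrite ?nnegrE ?expR_ge0 ?addr_ge0 // expR_ge1Dx.
rewrite -expRM_natl ler_expR mulrCA ler_piMr // ler_pdivrMr // mul1r ler_nat //.
Qed.

(** The steps are repeated until the density falls below [gam]. There are at most [N] of them, so
    error and potential grow by bounded exponential factors only. *)
Lemma nibble_run n (P : {set {set E}}) : (#|A0 :\: finset.cover P| <= n)%N ->
  finset.trivIset P -> (forall K, K \in P -> w K != 0) -> (#|A0 :\: finset.cover P| + k * #|P| = #|A0|)%N ->
  (0 < #|A0 :\: finset.cover P|)%N ->
  potential (A0 :\: finset.cover P) (b_ #|P|) <= potential A0 b0 * (1 + 2 * (lam ^+ 2 * (C3 * eta)) / N) ^+ #|P| ->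
  exists P' : {set {set E}}, [/\ finset.trivIset P', forall K, K \in P' -> w K != 0 &
    forall t, inside (om t) (A0 :\: finset.cover P') <= 2 * gam ^+ a t].
Proof.
have hb00 := b00; have kap0 : 0 < kap by rewrite divr_gt0 // exprn_gt0 // ltr0n.
have C30 : 0 <= 2 * (lam ^+ 2 * (C3 * eta)).
  rewrite mulr_ge0 // mulr_ge0 ?sqr_ge0 // mulr_ge0 ?(ltW eta0) //.
  by apply: divr_ge0; [apply: mulr_ge0 => //|]; apply: exprn_ge0; exact: ltW.
have pot0 : 0 <= potential A0 b0 by apply: sumr_ge0 => t _; rewrite addr_ge0 ?expR_ge0.
elim: n P => [|n IH] P hn tP hP cP A1 pot; first by move: A1; rewrite ltnNge hn.
set A := A0 :\: finset.cover P in hn cP A1 pot *.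
have Pk : (#|P| <= #|A0|)%N by rewrite -cP; move: k0; clear; nia.
have potlt : potential A (b_ #|P|) < 1.
  apply: le_lt_trans pot _; apply: le_lt_trans hP0; rewrite ler_wpM2l //; exact: pow_le_exp.
have bge : b0 <= b_ #|P|.
  rewrite /b_ ler_peMr ?(ltW b00) //; apply: exprn_ege1; rewrite lerDl divr_ge0 ?(ltW NR) //.
  by rewrite mulr_ge0 // ltW.
have ble : b_ #|P| <= 1 / 3.
  apply: le_trans hb0; rewrite /b_ ler_wpM2l ?(ltW b00) //; apply: pow_le_exp => //.
  by rewrite mulr_ge0 // ltW.
have AA : A \subset A0 by apply: finset.subsetDl.
(* At the stop a test differs from [q] by at most 1/3 after normalisation, hence is at most twice
   the power of the density. *)
case: (ltrP #|A|%:R (gam * N)) => hA.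
  exists P; split=> // t; have := dev_le t potlt; rewrite /dev ler_norml => /andP[_ h].
  have h1 := dev_bound h ble (q1 t).
  have p0 : 0 < #|A|%:R / N by rewrite divr_gt0 // ltr0n.
  rewrite ler_pdivrMr ?exprn_gt0 // in h1; apply: le_trans h1 _; rewrite ler_wpM2l //.
  by apply: lerXn2r; rewrite ?nnegrE ?(ltW p0) ?(ltW gam0) // ler_pdivrMr // ltW.
have [K [KA wK hK]] := potential_step AA hA bge ble potlt.
have dK : [disjoint K & finset.cover P].
  by move: KA; rewrite /A finset.subsetD => /andP[].
have K0 : K != finset.set0 by rewrite -card_gt0 (wk wK).
have KP : K \notin P.
  apply: contra K0 => KP; rewrite -finset.subset0; apply/fintype.subsetP=> e eK.
  by move: dK; rewrite disjoint_subset => /fintype.subsetP/(_ e eK); rewrite inE => /negP[]; apply/finset.bigcupP; exists K.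
have covE : A0 :\: finset.cover (K |: P) = A :\: K.
  by rewrite /finset.cover big_setU1 //= /A -/(finset.cover P) finset.setDDl finset.setUC.
have cAK : (#|A :\: K| + k = #|A|)%N.
  rewrite -(wk wK) -[in RHS](cardsID K A) (finset.setIidPr KA) addnC //.
have cKP : #|K |: P| = #|P|.+1 by rewrite cardsU1 KP.
apply: (IH (K |: P)); rewrite ?covE.
- by move: cAK hn k0; clear; lia.
- apply/finset.trivIsetP=> K1 K2; rewrite !inE => /orP[/eqP->|h1] /orP[/eqP->|h2]; rewrite ?eqxx // => ne.
  + by apply: disjointWr dK; apply: finset.bigcup_sup.
  + by rewrite disjoint_sym; apply: disjointWr dK; apply: finset.bigcup_sup.
  + by move/finset.trivIsetP: tP; apply.
- by move=> K1; rewrite !inE => /orP[/eqP->|/hP].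
- by rewrite cKP mulnS -cP -cAK addnA.
(* The uncovered set is still larger than one hyperedge because [eta * N >= 1] and
   [kap * eta < 1]. *)
- suff : (k < #|A|)%N by move: cAK; clear; lia.
  rewrite -(ltr_nat R); apply: lt_le_trans hA.
  have h1 : kap * eta < 1 := half_third heta (le_trans bge ble).
  have h2 : k%:R <= k%:R ^+ 2 :> R by rewrite expr2 ler_peMl // ler1n.
  have h3 : g <= gam by rewrite /g; rewrite -[X in _ <= X]expr1; apply: ler_wiXn2l => //; apply: ltW.
  have h4 : k%:R ^+ 2 = kap * g by rewrite /kap mulfVK // gt_eqF.
  have h5 : 1 <= eta * N by have := Neta; rewrite -ler_pdivrMr // div1r.
  apply: (@le_lt_trans _ _ (kap * g)); first by rewrite -h4.
  apply: (@le_lt_trans _ _ (kap * g * (eta * N))).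
    by rewrite ler_peMr // mulr_ge0 ?(ltW g0) // ltW.
  have -> : kap * g * (eta * N) = (kap * eta) * (g * N) by ring.
  apply: lt_le_trans (_ : 1 * (g * N) <= _); first by rewrite ltr_pM2r // mulr_gt0.
  by rewrite mul1r ler_pM2r.
- have -> : b_ #|K |: P| = b_ #|P| * (1 + 14 * kap / N) by rewrite /b_ cKP exprSr mulrA.
  apply: le_trans hK _; rewrite cKP (exprSr _ #|P|) [X in _ <= X]mulrA.
  have -> : 2 * (lam ^+ 2 * (C3 * eta / N)) = 2 * (lam ^+ 2 * (C3 * eta)) / N by ring.
  by rewrite ler_wpM2r // addr_ge0 // divr_ge0 // ltW.
Qed.
End Potential.

Lemma nibble (R : realType) (k : nat) (gam : R) : (0 < k)%N -> 0 < gam -> gam < 1 ->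
  exists b0 C eta1 : R, [/\ 0 < b0, 0 < C, 0 < eta1 &
  forall (E T : finType) (A0 : {set E}) (w : {set E} -> R) (a : T -> nat)
    (om : T -> {set E} -> R) (q : T -> R) (te : E -> T) (eta : R),
    (0 < #|A0|)%N -> (forall K, 0 <= w K) -> (forall K, w K != 0 -> #|K| = k) ->
    (forall e e', e != e' -> \sum_(K : {set E} | (e \in K) && (e' \in K)) w K <= eta) ->
    (forall t S, 0 <= om t S) -> (forall t S, om t S != 0 -> #|S| = a t) ->
    (forall t, (a t <= k)%N) -> (forall t f, \sum_(S : {set E} | f \in S) om t S <= eta) ->
    (forall t, 0 <= q t) -> (forall t, q t <= 1) ->
    (forall e, e \in A0 -> a (te e) = k.-1 /\ q (te e) = 1) ->
    (forall e (A : {set E}), A \subset A0 -> e \in A -> deg_in w A e = inside (om (te e)) A) ->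
    0 < eta -> eta <= eta1 -> (#|A0|%:R)^-1 <= eta ->
    (forall t, `|inside (om t) A0 - q t| <= b0 / 2) ->
    (2 * #|T|)%:R * expR (- (C / eta)) < 1 ->
    exists P : {set {set E}}, [/\ finset.trivIset P, forall K, K \in P -> w K != 0 &
      forall t, inside (om t) (A0 :\: finset.cover P) <= 2 * gam ^+ a t]].
Proof.
move=> k0 gam0 gam1; pose g := gam ^+ k; pose kap := k%:R ^+ 2 / g; pose C3 := 200 * kap ^+ 2 / g ^+ 2.
have g0 : 0 < g by apply: exprn_gt0.
have g1 : g <= 1 by apply: exprn_ile1 => //; apply: ltW.
have kR : 1 <= k%:R :> R by rewrite ler1n.
have kap1 : 1 <= kap by rewrite /kap ler_pdivlMr // mul1r (le_trans g1) // expr2 -[X in X <= _]mulr1 ler_pM.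
have kap0 : 0 < kap by apply: lt_le_trans kap1.
have C30 : 0 < C3.
  apply: divr_gt0; last exact: exprn_gt0.
  by apply: mulr_gt0; [rewrite ltr0n|apply: exprn_gt0].
(* The error grows by at most the factor [expR (14 * kap)] and must stay below 1/3. *)
pose b0 := expR (- (14 * kap)) / 3.
have b00 : 0 < b0 by rewrite divr_gt0 // expR_gt0.
have b01 : b0 <= 1 / 3.
  by rewrite ler_pM2r // -[X in _ <= X]expR0 ler_expR oppr_le0 mulr_ge0 // ltW.
exists b0, (b0 ^+ 2 / (32 * C3)), (b0 / (2 * kap)); split=> //.
- by apply: divr_gt0; [apply: exprn_gt0|apply: mulr_gt0].
- by apply: divr_gt0 => //; apply: mulr_gt0.
move=> E T A0 w a om q te eta N0 w0 wk codeg om0 oma ak ometa q0 q1 teE teD eta0 eta1 Neta hinit hT.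
(* Makes the initial gain [lam * b0 / 2] twice the total growth [2 * (lam ^+ 2 * (C3 * eta))]; the
   difference is the exponent [C / eta] with [C = b0 ^+ 2 / (32 * C3)]. *)
pose lam := b0 / (8 * C3 * eta).
have ce0 : 0 < 8 * C3 * eta by apply: mulr_gt0 => //; apply: mulr_gt0.
have lam0 : 0 < lam by rewrite divr_gt0.
have heta : 2 * kap * eta <= b0.
  by move: eta1; rewrite ler_pdivlMr; [rewrite mulrC|apply: mulr_gt0].
have hlam : lam * (11 * kap * eta) <= 1 / 2.
  have h1 : kap * g ^+ 2 <= kap by rewrite ler_piMr ?(ltW kap0) // exprn_ile1 // ltW.
  have h2 : kap <= kap ^+ 2 by rewrite expr2 ler_peMr // ltW.
  have h3 : 11 * kap <= C3.
    rewrite /C3 ler_pdivlMr ?exprn_gt0 //; have -> : 11 * kap * g ^+ 2 = 11 * (kap * g ^+ 2) by ring.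
    by move: h1 h2 kap0; move: (kap * _) (kap ^+ 2) => x y; clear; lra.
  apply: le_trans (_ : lam * (C3 * eta) <= _); first by rewrite ler_pM2l // ler_pM2r.
  have -> : lam * (C3 * eta) = b0 / 8 by rewrite /lam; field; rewrite !gt_eqF.
  by move: b01; clear; lra.
have hb0 : b0 * expR (14 * kap) <= 1 / 3.
  by rewrite /b0 mulrAC -expRD addNr expR0.
have pAA : #|A0|%:R / #|A0|%:R = 1 :> R by rewrite mulfV // pnatr_eq0 -lt0n.
have pot0 : potential A0 a om q lam A0 b0 <= (2 * #|T|)%:R * expR (- (lam * b0 / 2)).
  rewrite /potential natrM -mulrA mulrCA mulr_natl -sumr_const; apply: ler_sum => t _.
  rewrite /dev pAA expr1n divr1; have := hinit t; rewrite ler_norml => /andP[h1 h2].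
  have -> : 2 * expR (- (lam * b0 / 2)) = expR (- (lam * b0 / 2)) + expR (- (lam * b0 / 2)) by ring.
  have E1 : - (lam * b0 / 2) = lam * (- (b0 / 2)) by ring.
  by apply: lerD; rewrite ler_expR E1 ler_pM2l //; lra.
have hP0 : potential A0 a om q lam A0 b0 * expR (2 * (lam ^+ 2 * (C3 * eta))) < 1.
  apply: le_lt_trans hT; apply: le_trans (_ : (2 * #|T|)%:R * expR (- (lam * b0 / 2)) * expR (2 * (lam ^+ 2 * (C3 * eta))) <= _).
    by rewrite ler_pM2r ?expR_gt0.
  rewrite -mulrA -expRD ler_wpM2l // ler_expR le_eqVlt; apply/orP; left; apply/eqP.
  by rewrite /lam; field; rewrite !gt_eqF.
have cov0 : A0 :\: finset.cover (finset.set0 : {set {set E}}) = A0.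
  by rewrite /finset.cover big_set0 finset.setD0.
apply: (@nibble_run R E T k gam k0 gam0 gam1 A0 w a om q te eta b0 lam N0 w0 wk codeg om0 oma ak ometa q0 q1 teE teD
  eta0 Neta b00 heta lam0 hlam hb0 hP0 #|A0| finset.set0); rewrite ?cov0 //.
- by apply/finset.trivIsetP=> K1 K2; rewrite inE.
- by move=> K; rewrite inE.
- by rewrite cards0 muln0 addn0.
- by rewrite cards0 !expr0 !mulr1.
Qed.

Local Close Scope ring_scope.

(** * Random clique laws from fractional decompositions *)

Lemma card_determined (T V : finType) (D : {set T}) (FF : {set {ffun T -> V}}) :
  (forall f h, f \in FF -> h \in FF -> {in D, f =1 h} -> f = h) -> #|FF| <= #|V| ^ #|D|.
Proof.
move=> det; pose r (f : {ffun T -> V}) : {ffun {x | x \in D} -> V} := [ffun x => f (val x)].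
have <- : #|{: {ffun {x | x \in D} -> V}}| = #|V| ^ #|D| by rewrite card_ffun card_sig.
rewrite -(card_in_imset (f := r)) ?max_card // => f h hf hh E; apply: det => // x xD.
by have := congr1 (fun u : {ffun {x | x \in D} -> V} => u (exist _ x xD)) E; rewrite !ffunE.
Qed.

(** Multiplication by permutations on both sides carries any two such sets into each other. The
    count [c] normalises the passage from cliques to ordered cliques. *)
Lemma perm_pair_card (r : nat) : exists c, 0 < c /\ forall i j a b : 'I_r, i != j -> a != b ->
  #|[set s : 'S_r | (s i == a) && (s j == b)]| = c.
Proof.
have tr (i j a b : 'I_r) : i != j -> a != b -> exists s : 'S_r, s i = a /\ s j = b.
  move=> ij ab; exists (tperm i a * tperm (tperm i a j) b)%g; rewrite !permM tpermL; split.
    have nba : b != a by rewrite eq_sym.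
    have nt : tperm i a j != a by rewrite -{2}(tpermL i a) (inj_eq perm_inj) eq_sym.
    by apply: tpermD.
  by rewrite tpermL.
have le (i j a b i' j' a' b' : 'I_r) : i != j -> a != b -> i' != j' -> a' != b' ->
  #|[set s : 'S_r | (s i == a) && (s j == b)]| <= #|[set s : 'S_r | (s i' == a') && (s j' == b')]|.
  move=> ij ab ij' ab'; have [al [al1 al2]] := tr _ _ _ _ ij' ij; have [be [be1 be2]] := tr _ _ _ _ ab ab'.
  rewrite -(card_imset _ (f := fun s : 'S_r => (al * s * be)%g)); last first.
    by move=> s1 s2 /mulIg/mulgI.
  apply/subset_leq_card/fintype.subsetP=> s /imsetP[s1]; rewrite !inE => /andP[/eqP h1 /eqP h2] ->.
  by rewrite !permM al1 al2 h1 h2 be1 be2 !eqxx.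
case: r tr le => [|[|r]] tr le; [by exists 1; split=> // -[]| by exists 1; split=> // i j; rewrite !ord1|].
have h01 : (ord0 : 'I_r.+2) != lift ord0 ord0 by [].
exists #|[set s : 'S_r.+2 | (s ord0 == ord0) && (s (lift ord0 ord0) == lift ord0 ord0)]|; split.
  by apply/card_gt0P; exists 1%g; rewrite inE !perm1 !eqxx.
by move=> i j a b ij ab; apply/eqP; rewrite eqn_leq !le.
Qed.

Lemma card_set_type (T : finType) : #|{: {set T}}| = 2 ^ #|T|.
Proof. by rewrite -[LHS]cardsT -powersetT card_powerset cardsT. Qed.

Local Open Scope ring_scope.

(** Summing the loads of the edges gives [num_edges F] times the total weight, which is
    [num_edges G]. Since no load exceeds 1, all are equal to 1. *)
Lemma fractional_tight (R : realType) (F G : sgraph) : (0 < num_edges F)%N ->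
  has_fractional_decomposition R F G -> exists psi : subgraph_data G -> R,
  [/\ forall H, 0 <= psi H <= 1, forall H, H \notin copies F G -> psi H = 0 &
    forall e, e \in edges G -> \sum_(H : subgraph_data G | e \in H.2) psi H = 1].
Proof.
move=> k0 [psi [h01 hle hsum]]; pose psi' H := if H \in copies F G then psi H else 0.
exists psi'; split.
- by move=> H; rewrite /psi'; case: ifP => [/h01//|_]; rewrite lexx ler01.
- by move=> H /negPf nH; rewrite /psi' nH.
have sE e : \sum_(H : subgraph_data G | e \in H.2) psi' H = \sum_(H in copies F G | e \in H.2) psi H.
  by rewrite [RHS]big_mkcondl.
have tot : \sum_(e in edges G) (1 - \sum_(H : subgraph_data G | e \in H.2) psi' H) = 0.
  rewrite sumrB sumr_const (exchange_big_dep predT) //=.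
  have -> : \sum_(H : subgraph_data G) \sum_(e in edges G | e \in H.2) psi' H = \sum_(H in copies F G) (num_edges F)%:R * psi H.
    rewrite [RHS]big_mkcond; apply: eq_bigr => H _; rewrite /psi'; case: ifP => hH; last by rewrite big1.
    move: hH; rewrite inE => /andP[HG /existsP[f /and3P[/injectiveP fi _ /eqP E]]].
    rewrite (eq_bigl (fun e => e \in H.2)) => [|e]; last first.
      by case: (boolP (e \in H.2)) => [eH|]; rewrite ?(fintype.subsetP HG _ eH) ?andbF.
    have cE : #|H.2| = num_edges F by rewrite -E card_imset //; exact: finset.imset_inj.
    by rewrite sumr_const -[LHS]mulr_natl cE.
  by rewrite -mulr_sumr hsum mulrCA mulfV ?mulr1 ?subrr // pnatr_eq0 -lt0n.
have ge0 e : e \in edges G -> 0 <= 1 - \sum_(H : subgraph_data G | e \in H.2) psi' H.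
  by move=> eG; rewrite subr_ge0 sE; apply: hle.
move=> e eG; move/eqP: tot; rewrite psumr_eq0 => [/allP/(_ e)|]; last exact: ge0.
by rewrite mem_index_enum eG /= => /(_ isT); rewrite subr_eq0 => /eqP.
Qed.

(** Every clique is spread evenly over its orderings. The bound [C] depends on [r] and [m] only, not
    on the graph. *)
Lemma frac_ordered (R : realType) (r m : nat) : (1 < r)%N -> (0 < m)%N -> exists C : R, 0 <= C /\
  forall G : sgraph, #|G| = m -> has_fractional_decomposition R (complete_graph r) G ->
  exists B : {ffun 'I_r -> G} -> R, [/\ forall f, 0 <= B f <= C,
    forall f, B f != 0 -> forall i j, i != j -> adj (f i) (f j) &
    forall i j x y, i != j -> adj x y -> \sum_(f : {ffun 'I_r -> G} | (f i == x) && (f j == y)) B f = 1].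
Proof.
move=> r1 m0; have [c [c0 hc]] := perm_pair_card r.
have cR : 0 < c%:R :> R by rewrite ltr0n.
exists (#|subgraph_data (complete_graph m)|%:R * #|{: 'S_r}|%:R); split=> [|G Gm].
  by rewrite mulr_ge0.
have k0 : (0 < num_edges (complete_graph r))%N.
  have r0 := ltnW r1; apply/card_gt0P; exists [set (Ordinal r0 : complete_graph r); (Ordinal r1 : complete_graph r)].
  by rewrite edges_pair.
move/(fractional_tight k0) => [psi [p01 pN pE]].
have [h hP] : exists h : subgraph_data G -> {ffun 'I_r -> G}, forall H, psi H != 0 ->
    [/\ injective (h H), H.2 \subset edges G &
     forall e, (e \in H.2) = [exists a, exists b, (a != b) && (e == [set h H a; h H b])]].
  apply: (@fin_all_exists _ _ (fun H (hH : {ffun 'I_r -> G}) => psi H != 0 -> [/\ injective hH, H.2 \subset edges G &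
     forall e, (e \in H.2) = [exists a, exists b, (a != b) && (e == [set hH a; hH b])]])) => H.
  have /card_gt0P[x0 _] : (0 < #|G|)%N by rewrite Gm.
  case: (boolP (H \in copies (complete_graph r) G)) => [|/pN->]; last by exists [ffun=> x0]; rewrite eqxx.
  rewrite inE => /andP[HG /existsP[f /and3P[/injectiveP fi _ /eqP E]]]; exists f => _; split=> // e.
  rewrite -E; apply/imsetP/existsP => [[A /edgesP[a [b [ab ->]]] ->]|[a /existsP[b /andP[ab /eqP->]]]].
    by exists a; apply/existsP; exists b; rewrite imsetU1 imset_set1 eqxx andbT; exact: ab.
  by exists [set a; b : complete_graph r]; rewrite ?edges_pair // imsetU1 imset_set1.
pose cmp (H : subgraph_data G) (s : 'S_r) : {ffun 'I_r -> G} := [ffun i => h H (s i)].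
pose B (f : {ffun 'I_r -> G}) : R := c%:R^-1 * \sum_H psi H * \sum_(s : 'S_r) (f == cmp H s)%:R.
have in1 H f : (0 <= (\sum_(s : 'S_r) (f == cmp H s)%:R : R)) && ((\sum_(s : 'S_r) (f == cmp H s)%:R : R) <= #|{: 'S_r}|%:R).
  rewrite sumr_ge0 //= -[X in _ <= X]mulr_natr mul1r -sumr_const; apply: ler_sum => s _.
  by case: (_ == _); rewrite ?lexx ?ler01.
exists B; split.
- move=> f; apply/andP; split.
    apply: mulr_ge0; first by rewrite invr_ge0 ltW.
    apply: sumr_ge0 => H _; have /andP[h1 _] := p01 H.
    by rewrite mulr_ge0 //; have /andP[] := in1 H f.
  apply: le_trans (_ : 1 * \sum_(H : subgraph_data G) #|{: 'S_r}|%:R <= _).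
    apply: ler_pM; rewrite ?invr_ge0 ?(ltW cR) //.
    + by apply: sumr_ge0 => H _; have /andP[h1 _] := p01 H; rewrite mulr_ge0 //; have /andP[] := in1 H f.
    + by rewrite invf_le1 // ler1n.
    apply: ler_sum => H _; have /andP[h1 h2] := p01 H; have /andP[h3 h4] := in1 H f.
    by rewrite -[X in _ <= X]mul1r ler_pM.
  rewrite mul1r sumr_const -[_ *+ #|_|]mulr_natl ler_wpM2r // ler_nat.
  by rewrite -[#|xpredT|]/(#|{: {set G} * {set {set G}}}|) !card_prod !card_set_type card_ord Gm.
- move=> f Bf i j ij.
  have [H Hf] : exists H, psi H * \sum_(s : 'S_r) (f == cmp H s)%:R != 0.
    apply/existsP; apply: contraNT Bf => /existsPn h0; rewrite /B big1 ?mulr0 // => H _.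
    by apply/eqP; have := h0 H; rewrite negbK.
  have pH : psi H != 0 by apply: contraNneq Hf => ->; rewrite mul0r.
  have [s /eqP Es] : exists s : 'S_r, f == cmp H s.
    apply/existsP; apply: contraNT Hf => /existsPn h0; rewrite big1 ?mulr0 // => s _.
    by rewrite (negPf (h0 s)).
  have [hi HG hE] := hP H pH.
  rewrite -edges_pair; apply: (fintype.subsetP HG); rewrite hE; apply/existsP; exists (s i).
  by apply/existsP; exists (s j); rewrite (inj_eq perm_inj) ij Es !ffunE eqxx.
move=> i j x y ij xy.
rewrite /B -mulr_sumr exchange_big /=.
have main H : \sum_(f : {ffun 'I_r -> G} | (f i == x) && (f j == y)) psi H * \sum_(s : 'S_r) (f == cmp H s)%:R =
    c%:R * (if [set x; y] \in H.2 then psi H else 0).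
  case: (eqVneq (psi H) 0) => [->|pH]; first by rewrite big1 ?if_same ?mulr0 // => f _; rewrite mul0r.
  have [hi HG hE] := hP H pH.
  rewrite -mulr_sumr exchange_big /=.
  have -> : \sum_(s : 'S_r) \sum_(f : {ffun 'I_r -> G} | (f i == x) && (f j == y)) (f == cmp H s)%:R =
     #|[set s : 'S_r | (h H (s i) == x) && (h H (s j) == y)]|%:R :> R.
    rewrite -sum1dep_card natr_sum [RHS]big_mkcond; apply: eq_bigr => s _.
    case: ifP => hs.
      rewrite (bigD1 (cmp H s)) /= ?eqxx ?big1 ?addr0 //; last by rewrite !ffunE.
      by move=> f /andP[_ /negPf->].
    rewrite big1 // => f /andP[/eqP f1 /eqP f2]; case: eqP => // E.
    by move: hs; rewrite -f1 -f2 E !ffunE !eqxx.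
  case: ifP => hxy.
    move: hxy; rewrite hE => /existsP[a /existsP[b /andP[ab /eqP Eab]]].
    have [a' [b' [ab' Ex Ey]]] : exists a' b', [/\ a' != b', x = h H a' & y = h H b'].
      have nxy : x != y := adj_neq xy.
      have : x \in [set h H a; h H b] by rewrite -Eab !inE eqxx.
      have : y \in [set h H a; h H b] by rewrite -Eab !inE eqxx orbT.
      rewrite !inE => /orP[]/eqP Ey /orP[]/eqP Ex.
      + by move: nxy; rewrite Ex Ey eqxx.
      + by exists b, a; rewrite eq_sym.
      + by exists a, b.
      + by move: nxy; rewrite Ex Ey eqxx.
    rewrite -(hc i j a' b' ij ab') mulrC; congr (_%:R * _); apply: eq_card => s; rewrite !inE Ex Ey.
    by rewrite !(inj_eq hi).
  rewrite mulr0 (_ : [set s : 'S_r | _] = finset.set0) ?cards0 ?mulr0 //.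
  apply/setP=> s; rewrite !inE; apply/negP=> /andP[/eqP h1 /eqP h2].
  move: hxy; rewrite hE => /negbT/negP[]; apply/existsP; exists (s i); apply/existsP; exists (s j).
  by rewrite (inj_eq perm_inj) ij h1 h2 eqxx.
rewrite (eq_bigr _ (fun H _ => main H)) -mulr_sumr mulrA mulVf ?gt_eqF // mul1r -big_mkcond /=.
by apply: pE; rewrite edges_pair.
Qed.

Local Close Scope ring_scope.

Lemma min_degree_le (G : sgraph) (x : G) : min_degree G <= degree x.
Proof.
rewrite /min_degree; have : x \in index_enum G by rewrite mem_index_enum.
elim: (index_enum G) => [//|y s IH]; rewrite inE big_cons => /orP[/eqP<-|/IH h]; first exact: geq_minl.
by rewrite geq_min h orbT.
Qed.

Lemma min_degree_ex (G : sgraph) : 0 < #|G| -> exists x : G, min_degree G = degree x.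
Proof.
case/card_gt0P=> x0 _; case: (@arg_minnP _ x0 predT (@degree G) isT) => x _ hx; exists x.
apply/eqP; rewrite eqn_leq min_degree_le /=; rewrite /min_degree.
elim/big_ind: _ => [|a b ha hb|y _]; [exact: max_card|by rewrite leq_min ha hb|exact: hx].
Qed.

(** Each fibre of the two fixed values has at most this size, and the fibres add up to all
    functions; so equality holds in each. *)
Lemma card_two_fixed (I V : finType) (x y : I) (u v : V) : x != y ->
  #|[set f : {ffun I -> V} | (f x == u) && (f y == v)]| = #|V| ^ (#|I| - 2).
Proof.
move=> xy; pose a (w : V * V) := #|[set f : {ffun I -> V} | (f x == w.1) && (f y == w.2)]|.
have cD : #|~: [set x; y]| = #|I| - 2 by rewrite cardsCs finset.setCK cards2 xy.
have I2 : 2 <= #|I| by have <- : #|[set x; y]| = 2 by [rewrite cards2 xy]; exact: max_card.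
have le w : a w <= #|V| ^ (#|I| - 2).
  rewrite -cD; apply: card_determined => f h; rewrite !inE => /andP[/eqP f1 /eqP f2] /andP[/eqP h1 /eqP h2] E.
  apply/ffunP=> z; case: (eqVneq z x) => [->|zx]; first by rewrite f1 h1.
  case: (eqVneq z y) => [->|zy]; first by rewrite f2 h2.
  by apply: E; rewrite !inE negb_or zx.
have tot : \sum_w a w = \sum_(w : V * V) #|V| ^ (#|I| - 2).
  have I3 : (#|I| - 2).+2 = #|I| by rewrite -addn2 subnK.
  rewrite sum_nat_const card_prod -mulnA -!expnS I3.
    rewrite -card_ffun -sum1_card (partition_big (fun f : {ffun I -> V} => (f x, f y)) predT) //=.
    apply: eq_bigr => w _; rewrite sum1dep_card; apply: eq_card => f; rewrite !inE.
    by [].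
have := leqif_sum (P := predT) (fun w _ => leqif_eq (le w)).
rewrite tot => -[_]; rewrite eqxx => /esym/forallP/(_ (u, v)) /eqP; exact.
Qed.

Local Open Scope ring_scope.

Section Sampling.
Variables (R : realType) (G : sgraph) (d eps : R).
Hypothesis G0 : (0 < #|G|)%N.
Hypothesis d0 : 0 <= d.
Hypothesis eps0 : 0 < eps.
Hypothesis hdeg : forall z : G, (d + eps) * #|G|%:R <= (degree z)%:R.

Let d1 : d + eps <= 1.
Proof.
have /card_gt0P[z _] := G0; have h := hdeg z.
have : (degree z)%:R <= #|G|%:R :> R by rewrite ler_nat max_card.
by move/(le_trans h); rewrite -[X in _ <= X]mul1r ler_pM2r ?ltr0n.
Qed.

(** Conditionally on two sampled vertices being [u] and [v], and on the value [z] of the vertex [i],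
    the other [#|I| - 3] coordinates are independent and each hits the neighbourhood of [z] with
    probability at least [d + eps]. *)
Lemma bad_degree (I : finType) (x y i : I) (u v : G) : x != y ->
  d * #|I|%:R <= (d + eps / 2) * (#|I| - 3)%:R ->
  \sum_(s : {ffun I -> G} | (s x == u) && (s y == v)) ((degree (i : pull s))%:R < d * #|I|%:R)%R%:R
   <= expR (- ((eps / 2) ^+ 2 / 4 * (#|I| - 3)%:R)) * (#|G| ^ (#|I| - 2))%:R.
Proof.
move=> xy hI; pose A z j : pred G := [pred w | (j == x) ==> (w == u) & ((j == y) ==> (w == v)) && ((j == i) ==> (w == z))].
pose S := ~: (x |: (y |: [set i])).
have cS : (#|I| - 3 <= #|S|)%N.
  rewrite cardsCs finset.setCK; apply: leq_sub2l; rewrite !cardsU1 cards1; by case: (_ \notin _); case: (_ \notin _).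
have famA z (f : {ffun I -> G}) : (f \in family (A z)) = [&& f x == u, f y == v & f i == z].
  apply/familyP/and3P => [h|[h1 h2 h3] j].
    have := h x; have := h y; have := h i; rewrite !inE !eqxx /= => /and3P[_ _ ->] /and3P[_ -> _] /and3P[-> _ _].
    by [].
  rewrite !inE; apply/and3P; split; apply/implyP=> /eqP->; by [].
have step z : \sum_(s in family (A z)) ((degree (i : pull s))%:R < d * #|I|%:R)%R%:R
    <= expR (- ((eps / 2) ^+ 2 / 4 * (#|I| - 3)%:R)) * \sum_(s in family (A z)) 1.
  apply: le_trans (_ : _ <= \sum_(f in family (A z)) ((\sum_(j in S) (adj z (f j)))%N%:R <= (d + eps - eps / 2) * #|S|%:R :> R)%R%:R) _.
    apply: ler_sum => f; rewrite famA => /and3P[_ _ /eqP fi].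
    case: (boolP ((degree (i : pull f))%:R < d * #|I|%:R)) => [hlt|_]; last by rewrite ler0n.
    suff -> : ((\sum_(j in S) (adj z (f j)))%N%:R <= (d + eps - eps / 2) * #|S|%:R :> R)%R by [].
    apply: (@le_trans _ _ (d * #|I|%:R)); last first.
      apply: le_trans hI _; have -> : d + eps - eps / 2 = d + eps / 2 by field.
      by have hd := d0; have he := eps0; rewrite ler_wpM2l ?ler_nat //; lra.
    apply: le_trans (ltW hlt); rewrite ler_nat /degree -sum1dep_card big_mkcond [X in (_ <= X)%N]big_mkcond /=.
    by apply: leq_sum => j _; rewrite fi; case: (j \in S); case: (adj _ _).
  have e0 : 0 < eps / 2 by rewrite divr_gt0.
  have hq j : j \in S -> (d + eps) * #|A z j|%:R <= #|[pred w | A z j w && adj z w]|%:R. rewrite !inE !negb_or => /and3P[jx jy ji].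
    have -> : #|A z j| = #|G| by apply: eq_card => w; rewrite !inE (negPf jx) (negPf jy) (negPf ji).
    apply: le_trans (hdeg z) _; rewrite ler_nat /degree; apply/subset_leq_card/fintype.subsetP=> w.
    by rewrite inE => h; rewrite inE h andbT /A /= (negPf jx) (negPf jy) (negPf ji).
  apply: le_trans (@chernoff R I G (A z) S (fun _ w => adj z w) (d + eps) (eps / 2) e0 d1 hq) _.
  rewrite sumr_const card_family foldrE big_map big_enum /= natr_prod ler_wpM2r //.
    by apply: prodr_ge0.
  by rewrite ler_expR lerN2 ler_wpM2l ?ler_nat // divr_ge0 ?sqr_ge0.
have part (c : {ffun I -> G} -> R) : \sum_(s : {ffun I -> G} | (s x == u) && (s y == v)) c s =
    \sum_z \sum_(s in family (A z)) c s.
  rewrite (partition_big (fun s : {ffun I -> G} => s i) predT) //=; apply: eq_bigr => z _.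
  by apply: eq_bigl => s; rewrite famA andbA.
rewrite part; apply: le_trans (_ : _ <= expR (- ((eps / 2) ^+ 2 / 4 * (#|I| - 3)%:R)) * \sum_z \sum_(s in family (A z)) 1) _.
  by rewrite mulr_sumr; apply: ler_sum => z _; apply: step.
rewrite -part ler_wpM2l ?expR_ge0 // -(card_two_fixed u v xy) -sum1dep_card natr_sum.
by [].
Qed.
End Sampling.

(* Sample [m] vertices independently, with [m] fixed, and then a clique from a fractional decomposition
   of the sampled graph. *)
Lemma clique_law (R : realType) (r : nat) (d eps eta : R) : (1 < r)%N -> 0 <= d -> 0 < eps -> 0 < eta ->
  (exists M, forall m, (M <= m)%N -> forall G : sgraph, #|G| = m -> d * m%:R <= (min_degree G)%:R ->
     has_fractional_decomposition R (complete_graph r) G) ->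
  exists C : R, 0 < C /\ forall G : sgraph, (0 < #|G|)%N -> (d + eps) * #|G|%:R <= (min_degree G)%:R ->
  exists p : {ffun 'I_r -> G} -> R, [/\ forall f, 0 <= p f <= C / #|G|%:R ^+ r,
    forall f, p f != 0 -> forall i j, i != j -> adj (f i) (f j) &
    forall (i j : 'I_r) (u v : G), i != j -> adj u v ->
      (1 - eta) / #|G|%:R ^+ 2 <= \sum_(f : {ffun 'I_r -> G} | (f i == u) && (f j == v)) p f <= 1 / #|G|%:R ^+ 2].
Proof.
move=> r1 d0 eps0 eta0 [M hM].
pose c := (eps / 2) ^+ 2 / 4; have c0 : 0 < c by rewrite divr_gt0 // exprn_gt0 // divr_gt0.
pose K := (Num.trunc (expR (3 * c) / eta)).+1.
have hK : expR (3 * c) / eta < K%:R by apply: truncnS_gt.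
have [n1 hn1] := exp_beats_poly K 1 c0.
pose N3 := (Num.trunc (6 / eps)).+1.
have hN3 : 6 / eps < N3%:R by apply: truncnS_gt.
(* Large enough for the fractional decomposition ([M]), for the failure probability to be at most
   [eta] ([n1]), and for the three fixed coordinates to cost at most [eps / 2] of degree ([N3]). *)
pose m' := (M + n1 + N3)%N; pose m := m'.+3.
have e3 : (m - 3 = m')%N by rewrite /m; lia.
have e2 : (m - 2 = m'.+1)%N by rewrite /m; lia.
have mM : (M <= m)%N by rewrite /m /m'; lia.
have mn1 : (n1 <= m)%N by rewrite /m /m'; lia.
have mN3 : (N3 <= m)%N by rewrite /m /m'; lia.
have m6 : 6 <= eps * m%:R.
  have h : N3%:R <= m%:R :> R by rewrite ler_nat.
  by rewrite mulrC -ler_pdivrMr //; apply: le_trans (ltW hN3) h.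
have mexp : m%:R * expR (- (c * m'%:R)) <= eta.
  have := hn1 m mn1; rewrite expn1 natrM.
  have -> : - (c * m'%:R) = - (c * m%:R) + 3 * c by rewrite /m -addn3 natrD; ring.
  rewrite expRD mulrA => h; rewrite -ler_pdivlMr ?expR_gt0 //.
  have K0 : 0 < K%:R :> R by rewrite ltr0n.
  have h2 : m%:R * expR (- (c * m%:R)) < K%:R^-1 by rewrite -[_^-1]mul1r ltr_pdivlMr // mulrC mulrA.
  apply: le_trans (ltW h2) _; rewrite -[eta / _]invrK lef_pV2 ?posrE ?invr_gt0 ?divr_gt0 ?expR_gt0 //.
  by rewrite invf_div ltW.
have [Cb [Cb0 hB]] := @frac_ordered R r m r1 isT.
exists ((Cb + 1) * (m ^ r)%:R); split.
  by rewrite mulr_gt0 ?ltr0n ?expn_gt0 // ltr_wpDl.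
move=> G G0 hG; have nR : 0 < #|G|%:R :> R by rewrite ltr0n.
have hdeg (z : G) : (d + eps) * #|G|%:R <= (degree z)%:R.
  by apply: le_trans hG _; rewrite ler_nat min_degree_le.
have hI : d * #|'I_m|%:R <= (d + eps / 2) * (#|'I_m| - 3)%:R.
  rewrite card_ord /m -addn3 addnK natrD.
  have de1 : d + eps <= 1.
    have /card_gt0P[z _] := G0; have h := hdeg z.
    have : (degree z)%:R <= #|G|%:R :> R by rewrite ler_nat max_card.
    by move/(le_trans h); rewrite -[X in _ <= X]mul1r ler_pM2r.
  have E3 : m%:R = m'%:R + 3 :> R by rewrite /m -addn3 natrD.
  by move: m6 de1 eps0; rewrite E3; move: (m'%:R : R); clear => z; nra.
pose good (s : {ffun 'I_m -> G}) : bool := d * m%:R <= (min_degree (pull s))%:R.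
(* Samples of too small minimum degree contribute nothing; this is the loss [eta] in the lower
   bound. *)
have [B hB'] : exists B : {ffun 'I_m -> G} -> {ffun 'I_r -> 'I_m} -> R, forall s,
   [/\ forall g, 0 <= B s g <= Cb, forall g, B s g != 0 -> forall i j, i != j -> adj (s (g i)) (s (g j)) &
    forall (i j : 'I_r) (x y : 'I_m), i != j -> adj (s x) (s y) ->
      \sum_(g : {ffun 'I_r -> 'I_m} | (g i == x) && (g j == y)) B s g = (good s)%:R].
  apply: (@fin_all_exists _ _ (fun (s : {ffun 'I_m -> G}) (Bs : {ffun 'I_r -> 'I_m} -> R) => [/\ forall g, 0 <= Bs g <= Cb,
    forall g, Bs g != 0 -> forall i j, i != j -> adj (s (g i)) (s (g j)) &
    forall (i j : 'I_r) (x y : 'I_m), i != j -> adj (s x) (s y) ->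
      \sum_(g : {ffun 'I_r -> 'I_m} | (g i == x) && (g j == y)) Bs g = (good s)%:R])) => s.
  case: (boolP (good s)) => hs; last first.
    by exists (fun=> 0); split=> [g|g|i j x y _ _]; rewrite ?lexx ?eqxx ?big1.
  have Im : #|pull s| = m by apply: card_ord.
  exact: (hB (pull s) Im (hM m mM (pull s) Im hs)).
(* There are n^m samples, and m(m-1) ordered pairs of distinct positions at which [u] and [v] can be
   sampled. *)
pose Z : R := (#|G|%:R ^+ m * (m%:R * (m%:R - 1)))^-1.
have m1 : 1 <= m%:R - 1 :> R by rewrite /m -addn3 natrD; have : 0 <= m'%:R :> R by []; lra.
have mR : 1 <= m%:R :> R by lra.
have Zd : 0 < #|G|%:R ^+ m * (m%:R * (m%:R - 1)) :> R.
  by rewrite mulr_gt0 ?exprn_gt0 // mulr_gt0 //; lra.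
have Z0 : 0 < Z by rewrite invr_gt0.
pose cmp (s : {ffun 'I_m -> G}) (g : {ffun 'I_r -> 'I_m}) : {ffun 'I_r -> G} := [ffun i => s (g i)].
pose p f := Z * \sum_s \sum_g B s g * (f == cmp s g)%:R.
have B0 s g : 0 <= B s g by have [h _ _] := hB' s; have /andP[] := h g.
have p0 f : 0 <= p f.
  by apply: mulr_ge0; [exact: ltW|apply: sumr_ge0 => s _; apply: sumr_ge0 => g _; rewrite mulr_ge0].
have psupp f : p f != 0 -> forall i j, i != j -> adj (f i) (f j).
  move=> pf i j ij.
  have [s hs] : exists s, \sum_g B s g * (f == cmp s g)%:R != 0.
    by apply/existsP; apply: contraNT pf => /existsPn h; rewrite /p big1 ?mulr0 // => s _; apply/eqP; rewrite -[_ == _]negbK h.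
  have [g hg] : exists g, B s g * (f == cmp s g)%:R != 0.
    by apply/existsP; apply: contraNT hs => /existsPn h; rewrite big1 // => g _; apply/eqP; rewrite -[_ == _]negbK h.
  have Bg : B s g != 0 by apply: contraNneq hg => ->; rewrite mul0r.
  have Ef : f = cmp s g by apply/eqP; apply: contraNT hg => /negPf->; rewrite mulr0.
  by have [_ h _] := hB' s; rewrite Ef !ffunE; apply: h.
exists p; split=> //.
- move=> f; rewrite p0 /=.
  case: (boolP (injectiveb f)) => [/injectiveP fi|nf]; last first.
    have -> : p f = 0.
      apply/eqP; apply: contraNT nf => /psupp h; apply/injectiveP=> i j E.
      by apply/eqP; apply: contraT => /h; rewrite E adj_irrefl.
    by rewrite divr_ge0 ?exprn_ge0 // mulr_ge0 // addr_ge0.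
  have cnt g : (\sum_(s : {ffun 'I_m -> G}) (f == cmp s g) <= #|G| ^ (m - r))%N.
    have -> : (\sum_(s : {ffun 'I_m -> G}) (f == cmp s g))%N = #|[set s : {ffun 'I_m -> G} | f == cmp s g]|.
      by rewrite -sum1dep_card [RHS]big_mkcond; apply: eq_bigr => s _; case: (_ == _).
    case: (pickP (fun s : {ffun 'I_m -> G} => f == cmp s g)) => [s0 /eqP Es0|none]; last first.
      by rewrite (_ : [set s | _] = finset.set0) ?cards0 //; apply/setP=> s; rewrite !inE none.
    have gi : injective g.
      by move=> i j E; apply: fi; rewrite Es0 !ffunE E.
    have cD : #|~: (g @: [set: 'I_r])| = (m - r)%N.
      by rewrite cardsCs finset.setCK card_imset // cardsT !card_ord.
    rewrite -cD; apply: card_determined => s h; rewrite !inE => /eqP Es /eqP Eh E.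
    apply/ffunP=> z; case: (boolP (z \in g @: [set: 'I_r])) => [/imsetP[i _ ->]|nz].
      by have := congr1 (fun w : {ffun 'I_r -> G} => w i) Es; rewrite Eh !ffunE.
    by apply: E; rewrite inE.
  have le1 : \sum_s \sum_g B s g * (f == cmp s g)%:R <= Cb * (m ^ r)%:R * #|G|%:R ^+ (m - r).
    rewrite exchange_big /=; apply: le_trans (_ : \sum_(g : {ffun 'I_r -> 'I_m}) Cb * #|G|%:R ^+ (m - r) <= _).
      apply: ler_sum => g _; apply: le_trans (_ : \sum_s Cb * (f == cmp s g)%:R <= _).
        by apply: ler_sum => s _; rewrite ler_wpM2r //; have [h _ _] := hB' s; have /andP[] := h g.
      by rewrite -mulr_sumr ler_wpM2l // -natr_sum -natrX ler_nat.
    rewrite sumr_const card_ffun !card_ord -[_ *+ _]mulr_natl.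
    by rewrite mulrCA mulrA.
  case: (leqP r m) => rm; last first.
    have -> : p f = 0.
      rewrite /p big1 ?mulr0 // => s _; rewrite big1 // => g _; case: eqP => [Ef|_]; last by rewrite mulr0.
      have gi : injective g by move=> i j E; apply: fi; rewrite Ef !ffunE E.
      by have := max_card (g @: [set: 'I_r]); rewrite card_imset // cardsT !card_ord leqNgt rm.
    by rewrite divr_ge0 ?exprn_ge0 // mulr_ge0 // addr_ge0.
  apply: le_trans (_ : Z * (Cb * (m ^ r)%:R * #|G|%:R ^+ (m - r)) <= _); first by rewrite ler_wpM2l // ltW.
  rewrite ler_pdivlMr ?exprn_gt0 //.
  pose x : R := (m%:R * (m%:R - 1))^-1.
  have mm0 : 0 < m%:R * (m%:R - 1) :> R by rewrite mulr_gt0 //; lra.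
  have x1 : x <= 1 by rewrite invf_le1 //; have := m1; have := mR; move: (m%:R : R) => z; nra.
  have -> : Z * (Cb * (m ^ r)%:R * #|G|%:R ^+ (m - r)) * #|G|%:R ^+ r = Cb * (m ^ r)%:R * x.
    rewrite /Z invfM -/x -{1}(subnK rm) exprD; move: (_ ^+ (m - r)) (_ ^+ r) (exprn_gt0 (m - r) nR) (exprn_gt0 r nR).
    by move=> a b a0 b0; field; rewrite !gt_eqF.
  apply: le_trans (_ : Cb * (m ^ r)%:R * 1 <= _); first by rewrite ler_wpM2l // mulr_ge0.
  by rewrite mulr1 ler_wpM2r // lerDl.
- move=> i j u v ij uv; have nuv := adj_neq uv.
  have S1 : \sum_(f : {ffun 'I_r -> G} | (f i == u) && (f j == v)) p f =
      Z * \sum_s \sum_g B s g * ((s (g i) == u) && (s (g j) == v))%:R.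
    rewrite /p -mulr_sumr exchange_big; congr (_ * _); apply: eq_bigr => s _.
    rewrite exchange_big; apply: eq_bigr => g _; rewrite -mulr_sumr; congr (_ * _).
    case: (boolP ((s (g i) == u) && (s (g j) == v))) => hs; last first.
      rewrite big1 // => f /andP[/eqP f1 /eqP f2]; case: eqP => // E.
      by move: hs; rewrite -f1 -f2 E !ffunE !eqxx.
    rewrite (bigD1 (cmp s g)) /= ?eqxx ?big1 ?addr0 //; last by rewrite !ffunE.
    by move=> f /andP[_ /negPf->].
  have S2 s : \sum_g B s g * ((s (g i) == u) && (s (g j) == v))%:R =
      \sum_(w : 'I_m * 'I_m | (s w.1 == u) && (s w.2 == v)) (good s)%:R.
    transitivity (\sum_(g : {ffun 'I_r -> 'I_m} | (s (g i) == u) && (s (g j) == v)) B s g).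
      by rewrite [RHS]big_mkcond; apply: eq_bigr => g _; case: ifP; rewrite ?mulr1 ?mulr0.
    rewrite (partition_big (fun g : {ffun 'I_r -> 'I_m} => (g i, g j)) (fun w => (s w.1 == u) && (s w.2 == v))) //=.
    apply: eq_bigr => -[x y] /= /andP[/eqP sx /eqP sy].
    have [_ _ hs] := hB' s; rewrite -(hs i j x y ij); last by rewrite sx sy.
    apply: eq_bigl => g; rewrite xpair_eqE andbC; apply: andb_idr => /andP[/eqP-> /eqP->].
    by rewrite sx sy !eqxx.
  pose Mw (w : 'I_m * 'I_m) : R := \sum_(s : {ffun 'I_m -> G} | (s w.1 == u) && (s w.2 == v)) (good s)%:R.
  have S3 : \sum_s \sum_g B s g * ((s (g i) == u) && (s (g j) == v))%:R = \sum_w Mw w.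
    under eq_bigr do rewrite S2.
    by rewrite (exchange_big_dep predT).
  have nm : 0 < #|G|%:R ^+ m'.+1 :> R by apply: exprn_gt0.
  (* A pair of equal positions contributes 0 since [u != v]. *)
  have Mb w : (1 - eta) * #|G|%:R ^+ m'.+1 * (w.1 != w.2)%:R <= Mw w <= #|G|%:R ^+ m'.+1 * (w.1 != w.2)%:R.
    case: w => x y /=; case: (eqVneq x y) => [->|xy] /=.
      rewrite !mulr0 /Mw big1 ?lexx // => s /= /andP[/eqP-> /eqP E].
      by move: nuv; rewrite E eqxx.
    have tot : \sum_(s : {ffun 'I_m -> G} | (s x == u) && (s y == v)) 1 = #|G|%:R ^+ m'.+1 :> R.
      rewrite sumr_const -natrX; have := card_two_fixed u v xy; rewrite card_ord => <-.
      by rewrite cardsE.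
    rewrite !mulr1; apply/andP; split; last first.
      by rewrite -tot; apply: ler_sum => s _; case: (good s).
    have -> : Mw (x, y) = #|G|%:R ^+ m'.+1 - \sum_(s : {ffun 'I_m -> G} | (s x == u) && (s y == v)) (~~ good s)%:R.
      by rewrite -tot -sumrB; apply: eq_bigr => s _; case: (good s); rewrite ?subr0 ?subrr.
    rewrite mulrBl mul1r lerD2l lerN2.
    apply: le_trans (_ : \sum_(l : 'I_m) \sum_(s : {ffun 'I_m -> G} | (s x == u) && (s y == v))
        ((degree (l : pull s))%:R < d * #|'I_m|%:R)%R%:R <= _).
      rewrite exchange_big /=; apply: ler_sum => s _; rewrite /good -ltNge card_ord.
      case: (ltrP (min_degree (pull s))%:R (d * m%:R)) => hlt; last by apply: sumr_ge0.
      have G0m : (0 < #|pull s|)%N by rewrite card_ord.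
      have [l El] := min_degree_ex G0m; rewrite (bigD1 l) //= -El hlt lerDl.
      by apply: sumr_ge0.
    apply: le_trans (_ : \sum_(l : 'I_m) expR (- (c * m'%:R)) * #|G|%:R ^+ m'.+1 <= _).
      apply: ler_sum => l _; apply: le_trans (bad_degree G0 d0 eps0 hdeg l u v xy hI) _.
      by rewrite card_ord e3 e2 natrX.
    by rewrite sumr_const card_ord -[X in X <= _]mulr_natl mulrA ler_wpM2r // ltW.
  have nd : \sum_(w : 'I_m * 'I_m) (w.1 != w.2)%:R = m%:R * (m%:R - 1) :> R.
    rewrite -(pair_bigA _ (fun x y : 'I_m => (x != y)%:R)) /=.
    transitivity (\sum_(x : 'I_m) (m%:R - 1) : R); last by rewrite sumr_const card_ord -[LHS]mulr_natl.
    apply: eq_bigr => x _; have -> : \sum_(y : 'I_m) (x != y)%:R = #|[set~ x]|%:R :> R.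
      rewrite -sum1_card natr_sum [RHS]big_mkcond; apply: eq_bigr => y _.
      by rewrite !inE eq_sym; case: (_ == _).
    by rewrite cardsC1 card_ord -subn1 natrB.
  have ZE : Z * (#|G|%:R ^+ m'.+1 * (m%:R * (m%:R - 1))) = 1 / #|G|%:R ^+ 2.
    rewrite /Z; have -> : #|G|%:R ^+ m = #|G|%:R ^+ m'.+1 * #|G|%:R ^+ 2 :> R by rewrite -exprD addn2.
    by field; rewrite !gt_eqF //; lra.
  rewrite S1 S3; apply/andP; split.
    have -> : (1 - eta) / #|G|%:R ^+ 2 = Z * ((1 - eta) * #|G|%:R ^+ m'.+1 * (m%:R * (m%:R - 1))).
      by rewrite -[(1 - eta) / _]mulr1 -mulrA [_^-1 * 1]mulrC -ZE; ring.
    rewrite ler_pM2l // -nd mulr_sumr; apply: ler_sum => w _; by have /andP[] := Mb w.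
  rewrite -ZE ler_pM2l // -nd mulr_sumr; apply: ler_sum => w _; by have /andP[] := Mb w.
Qed.

(** * Duplicating colour classes *)

Definition chom (G : sgraph) (K T : finType) (c : T -> K) (f : T -> G) : Prop :=
  forall x y, c x != c y -> adj (f x) (f y).

(** A measure on homomorphisms to which every edge contributes nearly equally. The lower bound [z]
    on all homomorphisms keeps the conditional masses used in duplication from being small. *)
Definition law (R : realType) (G : sgraph) (K T : finType) (c : T -> K) (C z lo hi : R)
    (p : {ffun T -> G} -> R) : Prop :=
  [/\ forall f, 0 <= p f <= C / #|G|%:R ^+ #|T|,
      forall f, p f != 0 -> chom c f,
      forall f : {ffun T -> G}, chom c f -> z / #|G|%:R ^+ #|T| <= p f &
      forall x y u v, c x != c y -> adj u v ->
        lo / #|G|%:R ^+ 2 <= \sum_(f : {ffun T -> G} | (f x == u) && (f y == v)) p f <= hi / #|G|%:R ^+ 2].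

Arguments law {R} G {K T} c C z lo hi p.

Section Duplication.
Variables (R : realType) (G : sgraph) (K T : finType) (c : T -> K) (C z lo hi : R).
Variables (p : {ffun T -> G} -> R) (a : T).
Hypothesis C0 : 0 < C.
Hypothesis z0 : 0 < z.
Hypothesis G0 : (0 < #|G|)%N.
Hypothesis hG : forall S : {set G}, (#|S| <= #|T|)%N -> (#|G| <= 3 * #|common S|)%N.
Hypothesis lawp : law G c C z lo hi p.

Definition dup_col (o : option T) := if o is Some x then c x else c a.
Let upd (h : {ffun T -> G}) (w : G) : {ffun T -> G} := [ffun x => if x == a then w else h x].
Let res (f : {ffun option T -> G}) : {ffun T -> G} := [ffun x => f (Some x)].
Let alt (f : {ffun option T -> G}) : {ffun T -> G} := upd (res f) (f None).
Let ext (h : {ffun T -> G}) (w : G) : {ffun option T -> G} := [ffun o => if o is Some x then h x else w].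
Let swp (f : {ffun option T -> G}) : {ffun option T -> G} := ext (alt f) (f (Some a)).
Let Pm h := \sum_w p (upd h w).
(* The image of [a] and that of its copy are independent given the images of the other vertices. *)
Let p' f := p (res f) * p (alt f) / Pm (res f).

Let p0 f : 0 <= p f. Proof. by have [h _ _ _] := lawp; have /andP[] := h f. Qed.
Let nR : 0 < #|G|%:R :> R. Proof. by rewrite ltr0n. Qed.

Let upd_id h : upd h (h a) = h.
Proof. by apply/ffunP=> x; rewrite ffunE; case: eqP => [->|]. Qed.
Let upd_upd h w w' : upd (upd h w) w' = upd h w'.
Proof. by apply/ffunP=> x; rewrite !ffunE; case: eqP. Qed.
Let Pm_upd h w : Pm (upd h w) = Pm h.
Proof. by apply: eq_bigr => w' _; rewrite upd_upd. Qed.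
Let p_le_Pm h : p h <= Pm h.
Proof. by rewrite -{1}(upd_id h) /Pm (bigD1 (h a)) //= lerDl sumr_ge0. Qed.
Let res_ext h w : res (ext h w) = h.
Proof. by apply/ffunP=> x; rewrite !ffunE. Qed.
Let ext_res f : ext (res f) (f None) = f.
Proof. by apply/ffunP=> -[x|]; rewrite !ffunE. Qed.
Let res_swp f : res (swp f) = alt f. Proof. exact: res_ext. Qed.
Let alt_swp f : alt (swp f) = res f.
Proof. by rewrite /alt res_swp /alt upd_upd /swp ffunE -{2}(upd_id (res f)) ffunE. Qed.
Let swpK : involutive swp.
Proof.
by move=> f; rewrite /swp alt_swp !ffunE eqxx ext_res.
Qed.

Let p'_swp f : p' (swp f) = p' f.
Proof. by rewrite /p' res_swp alt_swp /alt Pm_upd [X in X / _]mulrC. Qed.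

(** Given the other images, the image of the new vertex has total conditional mass 1; where [Pm h]
    vanishes, so does [p h]. *)
Let marg_res (phi : {ffun T -> G} -> R) : \sum_f p' f * phi (res f) = \sum_h p h * phi h.
Proof.
rewrite (reindex (fun hw : {ffun T -> G} * G => ext hw.1 hw.2)) /=; last first.
  exists (fun f => (res f, f None)) => [[h w] _|f _] /=; last exact: ext_res.
  by rewrite res_ext ffunE.
rewrite -(pair_bigA _ (fun h w => p' (ext h w) * phi (res (ext h w)))) /=; apply: eq_bigr => h _.
have -> : \sum_w p' (ext h w) * phi (res (ext h w)) = p h * (\sum_w p (upd h w)) / Pm h * phi h.
  rewrite mulr_sumr mulr_suml mulr_suml; apply: eq_bigr => w _.
  by rewrite /p' /alt res_ext ffunE.
rewrite -/(Pm h); have [E|nE] := eqVneq (Pm h) 0; last by rewrite mulfK.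
have -> : p h = 0 by apply/eqP; rewrite eq_le p0 andbT -E p_le_Pm.
by rewrite !mul0r.
Qed.

(** Exchanging the images of the vertex and of its copy preserves [p'] and swaps the two
    restrictions. *)
Let marg_alt (phi : {ffun T -> G} -> R) : \sum_f p' f * phi (alt f) = \sum_h p h * phi h.
Proof.
rewrite -marg_res (reindex_inj (inv_inj swpK)); apply: eq_bigr => f _.
by rewrite p'_swp alt_swp.
Qed.

Let hom_upd (h : {ffun T -> G}) w : chom c h -> w \in common [set h y | y in [pred y | c y != c a]] -> chom c (upd h w).
Proof.
move=> hh hw x y cxy; rewrite !ffunE; case: (eqVneq x a) => [Ex|_]; case: (eqVneq y a) => [Ey|_].
- by move: cxy; rewrite Ex Ey eqxx.
- by apply: (commonP hw); apply/imsetP; exists y; rewrite ?inE // -Ex eq_sym.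
- by rewrite adj_sym; apply: (commonP hw); apply/imsetP; exists x; rewrite ?inE // -Ey.
- exact: hh.
Qed.

(** A pair with the new vertex is a pair with [a] in the restriction [alt], which again has law [p],
    so edge marginals are unchanged. The density bounds follow because [Pm] has the order of [#|G|]
    single masses: any [#|T|] vertices have a positive proportion of common neighbours. *)
Lemma duplicate : exists q, law G dup_col (3 * C ^+ 2 / z) (z ^+ 2 / C) lo hi q.
Proof.
have [pC psupp pz pm] := lawp.
pose t := #|T|; have nt : 0 < #|G|%:R ^+ t :> R by apply: exprn_gt0.
have Pm0 (h : {ffun T -> G}) : 0 <= Pm h by apply: sumr_ge0.
have Pm_low (h : {ffun T -> G}) : chom c h -> #|G|%:R / 3 * (z / #|G|%:R ^+ t) <= Pm h.
  move=> hh; set S := [set h y | y in [pred y | c y != c a]].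
  have cS : (#|S| <= #|T|)%N by apply: leq_trans (leq_imset_card _ _) (max_card _).
  apply: le_trans (_ : #|common S|%:R * (z / #|G|%:R ^+ t) <= _).
    rewrite ler_wpM2r //; first by rewrite divr_ge0 // ltW.
    by rewrite ler_pdivrMr // mulrC -natrM ler_nat; apply: hG.
  rewrite mulr_natl -sumr_const /Pm [X in X <= _]big_mkcond; apply: ler_sum => w _; case: ifP => // hw.
  by apply: pz; apply: hom_upd.
have Pm_up (h : {ffun T -> G}) : Pm h <= #|G|%:R * (C / #|G|%:R ^+ t).
  rewrite mulr_natl -sumr_const; apply: ler_sum => w _; by have /andP[] := pC (upd h w).
exists p'; split.
- move=> f; apply/andP; split; first by rewrite /p' divr_ge0 // mulr_ge0.
  have rhs0 : 0 <= 3 * C ^+ 2 / z / #|G|%:R ^+ #|{: option T}|.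
    apply: divr_ge0; last exact: exprn_ge0.
    by apply: divr_ge0; [apply: mulr_ge0 => //; apply: sqr_ge0|exact: ltW].
  have [E|nE] := eqVneq (p (res f)) 0; first by rewrite /p' E !mul0r.
  have hP := Pm_low _ (psupp _ nE).
  have d0 : 0 < #|G|%:R / 3 * (z / #|G|%:R ^+ t) by apply: mulr_gt0; apply: divr_gt0.
  have Pp := lt_le_trans d0 hP.
  rewrite /p' ler_pdivrMr //.
  have /andP[_ h1] := pC (res f); have /andP[_ h2] := pC (alt f).
  apply: le_trans (_ : (C / #|G|%:R ^+ t) * (C / #|G|%:R ^+ t) <= _); first by apply: ler_pM.
  apply: le_trans (_ : 3 * C ^+ 2 / z / #|G|%:R ^+ #|{: option T}| * (#|G|%:R / 3 * (z / #|G|%:R ^+ t)) <= _).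
    rewrite card_option -/t [_ ^+ t.+1]exprS le_eqVlt; apply/orP; left; apply/eqP.
    by move: (_ ^+ t) nt nR => y y0; move: #|G|%:R => w w0; field; rewrite !gt_eqF.
  by rewrite ler_wpM2l.
- move=> f pf.
  have h1 : p (res f) != 0 by apply: contraNneq pf => E; rewrite /p' E !mul0r.
  have h2 : p (alt f) != 0 by apply: contraNneq pf => E; rewrite /p' E mulr0 mul0r.
  have {}h1 := psupp _ h1; have {}h2 := psupp _ h2.
  move=> [x|] [y|] /= cxy; last by rewrite eqxx in cxy.
  + by have := h1 x y cxy; rewrite !ffunE.
  + have := h2 x a cxy; rewrite !ffunE eqxx; case: eqP => // E; by rewrite E eqxx in cxy.
  + have := h2 a y cxy; rewrite !ffunE eqxx; case: eqP => // E; by rewrite E eqxx in cxy.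
- move=> f hf.
  have h1 : chom c (res f) by move=> x y cxy; rewrite !ffunE; apply: hf.
  have h2 : chom c (alt f).
    move=> x y cxy; rewrite !ffunE; case: (eqVneq x a) => [Ex|_]; case: (eqVneq y a) => [Ey|_]; apply: hf => //=.
    + by move: cxy; rewrite Ex Ey eqxx.
    + by rewrite -Ex.
    + by rewrite -Ey.
  have d0 : 0 < #|G|%:R / 3 * (z / #|G|%:R ^+ t) by apply: mulr_gt0; apply: divr_gt0.
  have Pp := lt_le_trans d0 (Pm_low _ h1).
  rewrite /p' ler_pdivlMr //.
  apply: le_trans (_ : (z / #|G|%:R ^+ t) * (z / #|G|%:R ^+ t) <= _); last first.
    by apply: ler_pM; rewrite ?divr_ge0 ?(ltW z0) ?(ltW nt) //; apply: pz.
  apply: le_trans (_ : z ^+ 2 / C / #|G|%:R ^+ #|{: option T}| * (#|G|%:R * (C / #|G|%:R ^+ t)) <= _).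
    rewrite ler_wpM2l //; apply: divr_ge0; last exact: exprn_ge0.
    by apply: divr_ge0; [apply: sqr_ge0|exact: ltW].
  rewrite card_option -/t [_ ^+ t.+1]exprS le_eqVlt; apply/orP; left; apply/eqP.
  by field; rewrite !gt_eqF.
- have tr (b : bool) (e : R) : (if b then e else 0) = e * b%:R by case: b; rewrite ?mulr1 ?mulr0.
  move=> [x|] [y|] u v /= cxy uv; last by rewrite eqxx in cxy.
  + rewrite (_ : \sum_(f | _) p' f = \sum_(h : {ffun T -> G} | (h x == u) && (h y == v)) p h); first exact: pm.
    rewrite big_mkcond [RHS]big_mkcond.
    under [RHS]eq_bigr do rewrite tr.
    rewrite -(marg_res (fun h => ((h x == u) && (h y == v))%:R)); apply: eq_bigr => f _.
    by rewrite tr !ffunE.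
  + have xa : x == a = false by apply: contraNF cxy => /eqP->.
    rewrite (_ : \sum_(f | _) p' f = \sum_(h : {ffun T -> G} | (h x == u) && (h a == v)) p h); first exact: pm.
    rewrite big_mkcond [RHS]big_mkcond.
    under [RHS]eq_bigr do rewrite tr.
    rewrite -(marg_alt (fun h => ((h x == u) && (h a == v))%:R)); apply: eq_bigr => f _.
    by rewrite tr !ffunE eqxx xa.
  + have ya : y == a = false by apply: contraNF cxy => /eqP->.
    rewrite (_ : \sum_(f | _) p' f = \sum_(h : {ffun T -> G} | (h a == u) && (h y == v)) p h); first exact: pm.
    rewrite big_mkcond [RHS]big_mkcond.
    under [RHS]eq_bigr do rewrite tr.
    rewrite -(marg_alt (fun h => ((h a == u) && (h y == v))%:R)); apply: eq_bigr => f _.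
    by rewrite tr !ffunE eqxx ya.
Qed.

End Duplication.

(** The [K] original vertices are kept and one duplicate is added for each element of [l], so all
    steps look alike; the originals are summed out in [copy_law]. *)
Lemma duplicate_seq (R : realType) (U : finType) (K : finType) (cU : U -> K) (C0 z0 : R) (D : nat) (l : seq U) :
  0 < C0 -> 0 < z0 -> uniq l -> (#|K| + size l <= D)%N ->
  exists (T : finType) (c : T -> K) (emb : U -> T) (C z : R),
  [/\ 0 < C, 0 < z, #|T| = (#|K| + size l)%N, {in l &, injective emb} & 
   [/\ forall u, u \in l -> c (emb u) = cU u, forall i, exists a, c a = i &
   forall (G : sgraph) lo hi (p0 : {ffun K -> G} -> R), (0 < #|G|)%N ->
     (forall S : {set G}, (#|S| <= D)%N -> (#|G| <= 3 * #|common S|)%N) ->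
     law G (@id K) C0 z0 lo hi p0 -> exists p, law G c C z lo hi p]].
Proof.
move=> C00 z00; elim: l => [|u l IH] /=.
  move=> _ _; exists K, id, cU, C0, z0; split=> //; first by rewrite addn0.
  by split=> [//|i|G lo hi p0 _ _ hp]; [exists i|exists p0].
move=> /andP[ul unl]; rewrite addnS => hD.
have [T [c [emb [C [z [C1 z1 cT ei [ec sc hl]]]]]]] := IH unl (ltnW hD).
have [a ha] := sc (cU u).
exists (option T), (dup_col c a), (fun w => if w == u then None else Some (emb w)), (3 * C ^+ 2 / z), (z ^+ 2 / C); split.
- by apply: divr_gt0 => //; apply: mulr_gt0 => //; apply: exprn_gt0.
- by apply: divr_gt0 => //; apply: exprn_gt0.
- by rewrite card_option cT.
- move=> w w'; rewrite !inE; case: (eqVneq w u) => [->|nw]; case: (eqVneq w' u) => [->|nw'] //= h h' [E].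
  exact: ei.
split.
- by move=> w; rewrite inE; case: (eqVneq w u) => [->|nw] //= /ec.
- by move=> i; have [b hb] := sc i; exists (Some b).
move=> G lo hi p0 G0 hG hp; have [p lp] := hl G lo hi p0 G0 hG hp.
apply: (duplicate a C1 z1 G0 _ lp) => S hS; apply: hG; apply: leq_trans hS _.
by rewrite cT ltnW.
Qed.

(* A small multiple of the uniform measure on cliques makes the law bounded below on all cliques. *)
Lemma base_law (R : realType) (G : sgraph) (r : nat) (C eta : R) (p : {ffun 'I_r -> G} -> R) :
  (1 < r)%N -> 0 < eta -> (0 < #|G|)%N ->
  (forall f, 0 <= p f <= C / #|G|%:R ^+ r) ->
  (forall f, p f != 0 -> forall i j, i != j -> adj (f i) (f j)) ->
  (forall (i j : 'I_r) (u v : G), i != j -> adj u v ->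
      (1 - eta) / #|G|%:R ^+ 2 <= \sum_(f : {ffun 'I_r -> G} | (f i == u) && (f j == v)) p f <= 1 / #|G|%:R ^+ 2) ->
  exists q, law G (@id 'I_r) (C + eta) eta (1 - eta) (1 + eta) q.
Proof.
move=> r1 eta0 G0 pC psupp pm; have nR : 0 < #|G|%:R :> R by rewrite ltr0n.
pose cl (f : {ffun 'I_r -> G}) : bool := [forall x, forall y, (x != y) ==> adj (f x) (f y)].
have clP f : cl f <-> chom (@id 'I_r) f.
  split=> [/forallP h x y xy|h].
    by have /forallP/(_ y)/implyP := h x; apply.
  by apply/forallP=> x; apply/forallP=> y; apply/implyP=> xy; apply: h.
have e0 : 0 <= eta / #|G|%:R ^+ r by rewrite divr_ge0 ?exprn_ge0 // ltW.
exists (fun f => p f + (cl f)%:R * (eta / #|G|%:R ^+ r)); split.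
- move=> f; have /andP[h1 h2] := pC f; rewrite card_ord; apply/andP; split.
    by apply: addr_ge0 => //; apply: mulr_ge0.
  rewrite mulrDl; apply: lerD => //.
  by rewrite -[X in _ <= X]mul1r ler_wpM2r // lern1 leq_b1.
- move=> f; have [E|/psupp h _] := eqVneq (p f) 0; last by move=> x y; apply: h.
  rewrite E add0r; case: (boolP (cl f)) => [/clP //|_]; by rewrite mul0r eqxx.
- move=> f /clP hf; rewrite hf mul1r card_ord lerDr; by have /andP[] := pC f.
move=> i j u v ij uv; have /andP[h1 h2] := pm i j u v ij uv.
rewrite big_split /=; apply/andP; split.
  by apply: le_trans h1 _; rewrite lerDl sumr_ge0 // => f _; rewrite mulr_ge0.
rewrite mulrDl lerD //; apply: le_trans (_ : \sum_(f : {ffun 'I_r -> G} | (f i == u) && (f j == v)) eta / #|G|%:R ^+ r <= _).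
  by apply: ler_sum => f _; rewrite -[X in _ <= X]mul1r ler_wpM2r // lern1 leq_b1.
rewrite (eq_bigl (fun f => f \in [set f : {ffun 'I_r -> G} | (f i == u) && (f j == v)])) => [|f]; last by rewrite inE.
rewrite sumr_const card_two_fixed // card_ord -[_ *+ _]mulr_natl natrX.
have -> : #|G|%:R ^+ r = #|G|%:R ^+ (r - 2) * #|G|%:R ^+ 2 :> R by rewrite -exprD subnK.
move: (_ ^+ (r - 2)) (exprn_gt0 (r - 2) nR) (_ ^+ 2) (exprn_gt0 2 nR) => a a0 b b0.
by rewrite le_eqVlt; apply/orP; left; apply/eqP; field; rewrite !gt_eqF.
Qed.

(** Restrict the law on the duplicated clique to the duplicates. A map on [F] has at most n^r
    extensions, which is just the missing power of n in the density bound. *)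
Lemma copy_law (R : realType) (F : sgraph) (r : nat) (d eps eta : R) :
  (1 < r)%N -> 0 <= d -> 0 < eps -> 0 < eta -> colorable F r ->
  (exists M, forall m, (M <= m)%N -> forall G : sgraph, #|G| = m -> d * m%:R <= (min_degree G)%:R ->
     has_fractional_decomposition R (complete_graph r) G) ->
  exists C : R, 0 < C /\ forall G : sgraph, (0 < #|G|)%N -> (d + eps) * #|G|%:R <= (min_degree G)%:R ->
    (forall S : {set G}, (#|S| <= r + #|F|)%N -> (#|G| <= 3 * #|common S|)%N) ->
  exists p : {ffun F -> G} -> R, [/\ forall f, 0 <= p f <= C / #|G|%:R ^+ #|F|,
    forall f, p f != 0 -> forall x y, adj x y -> adj (f x) (f y) &
    forall (x y : F) (u v : G), adj x y -> adj u v ->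
      (1 - eta) / #|G|%:R ^+ 2 <= \sum_(f : {ffun F -> G} | (f x == u) && (f y == v)) p f <= (1 + eta) / #|G|%:R ^+ 2].
Proof.
move=> r1 d0 eps0 eta0 /existsP[cF /forallP hcF] hM.
have [C0 [C00 hC0]] := clique_law r1 d0 eps0 eta0 hM.
have [|//||T [c [emb [C [z [C1 z1 cT ei [ec sc hl]]]]]]] :=
  @duplicate_seq R F 'I_r cF (C0 + eta) eta (r + #|F|) (enum F) _ eta0.
- exact: addr_gt0.
- exact: enum_uniq.
- by rewrite card_ord -cardE.
have {}ei : injective emb by move=> x y; apply: ei; rewrite mem_enum.
have {}ec x : c (emb x) = cF x by apply: ec; rewrite mem_enum.
exists C; split=> // G G0 hG hc; have nR : 0 < #|G|%:R :> R by rewrite ltr0n.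
have [p0 [h1 h2 h3]] := hC0 G G0 hG; have [q0 hq0] := base_law r1 eta0 G0 h1 h2 h3.
have [p [pC psupp _ pm]] := hl G _ _ q0 G0 hc hq0.
pose pr (f : {ffun T -> G}) : {ffun F -> G} := [ffun x => f (emb x)].
have cadj x y : adj x y -> c (emb x) != c (emb y).
  by move=> xy; rewrite !ec; have /forallP/(_ y)/implyP := hcF x; apply.
have p0' f : 0 <= p f by have /andP[] := pC f.
exists (fun g => \sum_(f | pr f == g) p f); split.
- move=> g; rewrite sumr_ge0 //=.
  have cnt : (#|[set f | pr f == g]| <= #|G| ^ r)%N.
    have cD : #|~: (emb @: [set: F])| = r.
      by rewrite cardsCs finset.setCK card_imset // cardsT cT card_ord -cardE addnK.
    rewrite -{1}cD; apply: card_determined => f h; rewrite !inE => /eqP Ef /eqP Eh E.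
    apply/ffunP=> w; case: (boolP (w \in emb @: [set: F])) => [/imsetP[x _ ->]|nw].
      by have := congr1 (fun u : {ffun F -> G} => u x) Ef; rewrite -Eh !ffunE.
    by apply: E; rewrite inE.
  apply: le_trans (_ : \sum_(f | pr f == g) C / #|G|%:R ^+ #|T| <= _).
    by apply: ler_sum => f _; have /andP[] := pC f.
  rewrite sumr_const -[_ *+ _]mulr_natl.
  apply: le_trans (_ : (#|G| ^ r)%:R * (C / #|G|%:R ^+ #|T|) <= _).
    rewrite ler_wpM2r ?divr_ge0 ?exprn_ge0 ?(ltW C1) // ler_nat.
    by apply: leq_trans cnt; apply: subset_leq_card; apply/fintype.subsetP=> f; rewrite inE.
  rewrite cT card_ord -cardE exprD natrX le_eqVlt; apply/orP; left; apply/eqP.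
  move: (_ ^+ r) (_ ^+ #|F|) (exprn_gt0 r nR) (exprn_gt0 #|F| nR) => a b a0 b0.
  by field; rewrite !gt_eqF.
- move=> g gn x y xy.
  have [f /andP[/eqP Ef pf]] : exists f, (pr f == g) && (p f != 0).
    apply/existsP; apply: contraNT gn => /existsPn h; rewrite big1 // => f Ef.
    by apply/eqP; have := h f; rewrite Ef negbK.
  by rewrite -Ef !ffunE; apply: psupp pf _ _ (cadj _ _ xy).
move=> x y u v xy uv.
have -> : \sum_(g : {ffun F -> G} | (g x == u) && (g y == v)) \sum_(f | pr f == g) p f =
   \sum_(f : {ffun T -> G} | (f (emb x) == u) && (f (emb y) == v)) p f.
  rewrite [RHS](partition_big pr (fun g => (g x == u) && (g y == v))) /=; last first.
    by move=> f; rewrite !ffunE.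
  apply: eq_bigr => g hg; apply: eq_bigl => f; case: eqP => [E|]; rewrite ?andbF ?andbT //.
  by move: hg; rewrite -E !ffunE.
exact: pm (cadj _ _ xy) uv.
Qed.

Local Close Scope ring_scope.

(** * Packing almost all edges *)

Lemma handshake (G : sgraph) : \sum_(x : G) degree x = 2 * num_edges G.
Proof.
under eq_bigr do rewrite -card_star -sum1_card.
rewrite (exchange_big_dep (fun e => e \in edges G)) /=; last by move=> x e _; rewrite inE => /andP[].
rewrite mulnC -sum_nat_const; apply: eq_bigr => e eE.
rewrite -(edges_card2 eE) -sum1_card; apply: eq_bigl => x; by rewrite inE eE.
Qed.

Lemma card_three (I V : finType) (x y z : I) (FF : {set {ffun I -> V}}) : x != y -> z != x -> z != y ->
  (forall f h, f \in FF -> h \in FF -> {in ~: [set x; y; z], f =1 h} -> f = h) ->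
  #|FF| * #|V| ^ 3 <= #|V| ^ #|I|.
Proof.
move=> xy zx zy det; have c3 : #|[set x; y; z]| = 3.
  by rewrite finset.setUC cardsU1 cards2 !inE negb_or xy zx zy.
have <- : #|~: [set x; y; z]| + 3 = #|I| by rewrite -c3 addnC cardsC.
by rewrite expnD leq_mul2r card_determined ?orbT.
Qed.

(** Maps with three prescribed values are a fraction n^-3 of all maps; here the prescription may be
    chosen among [#|J|] ones. *)
Lemma cover_three (I V J : finType) (FF : {set {ffun I -> V}}) (Fj : J -> {set {ffun I -> V}}) :
  (forall f, f \in FF -> exists j, f \in Fj j) -> (forall j, #|Fj j| * #|V| ^ 3 <= #|V| ^ #|I|) ->
  #|FF| * #|V| ^ 3 <= #|J| * #|V| ^ #|I|.
Proof.
move=> hF hj; apply: leq_trans (_ : (\sum_j #|Fj j|) * #|V| ^ 3 <= _).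
  rewrite leq_mul2r; apply/orP; right.
  under eq_bigr do rewrite -sum1_card.
  rewrite (exchange_big_dep predT) //= -sum1_card big_mkcond; apply: leq_sum => f _; case: ifP => // /hF[j hj'].
  by rewrite sum1_card; apply/card_gt0P; exists j.
by rewrite big_distrl /= -sum_nat_const; apply: leq_sum => j _; apply: hj.
Qed.

Definition copy_edges (F G : sgraph) (f : {ffun F -> G}) : {set {set G}} := [set f @: (A : {set F}) | A in edges F].

Lemma copy_edgesP (F G : sgraph) (f : {ffun F -> G}) (e : {set G}) :
  reflect (exists x y, adj x y /\ e = [set f x; f y]) (e \in copy_edges f).
Proof.
apply: (iffP imsetP) => [[A /edgesP[x [y [xy ->]]] ->]|[x [y [xy ->]]]].
  by exists x, y; rewrite imsetU1 imset_set1.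
by exists [set x; y]; rewrite ?edges_pair // imsetU1 imset_set1.
Qed.

Lemma copy_edges_pair (F G : sgraph) (f : {ffun F -> G}) (u v : G) : u != v ->
  [set u; v] \in copy_edges f -> exists x y, [/\ adj x y, f x = u & f y = v].
Proof.
move=> uv /copy_edgesP[x [y [xy E]]].
have : u \in [set f x; f y] by rewrite -E !inE eqxx.
have : v \in [set f x; f y] by rewrite -E !inE eqxx orbT.
rewrite !inE => /orP[]/eqP Ev /orP[]/eqP Eu.
- by move: uv; rewrite Eu Ev eqxx.
- by exists y, x; rewrite adj_sym.
- by exists x, y.
- by move: uv; rewrite Eu Ev eqxx.
Qed.

(** By injectivity at most one ordered edge of [F] is mapped to [(u, v)]. *)
Lemma copy_edges_sum (F G : sgraph) (f : {ffun F -> G}) (u v : G) : injective f -> u != v ->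
  ([set u; v] \in copy_edges f : nat) = \sum_(z : F * F | adj z.1 z.2) ((f z.1 == u) && (f z.2 == v)).
Proof.
move=> fi uv; case: (boolP (_ \in _)) => [/(copy_edges_pair uv)[x [y [xy fx fy]]]|ne].
  rewrite (bigD1 (x, y)) //= fx fy !eqxx big1 // => -[x' y'] /= /andP[_ ne].
  by apply/eqP; rewrite eqb0; apply: contra ne => /andP[/eqP h1 /eqP h2]; rewrite -fx in h1; rewrite -fy in h2; rewrite (fi _ _ h1) (fi _ _ h2).
rewrite big1 // => -[x y] /= xy; apply/eqP; rewrite eqb0; apply: contra ne => /andP[/eqP<- /eqP<-].
by apply/copy_edgesP; exists x, y.
Qed.

Local Open Scope ring_scope.

Section Weights.
Variables (R : realType) (F G : sgraph) (C eta : R) (p : {ffun F -> G} -> R).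
Hypothesis k0 : (0 < num_edges F)%N.
Hypothesis G0 : (0 < #|G|)%N.
Hypothesis C0 : 0 < C.
Hypothesis pC : forall f, 0 <= p f <= C / #|G|%:R ^+ #|F|.
Hypothesis psupp : forall f, p f != 0 -> forall x y, adj x y -> adj (f x) (f y).
Hypothesis pm : forall (x y : F) (u v : G), adj x y -> adj u v ->
  (1 - eta) / #|G|%:R ^+ 2 <= \sum_(f : {ffun F -> G} | (f x == u) && (f y == v)) p f <= (1 + eta) / #|G|%:R ^+ 2.

Let nR : 0 < #|G|%:R :> R. Proof. by rewrite ltr0n. Qed.
Let p0 f : 0 <= p f. Proof. by have /andP[] := pC f. Qed.

Lemma small_sum (FF : {set {ffun F -> G}}) m : (#|FF| * #|G| ^ 3 <= m * #|G| ^ #|F|)%N ->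
  \sum_(f in FF) p f <= m%:R * C / #|G|%:R ^+ 3.
Proof.
move=> h; apply: le_trans (_ : \sum_(f in FF) C / #|G|%:R ^+ #|F| <= _).
  by apply: ler_sum => f _; have /andP[] := pC f.
rewrite sumr_const -[_ *+ _]mulr_natl ler_pdivlMr ?exprn_gt0 //.
rewrite -(ler_nat R) !natrM !natrX in h.
have a0 : 0 < #|G|%:R ^+ #|F| :> R by apply: exprn_gt0.
rewrite mulrA -[X in X <= _]mulrAC ler_pdivrMr //.
rewrite -[X in X <= _]mulrAC [X in _ <= X]mulrAC; by rewrite ler_wpM2r // ltW.
Qed.

(** A fixed edge is the image of one of [2 * num_edges F] ordered edges, each with mass close to
    n^-2; the factor normalises its weighted degree to about 1. *)
Definition weight (K : {set {set G}}) : R :=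
  #|G|%:R ^+ 2 / (2 * num_edges F)%:R * \sum_(f : {ffun F -> G} | injectiveb f && (copy_edges f == K)) p f.

Lemma weight_ge0 K : 0 <= weight K.
Proof. by rewrite mulr_ge0 ?divr_ge0 ?sqr_ge0 // sumr_ge0. Qed.

Lemma weight_supp K : weight K != 0 -> exists f : {ffun F -> G}, [/\ injective f, copy_edges f = K & K \subset edges G].
Proof.
move=> wK; have [f /andP[/andP[/injectiveP fi /eqP E] pf]] : exists f : {ffun F -> G}, (injectiveb f && (copy_edges f == K)) && (p f != 0).
  apply/existsP; apply: contraNT wK => /existsPn h; rewrite /weight big1 ?mulr0 // => f hf.
  by apply/eqP; have := h f; rewrite hf negbK.
exists f; split=> //; apply/fintype.subsetP=> e; rewrite -E => /copy_edgesP[x [y [xy ->]]].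
by rewrite edges_pair; apply: psupp.
Qed.

Lemma weight_sum (Q : pred {set {set G}}) :
  \sum_(K : {set {set G}} | Q K) weight K =
  #|G|%:R ^+ 2 / (2 * num_edges F)%:R * \sum_(f : {ffun F -> G} | injectiveb f && Q (copy_edges f)) p f.
Proof.
rewrite -mulr_sumr; congr (_ * _).
rewrite [RHS](partition_big (@copy_edges F G) Q) /=; last by move=> f /andP[].
apply: eq_bigr => K QK; apply: eq_bigl => f; case: eqP => [->|]; rewrite ?andbF ?andbT //.
by rewrite QK andbT.
Qed.

Lemma weight_card K : weight K != 0 -> #|K| = num_edges F.
Proof. by case/weight_supp=> f [fi <- _]; rewrite card_imset //; apply: finset.imset_inj. Qed.

(** Two different edges span at least three vertices, so the maps through both have three prescribed
    values. *)
Lemma weight_codeg e e' : e != e' ->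
  \sum_(K : {set {set G}} | (e \in K) && (e' \in K)) weight K <= (#|F| ^ 3)%:R * C / #|G|%:R.
Proof.
move=> ne; rewrite (weight_sum (fun K => (e \in K) && (e' \in K))).
pose FF := [set f : {ffun F -> G} | injectiveb f && ((e \in copy_edges f) && (e' \in copy_edges f))].
have cF : (#|FF| * #|G| ^ 3 <= #|F| ^ 3 * #|G| ^ #|F|)%N.
  case: (set_0Vmem FF) => [->|[f0]]; first by rewrite cards0 mul0n.
  rewrite inE => /and3P[/injectiveP fi /copy_edgesP[x0 [y0 [xy0 E0]]] /copy_edgesP[x1 [y1 [xy1 E1]]]].
  set u := f0 x0 in E0; set v := f0 y0 in E0.
  have uv : u != v by rewrite (inj_eq fi) adj_neq.
  have [w we' we] : exists2 w, w \in e' & w \notin e.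
    apply/subsetPn; apply: contra ne => sub; rewrite eq_sym eqEcard sub /= E0 E1 !cards2 uv.
    by rewrite (inj_eq fi) (adj_neq xy1).
  pose Fj (j : F * F * F) := [set f : {ffun F -> G} | [&& j.1.1 != j.1.2, j.2 != j.1.1 & j.2 != j.1.2] &&
     [&& f j.1.1 == u, f j.1.2 == v & f j.2 == w]].
  have -> : (#|F| ^ 3 = #|{: F * F * F}|)%N by rewrite !card_prod !expnS expn0 muln1 mulnA.
  apply: (@cover_three _ _ _ FF Fj) => [f|[[x y] z]].
    rewrite inE => /and3P[/injectiveP fi' h1 h2]; rewrite E0 in h1.
    have [x [y [xy fx fy]]] := copy_edges_pair uv h1.
    have [z fz] : exists z, f z = w.
      by case/copy_edgesP: h2 => a [b [_ E]]; move: we'; rewrite E !inE => /orP[]/eqP->; [exists a|exists b].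
    exists (x, y, z); rewrite inE /= fx fy fz !eqxx (adj_neq xy) /= !andbT.
    move: we; rewrite E0 !inE negb_or -fx -fy -fz !(inj_eq fi') => /andP[-> ->]; by [].
  case: (boolP [&& x != y, z != x & z != y]) => [/and3P[xy zx zy]|nd]; last first.
    rewrite (_ : Fj _ = finset.set0) ?cards0 ?mul0n //; apply/finset.setP=> f; rewrite !inE /=.
    by rewrite (negPf nd).
  apply: card_three xy zx zy _ => f h; rewrite !inE => /andP[_ /and3P[/eqP f1 /eqP f2 /eqP f3]] /andP[_ /and3P[/eqP h1 /eqP h2 /eqP h3]] E.
  apply/ffunP=> i; rewrite /= in f1 f2 f3 h1 h2 h3; case: (eqVneq i x) => [->|ix]; first by rewrite f1 h1.
  case: (eqVneq i y) => [->|iy]; first by rewrite f2 h2.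
  case: (eqVneq i z) => [->|iz]; first by rewrite f3 h3.
  by apply: E; rewrite !inE !negb_or ix iy iz.
have hs := small_sum cF.
rewrite (eq_bigl (fun f => f \in FF)) => [|f]; last by rewrite inE.
apply: le_trans (_ : #|G|%:R ^+ 2 / (2 * num_edges F)%:R * ((#|F| ^ 3)%:R * C / #|G|%:R ^+ 3) <= _).
  by rewrite ler_wpM2l // divr_ge0 // sqr_ge0.
have kR : 1 <= (2 * num_edges F)%:R :> R by rewrite ler1n muln_gt0 k0.
have k1 : (2 * num_edges F)%:R^-1 <= 1 :> R by rewrite invf_le1 // (lt_le_trans _ kR).
have -> : #|G|%:R ^+ 2 / (2 * num_edges F)%:R * ((#|F| ^ 3)%:R * C / #|G|%:R ^+ 3) = (2 * num_edges F)%:R^-1 * ((#|F| ^ 3)%:R * C / #|G|%:R).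
  by move: (_ %:R^-1) => y; move: #|G|%:R nR => x x0; move: (_ ^ 3)%N => m; field; rewrite gt_eqF.
have h0 : 0 <= (#|F| ^ 3)%:R * C / #|G|%:R by rewrite divr_ge0 // mulr_ge0 // ltW.
by rewrite -[X in _ <= X]mul1r ler_wpM2r.
Qed.

(** A collision determines a third value besides those at [x] and [y]. *)
Lemma noninj_sum (x y : F) (u v : G) : adj x y -> u != v ->
  \sum_(f : {ffun F -> G} | ((f x == u) && (f y == v)) && ~~ injectiveb f) p f <= (#|F| ^ 2)%:R * C / #|G|%:R ^+ 3.
Proof.
move=> xy uv; pose FF := [set f : {ffun F -> G} | ((f x == u) && (f y == v)) && ~~ injectiveb f].
rewrite (eq_bigl (fun f => f \in FF)) => [|f]; last by rewrite inE.
apply: small_sum; pose Fj (j : F * F) := [set f : {ffun F -> G} | [&& f x == u, f y == v, j.1 \notin [set x; y], j.1 != j.2 & f j.1 == f j.2]].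
have -> : (#|F| ^ 2 = #|{: F * F}|)%N by rewrite card_prod.
apply: (@cover_three _ _ _ FF Fj) => [f|[z z']].
  rewrite inE => /andP[/andP[/eqP fx /eqP fy]].
  move/injectivePn => [z [z' zz' E]].
  case: (boolP (z \in [set x; y])) => hz; last by exists (z, z'); rewrite inE /= fx fy E zz' !eqxx hz.
  case: (boolP (z' \in [set x; y])) => hz'; last by exists (z', z); rewrite inE /= fx fy E eq_sym zz' !eqxx hz'.
  move: hz hz'; rewrite !inE => /orP[]/eqP Ez /orP[]/eqP Ez'; move: zz' E; rewrite Ez Ez' ?eqxx // fx fy => _ E.
  - by move: uv; rewrite E eqxx.
  - by move: uv; rewrite E eqxx.
rewrite /Fj /=; case: (boolP ((z \notin [set x; y]) && (z != z'))) => [|nd]; last first.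
  rewrite (_ : [set f | _] = finset.set0) ?cards0 ?mul0n //; apply/finset.setP=> f; rewrite !inE /=.
  by move: nd; rewrite !inE negb_and; case/orP=> /negPf->; rewrite ?andbF.
rewrite !inE negb_or => /andP[/andP[zx zy] zz'].
apply: card_three (adj_neq xy) zx zy _ => f h; rewrite !inE => /and4P[/eqP f1 /eqP f2 _ /andP[_ /eqP f3]] /and4P[/eqP h1 /eqP h2 _ /andP[_ /eqP h3]] E.
have E' i : i != z -> f i = h i.
  move=> iz; case: (eqVneq i x) => [->|ix]; first by rewrite f1 h1.
  case: (eqVneq i y) => [->|iy]; first by rewrite f2 h2.
  by apply: E; rewrite !inE !negb_or ix iy iz.
apply/ffunP=> i; case: (eqVneq i z) => [->|/E' //].
by rewrite f3 h3 E' // eq_sym.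
Qed.

Lemma weight_deg e : e \in edges G ->
  `|\sum_(K : {set {set G}} | e \in K) weight K - 1| <= eta + (#|F| ^ 2)%:R * C / #|G|%:R.
Proof.
case/edgesP=> u [v [uv ->]]; have nuv := adj_neq uv.
rewrite (weight_sum (fun K : {set {set G}} => [set u; v] \in K)).
pose I (z : F * F) := \sum_(f : {ffun F -> G} | ((f z.1 == u) && (f z.2 == v)) && injectiveb f) p f.
have -> : \sum_(f : {ffun F -> G} | injectiveb f && ([set u; v] \in copy_edges f)) p f = \sum_(z : F * F | adj z.1 z.2) I z.
  have -> : \sum_(f : {ffun F -> G} | injectiveb f && ([set u; v] \in copy_edges f)) p f =
      \sum_(f : {ffun F -> G} | injectiveb f) p f * ([set u; v] \in copy_edges f)%:R.
    rewrite big_mkcondr; apply: eq_bigr => f _; by case: (_ \in _); rewrite ?mulr1 ?mulr0.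
  transitivity (\sum_(f : {ffun F -> G} | injectiveb f) \sum_(z : F * F | adj z.1 z.2) p f * ((f z.1 == u) && (f z.2 == v))%:R).
    apply: eq_bigr => f /injectiveP fi; by rewrite (copy_edges_sum fi nuv) natr_sum mulr_sumr.
  rewrite exchange_big /=; apply: eq_bigr => z _.
  rewrite /I [RHS]big_mkcondl; apply: eq_bigr => f _; by case: ifP; rewrite ?mulr1 ?mulr0.
pose c := (#|F| ^ 2)%:R * C / #|G|%:R ^+ 3.
have hI z : adj z.1 z.2 -> (1 - eta) / #|G|%:R ^+ 2 - c <= I z <= (1 + eta) / #|G|%:R ^+ 2.
  move=> zz; have /andP[m1 m2] := pm zz uv; have m3 := noninj_sum zz nuv; rewrite -/c in m3.
  move: m1 m2; rewrite (bigID (fun f : {ffun F -> G} => injectiveb f)) /= -/(I z) => m1 m2.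
  have m4 : 0 <= \sum_(f : {ffun F -> G} | ((f z.1 == u) && (f z.2 == v)) && ~~ injectiveb f) p f by apply: sumr_ge0.
  move: m1 m2 m3 m4; move: (\sum_(f | _ && ~~ _) p f) (I z) ((1 - eta) / _) ((1 + eta) / _) c => t1 t2 t3 t4 t5; lra.
pose M := (2 * num_edges F)%N.
have cM : #|[pred z : F * F | adj z.1 z.2]| = M.
  rewrite /M -handshake -sum1_card (eq_bigl (fun z : F * F => true && adj z.1 z.2)) //.
  rewrite -(pair_big_dep predT (fun x y => adj x y) (fun _ _ => 1%N)) /=; apply: eq_bigr => x _.
  by rewrite sum1dep_card.
have MR : 0 < M%:R :> R by rewrite ltr0n muln_gt0 k0.
have lo : M%:R * ((1 - eta) / #|G|%:R ^+ 2 - c) <= \sum_(z : F * F | adj z.1 z.2) I z.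
  rewrite mulr_natl -cM -sumr_const; apply: ler_sum => z hz; by have /andP[] := hI z hz.
have hi : \sum_(z : F * F | adj z.1 z.2) I z <= M%:R * ((1 + eta) / #|G|%:R ^+ 2).
  rewrite mulr_natl -cM -sumr_const; apply: ler_sum => z hz; by have /andP[] := hI z hz.
have q0 : 0 < #|G|%:R ^+ 2 / M%:R :> R by rewrite divr_gt0 // exprn_gt0.
rewrite -/M; rewrite -(ler_pM2l q0) in lo; rewrite -(ler_pM2l q0) in hi.
have E1 : #|G|%:R ^+ 2 / M%:R * (M%:R * ((1 - eta) / #|G|%:R ^+ 2 - c)) = 1 - eta - (#|F| ^ 2)%:R * C / #|G|%:R.
  rewrite /c; move: (M%:R) MR (_ ^ 2)%N #|G|%:R nR => m m0 f n n0; field; rewrite !gt_eqF //.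
have E2 : #|G|%:R ^+ 2 / M%:R * (M%:R * ((1 + eta) / #|G|%:R ^+ 2)) = 1 + eta.
  move: (M%:R) MR #|G|%:R nR => m m0 n n0; field; rewrite !gt_eqF //.
have d0 : 0 <= (#|F| ^ 2)%:R * C / #|G|%:R by rewrite divr_ge0 // mulr_ge0 // ltW.
rewrite E1 in lo; rewrite E2 in hi.
by rewrite ler_norml; move: lo hi d0; move: (_ / _ * _) (_ * C / _) eta=> t1 t2 t3; lra.
Qed.

End Weights.

Lemma sum_through (R : realType) (E : finType) (e : E) (w : {set E} -> R) (Q : pred {set E}) :
  \sum_(K : {set E} | (e \in K) && Q K) w K =
  \sum_(S : {set E} | (e \notin S) && Q (e |: S)) w (e |: S).
Proof.
rewrite (reindex_onto (fun S : {set E} => e |: S) (fun K => K :\ e)) /=; last first.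
  by move=> K /andP[eK _]; rewrite finset.setD1K.
apply: eq_bigl => S; rewrite !inE eqxx /= andbC; congr (_ && _).
apply/eqP/idP => [<-|eS]; first by rewrite !inE eqxx.
apply/finset.setP=> x; rewrite !inE; case: eqP => //= ->; exact/esym/negbTE.
Qed.

(** The hypergraph has the edges of [G] as vertices and the copies of [F] as hyperedges, with
    codegrees O(1/n). The exponentially small failure bound leaves room for the O(n^2) tests. *)
Lemma packing (R : realType) (F : sgraph) (gam : R) : (0 < num_edges F)%N -> 0 < gam -> gam < 1 ->
  exists b : R, 0 < b /\ forall C : R, 0 < C -> exists n0 : nat, forall (G : sgraph) (p : {ffun F -> G} -> R),
  (n0 <= #|G|)%N -> (0 < #|G|)%N -> (forall x : G, (0 < degree x)%N) ->
  (forall f, 0 <= p f <= C / #|G|%:R ^+ #|F|) ->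
  (forall f, p f != 0 -> forall x y, adj x y -> adj (f x) (f y)) ->
  (forall (x y : F) (u v : G), adj x y -> adj u v ->
    (1 - b) / #|G|%:R ^+ 2 <= \sum_(f : {ffun F -> G} | (f x == u) && (f y == v)) p f <= (1 + b) / #|G|%:R ^+ 2) ->
  exists P : {set {set {set G}}}, [/\ finset.trivIset P,
    forall K, K \in P -> exists f : {ffun F -> G}, [/\ injective f, copy_edges f = K & K \subset edges G] &
    forall x : G, #|[set e in edges G :\: finset.cover P | x \in e]|%:R <= 2 * gam * #|G|%:R :> R].
Proof.
move=> k0 gam0 gam1; have [b0 [Cn [eta1 [b00 Cn0 eta10 nib]]]] := nibble k0 gam0 gam1.
exists (b0 / 4); split=> [|C C0]; first exact: divr_gt0.
pose C' : R := (#|F| ^ 3)%:R * C + 2.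
have C'2 : 2 <= C' by rewrite lerDr mulr_ge0 // ltW.
have C'0 : 0 < C' by apply: lt_le_trans C'2.
have c0 : 0 < Cn / C' by apply: divr_gt0.
have [n1 hn1] := exp_beats_poly 4 2 c0.
pose n2 := (Num.trunc (C' / eta1)).+1; pose n3 := (Num.trunc ((#|F| ^ 2)%:R * C * 4 / b0)).+1.
exists (n1 + n2 + n3)%N => G p hn G0 hdeg pC psupp pm.
have nR : 0 < #|G|%:R :> R by rewrite ltr0n.
have hn2 : C' / eta1 <= #|G|%:R.
  apply: le_trans (ltW (truncnS_gt _)) _; rewrite ler_nat; apply: leq_trans hn.
  exact: leq_trans (leq_addl n1 n2) (leq_addr n3 _).
have hn3 : (#|F| ^ 2)%:R * C * 4 / b0 <= #|G|%:R.
  by apply: le_trans (ltW (truncnS_gt _)) _; rewrite ler_nat; apply: leq_trans hn; apply: leq_addl.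
have {hn1} hn1 := hn1 #|G| (leq_trans (leq_trans (leq_addr n2 n1) (leq_addr n3 _)) hn).
have [x0 _] := card_gt0P G0.
pose w := weight p.
(* The test [inl z] is the link of the edge [pr z], which keeps its degree under control. The test
   [inr x] counts the uncovered edges at [x], so that the final leftover has small maximum
   degree. *)
pose T : finType := ((G * G) + G)%type.
pose pr (z : G * G) : {set G} := [set z.1; z.2].
pose a (t : T) := if t is inl _ then (num_edges F).-1 else 1%N.
pose om (t : T) (S : {set {set G}}) : R := match t with
  | inl z => if pr z \in S then 0 else w (pr z |: S)
  | inr x => if (#|S| == 1) && (x \in finset.cover S) then #|G|%:R^-1 else 0 end.
pose q (t : T) : R := match t with inl z => (pr z \in edges G)%:R | inr x => (degree x)%:R / #|G|%:R end.
pose te (e : {set G}) : T := if [pick z | pr z == e] is Some z then inl z else inr x0.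
have teP e : e \in edges G -> exists2 z, te e = inl z & pr z = e.
  case/edgesP=> u [v [_ ->]]; rewrite /te; case: pickP => [z /eqP E|/(_ (u, v))]; first by exists z.
  by rewrite eqxx.
have w0 K : 0 <= w K by apply: weight_ge0 pC K.
have wsupp K : w K != 0 -> K \subset edges G by case/(weight_supp psupp)=> f [].
have eA0 : (0 < #|edges G|)%N.
  have /card_gt0P[y] := hdeg x0; rewrite inE => xy; apply/card_gt0P; exists [set x0; y]; by rewrite edges_pair.
have cdl e e' : e != e' -> \sum_(K : {set {set G}} | (e \in K) && (e' \in K)) w K <= C' / #|G|%:R.
  move=> ne; apply: le_trans (weight_codeg k0 G0 C0 pC ne) _.
  by rewrite ler_wpM2r ?invr_ge0 ?(ltW nR) // lerDl.
have inl_in z A : inside (om (inl z)) A = \sum_(K : {set {set G}} | (pr z \in K) && (K :\ pr z \subset A)) w K.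
  rewrite (sum_through (pr z) w (fun K => K :\ pr z \subset A)) /inside big_mkcond [RHS]big_mkcond /=.
  apply: eq_bigr => S _; case: (boolP (pr z \in S)) => zS /=; first by case: ifP.
  have -> : (pr z |: S) :\ pr z = S by apply/finset.setP=> x; rewrite !inE; case: eqP => //= ->; exact/esym/negbTE.
  by [].
have inr_in x A : inside (om (inr x)) A = #|[set e in A | x \in e]|%:R / #|G|%:R.
  rewrite /inside /om -big_mkcondr /= sumr_const -[_ *+ _]mulr_natl; congr (_%:R / _).
  rewrite -(card_imset _ (f := @finset.set1 {set G})); last exact: finset.set1_inj.
  apply: eq_card => S; apply/and3P/imsetP => [[SA /cards1P[e E] xS]|[e]].
    exists e => //; move: SA xS; rewrite E /finset.cover finset.big_set1 finset.sub1set inE => -> ->; by [].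
  by rewrite inE => /andP[eA xe] ->; rewrite finset.sub1set eA cards1 eqxx /finset.cover finset.big_set1.
have [||t S|t S|t|t f|t|t|e|e A AA eA||||||P [tP hP lP]] := nib _ T (edges G) w a om q te (C' / #|G|%:R) eA0 w0.
- by move=> K; apply: weight_card.
- exact: cdl.
- case: t => [z|x] /=; first by case: ifP.
  by case: ifP; rewrite ?invr_ge0.
- case: t => [z|x] /=.
    case: ifP => [|/negbT zS /weight_card]; rewrite ?eqxx // => /(_ psupp).
    by rewrite cardsU1 zS => <-.
  by case: ifP => [/andP[/eqP ->]|]; rewrite ?eqxx.
- case: t => [z|x] /=; [exact: leq_pred|exact: k0].
- case: t => [z|x] /=.
    case: (eqVneq (pr z) f) => [<-|ne].
      by rewrite big1 ?divr_ge0 ?(ltW C'0) // => S ->.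
    apply: le_trans (cdl _ _ ne); rewrite (sum_through (pr z) w (fun K => f \in K)) big_mkcond [X in _ <= X]big_mkcond.
    apply: ler_sum => S _; case: (boolP (pr z \in S)) => zS /=; first by case: ifP.
    by rewrite !inE eq_sym (negPf ne).
  apply: le_trans (_ : \sum_(S : {set {set G}} | S == [set f]) #|G|%:R^-1 <= _).
    rewrite big_mkcond [X in _ <= X]big_mkcond; apply: ler_sum => S _.
    case: ifP => fS; last by case: ifP; rewrite ?invr_ge0.
    case: ifP => [/andP[/cards1P[e E] _]|]; last by case: ifP; rewrite ?invr_ge0.
    by move: fS; rewrite E inE => /eqP->; rewrite eqxx.
  by rewrite big_pred1_eq -[X in X <= _]mul1r ler_wpM2r ?invr_ge0 //; lra.
- by case: t => [z|x] /=; rewrite ?divr_ge0.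
- case: t => [z|x] /=; first by case: (_ \in _).
  by rewrite ler_pdivrMr // mul1r ler_nat max_card.
- by move=> eA; have [z -> Ez] := teP e eA; rewrite /= Ez eA.
- have [z -> Ez] := teP e (fintype.subsetP AA e eA).
  rewrite inl_in Ez /deg_in; apply: eq_bigl => K; rewrite andbC; case: (boolP (e \in K)) => //= eK.
  apply/idP/idP => /fintype.subsetP h; apply/fintype.subsetP=> y; first by rewrite !inE => /andP[_ /h].
  by move=> yK; case: (eqVneq y e) => [->//|ye]; apply: h; rewrite !inE ye.
- exact: divr_gt0.
- by rewrite ler_pdivrMr // mulrC -ler_pdivrMr.
- have h2 : #|G|%:R <= 2 * #|edges G|%:R :> R.
    rewrite -natrM ler_nat -[(2 * _)%N]handshake -sum1_card; apply: leq_sum => x _; exact: hdeg.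
  have eR : 0 < #|edges G|%:R :> R by rewrite ltr0n.
  rewrite -[_^-1]mul1r ler_pdivrMr // mulrAC ler_pdivlMr // mul1r.
  by apply: le_trans h2 _; rewrite ler_wpM2r // ltW.
- move=> [z|x]; last first.
    rewrite inr_in /q /= -card_star subrr normr0; apply: divr_ge0 => //; exact: ltW.
  rewrite inl_in; case: (boolP (pr z \in edges G)) => zE /=.
    have -> : \sum_(K : {set {set G}} | (pr z \in K) && (K :\ pr z \subset edges G)) w K = \sum_(K : {set {set G}} | pr z \in K) w K.
      rewrite [RHS](bigID (fun K : {set {set G}} => K :\ pr z \subset edges G)) /= [X in _ = _ + X]big1 ?addr0 // => K /andP[_ nK].
      apply/eqP; apply: contraNT nK => /wsupp KE; exact: fintype.subset_trans (finset.subD1set _ _) KE.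
    rewrite zE; apply: le_trans (weight_deg k0 G0 C0 pC pm zE) _.
    have -> : b0 / 2 = b0 / 4 + b0 / 4 by field.
    rewrite lerD2l ler_pdivrMr //; move: hn3; rewrite ler_pdivrMr //; move: (_ * C) => X hX.
    have -> : b0 / 4 * #|G|%:R = #|G|%:R * b0 / 4 by ring.
    by rewrite ler_pdivlMr.
  rewrite (negPf zE) big1 ?subr0 ?normr0 ?divr_ge0 ?(ltW b00) // => K /andP[zK _].
  by apply/eqP; apply: contraNT zE => /wsupp/fintype.subsetP; apply.
- have cT : #|T| = (#|G| * #|G| + #|G|)%N by rewrite card_sum card_prod.
  apply: le_lt_trans hn1; rewrite invf_div mulrA [Cn / C' * _]mulrAC ler_wpM2r ?expR_ge0 // ler_nat cT.
  rewrite expnS expn1 (_ : 4 = 2 * 2)%N // -[(2 * 2 * _)%N]mulnA leq_mul2l /= mul2n -addnn leq_add2l.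
  exact: leq_pmulr.
exists P; split=> //.
- by move=> K /hP wK; apply: weight_supp psupp _ wK.
move=> x; have := lP (inr x); by rewrite inr_in /= expr1 ler_pdivrMr.
Qed.

(** * Assembly *)

(** The limsup is an infimum of suprema over tails, so a strict inequality gives one tail on which
    every infimum is below [d]. *)
Lemma delta_star_threshold (R : realType) (F : sgraph) (d : R) : (delta_star R F < d%:E)%E ->
  exists M, forall m, (M <= m)%N -> forall G : sgraph, #|G| = m -> d * m%:R <= (min_degree G)%:R ->
    has_fractional_decomposition R F G.
Proof.
rewrite /delta_star /limn_esup limf_esupE => /ereal_inf_lt[_ [V [M _ hM] <-] hV].
exists M => m Mm G Gm hG.
have hm : (delta_star_n R F m < d%:E)%E.
  by apply: le_lt_trans hV; apply: ereal_sup_ubound; exists m => //; apply: hM.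
have [_ [d' hd' <-]] := ereal_inf_lt hm; rewrite lte_fin => dd; apply: hd' => //.
by apply: le_trans hG; rewrite ler_wpM2r // ltW.
Qed.

Lemma mdec_packing (F G : sgraph) (P : {set {set {set G}}}) : finset.trivIset P ->
  (forall K, K \in P -> exists f : {ffun F -> G}, injective f /\ copy_edges f = K) ->
  mdec F (ind (finset.cover P)).
Proof.
move=> tP hP; apply: mdec_eq (@mdec_sum F G {set {set G}} (index_enum _) (fun K => K \in P) (@ind G) _).
  move=> e; rewrite /ind; case: (boolP (e \in finset.cover P)) => [/finset.bigcupP[K KP eK]|ne].
    rewrite (bigD1 K) //= eK big1 // => K' /andP[K'P ne]; apply/eqP; rewrite eqb0; apply: contra ne => eK'.
    by apply/eqP; rewrite -(finset.def_pblock tP KP eK) (finset.def_pblock tP K'P eK').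
  by rewrite big1 // => K KP; apply/eqP; rewrite eqb0; apply: contra ne => eK; apply/finset.bigcupP; exists K.
move=> K /hP[f [fi <-]]; apply: mdec_eq (mdec_copy fi) => e.
exact: mul_edges.
Qed.

Lemma degree_defect (R : realType) (k n m : nat) : (0 < k)%N -> (m <= n)%N ->
  (1 - 1 / (6 * k%:R)) * n%:R <= m%:R :> R -> (6 * k * (n - m) <= n)%N.
Proof.
move=> k0 mn h; rewrite -(ler_nat R) natrM natrB // natrM.
have kR : 0 < 6 * k%:R :> R by rewrite mulr_gt0 ?ltr0n.
have h1 : 6 * k%:R * ((1 - 1 / (6 * k%:R)) * n%:R) <= 6 * k%:R * m%:R :> R by rewrite ler_wpM2l // ltW.
have h2 : 6 * k%:R * ((1 - 1 / (6 * k%:R)) * n%:R) = 6 * k%:R * n%:R - n%:R :> R.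
  by field; rewrite ?gt_eqF ?ltr0n.
rewrite h2 in h1; rewrite mulrBr; move: h1; move: (6 * k%:R * n%:R : R) (6 * k%:R * m%:R : R) (n%:R : R) => x y z; lra.
Qed.

(** Reserve and absorber are fixed before the packing, which is made in the graph without them; half
    of [eps] pays for the lost degrees. *)
Lemma decomposition_core (R : realType) (F : sgraph) (r : nat) (d eps : R) :
  (0 < num_edges F)%N -> (#|F| <= 2 * num_edges F)%N -> (1 < r)%N -> (r <= #|F|)%N -> colorable F r ->
  0 <= d -> 0 < eps ->
  (exists M, forall m, (M <= m)%N -> forall G : sgraph, #|G| = m -> d * m%:R <= (min_degree G)%:R ->
     has_fractional_decomposition R (complete_graph r) G) ->
  exists n0, forall G : sgraph, (n0 <= #|G|)%N -> (d + eps) * #|G|%:R <= (min_degree G)%:R ->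
    (1 - 1 / (6 * (num_edges F)%:R) + eps) * #|G|%:R <= (min_degree G)%:R ->
    mdiv F (ind (edges G)) -> mdec F (ind (edges G)).
Proof.
move=> k0 F2 r1 rF cF d0 eps0 hM; set k := num_edges F in k0 F2 *.
have [a [b ab]] := num_edges_gt0 k0.
have hD : (2 * #|F| <= 4 * k)%N by rewrite -(leq_pmul2l (isT : 0 < 2)%N) in F2; rewrite (leq_trans F2) // mulnA.
(* Makes the degrees of reserve and absorber together at most [eps / 2 * #|G|]. *)
pose N := (Num.trunc (2 / eps)).+1.
have hN : 2 / eps < N%:R by apply: truncnS_gt.
have [t [n1 [t0 absorb]]] := reserve_absorber N hD ab.
have [n2 part] := @partition_exists R (4 * k) t t0.
have [M [n3 [M0 cover]]] := reserve_cover hD ab t0.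
have MR : 0 < M%:R :> R by rewrite ltr0n.
(* Then the leftover degree [2 * gam * #|G|] is [#|G| / M], as the covering step requires. *)
pose gam : R := 1 / (2 * M%:R).
have gam0 : 0 < gam by rewrite divr_gt0 // mulr_gt0.
have gam1 : gam < 1.
  rewrite /gam ltr_pdivrMr ?mulr_gt0 // mul1r; have : 1 <= M%:R :> R by rewrite ler1n.
  by move: (M%:R) => x; lra.
have [eta [eta0 pack]] := @packing R F gam k0 gam0 gam1.
have e20 : 0 < eps / 2 by rewrite divr_gt0.
have [C [C0 law]] := copy_law r1 d0 e20 eta0 cF hM.
have [n4 {}pack] := pack C C0.
exists (n1 + n2 + n3 + n4 + 1)%N => G hn hdG hkG hdiv.
have hn1 : (n1 <= #|G|)%N by rewrite (leq_trans _ hn) // -!addnA leq_addr.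
have hn2 : (n2 <= #|G|)%N by rewrite (leq_trans _ hn) // -!addnA addnCA leq_addr.
have hn3 : (n3 <= #|G|)%N by rewrite (leq_trans _ hn) // -!addnA [(n2 + _)%N]addnCA addnCA leq_addr.
have hn4 : (n4 <= #|G|)%N by rewrite (leq_trans _ hn) // -addnA [(n4 + 1)%N]addnC addnA leq_addl.
have G0 : (0 < #|G|)%N by rewrite (leq_trans _ hn) // addn1.
have nR : 0 < #|G|%:R :> R by rewrite ltr0n.
have hk (x : G) : (1 - 1 / (6 * k%:R) + eps) * #|G|%:R <= (degree x)%:R :> R.
  by apply: le_trans hkG _; rewrite ler_nat min_degree_le.
have hcom : forall S : {set G}, (#|S| <= 4 * k)%N -> (#|G| <= 3 * #|common S|)%N.
  apply: common_large => x; apply: (@degree_defect R) => //; first exact: max_card.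
  by apply: le_trans (hk x); rewrite ler_wpM2r // lerDl ltW.
have [lab [hlab hX]] := part G hn2 hcom; set X := reserve lab in hX.
have [A [AG hU mA hA]] := absorb G lab hn1 hcom hX; rewrite -/X in AG hU hA.
pose G' := remove (X :|: A).
have hdU x : #|[set e in X :|: A | x \in e]|%:R <= eps / 2 * #|G|%:R :> R.
  have := hU x; rewrite -(ler_nat R) natrM; move: (#|_|%:R : R) => y hy.
  have h1 : y * (2 / eps) <= #|G|%:R.
    have [y0|y0] := lerP 0 y; last by apply: le_trans (ltW nR); rewrite mulr_le0_ge0 ?divr_ge0 // ltW.
    by apply: le_trans hy; rewrite ler_wpM2l // ltW.
  have -> : y = eps / 2 * (y * (2 / eps)) by field; rewrite gt_eqF.
  by rewrite ler_wpM2l // ltW.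
have hdeg' (x : G') : (degree (x : G))%:R - eps / 2 * #|G|%:R <= (degree x)%:R :> R.
  have := degree_remove (X :|: A) x; rewrite -(ler_nat R) natrD; have := hdU x.
  move: (eps / 2 * #|G|%:R : R) (#|[set e in X :|: A | x \in e]|%:R : R) => u v.
  by move: ((degree x)%:R : R) ((degree (x : G))%:R : R) => w z; lra.
have hk' (x : G') : (1 - 1 / (6 * k%:R)) * #|G'|%:R <= (degree x)%:R :> R.
  apply: le_trans (hdeg' x); have := hk x; move: (1 - _) => u.
  have := mulr_ge0 (ltW eps0) (ltW nR); have -> : #|G'|%:R = #|G|%:R :> R by [].
  move: (#|G|%:R : R) (_%:R : R) => v w; rewrite mulrDl mulrAC; move: (u * v) (eps * v) => *; lra.
have hkn' (x : G') : (6 * k * (#|G'| - degree x) <= #|G'|)%N.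
  by apply: (@degree_defect R) => //; exact: max_card.
have hcom' : forall S : {set G'}, (#|S| <= r + #|F|)%N -> (#|G'| <= 3 * #|common S|)%N.
  move=> S hS; apply: (common_large hkn'); apply: leq_trans hS _.
  by apply: leq_trans (_ : #|F| + #|F| <= _)%N; [rewrite leq_add2r|rewrite addnn -mul2n].
have hd' : (d + eps / 2) * #|G'|%:R <= (min_degree G')%:R.
  have [x ->] := min_degree_ex (G := G') G0; apply: le_trans (hdeg' x).
  have : (d + eps) * #|G|%:R <= (degree (x : G))%:R by apply: le_trans hdG _; rewrite ler_nat min_degree_le.
  have -> : #|G'|%:R = #|G|%:R :> R by [].
  move: (#|G|%:R : R) (_%:R : R) => v w; rewrite !mulrDl mulrAC; move: (d * v) (eps * v) => *; lra.
have deg0 (x : G') : (0 < degree x)%N.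
  have := hkn' x; case: (degree x) => // ; rewrite subn0.
  have G0' : (0 < #|G'|)%N := G0.
  have : (1 < 6 * k)%N by rewrite (leq_trans (isT : 1 < 6)%N) // leq_pmulr.
  by move=> h; rewrite -[X in (_ <= X)%N]mul1n leq_pmul2r // leqNgt h.
have [p [p1 p2 p3]] := law G' G0 hd' hcom'.
have [P [tP hP lP]] := pack G' p hn4 G0 deg0 p1 p2 p3.
have EG' : edges G' = edges G :\: (X :|: A) :> {set {set G}} by apply: edges_remove.
pose cP : {set {set G}} := finset.cover P.
pose L0 : {set {set G}} := (edges G :\: (X :|: A)) :\: cP.
have L0X : L0 \subset edges G :\: X.
  by apply/fintype.subsetP=> e; rewrite !inE negb_or => /and3P[_ /andP[-> _] ->].
have dL0 x : (#|[set e in L0 | x \in e]| * M <= #|G|)%N.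
  rewrite -(ler_nat R) natrM -ler_pdivlMr //; have := lP x; rewrite EG' -/cP -/L0.
  have -> : 2 * gam * #|G'|%:R = #|G|%:R / M%:R by rewrite /gam; field; rewrite gt_eqF.
  by [].
have [C' [CX mC]] := cover G lab L0 hn3 hlab L0X dL0; rewrite -/X in CX.
pose L := X :\: C'.
have XG : X \subset edges G by apply/fintype.subsetP=> e; rewrite inE => /andP[].
have cPG : cP \subset edges G :\: (X :|: A).
  apply/fintype.subsetP=> e /finset.bigcupP[K KP eK]; have [f [_ _ /fintype.subsetP/(_ e eK)]] := hP K KP.
  by rewrite EG'.
have E e : ind (edges G) e = ((ind cP e + (ind L0 e + ind C' e) + ind A e) + ind L e)%N.
  have := fintype.subsetP cPG e; have := fintype.subsetP CX e; have := fintype.subsetP XG e; have := fintype.subsetP AG e.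
  rewrite /ind /L0 /L !(finset.in_setD, finset.in_setU).
  case: (e \in A); case: (e \in X); case: (e \in C'); case: (e \in cP); case: (e \in edges G) => //=; by [move=> /(_ isT)|move=> _ /(_ isT)|move=> _ _ /(_ isT)|move=> _ _ _ /(_ isT)].
have mcP : mdec F (ind cP) by apply: (mdec_packing (G := G')) => // K /hP[f [h1 h2 _]]; exists f.
have m1 := mdecD mcP mC.
have mL : mdiv F (ind L).
  apply: (@mdivDr F G (fun e => (ind cP e + (ind L0 e + ind C' e) + ind A e)%N)).
    by apply: mdec_mdiv; apply: mdecD m1 mA.
  have [h1 h2] := hdiv; split=> [x|]; first by rewrite -(mdeg_eq _ E).
  by rewrite -(mtot_eq E).
apply: mdec_eq (mdecD m1 (hA L (finset.subsetDl _ _) mL)) => e.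
by rewrite E !addnA.
Qed.

Theorem theorem6p3 (R : realType) (F : sgraph) (hF : (0 < num_edges F)%N)
    (eps : R) (heps : (0 < eps)%R) :
  exists n0 : nat, forall G : sgraph,
    (n0 <= #|vertex G|)%N ->
    divisible F G ->
    ((delta_bound R F + eps%:E) * (#|vertex G|%:R)%:E
       <= ((min_degree G)%:R)%:E)%E ->
    has_decomposition F G.
Proof.
(* The core works without isolated vertices; this changes neither the number of edges nor the degree
   condition, and the gcd only in the harmless direction. *)
pose S := support F; pose r := chromatic_number F.
have kS : num_edges S = num_edges F.
  by apply/eqP; rewrite -(eqn_pmul2l (isT : 0 < 2)%N) -!handshake sum_degree_support.
have kS0 : (0 < num_edges S)%N by rewrite kS.
have S2 : (#|S| <= 2 * num_edges S)%N.
  by rewrite -handshake -sum1_card; apply: leq_sum => x _; rewrite degree_support; apply: valP x.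
have [a [b ab]] := num_edges_gt0 kS0.
have rS : (r <= #|S|)%N by apply: chromatic_le_support; apply/card_gt0P; exists a.
have [cF cS] : colorable F r /\ colorable S r.
  have h : colorable F r by rewrite /r /chromatic_number; case: ex_minnP.
  split=> //; have /existsP[c /forallP hc] := h; apply/existsP; exists [ffun x => c (val x)].
  apply/forallP=> x; apply/forallP=> y; rewrite !ffunE; by have /forallP/(_ (val y)) := hc (val x).
have r1 : (1 < r)%N.
  have /existsP[c /forallP/(_ a)/forallP/(_ b)/implyP/(_ ab)] := cS.
  case: r c {rS cF cS} => [|[|//]] c; first by case: (c a).
  by rewrite !ord1 eqxx.
pose c0 : R := 1 - 1 / (6 * (num_edges F)%:R).
have kR : 1 <= (num_edges F)%:R :> R by rewrite ler1n.
have c00 : 0 <= c0.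
  by rewrite /c0 subr_ge0 ler_pdivrMr ?mulr_gt0 ?(lt_le_trans ltr01) //; lra.
case Es : (delta_bound R F) => [s| |].
- have hs : (delta_star R (complete_graph r) <= s%:E)%E by rewrite -Es /delta_bound le_max lexx.
  have hc : c0 <= s by rewrite -lee_fin -Es /delta_bound le_max lexx orbT.
  (* Half of [eps] makes the inequality with [delta_star] strict, the other half remains as slack in
     the degrees. *)
  have [|||n0 core] := @decomposition_core R S r (s + eps / 2) (eps / 2) kS0 S2 r1 rS cS _ _ (delta_star_threshold _).
  + by apply: addr_ge0; [apply: le_trans hc|rewrite divr_ge0 // ltW].
  + by rewrite divr_gt0.
  + by apply: le_lt_trans hs _; rewrite lte_fin ltrDl divr_gt0.
  exists (n0 + #|F|)%N => G hn [d1 d2] hdeg.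
  rewrite -EFinD -EFinM lee_fin in hdeg.
  apply: mdec_decomposition => //; first exact: leq_trans (leq_addl _ _) hn.
  apply: core => //.
  + exact: leq_trans (leq_addr _ _) hn.
  + by rewrite -addrA -splitr.
  + apply: le_trans hdeg; rewrite ler_wpM2r // kS -/c0 lerD //.
    by rewrite ler_pdivrMr //; lra.
  split=> [x|].
    have -> : mdeg (ind (edges G)) x = degree x.
      by rewrite -card_star /mdeg /ind /star -sum1dep_card big_mkcond [RHS]big_mkcond; apply: eq_bigr => e _; case: (x \in e); case: (e \in edges G).
    apply: dvdn_trans (gcd_support F) _; apply: dvdn_trans d2 _; exact: gcd_degree_dvd.
  have -> : mtot (ind (edges G)) = num_edges G.
    by rewrite /mtot /ind /num_edges -sum1_card [RHS]big_mkcond; apply: eq_bigr => e _; case: (_ \in _).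
  by rewrite kS.
(* An infinite bound makes the degree hypothesis impossible; the value [-oo] is excluded below,
   because the maximum is at least [c0]. *)
- exists 1%N => G G0 _; rewrite addye // mulyr gtr0_sg ?ltr0n // mul1e leye_eq.
  by [].
- have : (c0%:E <= -oo)%E by rewrite -Es /delta_bound le_max lexx orbT.
  by [].
Qed.
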